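(* Let $V^\alpha$ and $V^\beta$ be strongly local simple unitary vertex operator algebras. Then $V^\alpha\otimes V^\beta$ is strongly local and $\mathcal{A}_{V^\alpha\otimes V^\beta}=\mathcal{A}_{V^\alpha}\otimes\mathcal{A}_{V^\beta}$.
   Context: Unitary VOAs. Vertex algebras are over $\mathbb{C}$ and local (not super). A VOA $V$ has vacuum $\Omega$, vertex operators $Y(a,z)=\sum_n a_{(n)}z^{-n-1}$, conformal vector $\nu$ with $Y(\nu,z)=\sum_nL_nz^{-n-2}$ (Virasoro relations, $L_{-1}$ the infinitesimal translation operator), $V=\bigoplus_{n\in\mathbb{Z}}V_n$ with $V_n=\mathrm{Ker}(L_0-n1_V)$ finite-dimensional and zero for $n$ sufficiently small. For $a\in V_{d_a}$ put $a_n=a_{(n+d_a-1)}$, extended linearly to all $a\in V$. $V$ is simple if it has no nontrivial ideals. A bilinear form is invariant if $(Y(a,z)b,c)=(b,Y(e^{zL_1}(-z^{-2})^{L_0}a,z^{-1})c)$. A scalar product (positive-definite, linear in the second variable) is normalized if $(\Omega|\Omega)=1$ and invariant if there is an antilinear vertex algebra automorphism $\theta$ of $V$ with $\theta\nu=\nu$ such that $(\theta\cdot|\cdot)$ is an invariant bilinear form. A unitary VOA is a VOA with a normalized invariant scalar product. The tensor product of two unitary VOAs is the tensor product VOA (vacuum $\Omega\otimes\Omega$, conformal vector $\nu^\alpha\otimes\Omega+\Omega\otimes\nu^\beta$) with the tensor product scalar product; it is again a unitary VOA. The net $\mathcal{A}_V$. Let $\mathcal{H}_V$ be the Hilbert space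 completion of $V$. $a\in V$ satisfies energy bounds if there are positive integers $s,k$ and $M>0$ with $\|a_nb\|\le M(|n|+1)^s\|(L_0+1_V)^kb\|$ for all $n\in\mathbb{Z}$, $b\in V$; $V$ is energy-bounded if every $a\in V$ does. Then for $f\in C^\infty(S^1)$ with Fourier coefficients $\hat f_n$, $Y(a,f)$ is the closure on $\mathcal{H}_V$ of $b\mapsto\sum_n\hat f_na_nb$, $b\in V$. Let $\mathcal{I}$ be the set of open, connected, non-empty, non-dense subsets of $S^1$, and $I'$ the interior of $S^1\setminus I$. For a family of closed densely defined operators, $W^*(\cdot)$ is the smallest von Neumann algebra to which all are affiliated. Put $\mathcal{A}_V(I)=W^*(\{Y(a,f):a\in V,\ f\in C^\infty(S^1),\ \mathrm{supp}f\subset I\})$. $V$ is strongly local if it is energy-bounded and $\mathcal{A}_V(I)\subset\mathcal{A}_V(I')'$ for all $I\in\mathcal{I}$. For simple strongly local $V$, $I\mapsto\mathcal{A}_V(I)$ is an irreducible conformal net on $\mathcal{H}_V$ with vacuum $\Omega$. Tensor product of nets: $(\mathcal{A}_1\otimes\mathcal{A}_2)(I)=\mathcal{A}_1(I)\,\overline{\otimes}\,\mathcal{A}_2(I)$ (von Neumann tensor product) acting on $\mathcal{H}_1\overline{\otimes}\mathcal{H}_2$, with vacuum $\Omega_1\otimes\Omega_2$ and representation $U_1\otimes U_2$. *)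

(* Defs.v *)
From HB Require Import structures.
From mathcomp Require Import all_boot all_order all_algebra.
From mathcomp Require Import complex.
From mathcomp Require Import all_classical all_reals all_analysis.
Import Order.TTheory GRing.Theory Num.Theory.
Import numFieldNormedType.Exports.

Set Implicit Arguments.
Unset Strict Implicit.
Unset Printing Implicit Defensive.

Local Open Scope classical_set_scope.
Local Open Scope complex_scope.
Local Open Scope ring_scope.

(* The library's forms are linear in the first variable; [braket] is linear in
   the second one and antilinear in the first one. *)
Definition braket (R : realType) (V : lmodType R[i])
  (f : {dot V for @Num.conj R[i]}) (x y : V) : R[i] := f y x.

Definition is_bilinear (R : realType) (U V W : lmodType R[i])
    (f : U -> V -> W) : Prop :=
  (forall v, linear (fun u => f u v)) /\ (forall u, linear (f u)).

(* In vertex algebras, [Y a n b] stands for a_(n) b. *)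

Section VertexAlgebra.
Context (R : realType) (V : lmodType R[i]).
Implicit Types (a b c v : V) (A B : int -> V -> V) (Y : V -> int -> V -> V).

Definition is_field A : Prop :=
  forall b, exists N : int, forall n : int, N <= n -> A n b = 0.

(* (z - w)^N [A(z), B(w)] = 0, read off at z^(-m-1) w^(-k-1). *)
Definition mutually_local A B : Prop :=
  exists N : nat, forall (m k : int) c,
    \sum_(j < N.+1) ((-1) ^+ j * 'C(N, j)%:R) *:
      (A (m + N%:Z - j%:Z) (B (k + j%:Z) c)
       - B (k + j%:Z) (A (m + N%:Z - j%:Z) c)) = 0.

Record is_vertex_algebra (Om : V) (T : V -> V) Y : Prop := IsVertexAlgebra {
  va_bilinear : forall n : int, is_bilinear (fun a b => Y a n b);
  va_T_linear : linear T;
  va_field : forall a, is_field (Y a);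
  va_translation : forall a (n : int) b,
    T (Y a n b) - Y a n (T b) = (- n)%:~R *: Y a (n - 1) b;
  va_T_vacuum : T Om = 0;
  va_vacuum : forall (n : int) b, Y Om n b = if n == -1 then b else 0;
  va_creation : forall a, Y a (-1) Om = a;
  va_locality : forall a b, mutually_local (Y a) (Y b)
}.

(* [L Y nu n] is L_n, the coefficient nu_(n+1). *)
Definition L Y (nu : V) (n : int) : V -> V := Y nu (n + 1).

Definition has_weight Y (nu : V) (n : int) v : Prop := L Y nu 0 v = n%:~R *: v.

(* [p] is the family of homogeneous components of [v]. *)
Definition is_decomposition Y (nu : V) v (p : int -> V) : Prop :=
  [/\ forall n, has_weight Y nu n (p n),
      finite_set [set n | p n != 0] &
      v = \sum_(n \in [set: int]) p n].

Record is_voa (Om : V) Y (nu : V) : Prop := IsVOA {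
  voa_va : is_vertex_algebra Om (L Y nu (-1)) Y;
  voa_virasoro : exists c : R[i], forall (m n : int) b,
    L Y nu m (L Y nu n b) - L Y nu n (L Y nu m b)
    = (m - n)%:~R *: L Y nu (m + n) b
      + (if m + n == 0 then (m ^+ 3 - m)%:~R / 12%:R * c else 0) *: b;
  (* eigenspaces of L_0 are automatically independent, so this says that V is
     the direct sum of the V_n *)
  voa_grading : forall v, exists p, is_decomposition Y nu v p;
  voa_finite_dim : forall n : int, exists s : seq V, forall v,
    has_weight Y nu n v ->
    exists c : nat -> R[i], v = \sum_(i < size s) c i *: s`_i;
  voa_bounded_below : exists N : int, forall n : int, n < N ->
    forall v, has_weight Y nu n v -> v = 0
}.

(* Coefficient of z^(-n-1) in
   B(Y(a,z)b, c) = B(b, Y(e^(z L_1) (-z^-2)^(L_0) a, z^-1) c),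
   for a homogeneous of weight d; the sum over l is finite since L_1 lowers
   weights. *)
Definition invariant_bilinear Y (nu : V) (B : V -> V -> R[i]) : Prop :=
  [/\ forall y, scalar (fun x => B x y), forall x, scalar (B x) &
    forall (d : int) a, has_weight Y nu d a -> forall b c (n : int),
      B (Y a n b) c
      = (-1) ^ d * \sum_(l \in [set: nat]) (l`!%:R)^-1 *
          B b (Y (iter l (L Y nu 1) a) (2 * d - l%:Z - n - 2) c)].

(* Such a map automatically fixes the vacuum. *)
Definition antilinear_automorphism Y (th : V -> V) : Prop :=
  [/\ forall (k : R[i]) a b, th (k *: a + b) = Num.conj k *: th a + th b,
      bijective th &
      forall a (n : int) b, th (Y a n b) = Y (th a) n (th b)].

Definition is_ideal Y (J : set V) : Prop :=
  [/\ J 0,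
      forall (k : R[i]) a b, J a -> J b -> J (k *: a + b) &
      forall a b (n : int), J b -> J (Y a n b) /\ J (Y b n a)].

End VertexAlgebra.

Record unitary_voa (R : realType) := UnitaryVOA {
  uv_space :> lmodType R[i];
  vac : uv_space;
  vop : uv_space -> int -> uv_space -> uv_space;
  conf : uv_space;
  uv_dot : {dot uv_space for @Num.conj R[i]};
  uv_is_voa : is_voa vac vop conf;
  uv_normalized : braket uv_dot vac vac = 1;
  uv_invariant : exists th : uv_space -> uv_space,
    [/\ antilinear_automorphism vop th, th conf = conf &
        invariant_bilinear vop conf (fun a b => braket uv_dot (th a) b)]
}.
Arguments vac {R} _.
Arguments vop {R} _ _ _ _.
Arguments conf {R} _.
Arguments uv_dot {R} _.

Section UnitaryVOA.
Context (R : realType) (V : unitary_voa R).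

Definition simple_voa : Prop :=
  forall J : set V, is_ideal (vop V) J -> J = [set 0] \/ J = setT.

Definition ip (a b : V) : R[i] := braket (uv_dot V) a b.

Definition vnorm (a : V) : R[i] := sqrtC (ip a a).

Definition hcomp (a : V) : int -> V :=
  sval (cid (voa_grading (uv_is_voa V) a)).

(* a_n b, with a_n = a_(n+d-1) for a homogeneous of weight d. *)
Definition mode (a : V) (n : int) (b : V) : V :=
  \sum_(d \in [set: int]) vop V (hcomp a d) (n + d - 1) b.

Definition energy_bounds (a : V) : Prop :=
  exists (s k : nat) (M : R[i]), [/\ (0 < s)%N, (0 < k)%N, 0 < M &
    forall (n : int) (b : V),
      vnorm (mode a n b)
      <= M * ((absz n).+1)%:R ^+ s
         * vnorm (iter k (fun v => L (vop V) (conf V) 0 v + v) b)].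

Definition energy_bounded : Prop := forall a : V, energy_bounds a.

End UnitaryVOA.

Record hilbert (R : realType) := Hilbert {
  hs_space :> completeNormedModType R[i];
  hs_dot : {dot hs_space for @Num.conj R[i]};
  hs_normE : forall x : hs_space, `|x| ^+ 2 = hs_dot x x
}.

Section Operators.
Context (R : realType) (H : hilbert R).

Definition hip (x y : H) : R[i] := braket (hs_dot H) x y.

Definition bounded_op : set (H -> H) := [set A | linear A /\ continuous A].

Definition adjoint_op (A B : H -> H) : Prop :=
  forall x y, hip (A x) y = hip x (B y).

Definition unitary_op : set (H -> H) :=
  [set u | [/\ bounded_op u, forall x y, hip (u x) (u y) = hip x y &
              forall y, exists x, u x = y]].

Definition commutant (M : set (H -> H)) : set (H -> H) :=
  [set B | bounded_op B /\ forall A, M A -> B \o A = A \o B].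

Record von_neumann (M : set (H -> H)) : Prop := VonNeumann {
  vN_bounded : M `<=` bounded_op;
  vN_adjoint : forall A B, M A -> bounded_op B -> adjoint_op A B -> M B;
  vN_bicommutant : commutant (commutant M) = M
}.

Definition vN_generated (S : set (H -> H)) : set (H -> H) :=
  [set A | forall M, von_neumann M -> S `<=` M -> M A].

(* An unbounded operator is given by its graph G; u G u^-1 = G for every
   unitary u of M'. *)
Definition affiliated (G : set (H * H)) (M : set (H -> H)) : Prop :=
  forall u, commutant M u -> unitary_op u ->
    forall x y, G (x, y) <-> G (u x, u y).

Definition Wstar (F : set (set (H * H))) : set (H -> H) :=
  [set A | forall M, von_neumann M -> (forall G, F G -> affiliated G M) -> M A].

End Operators.

Section HilbertTensor.
Context (R : realType) (H1 H2 K : hilbert R).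

Record is_hilbert_tensor (T : H1 -> H2 -> K) : Prop := IsHilbertTensor {
  ht_bilinear : is_bilinear T;
  ht_hip : forall x x' y y',
    hip (T x y) (T x' y') = hip x x' * hip y y';
  ht_dense : dense [set z : K | exists (n : nat) (x : nat -> H1) (y : nat -> H2),
    z = \sum_(i < n) T (x i) (y i)]
}.

Definition vN_tensor (T : H1 -> H2 -> K)
    (M1 : set (H1 -> H1)) (M2 : set (H2 -> H2)) : set (K -> K) :=
  vN_generated [set X | bounded_op X /\ exists A B,
    [/\ M1 A, M2 B & forall x y, X (T x y) = T (A x) (B y)]].

End HilbertTensor.

Definition S1 (R : realType) : set R[i]^o := [set z | `|z| = 1].

Arguments S1 R : clear implicits.

Lemma expi_S1 (R : realType) (t : R) : ((cos t +i* sin t) : R[i]^o) \in S1 R.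
Proof.
by apply/mem_set; rewrite /S1 /= normc_def /= cos2Dsin2 sqrtr1.
Qed.

Definition expi (R : realType) (t : R) : S1 R := @exist _ (fun z => z \in S1 R) _ (expi_S1 t).

Section Circle.
Context (R : realType).
Local Notation circle := (set_type (S1 R)).

Definition interval1 : set (set circle) :=
  [set I | [/\ open I, connected I, I !=set0 & ~ dense I]].

Definition icompl (I : set circle) : set circle := interior (~` I).

Definition smooth_real (g : R -> R) : Prop :=
  forall (n : nat) (t : R), derivable (derive1n n g) t 1.

Definition smooth_circle (f : circle -> R[i]) : Prop :=
  smooth_real (fun t => complex.Re (f (expi t))) /\
  smooth_real (fun t => complex.Im (f (expi t))).

Definition support (f : circle -> R[i]) : set circle :=
  closure [set z | f z != 0].

(* (2 pi)^-1 * int_(-pi)^pi f(e^(it)) e^(-int) dt *)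
Definition fourier (f : circle -> R[i]) (n : int) : R[i] :=
  let g t : R[i] := f (expi t) * set_val (expi (- (n%:~R * t))) in
  ((2 * pi)^-1 *
     Rintegral (@lebesgue_measure R) `[- pi, pi] (fun t => complex.Re (g t)))
  +i* ((2 * pi)^-1 *
     Rintegral (@lebesgue_measure R) `[- pi, pi] (fun t => complex.Im (g t))).

End Circle.

Record completion (R : realType) (V : unitary_voa R) := Completion {
  cpl_space :> hilbert R;
  emb : V -> cpl_space;
  emb_linear : linear emb;
  emb_isometry : forall a b, hip (emb a) (emb b) = ip a b;
  emb_dense : dense (range emb)
}.
Arguments emb {R V} _ _.

Section Net.
Context (R : realType) (V : unitary_voa R) (H : completion V).
Local Notation circle := (set_type (S1 R)).

(* b |-> sum_n f^_n a_n b on V; under energy bounds the series converges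
   absolutely, so the symmetric partial sums compute its sum. *)
Definition smeared0 (a : V) (f : circle -> R[i]) : set (H * H) :=
  [set p | exists2 b : V, p.1 = emb H b &
    (fun N : nat => \sum_(k < (N + N).+1)
       fourier f (k%:Z - N%:Z) *: emb H (mode a (k%:Z - N%:Z) b)) @ \oo --> p.2].

Definition smeared (a : V) (f : circle -> R[i]) : set (H * H) :=
  closure (smeared0 a f).

Definition local_algebra (I : set circle) : set (H -> H) :=
  Wstar [set G | exists a f,
    [/\ smooth_circle f, support f `<=` I & G = smeared a f]].

Definition strongly_local : Prop :=
  energy_bounded V /\
  forall I, interval1 I -> local_algebra I `<=` commutant (local_algebra (icompl I)).

End Net.
Arguments local_algebra {R V} H I.

(* The covariance representation of a conformal net is determined by its local
   algebras and its vacuum vector, hence is not recorded. *)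
Record net (R : realType) (H : hilbert R) := Net {
  net_algebra : {I : set (set_type (S1 R)) | interval1 I} -> set (H -> H);
  net_vacuum : H
}.

Definition voa_net (R : realType) (V : unitary_voa R) (H : completion V) : net H :=
  Net (fun I => local_algebra H (sval I)) (emb H (vac V)).

Definition net_tensor (R : realType) (H1 H2 K : hilbert R) (T : H1 -> H2 -> K)
    (A1 : net H1) (A2 : net H2) : net K :=
  Net (fun I => vN_tensor T (net_algebra A1 I) (net_algebra A2 I))
      (T (net_vacuum A1) (net_vacuum A2)).

Definition is_tensor_product (R : realType) (U V W : lmodType R[i])
    (t : U -> V -> W) : Prop :=
  is_bilinear t /\
  forall (X : lmodType R[i]) (f : U -> V -> X), is_bilinear f ->
    exists g : W -> X, [/\ linear g, forall a b, g (t a b) = f a b &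
      forall g' : W -> X, linear g' -> (forall a b, g' (t a b) = f a b) -> g' = g].

Record is_voa_tensor (R : realType) (Va Vb W : unitary_voa R)
    (t : Va -> Vb -> W) : Prop := IsVOATensor {
  vt_tensor : is_tensor_product t;
  vt_vac : vac W = t (vac Va) (vac Vb);
  (* Y(a (x) b, z) = Y(a, z) (x) Y(b, z); the sum is finite *)
  vt_vop : forall a b (n : int) c d,
    vop W (t a b) n (t c d)
    = \sum_(k \in [set: int]) t (vop Va a k c) (vop Vb b (n - 1 - k) d);
  vt_conf : conf W = t (conf Va) (vac Vb) + t (vac Va) (conf Vb);
  vt_ip : forall a b c d, ip (t a b) (t c d) = ip a c * ip b d
}.

(* Main.v *)
(* Slices of an operator commuting with A(I) preserve the graphs of the smeared
   vertex operators of either factor, because Y(a (x) 1, f) restricts to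
   Y(a, f) (x) 1; hence A_a(I) (x) A_b(I) is contained in A(I). Conversely let u
   commute with A_a(I) (x) A_b(I). Taking slices again, u commutes weakly with
   Y(a, h) (x) Y(b, chi) when h and chi are supported in I. Replacing h, chi by
   z^m f, z^-m chi with chi = 1 on the support of f and summing over m restricts
   Y(a, z) (x) Y(b, w) to the diagonal, so u commutes weakly with Y(a (x) b, f).
   The same holds for small rotations of f, and averaging over them (a cut-off in
   L_0) upgrades the weak commutation to the invariance of the graph of the closed
   operator Y(a (x) b, f); hence A(I) is contained in A_a(I) (x) A_b(I). Locality
   follows from the equality for I and for I'. Energy bounds hold on a weight
   space of the tensor product because only finitely many products of modes act
   on it, each bounded after orthonormalizing one leg. *)

Require Import Defs.
From HB Require Import structures.
From mathcomp Require Import all_boot all_order all_algebra.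
From mathcomp Require Import complex.
From mathcomp Require Import all_classical all_reals all_analysis.
From mathcomp Require Import ring lra zify.
Import Order.TTheory GRing.Theory Num.Theory.
Import numFieldNormedType.Exports.
Set Implicit Arguments.
Unset Strict Implicit.
Unset Printing Implicit Defensive.
Local Open Scope classical_set_scope.
Local Open Scope complex_scope.
Local Open Scope ring_scope.

(** * Hilbert spaces *)

(** Affiliation is tested on unitaries of a commutant, while slices of operators are not unitary.
    The link is the orthogonal projection onto a graph in H x H, a 2 x 2 matrix of bounded
    operators: a unitary commuting with its four entries preserves the graph, and Cayley transforms
    of small self-adjoint operators provide enough unitaries. The obstacle in the harder inclusion
    is domains. Weak commutation only places u b in the domain of the adjoint of (the adjoint of
    Y(w, f) restricted to finite-energy vectors), which may exceed the domain of the closed operator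
    Y(w, f). The cut-off helps because energy bounds make Y(w, f) g(L_0) bounded for rapidly
    decreasing g. It requires the weak relation for all rotations by small angles, since only those
    functions of L_0 that average small rotations can be inserted into it. That modes shift weights
    is not an axiom here: it is derived from locality and from the action on the vacuum.
    Nonnegativity of the weights comes from unitarity and makes the sums over modes finite. *)

Section PreHilbert.
Context (R : realType) (V : lmodType R[i]) (f : {dot V for @Num.conj R[i]}).
Local Notation "'<< x , y >>" := (braket f x y) (at level 8, x at level 99).

Lemma braketC x y : '<< x, y >> = ('<< y, x >>)^*.
Proof. rewrite /braket hermC /= expr0 mul1r //. Qed.
Lemma braketDr x y z : '<< x, y + z >> = '<< x, y >> + '<< x, z >>.
Proof. by rewrite /braket linearDl. Qed.
Lemma braketZr x k y : '<< x, k *: y >> = k * '<< x, y >>.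
Proof. by rewrite /braket linearZl_LR. Qed.
Lemma braketDl x y z : '<< x + y, z >> = '<< x, z >> + '<< y, z >>.
Proof. by rewrite /braket linearDr. Qed.
Lemma braketZl k x y : '<< k *: x, y >> = k^* * '<< x, y >>.
Proof. rewrite /braket linearZr_LR //. Qed.
Lemma braket0r x : '<< x, 0 >> = 0.
Proof. by rewrite /braket linear0l. Qed.
Lemma braket0l x : '<< 0, x >> = 0.
Proof. by rewrite /braket linear0r. Qed.
Lemma braketNr x y : '<< x, - y >> = - '<< x, y >>.
Proof. by rewrite -scaleN1r braketZr mulN1r. Qed.
Lemma braketNl x y : '<< - x, y >> = - '<< x, y >>.
Proof. by rewrite /braket linearNr. Qed.
Lemma braketBr x y z : '<< x, y - z >> = '<< x, y >> - '<< x, z >>.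
Proof. by rewrite braketDr braketNr. Qed.
Lemma braketBl x y z : '<< x - y, z >> = '<< x, z >> - '<< y, z >>.
Proof. by rewrite braketDl braketNl. Qed.
Lemma braket_ge0 x : 0 <= '<< x, x >>.
Proof. exact: dnorm_ge0. Qed.
Lemma braket_eq0 x : ('<< x, x >> == 0) = (x == 0).
Proof. exact: dnorm_eq0. Qed.
Lemma braket_sumr (I : Type) (r : seq I) (P : pred I) x F :
  '<< x, \sum_(i <- r | P i) F i >> = \sum_(i <- r | P i) '<< x, F i >>.
Proof. exact: (big_morph _ (braketDr x) (braket0r x)). Qed.
Lemma braket_suml (I : Type) (r : seq I) (P : pred I) F y :
  '<< \sum_(i <- r | P i) F i, y >> = \sum_(i <- r | P i) '<< F i, y >>.
Proof.
by apply: (big_morph (fun x => '<< x, y >>)) => [a b|]; rewrite ?braketDl ?braket0l.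
Qed.

Lemma braket_CauchySchwarz x y : `|'<< x, y >>| ^+ 2 <= '<< x, x >> * '<< y, y >>.
Proof.
have [->|y0] := eqVneq y 0; first by rewrite !braket0r normr0 expr0n mulr0.
have yy : 0 < '<< y, y >> by rewrite lt_def braket_eq0 y0 braket_ge0.
set k := '<< y, x >> / '<< y, y >>.
have := braket_ge0 (x - k *: y).
rewrite braketBl !braketBr !braketZl !braketZr.
have -> : k * '<< y, y >> = '<< y, x >> by rewrite /k divfK// gt_eqF.
rewrite subrr subr0 subr_ge0 => h.
rewrite normCK -braketC -ler_pdivrMr//; apply: le_trans h.
by rewrite [X in X / _]mulrC /k mulrAC.
Qed.

End PreHilbert.

(** Norms take values in [R[i]]; the real part lives in the ordered field [R], where the estimates
    are carried out. *)
Definition rn (R : realType) (V : normedZmodType R[i]) (x : V) : R :=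
  complex.Re `|x|.

Section RealNorm.
Context (R : realType) (V : normedZmodType R[i]).
Implicit Types x y z : V.

Lemma rnE x : `|x| = (rn x)%:C.
Proof.
by have := normr_ge0 x; rewrite lecE /rn; case: `|x| => a b /= /andP[/eqP -> _].
Qed.
Lemma rn_ge0 x : 0 <= rn x.
Proof. by rewrite -lecR -rnE normr_ge0. Qed.
Lemma rnD x y : rn (x + y) <= rn x + rn y.
Proof. by rewrite -lecR rmorphD /= -!rnE ler_normD. Qed.
Lemma rnN x : rn (- x) = rn x.
Proof. by rewrite /rn normrN. Qed.
Lemma rnB x y : rn (x - y) <= rn x + rn y.
Proof. by rewrite -(rnN y) rnD. Qed.
Lemma rn_distC x y : rn (x - y) = rn (y - x).
Proof. by rewrite -rnN opprB. Qed.
Lemma rn0 : rn (0 : V) = 0.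
Proof. by rewrite /rn normr0. Qed.
Lemma rn_eq0 x : (rn x == 0) = (x == 0).
Proof. by rewrite -(normr_eq0 x) rnE -(inj_eq (@complexI _)). Qed.
Lemma rn_tri x y z : rn (x - z) <= rn (x - y) + rn (y - z).
Proof. by apply: le_trans (rnD _ _); rewrite addrA subrK. Qed.
Lemma rn_sum (I : Type) (r : seq I) (P : pred I) (F : I -> V) :
  rn (\sum_(i <- r | P i) F i) <= \sum_(i <- r | P i) rn (F i).
Proof.
elim/big_ind2: _ => [|x a y b xa yb|//]; first by rewrite rn0.
exact: le_trans (rnD _ _) (lerD xa yb).
Qed.
End RealNorm.

Lemma rnM (R : realType) (a b : R[i]) : rn (a * b) = rn a * rn b.
Proof. by apply: (@complexI R); rewrite rmorphM /= -!rnE normrM. Qed.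
Lemma rn1 (R : realType) : rn (1 : R[i]) = 1.
Proof. by rewrite /rn normr1. Qed.
Lemma rnX (R : realType) (a : R[i]) n : rn (a ^+ n) = rn a ^+ n.
Proof. by elim: n => [|n ih]; rewrite ?expr0 ?rn1// !exprS rnM ih. Qed.
Lemma rn_real (R : realType) (a : R) : rn (a%:C : R[i]) = `|a|.
Proof. by rewrite /rn normc_def /= expr0n addr0 sqrtr_sqr. Qed.
Lemma rn_nat (R : realType) n : rn (n%:R : R[i]) = n%:R.
Proof. by rewrite -(rmorph_nat (real_complex R)) rn_real ger0_norm. Qed.
Lemma rn_conj (R : realType) (a : R[i]) : rn (a^*) = rn a.
Proof. by rewrite /rn norm_conjC. Qed.
Lemma rn_sqrt (R : realType) (a : R[i]) :
  rn a = Num.sqrt (complex.Re a ^+ 2 + complex.Im a ^+ 2).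
Proof. by rewrite /rn normc_def. Qed.
Lemma rn_Re (R : realType) (a : R[i]) : `|complex.Re a| <= rn a.
Proof. by rewrite rn_sqrt -sqrtr_sqr ler_wsqrtr// lerDl sqr_ge0. Qed.
Lemma rn_Im (R : realType) (a : R[i]) : `|complex.Im a| <= rn a.
Proof. by rewrite rn_sqrt -sqrtr_sqr ler_wsqrtr// lerDr sqr_ge0. Qed.
Lemma rn_le (R : realType) (a : R[i]) :
  rn a <= `|complex.Re a| + `|complex.Im a|.
Proof.
rewrite rn_sqrt -(ler_pXn2r (n:=2))// ?nnegrE ?sqrtr_ge0 ?addr_ge0//.
rewrite sqr_sqrtr ?addr_ge0 ?sqr_ge0// sqrrD !real_normK ?num_real//.
by rewrite lerD2r lerDl mulrn_wge0 ?mulr_ge0.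
Qed.

Section RealNormMod.
Context (R : realType) (V : normedModType R[i]).
Implicit Types x y z : V.

Lemma rnZ k x : rn (k *: x) = rn k * rn x.
Proof. by apply: (@complexI R); rewrite rmorphM /= -!rnE normrZ. Qed.

(** A positive element of [R[i]] is a positive real, so real tolerances describe the same
    neighbourhoods. The next lemmas do the same for closures and density. *)
Lemma cvg_rn (u : nat -> V) l : u @ \oo --> l <->
  forall e : R, 0 < e -> exists N, forall n, (N <= n)%N -> rn (u n - l) < e.
Proof.
split=> [ul e e0|h].
  have /cvgrPdist_lt/(_ e%:C) := ul; rewrite ltcR => /(_ e0) [N _ hN].
  by exists N => n /hN /=; rewrite rnE ltcR rn_distC.
apply/cvgrPdist_lt => e; rewrite ltcE => /andP[/eqP e1 e0].
have [N hN] := h _ e0; exists N => // n /hN /=.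
by rewrite rnE rn_distC ltcE /= e1 eqxx.
Qed.

Lemma closure_rn (A : set V) x : closure A x <->
  forall e : R, 0 < e -> exists2 a, A a & rn (x - a) < e.
Proof.
split=> [h e e0|h B].
  have [|a [Aa xa]] := h (ball x e%:C); first by apply: nbhsx_ballx; rewrite ltcR.
  by exists a => //; move: xa; rewrite -ball_normE /= rnE ltcR.
move=> /nbhs_ballP[e /=]; rewrite ltcE => /andP[/eqP e1 e0] eB.
have [a Aa xa] := h _ e0; exists a; split=> //; apply: eB.
by rewrite -ball_normE /= rnE ltcE /= e1 eqxx.
Qed.

Lemma dense_rn (A : set V) : dense A <->
  forall x (e : R), 0 < e -> exists2 a, A a & rn (x - a) < e.
Proof.
split=> [h x e e0|h O [x Ox]].
  have [||a [xa Aa]] := h (ball x e%:C).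
  - by exists x; apply: ballxx; rewrite ltcR.
  - by apply: ball_open; rewrite ltcR.
  by exists a => //; move: xa; rewrite -ball_normE /= rnE ltcR.
rewrite openE => /(_ _ Ox) /nbhs_ballP[e /=].
rewrite ltcE => /andP[/eqP e1 e0] eB.
have [a Aa xa] := h x _ e0; exists a; split=> //; apply: eB.
by rewrite -ball_normE /= rnE ltcE /= e1 eqxx.
Qed.

End RealNormMod.

Section RealNormPair.
Context (R : realType) (V W : normedModType R[i]).

Lemma closure2_rn (A : set (V * W)) p : closure A p <->
  forall e : R, 0 < e -> exists2 a, A a & rn (p.1 - a.1) < e /\ rn (p.2 - a.2) < e.
Proof.
split=> [h e e0|h B].
  have [|a [Aa xa]] := h (ball p e%:C); first by apply: nbhsx_ballx; rewrite ltcR.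
  by exists a => //; case: xa; rewrite -!ball_normE /= !rnE !ltcR.
move=> /nbhs_ballP[e /=]; rewrite ltcE => /andP[/eqP e1 e0] eB.
have [a Aa [xa ya]] := h _ e0; exists a; split=> //; apply: eB.
by split; rewrite -ball_normE /= rnE ltcE /= e1 eqxx.
Qed.

Lemma linear_continuous_rn (A : V -> W) : linear A -> continuous A <->
  exists2 C : R, 0 <= C & forall x, rn (A x) <= C * rn x.
Proof.
move=> lA.
pose f : {linear V -> W} := HB.pack A (GRing.isLinear.Build _ _ _ _ A lA).
have AB x y : A (x - y) = A x - A y by exact: (linearB f).
have AZ k x : A (k *: x) = k *: A x by exact: (linearZ_LR f).
have A0 : A 0 = 0 by exact: (linear0 f).
split=> [cA|[C C0 hC] x].
  have /cvgrPdist_lt/(_ 1 ltr01) := cA 0.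
  move=> /nbhs_ballP[d /=]; rewrite ltcE => /andP[/eqP d1 d0] dB.
  have h y : rn y < complex.Re d -> rn (A y) < 1.
    move=> yd; have := dB y; rewrite -ball_normE /= sub0r normrN rnE ltcE /= d1 eqxx.
    by move=> /(_ yd); rewrite A0 sub0r normrN rnE -[X in _ < X]/(1%:C) ltcR.
  have d20 : 0 < 2 / complex.Re d by rewrite divr_gt0.
  exists (2 / complex.Re d); first exact: ltW.
  move=> x; have [->|x0] := eqVneq x 0; first by rewrite A0 !rn0 mulr0.
  have rx : 0 < rn x by rewrite lt_def rn_eq0 x0 rn_ge0.
  (* [k] rescales [x] to half the radius of the ball on which [A] stays below 1. *)
  pose k := complex.Re d / 2 / rn x.
  have k0 : 0 < k by rewrite !divr_gt0.
  have := h (k%:C *: x); rewrite AZ !rnZ rn_real gtr0_norm// => /(_ _)/ltW.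
  rewrite -ler_pdivlMl// mulr1 => hh; apply: le_trans (hh _) _.
    by rewrite divfK ?gt_eqF// gtr_pMr// invf_lt1// ltr1n.
  by rewrite le_eqVlt; apply/orP; left; apply/eqP; rewrite /k; field; rewrite !gt_eqF.
apply/cvgrPdist_lt => e; rewrite ltcE => /andP[/eqP e1 e0].
have C1 : 0 < C + 1 by rewrite ltr_wpDl.
have e' : 0 < (complex.Re e / (C + 1))%:C :> R[i] by rewrite ltcR divr_gt0.
near=> y.
rewrite -AB rnE ltcE /= e1 eqxx /=.
apply: le_lt_trans (hC _) _.
have : `|x - y| < (complex.Re e / (C + 1))%:C.
  by near: y; apply: cvgr_dist_lt.
rewrite rnE ltcR ltr_pdivlMr// => h; apply: le_lt_trans h.
by rewrite mulrC ler_wpM2l ?rn_ge0// lerDl.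
Unshelve. all: by end_near. Qed.
End RealNormPair.

Lemma complete_rn (R : realType) (V : completeNormedModType R[i]) (u : nat -> V) :
  (forall e : R, 0 < e -> exists N, forall m n, (N <= m)%N -> (N <= n)%N ->
     rn (u m - u n) < e) ->
  exists l, forall e : R, 0 < e -> exists N, forall n, (N <= n)%N -> rn (u n - l) < e.
Proof.
move=> h; suff /cvg_ex[l /cvg_rn hl] : cvgn u by exists l.
apply/cauchy_cvgP/cauchy_ballP => e; rewrite ltcE => /andP[/eqP e1 e0].
have [N hN] := h _ e0.
exists (u @` [set n | (N <= n)%N], u @` [set n | (N <= n)%N]) => /=.
  by split; exists N => // n Nn; exists n.
move=> [_ _] /= [[m Nm <-] [n Nn <-]].
by rewrite -ball_normE /= rnE ltcE /= e1 eqxx hN.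
Qed.

Lemma invS_small (R : realType) (e : R) : 0 < e ->
  exists N, forall n, (N <= n)%N -> n.+1%:R^-1 < e.
Proof.
by move=> e0; have [N _ h] := near_infty_natSinv_lt (PosNum e0); exists N.
Qed.

(** * Orthogonal projection onto complete subspaces *)

Section Projection.
Context (R : realType) (V : lmodType R[i]) (f : {dot V for @Num.conj R[i]}).
Local Notation "'<< x , y >>" := (braket f x y) (at level 8, x at level 99).
Definition sqn (x : V) : R := complex.Re '<< x, x >>.

Lemma sqnE x : '<< x, x >> = (sqn x)%:C.
Proof.
by have := braket_ge0 f x; rewrite lecE /sqn; case: '<< x, x >> => a b /= /andP[/eqP -> _].
Qed.
Lemma sqn_ge0 x : 0 <= sqn x.
Proof. by rewrite -lecR -sqnE braket_ge0. Qed.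
Lemma sqn_eq0 x : sqn x = 0 -> x = 0.
Proof. by move=> h; apply/eqP; rewrite -(braket_eq0 f) sqnE h. Qed.
Lemma sqn_CS x y : rn '<< x, y >> ^+ 2 <= sqn x * sqn y.
Proof.
by have := braket_CauchySchwarz f x y; rewrite rnE -rmorphXn !sqnE -rmorphM lecR.
Qed.
Lemma sqn_parallelogram x y : sqn (x - y) + sqn (x + y) = 2 * sqn x + 2 * sqn y.
Proof.
apply: (@complexI R); rewrite !rmorphD !rmorphM /= -!sqnE.
rewrite !braketDl !braketDr !braketNl !braketNr; ring.
Qed.
Lemma sqnZ k x : sqn (k *: x) = rn k ^+ 2 * sqn x.
Proof.
apply: (@complexI R); rewrite rmorphM rmorphXn /= -!sqnE -rnE.
by rewrite braketZl braketZr normCK; ring.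
Qed.

(** Completeness is expressed through the squared norm of the dot product, so that one projection
    theorem serves both H and the direct sum H x H, whose product norm does not come from a scalar
    product. *)
Definition dot_complete (G : set V) := forall u : nat -> V, (forall n, G (u n)) ->
  (forall e : R, 0 < e -> exists N, forall m n, (N <= m)%N -> (N <= n)%N ->
     sqn (u m - u n) < e) ->
  exists2 l, G l & forall e : R, 0 < e -> exists N, forall n, (N <= n)%N -> sqn (u n - l) < e.

Definition subspace_set (G : set V) :=
  G 0 /\ forall (k : R[i]) a b, G a -> G b -> G (k *: a + b).

Lemma sqn_sub_proj g y : 0 < sqn g ->
  sqn (y - ('<< g, y >> / '<< g, g >>) *: g) = sqn y - rn '<< g, y >> ^+ 2 / sqn g.
Proof.
move=> g0; apply: (@complexI R).
rewrite (rmorphB (real_complex R)) (rmorphM (real_complex R)).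
rewrite (rmorphXn (real_complex R)) (fmorphV (real_complex R)) /= -!sqnE -rnE normCK.
have gg : '<< g, g >> != 0 by rewrite braket_eq0; apply: contraTneq g0 => ->; rewrite /sqn braket0r ltxx.
have kc : ('<< g, y >> / '<< g, g >>)^* = '<< y, g >> / '<< g, g >>.
  by rewrite fmorph_div /= (braketC f y g) -(braketC f g g).
rewrite !braketBl !braketBr !braketZl !braketZr kc -(braketC f y g).
by field.
Qed.

Lemma dot_projection (G : set V) x : subspace_set G -> dot_complete G ->
  exists2 p, G p & forall g, G g -> '<< g, x - p >> = 0.
Proof.
move=> [G0 GD] Gc.
have GZ k a : G a -> G (k *: a) by move=> Ga; rewrite -[_ *: _]addr0; apply: GD.
have GA a b : G a -> G b -> G (a + b) by move=> Ga Gb; rewrite -[a]scale1r; apply: GD.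
pose S := [set sqn (x - g) | g in G].
have Sinf : has_inf S.
  split; first by exists (sqn (x - 0)), 0.
  by exists 0 => _ [g _ <-]; apply: sqn_ge0.
pose D := inf S.
have DS g : G g -> D <= sqn (x - g).
  by move=> Gg; apply: ge_inf; [case: Sinf | exists g].
have /choice[u hu] : forall n : nat, exists g, G g /\ sqn (x - g) < D + n.+1%:R^-1.
  move=> n; have n0 : 0 < n.+1%:R^-1 :> R by rewrite invr_gt0.
  by have [_ [g Gg <-] hg] := inf_adherent n0 Sinf; exists g.
(* Parallelogram law: the midpoint of [u m] and [u n] lies in [G], so its squared distance to [x] is
   at least [D]. *)
have cauchy m n : sqn (u m - u n) <= 2 * n.+1%:R^-1 + 2 * m.+1%:R^-1.
  have [Gm hm] := hu m; have [Gn hn] := hu n.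
  have := sqn_parallelogram (x - u n) (x - u m).
  have -> : x - u n - (x - u m) = u m - u n.
    by rewrite opprB addrAC addrCA subrr addr0 addrC.
  have -> : x - u n + (x - u m) = 2%:R *: (x - 2^-1 *: (u n + u m)).
    rewrite scalerBr scalerA divff ?pnatr_eq0// scale1r scaler_nat mulr2n.
    by rewrite addrACA -opprD.
  rewrite sqnZ rn_nat.
  have := DS _ (GZ 2^-1 _ (GA _ _ Gn Gm)).
  move: hm hn; move: (sqn (x - 2^-1 *: _)) (sqn (x - u m)) (sqn (x - u n)) (sqn _).
  by move: (m.+1%:R^-1) (n.+1%:R^-1) => b a p q r t; lra.
have [l Gl hl] : exists2 l, G l & forall e : R, 0 < e ->
    exists N, forall n, (N <= n)%N -> sqn (u n - l) < e.
  apply: Gc => [n|e e0]; first by case: (hu n).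
  have e4 : 0 < e / 4 by rewrite divr_gt0.
  have [N hN] := invS_small e4; exists N => m n Nm Nn.
  apply: le_lt_trans (cauchy m n) _.
  have := hN _ Nm; have := hN _ Nn.
  by move: (m.+1%:R^-1) (n.+1%:R^-1) => b a; lra.
exists l => // g Gg.
have [g0|] := eqVneq (sqn g) 0; first by rewrite (sqn_eq0 g0) braket0l.
rewrite neq_lt ltNge sqn_ge0 /= => g0.
(* Moving [u n] along [g] cannot push the squared distance below the infimum [D], so the component
   of [x - u n] along [g] is controlled by the excess [n.+1%:R^-1]. *)
have small n : rn '<< g, x - u n >> ^+ 2 <= sqn g * n.+1%:R^-1.
  have [Gn hn] := hu n.
  pose k := '<< g, x - u n >> / '<< g, g >>.
  have := DS _ (GD k _ _ Gg Gn).
  have -> : x - (k *: g + u n) = x - u n - k *: g by rewrite opprD addrCA addrC.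
  rewrite sqn_sub_proj// => h; rewrite mulrC -ler_pdivrMr//.
  by move: h hn; move: (n.+1%:R^-1) (_ / _) (sqn _) => a b c; lra.
apply/eqP; rewrite -(rn_eq0); apply: contraT => r0.
have {}r0 : 0 < rn '<< g, x - l >> by rewrite lt_def r0 rn_ge0.
set r := rn _ in r0.
have e1 : 0 < (r / 2) ^+ 2 / sqn g by rewrite divr_gt0// exprn_gt0// divr_gt0.
have [N1 h1] := invS_small e1; have [N2 h2] := hl _ e1.
pose n := maxn N1 N2.
have a1 : rn '<< g, x - u n >> < r / 2.
  rewrite -(ltr_pXn2r (n:=2))// ?nnegrE ?rn_ge0 ?divr_ge0 ?ltW//.
  apply: le_lt_trans (small n) _; rewrite mulrC -ltr_pdivlMr//.
  by apply: h1; rewrite leq_maxl.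
have a2 : rn '<< g, u n - l >> < r / 2.
  rewrite -(ltr_pXn2r (n:=2))// ?nnegrE ?rn_ge0 ?divr_ge0 ?ltW//.
  apply: le_lt_trans (sqn_CS _ _) _; rewrite mulrC -ltr_pdivlMr//.
  by apply: h2; rewrite leq_maxr.
have : r <= rn '<< g, x - u n >> + rn '<< g, u n - l >>.
  by rewrite /r; have -> : x - l = (x - u n) + (u n - l); rewrite ?braketDr ?rnD// addrA subrK.
by move=> h; exfalso; move: h a1 a2; lra.
Qed.

End Projection.

Section HilbertBasics.
Context (R : realType) (H : hilbert R).
Implicit Types x y z : H.

Lemma hip_sqn x : sqn (hs_dot H) x = rn x ^+ 2.
Proof.
by apply: (@complexI R); rewrite -sqnE rmorphXn /= -rnE hs_normE.
Qed.
Lemma hip_CS x y : rn (hip x y) <= rn x * rn y.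
Proof.
rewrite -(ler_pXn2r (n:=2))// ?nnegrE ?mulr_ge0 ?rn_ge0// exprMn -!hip_sqn.
exact: sqn_CS.
Qed.
Lemma hipC x y : hip x y = (hip y x)^*. Proof. exact: braketC. Qed.
Lemma hipDr x y z : hip x (y + z) = hip x y + hip x z. Proof. exact: braketDr. Qed.
Lemma hipDl x y z : hip (x + y) z = hip x z + hip y z. Proof. exact: braketDl. Qed.
Lemma hipBr x y z : hip x (y - z) = hip x y - hip x z. Proof. exact: braketBr. Qed.
Lemma hipBl x y z : hip (x - y) z = hip x z - hip y z. Proof. exact: braketBl. Qed.
Lemma hipNr x y : hip x (- y) = - hip x y. Proof. exact: braketNr. Qed.
Lemma hipNl x y : hip (- x) y = - hip x y. Proof. exact: braketNl. Qed.
Lemma hipZr x k y : hip x (k *: y) = k * hip x y. Proof. exact: braketZr. Qed.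
Lemma hipZl x k y : hip (k *: x) y = k^* * hip x y. Proof. exact: braketZl. Qed.
Lemma hip0r x : hip x 0 = 0. Proof. exact: braket0r. Qed.
Lemma hip0l x : hip 0 x = 0. Proof. exact: braket0l. Qed.
Lemma hip_sumr (I : Type) (r : seq I) (P : pred I) x (F : I -> H) :
  hip x (\sum_(i <- r | P i) F i) = \sum_(i <- r | P i) hip x (F i).
Proof. exact: braket_sumr. Qed.
Lemma hip_suml (I : Type) (r : seq I) (P : pred I) (F : I -> H) y :
  hip (\sum_(i <- r | P i) F i) y = \sum_(i <- r | P i) hip (F i) y.
Proof. exact: braket_suml. Qed.
Lemma hip_rn x : hip x x = (rn x ^+ 2)%:C.
Proof. by rewrite -hip_sqn -sqnE. Qed.

Lemma eq0_eps (a : R) (C : R) : 0 <= a -> (forall e, 0 < e -> a <= C * e) -> a = 0.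
Proof.
move=> a0 h; apply/eqP; rewrite eq_le a0 andbT leNgt; apply/negP => a1.
have C1 : 0 < `|C| + 1 by rewrite ltr_wpDl.
have := h (a / (2 * (`|C| + 1))).
rewrite !divr_gt0 ?mulr_gt0// => /(_ isT).
rewrite mulrA ler_pdivlMr ?mulr_gt0// => h2.
have := ler_norm C; nra.
Qed.

Lemma hip_dense0 (A : set H) x : dense A -> (forall a, A a -> hip a x = 0) -> x = 0.
Proof.
move=> /dense_rn dA h; apply/eqP; rewrite -rn_eq0; apply/eqP.
suff : rn x ^+ 2 = 0 by move/eqP; rewrite sqrf_eq0 => /eqP.
apply: (@eq0_eps _ (rn x)) => [|e e0]; first by rewrite sqr_ge0.
have [a Aa xa] := dA x e e0.
have -> : rn x ^+ 2 = rn (hip (x - a) x).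
  by rewrite hipBl (h a)// subr0 hip_rn rn_real ger0_norm// sqr_ge0.
apply: le_trans (hip_CS _ _) _; rewrite mulrC ler_wpM2l ?rn_ge0//; exact: ltW.
Qed.

End HilbertBasics.

Section LinearMaps.
Context (R : realType) (V W : lmodType R[i]) (A : V -> W) (lA : linear A).
Lemma linD x y : A (x + y) = A x + A y.
Proof. by rewrite -[x]scale1r lA !scale1r. Qed.
Lemma lin0 : A 0 = 0.
Proof. by apply: (addrI (A 0)); rewrite addr0 -linD addr0. Qed.
Lemma linZ k x : A (k *: x) = k *: A x.
Proof. by rewrite -[_ *: x]addr0 lA lin0 addr0. Qed.
Lemma linN x : A (- x) = - A x.
Proof. by rewrite -scaleN1r linZ scaleN1r. Qed.
Lemma linB x y : A (x - y) = A x - A y.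
Proof. by rewrite linD linN. Qed.
Lemma lin_sum (I : Type) (r : seq I) (P : pred I) (F : I -> V) :
  A (\sum_(i <- r | P i) F i) = \sum_(i <- r | P i) A (F i).
Proof. exact: (big_morph _ linD lin0). Qed.
End LinearMaps.

Lemma conj_rc (R : realType) (x : R) : (x%:C : R[i])^* = x%:C.
Proof. by apply/CrealP; rewrite realE -[0]/(0%:C) !lecR le_total. Qed.

(** * Von Neumann algebras and unbounded operators *)

Section Bounded.
Context (R : realType) (H1 H2 : hilbert R).

Lemma bounded_pos (A : H1 -> H2) : linear A -> continuous A ->
  exists2 C : R, 0 < C & forall x, rn (A x) <= C * rn x.
Proof.
move=> lA /(linear_continuous_rn lA)[C C0 hC]; exists (C + 1); first exact: ltr_wpDl.
by move=> x; apply: le_trans (hC x) _; rewrite ler_wpM2r ?rn_ge0// lerDl.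
Qed.

Lemma hip_ext (H : hilbert R) (x y : H) : (forall z, hip z x = hip z y) -> x = y.
Proof.
move=> h; apply/eqP; rewrite -subr_eq0; apply/eqP/(@hip_dense0 _ _ setT).
  by apply/dense_rn => a e e0; exists a; rewrite // subrr rn0.
by move=> a _; rewrite hipBr h subrr.
Qed.

Lemma closed_dot_complete (H : hilbert R) (G : set H) :
  closure G `<=` G -> dot_complete (hs_dot H) G.
Proof.
move=> cG u Gu cu.
have [l hl] : exists l, forall e : R, 0 < e -> exists N, forall n, (N <= n)%N -> rn (u n - l) < e.
  apply: complete_rn => e e0.
  have [N hN] := cu _ (exprn_gt0 2 e0); exists N => m n Nm Nn.
  have := hN m n Nm Nn; rewrite hip_sqn ltr_pXn2r// nnegrE ?rn_ge0//; exact: ltW.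
exists l.
  apply: cG; apply/closure_rn => e e0; have [N hN] := hl _ e0.
  by exists (u N) => //; rewrite rn_distC hN.
move=> e e0; have s0 : 0 < Num.sqrt e by rewrite sqrtr_gt0.
have [N hN] := hl _ s0; exists N => n Nn.
rewrite hip_sqn -[ltRHS]sqr_sqrtr ?(ltW e0)// ltr_pXn2r ?nnegrE ?rn_ge0 ?sqrtr_ge0//.
exact: hN.
Qed.

Lemma riesz (H : hilbert R) (phi : H -> R[i]) (C : R) : scalar phi ->
  (forall x, rn (phi x) <= C * rn x) -> exists v, forall x, phi x = hip v x.
Proof.
move=> lp bp; have lp' : linear (phi : H -> R[i]^o) by [].
pose G := [set x | phi x = 0].
have sG : subspace_set G.
  split; first exact: (lin0 lp').
  by move=> k a b Ga Gb; rewrite /G /= (lp k a b) Ga Gb mulr0 addr0.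
have cG : dot_complete (hs_dot H) G.
  apply: closed_dot_complete => x /closure_rn hx /=; apply/eqP; rewrite -rn_eq0; apply/eqP.
  apply: (@eq0_eps _ _ `|C|) => [|e e0]; first exact: rn_ge0.
  have [a Ga xa] := hx _ e0.
  have -> : phi x = phi (x - a) by rewrite (linB lp') Ga subr0.
  apply: le_trans (bp _) _; apply: le_trans (ler_wpM2r (rn_ge0 _) (ler_norm C)) _.
  by rewrite ler_wpM2l// ltW.
have [[x0 px0]|px] := pselect (exists x, phi x != 0); last first.
  exists 0 => x; rewrite hip0l; apply/eqP; apply: contrapT => /negP h; apply: px; by exists x.
have [p Gp hp] := dot_projection x0 sG cG.
set n := x0 - p.
have pn : phi n != 0 by rewrite /n (linB lp') Gp subr0.
have nn : hip n n != 0.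
  by rewrite /hip braket_eq0; apply: contra pn => /eqP ->; rewrite (lin0 lp').
(* [n] spans the orthogonal complement of the kernel of [phi]; the scalar is fixed by testing at
   [n], where the value must be [phi n]. *)
exists (((phi n)^* / hip n n) *: n) => x.
rewrite hipZl fmorph_div /= conjCK -hipC.
have : phi (x - (phi x / phi n) *: n) = 0.
  by rewrite (linB lp') (linZ lp') /=  -[_ *: _]/(_ * _) divfK// subrr.
move=> /hp; rewrite -/n -/(hip _ _) => /(congr1 Num.conj).
rewrite rmorph0 -hipC hipBr hipZr => /eqP; rewrite subr_eq0 => /eqP ->.
by field; rewrite nn pn.
Qed.

Lemma adjoint_exists (A : H1 -> H2) : linear A -> continuous A ->
  exists B : H2 -> H1, [/\ linear B, continuous B &
    forall x y, hip (A x) y = hip x (B y)].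
Proof.
move=> lA cA; have [C C0 hC] := bounded_pos lA cA.
have /choice[B hB] y : exists v : H1, forall x, hip y (A x) = hip v x.
  apply: (@riesz _ _ (rn y * C)) => [k a b|x].
    by rewrite lA hipDr hipZr.
  apply: le_trans (hip_CS _ _) _.
  by rewrite -mulrA ler_wpM2l ?rn_ge0.
have BE x y : hip (A x) y = hip x (B y) by rewrite hipC hB -hipC.
have lB : linear B.
  move=> k a b; apply: hip_ext => z.
  by rewrite hipDr hipZr -!BE hipDr hipZr.
exists B; split=> //.
apply/(linear_continuous_rn lB); exists C; first exact: ltW.
(* The bound comes from the squared norm of [B y], which is the pairing of [A (B y)] with [y]. *)
move=> y; have [->|By] := eqVneq (B y) 0; first by rewrite rn0 mulr_ge0 ?rn_ge0 ?ltW.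
have b0 : 0 < rn (B y) by rewrite lt_def rn_eq0 By rn_ge0.
rewrite -(ler_pM2l b0) -expr2.
have -> : rn (B y) ^+ 2 = rn (hip (B y) (B y)) by rewrite hip_rn rn_real ger0_norm ?sqr_ge0.
rewrite -BE; apply: le_trans (hip_CS _ _) _.
by rewrite [leRHS]mulrA ler_wpM2r ?rn_ge0// mulrC hC.
Qed.

End Bounded.

Section Operators.
Context (R : realType) (H : hilbert R).
Implicit Types (A B C : H -> H) (S M : set (H -> H)).

Lemma bounded_opP A : bounded_op A <->
  linear A /\ exists2 C : R, 0 <= C & forall x, rn (A x) <= C * rn x.
Proof.
by split=> -[lA h]; split=> //; move: h => /linear_continuous_rn; exact.
Qed.

Lemma bounded_id : bounded_op (@id H).
Proof.
by apply/bounded_opP; split=> [k a b//|]; exists 1 => // x; rewrite mul1r.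
Qed.
Lemma bounded_comp A B : bounded_op A -> bounded_op B -> bounded_op (A \o B).
Proof.
move=> /bounded_opP[lA [c c0 hA]] /bounded_opP[lB [d d0 hB]]; apply/bounded_opP.
split=> [k a b|]; first by rewrite /= lB lA.
exists (c * d) => [|x]; first exact: mulr_ge0.
by rewrite -mulrA; apply: le_trans (hA _) _; rewrite ler_wpM2l.
Qed.
Lemma bounded_lincomb k A B : bounded_op A -> bounded_op B ->
  bounded_op (fun x => k *: A x + B x).
Proof.
move=> /bounded_opP[lA [c c0 hA]] /bounded_opP[lB [d d0 hB]]; apply/bounded_opP.
split=> [l a b|].
  by rewrite lA lB !scalerDr !scalerA (mulrC l k) addrACA.
exists (rn k * c + d) => [|x]; first by rewrite addr_ge0 ?mulr_ge0 ?rn_ge0.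
apply: le_trans (rnD _ _) _; rewrite mulrDl lerD// rnZ -mulrA.
by rewrite ler_wpM2l ?rn_ge0.
Qed.
Lemma bounded_0 : bounded_op (fun _ : H => 0 : H).
Proof.
apply/bounded_opP; split=> [k a b|]; first by rewrite scaler0 addr0.
by exists 0 => // x; rewrite rn0 mul0r.
Qed.

Lemma adjoint_sym A B : adjoint_op A B -> adjoint_op B A.
Proof. by move=> h x y; rewrite hipC -h -hipC. Qed.

Lemma bounded_adjoint A : bounded_op A -> exists2 B, bounded_op B & adjoint_op A B.
Proof. by move=> [lA cA]; have [B [? ? ?]] := adjoint_exists lA cA; exists B. Qed.

Definition star_closed S := forall A, S A -> exists2 B, S B & adjoint_op A B.

Lemma commutant_anti S M : S `<=` M -> commutant M `<=` commutant S.
Proof. by move=> SM B [bB hB]; split=> // A /SM; apply: hB. Qed.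

Lemma commutant_bi S : S `<=` @bounded_op R H -> S `<=` commutant (commutant S).
Proof. by move=> bS A SA; split; [exact: bS | move=> B [_ hB]; rewrite hB]. Qed.

Lemma commutant_bounded S : commutant S `<=` @bounded_op R H.
Proof. by move=> A []. Qed.

(** Star-closure makes the commutant stable under adjoints, and any commutant equals its own double
    commutant. *)
Lemma vN_commutant S : S `<=` @bounded_op R H -> star_closed S -> von_neumann (commutant S).
Proof.
move=> bS sS; split=> [A []//|A B [bA hA] bB AB|].
  split=> // s Ss; have [s' Ss' ss'] := sS _ Ss.
  have e z : s' (A z) = A (s' z) by have /(congr1 (@^~ z)) := hA _ Ss'.
  apply/funext => x /=; apply: hip_ext => z.
  by rewrite -AB -(adjoint_sym ss') e AB (adjoint_sym ss').
apply/seteqP; split; last by apply: commutant_bi; exact: commutant_bounded.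
exact/commutant_anti/commutant_bi.
Qed.

Lemma vN_star M : von_neumann M -> star_closed M.
Proof.
move=> vM A MA; have [B bB AB] := bounded_adjoint (vN_bounded vM MA).
by exists B => //; exact: vN_adjoint AB.
Qed.

Lemma vN_commutant_vN M : von_neumann M -> von_neumann (commutant M).
Proof. by move=> vM; apply: vN_commutant; [case: vM | exact: vN_star]. Qed.

Lemma vN_inter (P : set (set (H -> H))) : (forall M, P M -> von_neumann M) ->
  P !=set0 -> von_neumann [set A | forall M, P M -> M A].
Proof.
move=> vP [M0 PM0].
have b : [set A | forall M, P M -> M A] `<=` @bounded_op R H.
  by move=> A /(_ _ PM0); exact: (vN_bounded (vP _ PM0)).
split=> //.
  by move=> A B hA bB AB M PM; apply: (vN_adjoint (vP _ PM)) AB => //; exact: hA.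
apply/seteqP; split; last exact: commutant_bi.
move=> A hA M PM; rewrite -(vN_bicommutant (vP _ PM)).
by apply: (commutant_anti _ hA); apply: commutant_anti => B; exact.
Qed.

(** The double commutant property as a membership test; this is how inverses and linear combinations
    are placed in a given algebra. *)
Lemma vN_mem M A : von_neumann M -> bounded_op A ->
  (forall B, commutant M B -> A \o B = B \o A) -> M A.
Proof. by move=> vM bA h; rewrite -(vN_bicommutant vM); split=> // B /h. Qed.

Lemma vN_id M : von_neumann M -> M id.
Proof. by move=> vM; apply: vN_mem => //; exact: bounded_id. Qed.
Lemma vN_0 M : von_neumann M -> M (fun=> 0).
Proof.
move=> vM; apply: vN_mem => //; first exact: bounded_0.
by move=> B [[lB _] _]; apply/funext => x /=; rewrite (lin0 lB).
Qed.
Lemma vN_lincomb M k A B : von_neumann M -> M A -> M B -> M (fun x => k *: A x + B x).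
Proof.
move=> vM MA MB; apply: vN_mem => //.
  by apply: bounded_lincomb; apply: vN_bounded vM _ _.
move=> C [[lC _] hC]; apply/funext => x /=.
have /(congr1 (@^~ x)) /= <- := hC _ MA.
have /(congr1 (@^~ x)) /= <- := hC _ MB.
by rewrite lC.
Qed.

(** The bound 1/2 makes the norm of [x - 'i *: C x] comparable with that of [x] by the triangle
    inequality alone, which is what inverting 1 - iC rests on. *)
Definition small_selfadj C :=
  adjoint_op C C /\ forall x, rn (C x) <= 2^-1 * rn x.

(** Every element is a combination of its real and imaginary parts, and each of these is a multiple
    of a self-adjoint operator of norm at most 1/2. *)
Lemma vN_selfadj_ind M (P : (H -> H) -> Prop) : von_neumann M ->
  (forall C, M C -> small_selfadj C -> P C) ->
  (forall k A B, P A -> P B -> P (fun x => k *: A x + B x)) ->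
  forall A, M A -> P A.
Proof.
move=> vM PC PD A MA.
have P0 : P (fun=> 0).
  apply: PC; first exact: vN_0.
  by split=> [x y|x]; rewrite ?hip0l ?hip0r// rn0 mulr_ge0 ?rn_ge0.
have PZ k B : P B -> P (fun x => k *: B x).
  by move=> PB; have := PD k _ _ PB P0; congr P; apply/funext => x; rewrite addr0.
have MZ k B : M B -> M (fun x => k *: B x).
  move=> MB; have := vN_lincomb k vM MB (vN_0 vM); congr M.
  by apply/funext => x; rewrite addr0.
have sa B : M B -> adjoint_op B B -> P B.
  move=> MB sB; have /bounded_opP[lB [c c0 hc]] := vN_bounded vM MB.
  have c1 : 0 < c + 1 by exact: ltr_wpDl.
  pose d : R := (2 * (c + 1))^-1.
  have d0 : 0 < d by rewrite invr_gt0 mulr_gt0.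
  have : P (fun x => d%:C *: B x).
    apply: PC; first exact: MZ.
    split=> [x y|x]; first by rewrite hipZl hipZr sB conj_rc.
    rewrite rnZ rn_real gtr0_norm//.
    apply: le_trans (ler_wpM2l (ltW d0) (hc _)) _; rewrite mulrA ler_wpM2r ?rn_ge0//.
    by rewrite /d invfM -mulrA ler_piMr ?invr_ge0// ler_pdivrMl ?mulr1// lerDl.
  move=> /(PZ d%:C^-1); congr P; apply/funext => x.
  rewrite scalerA mulVf ?scale1r//.
  by rewrite -rn_eq0 rn_real gtr0_norm// gt_eqF.
have [B MB AB] := vN_star vM MA; have BA := adjoint_sym AB.
have P1 : P (fun x => 1 *: A x + B x).
  apply: sa => [|x y]; first exact: vN_lincomb.
  by rewrite !scale1r hipDl hipDr AB BA addrC.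
have P2 : P (fun x => 'i *: A x + (- 'i) *: B x).
  apply: sa => [|x y]; first by apply: vN_lincomb => //; exact: MZ.
  by rewrite hipDl hipDr !hipZl !hipZr AB BA rmorphN /= conjCi opprK addrC.
(* With B the adjoint of A: A = (A + B)/2 - (i/2)(iA - iB). *)
have := PD 2^-1 _ _ P1 (PZ (- 'i / 2) _ P2).
congr P; apply/funext => x.
rewrite scale1r !scalerDr !scalerA !addrA.
have -> : - 'i / 2 * 'i = 2^-1 :> R[i].
  by rewrite mulrAC mulNr -expr2 sqrCi opprK mul1r.
have -> : - 'i / 2 * - 'i = - 2^-1 :> R[i].
  by rewrite mulrAC mulrNN -expr2 sqrCi mulN1r.
rewrite addrAC scaleNr addrK -scalerDl -[RHS]scale1r; congr (_ *: _).
by rewrite -mulr2n -[_ *+ 2]mulr_natr mulVf ?pnatr_eq0.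
Qed.

End Operators.

Lemma rn_i (R : realType) : rn ('i : R[i]) = 1.
Proof. by rewrite /rn normCi. Qed.

(** * Cayley transforms of bounded self-adjoint operators *)

Section Cayley.
Context (R : realType) (H : hilbert R).
Implicit Types (A B C : H -> H) (S M : set (H -> H)).

Lemma cayley_bound C x : small_selfadj C -> rn x <= 2 * rn (x - 'i *: C x).
Proof.
move=> [_ /(_ x) hC]; have := rnD (x - 'i *: C x) ('i *: C x).
rewrite subrK rnZ rn_i mul1r => h.
have := le_trans h (lerD (lexx _) hC); lra.
Qed.

(** The range of 1 - iC is closed because the map is bounded below. A vector [w] orthogonal to the
    range satisfies [hip w w = hip ('i *: C w) w], which with the bound 1/2 forces [w = 0]. *)
Lemma cayley_surj C : bounded_op C -> small_selfadj C ->
  forall y, exists x, x - 'i *: C x = y.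
Proof.
move=> [lC _] sC y.
pose D x := x - 'i *: C x.
have lD : linear D.
  move=> k a b; rewrite /D lC scalerDr !scalerBr opprD addrACA; congr (_ - _ + _).
  by rewrite !scalerA mulrC.
pose G := [set z | exists x, D x = z].
have sG : subspace_set G.
  split; first by exists 0; rewrite (lin0 lD).
  by move=> k _ _ [a <-] [b <-]; exists (k *: a + b); rewrite lD.
have Dle x : rn x <= 2 * rn (D x) by exact: cayley_bound.
have Dge x : rn (D x) <= 2 * rn x.
  have [_ /(_ x) hC] := sC.
  apply: le_trans (rnB _ _) _; rewrite rnZ rn_i mul1r.
  have := rn_ge0 x; lra.
have cG : dot_complete (hs_dot H) G.
  move=> u /choice[v hv] cu.
  have [l hl] : exists l, forall e : R, 0 < e -> exists N, forall n, (N <= n)%N -> rn (v n - l) < e.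
    apply: complete_rn => e e0.
    have e2 : 0 < (e / 2) ^+ 2 by rewrite exprn_gt0// divr_gt0.
    have [N hN] := cu _ e2; exists N => m n Nm Nn.
    have := hN m n Nm Nn; rewrite hip_sqn ltr_pXn2r ?nnegrE ?rn_ge0 ?divr_ge0 ?ltW//.
    by have := Dle (v m - v n); rewrite (linB lD) !hv; lra.
  exists (D l); first by exists l.
  move=> e e0; have s0 : 0 < Num.sqrt e by rewrite sqrtr_gt0.
  have [N hN] := hl _ (divr_gt0 s0 (ltr0n R 2)); exists N => n Nn.
  rewrite hip_sqn -[ltRHS]sqr_sqrtr ?(ltW e0)// ltr_pXn2r ?nnegrE ?rn_ge0 ?sqrtr_ge0//.
  have := hN n Nn; have := Dge (v n - l); rewrite (linB lD) hv; lra.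
have [p [x <-] hp] := dot_projection y sG cG.
exists x; apply/esym/eqP; rewrite -subr_eq0; set w := y - D x in hp *.
have : hip (D w) w = 0 by apply: hp; exists w.
rewrite hipBl => /eqP; rewrite subr_eq0 => /eqP h.
have [_ hC] := sC.
have : rn w ^+ 2 <= 2^-1 * rn w ^+ 2.
  have {1}-> : rn w ^+ 2 = rn (hip w w) by rewrite hip_rn rn_real ger0_norm ?sqr_ge0.
  rewrite h; apply: le_trans (hip_CS _ _) _; rewrite rnZ rn_i mul1r.
  by rewrite expr2 mulrA ler_wpM2r ?rn_ge0.
rewrite -rn_eq0 => h2; rewrite -sqrf_eq0 eq_le sqr_ge0 andbT; lra.
Qed.

Lemma small_selfadjN C : small_selfadj C -> small_selfadj (fun x => - C x).
Proof.
by move=> [aC hC]; split=> [x y|x]; rewrite ?hipNl ?hipNr ?aC// rnN.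
Qed.

(** [Q] is the inverse of 1 - iC, and [2 *: Q x - x] is the Cayley transform (1 + iC)(1 - iC)^-1. A
    linear operator commutes with C exactly when it commutes with this unitary, so unitaries can
    stand for small self-adjoint operators. *)
Lemma cayley C : bounded_op C -> small_selfadj C ->
  exists Q : H -> H, [/\ bounded_op Q, forall x, Q (x - 'i *: C x) = x,
    forall x, Q x - 'i *: C (Q x) = x & unitary_op (fun x => 2 *: Q x - x)].
Proof.
move=> bC sC; have [lC _] := bC.
have /choice[Q hQ] := cayley_surj bC sC.
pose D x := x - 'i *: C x.
have lD : linear D.
  move=> k a b; rewrite /D lC scalerDr !scalerBr opprD addrACA; congr (_ - _ + _).
  by rewrite !scalerA mulrC.
have Dle x : rn x <= 2 * rn (D x) by exact: cayley_bound.
have Dinj x y : D x = D y -> x = y.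
  move=> e; apply/eqP; rewrite -subr_eq0 -rn_eq0 eq_le rn_ge0 andbT.
  by apply: le_trans (Dle _) _; rewrite (linB lD) e subrr rn0 mulr0.
have DQ x : D (Q x) = x by exact: hQ.
have QD x : Q (D x) = x by apply: Dinj; rewrite DQ.
have lQ : linear Q by move=> k a b; apply: Dinj; rewrite lD !DQ.
have bQ : bounded_op Q.
  by apply/bounded_opP; split=> //; exists 2 => // x; have := Dle (Q x); rewrite DQ.
have uD x : 2 *: Q (D x) - D x = x + 'i *: C x.
  by rewrite QD /D opprB scaler_nat mulr2n addrC addrA subrK addrC.
exists Q; split=> //; split.
- have := bounded_lincomb 2 bQ (bounded_lincomb (-1) (bounded_id H) (bounded_0 H)).
  by congr bounded_op; apply/funext => x; rewrite scaleN1r addr0.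
- move=> x y; rewrite -(DQ x) -(DQ y) !uD; have [aC _] := sC.
  set a := Q x; set b := Q y; rewrite /D.
  rewrite !hipDl !hipDr !hipNl !hipNr !hipZl !hipZr conjCi aC; ring.
- move=> y; have [|x hx] := cayley_surj _ (small_selfadjN sC) y.
    have := bounded_lincomb (-1) bC (bounded_0 H).
    by congr bounded_op; apply/funext => x; rewrite scaleN1r addr0.
  by exists (D x); rewrite uD -hx scalerN opprK.
Qed.

Lemma commute_cayley C Q B : linear C -> linear B ->
  (forall x, Q (x - 'i *: C x) = x) -> (forall x, Q x - 'i *: C (Q x) = x) ->
  (forall x, B (Q x) = Q (B x)) -> forall x, B (C x) = C (B x).
Proof.
move=> lC lB QD DQ BQ x.
have := BQ (x - 'i *: C x); rewrite QD => e.
have := DQ (B (x - 'i *: C x)); rewrite -e (linB lB) (linZ lB) => /eqP.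
by rewrite (inj_eq (addrI _)) eqr_opp (inj_eq (scalerI (neq0Ci _))) => /eqP.
Qed.

Lemma cayley_commute C Q B : linear C -> linear B ->
  (forall x, Q (x - 'i *: C x) = x) -> (forall x, Q x - 'i *: C (Q x) = x) ->
  (forall x, B (C x) = C (B x)) -> forall x, B (Q x) = Q (B x).
Proof.
move=> lC lB QD DQ BC x.
have e : B x = B (Q x) - 'i *: C (B (Q x)) by rewrite -BC -(linZ lB) -(linB lB) DQ.
by rewrite e QD.
Qed.

(** The Cayley transform of a small self-adjoint element lies in [M], and commuting with it means
    commuting with the element; such elements span [M]. *)
Lemma vN_unitaries M B : von_neumann M -> bounded_op B ->
  (forall u, M u -> unitary_op u -> forall x, B (u x) = u (B x)) -> commutant M B.
Proof.
move=> vM bB hB; split=> // A MA; have [lB _] := bB.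
suff : forall x, B (A x) = A (B x) by move=> h; apply/funext.
move: A MA; apply: (vN_selfadj_ind vM) => [C MC sC|k A A' hA hA' x].
  have bC := vN_bounded vM MC; have [lC _] := bC.
  have [Q [bQ QD DQ uQ]] := cayley bC sC.
  apply: (commute_cayley lC lB QD DQ) => x.
  have MQ : M Q.
    apply: vN_mem => // E [[lE _] hE]; apply/funext => y /=; apply/esym.
    apply: (cayley_commute lC lE QD DQ) => z.
    by have /(congr1 (@^~ z)) := hE _ MC.
  have Mu : M (fun x => 2 *: Q x - x).
    have := vN_lincomb 2 vM MQ (vN_lincomb (-1) vM (vN_id vM) (vN_0 vM)).
    by congr M; apply/funext => y; rewrite scaleN1r addr0.
  have := hB _ Mu uQ x; rewrite (linB lB) (linZ lB) => /eqP.
  by rewrite (inj_eq (addIr _)) (inj_eq (scalerI _)) ?pnatr_eq0// => /eqP.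
by rewrite lB hA hA'.
Qed.

End Cayley.

(** * The direct sum of two copies of a Hilbert space, and graphs of operators *)

Section PairDot.
Context (R : realType) (H : hilbert R).

Definition pair_form (x y : H * H) : R[i] := hs_dot H x.1 y.1 + hs_dot H x.2 y.2.

Lemma pair_bilinear : bilinear_for *%R (Num.conj \; *%R) pair_form.
Proof.
split=> z k x y; rewrite /pair_form /=.
  by rewrite !linearPl /= mulrDr addrACA.
by rewrite !linearPr /= mulrDr addrACA.
Qed.
HB.instance Definition _ := bilinear_isBilinear.Build R[i] _ _ _ _ _ pair_form pair_bilinear.

Lemma pair_hermitian x y : pair_form x y = (-1) ^+ false * Num.conj (pair_form y x).
Proof.
rewrite expr0 mul1r /pair_form rmorphD /=.
by congr (_ + _); apply: (braketC (hs_dot H)).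
Qed.
HB.instance Definition _ := isHermitianSesquilinear.Build R[i] _ _ _ pair_form pair_hermitian.

Lemma pair_pos x : x != 0 -> 0 < pair_form x x.
Proof.
case: x => a b; rewrite xpair_eqE negb_and /pair_form /= => /orP[] h.
  by rewrite ltr_pwDl ?dnorm_gt0 ?dnorm_ge0.
by rewrite ltr_wpDl ?dnorm_gt0 ?dnorm_ge0.
Qed.
HB.instance Definition _ := isDotProduct.Build R[i] _ pair_form pair_pos.

Definition pair_dot : {dot (H * H)%type for @Num.conj R[i]} := pair_form.

Lemma pair_hip x y : braket pair_dot x y = hip x.1 y.1 + hip x.2 y.2.
Proof. by []. Qed.
End PairDot.

Section Graphs.
Context (R : realType) (H : hilbert R).
Implicit Types (A B C : H -> H) (S M : set (H -> H)) (G : set (H * H)%type).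

Definition closed_subspace G := subspace_set G /\ closure G `<=` G.

Definition gperp G : set (H * H)%type :=
  [set h | forall g, G g -> hip g.1 h.1 + hip g.2 h.2 = 0].

Lemma pair_sqn (x : (H * H)%type) : sqn (pair_dot H) x = rn x.1 ^+ 2 + rn x.2 ^+ 2.
Proof.
by apply: (@complexI R); rewrite -sqnE pair_hip !hip_rn rmorphD.
Qed.

Lemma pair_complete G : closure G `<=` G -> dot_complete (pair_dot H) G.
Proof.
move=> cG u Gu cu.
have lim (p : H * H -> H) : (forall x y, p (x - y) = p x - p y) ->
    (forall x, rn (p x) ^+ 2 <= sqn (pair_dot H) x) ->
    exists l, forall e : R, 0 < e -> exists N, forall n, (N <= n)%N -> rn (p (u n) - l) < e.
  move=> pB pn; apply: complete_rn => e e0.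
  have [N hN] := cu _ (exprn_gt0 2 e0); exists N => m n Nm Nn.
  rewrite -(ltr_pXn2r (n:=2))// ?nnegrE ?rn_ge0 ?(ltW e0)// -pB.
  exact: le_lt_trans (pn _) (hN m n Nm Nn).
have [|l1 h1] := lim fst (fun _ _ => erefl) => [x|].
  by rewrite pair_sqn lerDl sqr_ge0.
have [|l2 h2] := lim snd (fun _ _ => erefl) => [x|].
  by rewrite pair_sqn lerDr sqr_ge0.
exists (l1, l2).
  apply: cG; apply/closure2_rn => e e0.
  have [N1 hN1] := h1 _ e0; have [N2 hN2] := h2 _ e0.
  exists (u (maxn N1 N2)); first exact: Gu.
  by rewrite /= !(rn_distC l1) !(rn_distC l2) hN1 ?hN2// ?leq_maxl ?leq_maxr.
move=> e e0; have s0 : 0 < Num.sqrt (e / 2) by rewrite sqrtr_gt0 divr_gt0.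
have [N1 hN1] := h1 _ s0; have [N2 hN2] := h2 _ s0.
exists (maxn N1 N2) => n; rewrite geq_max => /andP[n1 n2].
rewrite pair_sqn /=.
have sq (x : R) : 0 <= x -> x < Num.sqrt (e / 2) -> x ^+ 2 < e / 2.
  move=> x0 xe; rewrite -[ltRHS]sqr_sqrtr ?divr_ge0 ?(ltW e0)//.
  by rewrite ltr_pXn2r ?nnegrE ?sqrtr_ge0.
have := sq _ (rn_ge0 _) (hN1 _ n1); have := sq _ (rn_ge0 _) (hN2 _ n2); lra.
Qed.

Lemma graph_decomp G : closed_subspace G ->
  forall x : (H * H)%type, exists2 p, G p & gperp G (x - p).
Proof.
move=> [sG cG] x; have [p Gp hp] := dot_projection x sG (pair_complete cG).
by exists p => // g /hp; rewrite pair_hip.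
Qed.

Lemma gperp_disj G x : G x -> gperp G x -> x = 0.
Proof.
move=> Gx /(_ _ Gx) h; apply: (sqn_eq0 (f := pair_dot H)).
by rewrite /sqn pair_hip h.
Qed.

Lemma gperp_perp G : closed_subspace G -> gperp (gperp G) `<=` G.
Proof.
move=> cG x hx; have [p Gp hp] := graph_decomp cG x.
suff -> : x = p by [].
apply/eqP; rewrite -subr_eq0; apply/eqP/(sqn_eq0 (f := pair_dot H)).
rewrite /sqn pair_hip [X in hip _ X]/= {2}/snd !hipBr addrACA hx// add0r -opprD.
have := hp _ Gp => /(congr1 Num.conj); rewrite rmorphD /= -!hipC rmorph0 => ->.
by rewrite oppr0.
Qed.

Lemma gperp_subspace G : subspace_set (gperp G).
Proof.
split; first by move=> g _; rewrite !hip0r addr0.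
move=> k a b ha hb g Gg; rewrite /= !hipDr !hipZr addrACA -mulrDr.
by rewrite ha// hb// mulr0 addr0.
Qed.

Lemma gperp_adjoint G A B : linear A -> @adjoint_op R H A B ->
  (forall x, G x -> G (A x.1, A x.2)) -> forall x, gperp G x -> gperp G (B x.1, B x.2).
Proof. by move=> lA AB hA x hx g /hA/hx; rewrite /= !AB. Qed.

Definition map2 A (x : (H * H)%type) : H * H := (A x.1, A x.2).

Lemma map2_linear A : linear A -> linear (map2 A).
Proof. by move=> lA k a b; rewrite /map2 /= !lA. Qed.

Lemma unitary_adjoint (u : H -> H) : unitary_op u ->
  exists v : H -> H, [/\ bounded_op v, adjoint_op u v, cancel u v & cancel v u].
Proof.
move=> [bu hu su]; have [v bv uv] := bounded_adjoint bu.
have uK : cancel u v by move=> x; apply: hip_ext => z; rewrite -uv hu.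
exists v; split=> // y; have [x <-] := su y; by rewrite uK.
Qed.

Lemma unitary_linear (u : H -> H) : unitary_op u -> linear u.
Proof. by move=> [[]]. Qed.

(** Affiliation speaks of unitaries only. For a small self-adjoint [C] in the commutant, the Cayley
    transform and its inverse preserve [G], so [Q] preserves both [G] and [gperp G]. It follows that
    the inverse of [Q] preserves [G], and [C] is an affine function of that inverse. *)
Lemma aff_commutant M G B : von_neumann M -> closed_subspace G -> affiliated G M ->
  commutant M B -> forall x, G x -> G (map2 B x).
Proof.
move=> vM cG aG; have [[G0 GD] _] := cG.
move: B; apply: (vN_selfadj_ind (vN_commutant_vN vM)) => [C MC sC|k A B hA hB x Gx]; last first.
  by have := GD k _ _ (hA _ Gx) (hB _ Gx).
have bC := commutant_bounded MC; have [lC _] := bC.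
have [Q [bQ QD DQ uQ]] := cayley bC sC; have [lQ _] := bQ.
set u := (fun x => _) in uQ.
have M'Q : commutant M Q.
  apply: (vN_mem (vN_commutant_vN vM)) => // E [[lE _] hE]; apply/funext => y /=; apply/esym.
  apply: (cayley_commute lC lE QD DQ) => z.
  by have /(congr1 (@^~ z)) := hE _ MC.
have M'u : commutant M u.
  have vM' := vN_commutant_vN vM.
  have := vN_lincomb 2 vM' M'Q (vN_lincomb (-1) vM' (vN_id vM') (vN_0 vM')).
  by congr (commutant M _); apply/funext => y; rewrite scaleN1r addr0.
have Gu x : G x <-> G (map2 u x).
  by rewrite [x in G x]surjective_pairing; exact: aG.
have Qu x : map2 Q x = 2^-1 *: map2 u x + 2^-1 *: x.
  rewrite -scalerDr /map2 /u /=; case: x => x1 x2 /=.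
  rewrite -[(_, _) + _]/(_, _) /= !subrK -[_ *: (_, _)]/(_, _) /= !scalerA.
  by rewrite mulVf ?pnatr_eq0// !scale1r.
have GQ x : G x -> G (map2 Q x).
  by move=> Gx; rewrite Qu; apply: (GD); [exact: (proj1 (Gu x))|rewrite -[_ *: _]addr0; apply: (GD)].
have [v [bv uv uK vK]] := unitary_adjoint uQ.
have pv x : G x -> G (map2 v x).
  move=> Gx; apply/Gu; rewrite /map2 /= !vK; by case: x Gx.
have pu x : gperp G x -> gperp G (map2 u x).
  by apply: (gperp_adjoint (proj1 bv)) => //; apply: adjoint_sym.
have pQ x : gperp G x -> gperp G (map2 Q x).
  have [p0 pD] := gperp_subspace G.
  by move=> Gx; rewrite Qu; apply: (pD); [exact: pu|rewrite -[_ *: _]addr0; apply: (pD)].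
move=> x Gx.
pose D y := y - 'i *: C y.
suff GDx : G (map2 D x).
  have -> : map2 C x = ('i) *: map2 D x + ((- 'i) *: x + 0).
    case: x {Gx GDx} => x1 x2.
    rewrite addr0 /map2 /D.
    by congr pair; rewrite /= scalerBr scalerA -expr2 sqrCi scaleN1r opprK scaleNr addrC addKr.
  by apply: (GD) => //; apply: (GD).
have [g Gg hp] := graph_decomp cG (map2 D x).
have lDm : linear (map2 Q) by exact: map2_linear.
have e : map2 Q (map2 D x) = x.
  by case: x {Gx Gg hp} => x1 x2; rewrite /map2 /= /D !QD.
(* Applying [Q] to the decomposition of D x along [G] puts [x - map2 Q g] both in [G] and in its
   complement; hence x = Q g and D x = g. *)
have pz : gperp G (x - map2 Q g).
  by rewrite -[x in x - _]e -(linB lDm); exact: pQ.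
have Gz : G (x - map2 Q g).
  rewrite addrC -scaleN1r; apply: (GD) => //; exact: GQ.
have /eqP := gperp_disj Gz pz; rewrite subr_eq0 => /eqP xe.
suff -> : map2 D x = g by [].
by rewrite xe; case: g {Gg hp pz Gz xe} => g1 g2; rewrite /map2 /= /D !DQ.
Qed.

Definition graph_invariant G S := forall s, S s -> forall x, G x -> G (map2 s x).

(* E consists of the four matrix entries of the orthogonal projection onto G *)
Lemma graph_entries G : closed_subspace G -> exists E : set (H -> H),
  (forall S, S `<=` @bounded_op R H -> star_closed S -> graph_invariant G S ->
     E `<=` commutant S) /\
  (forall u, unitary_op u -> (forall e, E e -> forall x, u (e x) = e (u x)) ->
     forall x y, G (x, y) <-> G (u x, u y)).
Proof.
move=> cG; have [[G0 GD] _] := cG.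
have GB x y : G x -> G y -> G (x - y).
  by move=> Gx Gy; rewrite addrC -scaleN1r; apply: (GD).
have [p0 pD] := gperp_subspace G.
have pB x y : gperp G x -> gperp G y -> gperp G (x - y).
  by move=> Gx Gy; rewrite addrC -scaleN1r; apply: (pD).
have /choice[P hP] : forall x, exists p, G p /\ gperp G (x - p).
  by move=> x; have [p] := graph_decomp cG x; exists p.
have Puniq x p : G p -> gperp G (x - p) -> P x = p.
  move=> Gp hp; have [GP hPx] := hP x.
  apply/eqP; rewrite -subr_eq0; apply/eqP/(gperp_disj (GB _ _ GP Gp)).
  have -> : P x - p = (x - p) - (x - P x) by rewrite opprB [RHS]addrC addrA subrK.
  exact: pB.
have lP : linear P.
  move=> k a b; have [GPa ha] := hP a; have [GPb hb] := hP b; apply: Puniq.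
    exact: GD.
  have -> : k *: a + b - (k *: P a + P b) = k *: (a - P a) + (b - P b).
    by rewrite scalerBr opprD addrACA.
  exact: pD.
have Pn x : rn (P x).1 ^+ 2 + rn (P x).2 ^+ 2 <= rn x.1 ^+ 2 + rn x.2 ^+ 2.
  have [GP hp] := hP x.
  rewrite -!pair_sqn -[x in leRHS](subrK (P x)).
  have -> : sqn (pair_dot H) (x - P x + P x) = sqn (pair_dot H) (x - P x) + sqn (pair_dot H) (P x).
    apply: (@complexI R); rewrite rmorphD /= -!sqnE.
    have h : braket (pair_dot H) (P x) (x - P x) = 0 by rewrite pair_hip; exact: hp.
    move: h; move: (x - P x) => w h; rewrite braketDl !braketDr.
    by rewrite h (braketC _ w (P x)) h rmorph0 addr0 add0r.
  by rewrite lerDr sqn_ge0.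
(* A star-closed family preserving [G] also preserves its complement, hence commutes with the
   projection. *)
have Ps S s : S `<=` @bounded_op R H -> star_closed S -> graph_invariant G S ->
    S s -> forall x, P (map2 s x) = map2 s (P x).
  move=> bS sS hS Ss x; have [GP hp] := hP x; have [ls _] := bS _ Ss.
  apply: Puniq; first exact: hS.
  rewrite -(linB (map2_linear ls)).
  have [s' Ss' ss'] := sS _ Ss; have [ls' _] := bS _ Ss'.
  by apply: (gperp_adjoint ls') => //; [exact: adjoint_sym | exact: hS].
pose i1 (x : H) : H * H := (x, 0); pose i2 (x : H) : H * H := (0, x).
have i1D k a b : i1 (k *: a + b) = k *: i1 a + i1 b.
  by congr pair; rewrite /= ?scaler0 ?addr0.
have i2D k a b : i2 (k *: a + b) = k *: i2 a + i2 b.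
  by congr pair; rewrite /= ?scaler0 ?addr0.
have i1N x : rn (i1 x).1 ^+ 2 + rn (i1 x).2 ^+ 2 = rn x ^+ 2.
  by rewrite /= rn0 expr0n addr0.
have i2N x : rn (i2 x).1 ^+ 2 + rn (i2 x).2 ^+ 2 = rn x ^+ 2.
  by rewrite /= rn0 expr0n add0r.
have i1S s x : linear s -> i1 (s x) = map2 s (i1 x).
  by move=> ls; rewrite /map2 /i1 /= (lin0 ls).
have i2S s x : linear s -> i2 (s x) = map2 s (i2 x).
  by move=> ls; rewrite /map2 /i2 /= (lin0 ls).
pose E := [set e | exists i q, [/\ i = i1 \/ i = i2, q = fst \/ q = snd &
   e = (fun x => q (P (i x)))]].
exists E; split=> [S bS sS hS _ [i [q [hi hq ->]]]|u uu hu x y].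
  have [iD iN iS] : [/\ forall k a b, i (k *: a + b) = k *: i a + i b,
      forall x, rn (i x).1 ^+ 2 + rn (i x).2 ^+ 2 = rn x ^+ 2 &
      forall s x, linear s -> i (s x) = map2 s (i x)].
    by case: hi => ->.
  have [qD qN qS] : [/\ forall k a b, q (k *: a + b) = k *: q a + q b,
      forall x, rn (q x) ^+ 2 <= rn x.1 ^+ 2 + rn x.2 ^+ 2 &
      forall s x, q (map2 s x) = s (q x)].
    by case: hq => ->; split=> // z; rewrite ?lerDl ?lerDr sqr_ge0.
  split.
    apply/bounded_opP; split; first by move=> k a b; rewrite iD lP qD.
    exists 1 => // x; rewrite mul1r.
    rewrite -(ler_pXn2r (n:=2))// ?nnegrE ?rn_ge0// -[leRHS]iN.
    exact: le_trans (qN _) (Pn _).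
  move=> s Ss; apply/funext => x /=; have [ls _] := bS _ Ss.
  by rewrite iS// (Ps S)// qS.
have lu := unitary_linear uu.
have uP z : map2 u (P z) = P (map2 u z).
  have -> : z = i1 z.1 + i2 z.2 by case: z => a b; congr pair; rewrite /= ?addr0 ?add0r.
  have lu2 := map2_linear lu.
  rewrite (linD lP) !(linD lu2) (linD lP) -!i1S// -!i2S//.
  congr (_ + _); rewrite [RHS]surjective_pairing; congr pair.
  - by apply: (hu (fun x => (P (i1 x)).1)); exists i1, fst; split=> //; left.
  - by apply: (hu (fun x => (P (i1 x)).2)); exists i1, snd; split=> //; [left|right].
  - by apply: (hu (fun x => (P (i2 x)).1)); exists i2, fst; split=> //; [right|left].
  - by apply: (hu (fun x => (P (i2 x)).2)); exists i2, snd; split=> //; right.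
have Pid z : G z -> P z = z.
  by move=> Gz; apply: Puniq => //; rewrite subrr.
split=> [Gxy|Gu].
  have [] := hP (map2 u (x, y)); by rewrite -uP Pid.
(* [u] intertwines the projection with itself and is injective, so (x, y) is fixed as soon as (u x,
   u y) is. *)
have := Pid _ Gu; rewrite -[(u x, u y)]/(map2 u (x, y)) -uP => e.
have [v [_ _ uK _]] := unitary_adjoint uu.
suff <- : P (x, y) = (x, y) by case: (hP (x, y)).
move: e; case: (P (x, y)) => a b [] /(congr1 v) + /(congr1 v).
by rewrite !uK => -> ->.
Qed.

(** The matrix entries of the projection lie in the commutant of [S]; a unitary commuting with that
    commutant commutes with them and so preserves [G]. *)
Lemma aff_of_invariant S G : S `<=` @bounded_op R H -> star_closed S ->
  closed_subspace G -> graph_invariant G S -> affiliated G (commutant S).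
Proof.
move=> bS sS cG hS u [_ hu] uu; have [E [ES Eu]] := graph_entries cG.
by apply: Eu => // e /(ES _ bS sS hS)/hu/(congr1 (@^~ _)) /= ue x; rewrite ue.
Qed.

Lemma invariant_of_aff M G : von_neumann M -> closed_subspace G -> affiliated G M ->
  graph_invariant G (commutant M).
Proof. by move=> vM cG aG B /(aff_commutant vM cG aG). Qed.

(** Affiliation does not pass to intersections formally, since the commutant grows. But the entries
    of the graph projection lie in every algebra to which the graphs are affiliated, hence in the
    intersection. *)
Lemma affiliated_Wstar (F : set (set (H * H)%type)) G :
  F G -> closed_subspace G -> affiliated G (Wstar F).
Proof.
move=> FG cG u [_ hu] uu; have [E [ES Eu]] := graph_entries cG.
apply: Eu => // e Ee x.
suff /hu/(congr1 (@^~ x)) : Wstar F e by [].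
move=> M vM /(_ _ FG) aG; rewrite -(vN_bicommutant vM).
apply: ES Ee; first exact: commutant_bounded.
  exact/vN_star/vN_commutant_vN.
exact: invariant_of_aff.
Qed.

Lemma vN_Wstar (F : set (set (H * H)%type)) :
  (forall G, F G -> closed_subspace G) -> von_neumann (Wstar F).
Proof.
move=> cF.
have -> : Wstar F = [set A | forall M,
    von_neumann M /\ (forall G, F G -> affiliated G M) -> M A].
  by apply/seteqP; split=> A h M; [case; exact: h | move=> vM aM; exact: h].
apply: vN_inter => [M []//|].
have b1 : [set id] `<=` @bounded_op R H by move=> _ ->; exact: bounded_id.
have s1 : @star_closed R H [set id] by move=> _ ->; exists id.
(* The algebra of all bounded operators, written as the commutant of the identity, shows that the
   intersected family is not empty. *)
exists (commutant [set id]); split; first exact: vN_commutant.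
move=> G FG; apply: aff_of_invariant => //; first exact: cF.
by move=> _ -> [].
Qed.

End Graphs.

Section IsometricExtension.
Context (R : realType) (K : hilbert R).

(** The map is given as a linear relation, so no representative has to be chosen: isometry makes the
    closure single-valued, and density of the domain together with completeness makes it total. *)
Lemma isometric_extension (P : set (K * K)%type) : subspace_set P ->
  (forall p, P p -> rn p.1 = rn p.2) ->
  (forall z (e : R), 0 < e -> exists2 p, P p & rn (z - p.1) < e) ->
  exists X : K -> K, [/\ bounded_op X, forall z, rn (X z) = rn z &
    forall p, P p -> X p.1 = p.2].
Proof.
move=> [P0 PD] iP dP.
have PB p q : P p -> P q -> P (p - q).
  by move=> Pp Pq; rewrite addrC -scaleN1r; apply: (PD).
have /choice[X hX] z : exists w, closure P (z, w).
  have /choice[u hu] (n : nat) : exists p, P p /\ rn (z - p.1) < n.+1%:R^-1.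
    have n0 : 0 < n.+1%:R^-1 :> R by rewrite invr_gt0.
    by have [p Pp hp] := dP z _ n0; exists p.
  have [w hw] : exists w, forall e : R, 0 < e -> exists N, forall n, (N <= n)%N -> rn ((u n).2 - w) < e.
    apply: complete_rn => e e0; have e2 : 0 < e / 2 by rewrite divr_gt0.
    have [N hN] := invS_small e2; exists N => m n Nm Nn.
    have [Pm hm] := hu m; have [Pn hn] := hu n.
    have := iP _ (PB _ _ Pm Pn); rewrite /= => <-.
    have := rn_tri (u m).1 z (u n).1; rewrite (rn_distC _ z) => h.
    have := hN _ Nm; have := hN _ Nn; move: h hm hn.
    by move: (m.+1%:R^-1) (n.+1%:R^-1) => b a; lra.
  exists w; apply/closure2_rn => e e0.
  have [N1 h1] := invS_small e0; have [N2 h2] := hw _ e0.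
  have [Pm hm] := hu (maxn N1 N2).
  exists (u (maxn N1 N2)) => //=; split.
    by apply: lt_trans hm _; apply: h1; rewrite leq_maxl.
  by rewrite rn_distC; apply: h2; rewrite leq_maxr.
have iC p : closure P p -> rn p.1 = rn p.2.
  move=> /closure2_rn hp; apply/eqP; rewrite -subr_eq0 -normr_eq0; apply/eqP.
  apply: (@eq0_eps _ _ 2) => // e e0; have [q Pq [q1 q2]] := hp _ e0.
  have := iP _ Pq.
  have := rnD (p.1 - q.1) q.1; have := rnD (p.2 - q.2) q.2.
  have := rnD (q.1 - p.1) p.1; have := rnD (q.2 - p.2) p.2.
  rewrite !subrK (rn_distC q.1) (rn_distC q.2) => *.
  rewrite ler_norml; apply/andP; split; lra.
have cD k p q : closure P p -> closure P q -> closure P (k *: p + q).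
  move=> /closure2_rn hp /closure2_rn hq; apply/closure2_rn => e e0.
  have k1 : 0 < rn k + 1 by rewrite ltr_wpDl ?rn_ge0.
  have e1 : 0 < e / (2 * (rn k + 1)) by rewrite divr_gt0// mulr_gt0.
  have e2 : 0 < e / 2 by rewrite divr_gt0.
  have [p' Pp [a1 a2]] := hp _ e1; have [q' Pq [b1 b2]] := hq _ e2.
  exists (k *: p' + q'); first exact: (PD).
  have aux (x x' y y' : K) : rn (x - x') < e / (2 * (rn k + 1)) -> rn (y - y') < e / 2 ->
      rn (k *: x + y - (k *: x' + y')) < e.
    move=> hx hy; rewrite opprD addrACA -scalerBr; apply: le_lt_trans (rnD _ _) _.
    rewrite rnZ; move: hx; rewrite ltr_pdivlMr ?mulr_gt0// => hx.
    have := rn_ge0 k; have := rn_ge0 (x - x'); nra.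
  by split; apply: aux.
have uniq z w w' : closure P (z, w) -> closure P (z, w') -> w = w'.
  move=> h h'; apply/eqP; rewrite -subr_eq0 -rn_eq0.
  have := iC _ (cD (-1) _ _ h' h); by rewrite /= !scaleN1r addNr rn0 (addrC _ w) => <-.
exists X; split=> [|z|p Pp].
- apply/bounded_opP; split=> [k a b|].
    by apply: uniq (hX _) _; apply: (cD _ (_, _) (_, _)).
  by exists 1 => // z; rewrite mul1r -(iC _ (hX z)).
- by rewrite -(iC _ (hX z)).
- by apply: uniq (hX _) _; rewrite -surjective_pairing; exact: subset_closure.
Qed.
End IsometricExtension.

Lemma rn_hip (R : realType) (H : hilbert R) (x : H) : rn (hip x x) = rn x ^+ 2.
Proof. by rewrite hip_rn rn_real ger0_norm ?sqr_ge0. Qed.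

(** * Tensor products of von Neumann algebras *)

Section Tensor.
Context (R : realType) (H1 H2 K : hilbert R) (T : H1 -> H2 -> K).
Hypothesis hT : is_hilbert_tensor T.

Lemma tenl y : linear (fun x => T x y). Proof. by have [] := ht_bilinear hT. Qed.
Lemma tenr x : linear (T x). Proof. by have [] := ht_bilinear hT. Qed.
Lemma ten_hip x x' y y' : hip (T x y) (T x' y') = hip x x' * hip y y'.
Proof. exact: ht_hip. Qed.
Lemma ten_rn x y : rn (T x y) = rn x * rn y.
Proof.
apply/eqP; rewrite -(eqrXn2 (n:=2))// ?mulr_ge0 ?rn_ge0// exprMn; apply/eqP.
by rewrite -!rn_hip -rnM -ten_hip.
Qed.

Lemma ten_ext0 z : (forall x y, hip (T x y) z = 0) -> z = 0.
Proof.
move=> h; apply: (hip_dense0 (ht_dense hT)) => _ [n [x [y ->]]].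
by rewrite hip_suml big1.
Qed.

Lemma ten_ext z w : (forall x y, hip (T x y) z = hip (T x y) w) -> z = w.
Proof.
move=> h; apply/eqP; rewrite -subr_eq0; apply/eqP/ten_ext0 => x y.
by rewrite hipBr h subrr.
Qed.

Lemma ten_ext_op X Y : bounded_op X -> bounded_op Y ->
  (forall x y, X (T x y) = Y (T x y)) -> X = Y.
Proof.
move=> bX bY h; have [X' _ XX'] := bounded_adjoint bX; have [Y' _ YY'] := bounded_adjoint bY.
have e w : X' w = Y' w by apply: ten_ext => x y; rewrite -XX' -YY' h.
by apply/funext => z; apply: hip_ext => w; rewrite -(adjoint_sym XX') -(adjoint_sym YY') e.
Qed.

(** The slice composes the insertion of [y], the operator [C], and the adjoint of the insertion of
    [y']. *)
Lemma slice_exists C y y' : bounded_op C -> exists2 s : H1 -> H1, bounded_op s &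
  forall x x', hip x' (s x) = hip (T x' y') (C (T x y)).
Proof.
move=> bC; have lin y0 : linear (fun x => T x y0) by exact: tenl.
have cont y0 : continuous (fun x => T x y0).
  apply/(linear_continuous_rn (lin y0)); exists (rn y0); first exact: rn_ge0.
  by move=> x; rewrite ten_rn mulrC.
have [S [lS cS hS]] := adjoint_exists (lin y') (cont y').
exists (fun x => S (C (T x y))) => [|x x']; last by rewrite -hS.
have /bounded_opP[lC [c c0 hc]] := bC.
have /(linear_continuous_rn lS)[d d0 hd] := cS.
apply/bounded_opP; split=> [k a b|]; first by rewrite tenl lC lS.
exists (d * (c * rn y)) => [|x]; first by rewrite !mulr_ge0 ?rn_ge0.
apply: le_trans (hd _) _; rewrite -mulrA ler_wpM2l//.
by apply: le_trans (hc _) _; rewrite ten_rn (mulrC (rn x)) mulrA.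
Qed.

Definition is_slice C y y' (s : H1 -> H1) := bounded_op s /\
  forall x x', hip x' (s x) = hip (T x' y') (C (T x y)).

Lemma slice_adjoint C C' y y' s s' : adjoint_op C C' ->
  is_slice C y y' s -> is_slice C' y' y s' -> adjoint_op s s'.
Proof.
by move=> CC' [_ hs] [_ hs'] a b; rewrite hs' -CC' hipC hs -hipC.
Qed.

(** The relation is defined on finite lists of elementary tensors. Different lists may represent the
    same vector; that [v] preserves inner products settles well-definedness. *)
Lemma tensor_unitary v : unitary_op v ->
  exists2 X : K -> K, bounded_op X & forall x y, X (T x y) = T (v x) y.
Proof.
move=> uv; have lv := unitary_linear uv.
pose F (w : H1 -> H1) (s : seq (H1 * H2)) := \sum_(p <- s) T (w p.1) p.2.
pose P := [set p : K * K | exists s, p = (F id s, F v s)].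
have FD w s t : F w (s ++ t) = F w s + F w t by rewrite /F big_cat.
have FZ w k s : linear w -> F w [seq (k *: p.1, p.2) | p <- s] = k *: F w s.
  move=> lw; rewrite /F big_map scaler_sumr; apply: eq_bigr => p _ /=.
  by rewrite (linZ lw) (linZ (tenl p.2)).
have sP : subspace_set P.
  split; first by exists [::]; rewrite /F !big_nil.
  move=> k _ _ [s ->] [t ->]; exists ([seq (k *: p.1, p.2) | p <- s] ++ t).
  by rewrite !FD !FZ.
have [||X [bX _ hX]] := isometric_extension sP.
- move=> _ [s ->] /=; apply/eqP; rewrite -(eqrXn2 (n:=2))// ?rn_ge0//; apply/eqP.
  apply: (@complexI R); rewrite -!hip_rn /F !hip_suml; apply: eq_bigr => p _.
  by rewrite !hip_sumr; apply: eq_bigr => q _; rewrite !ten_hip; case: uv => _ -> _.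
- move=> z e e0; have /dense_rn/(_ z _ e0)[_ [n [x [y ->]]] h] := ht_dense hT.
  exists (\sum_(i < n) T (x i) (y i), \sum_(i < n) T (v (x i)) (y i)) => //.
  by exists [seq (x i, y i) | i <- index_iota 0 n]; rewrite /F !big_map !big_mkord.
exists X => // x y; apply: (hX (T x y, T (v x) y)).
by exists [:: (x, y)]; rewrite /F !big_seq1.
Qed.

End Tensor.

(** Lets every statement about the first leg be applied to the second. *)
Lemma tensor_swap (R : realType) (H1 H2 K : hilbert R) (T : H1 -> H2 -> K) :
  is_hilbert_tensor T -> is_hilbert_tensor (fun y x => T x y).
Proof.
move=> [[b1 b2] h d]; split=> //; first by move=> *; rewrite h mulrC.
apply/dense_rn => x e e0; have /dense_rn/(_ x e e0)[_ [n [u [v ->]]]] := d.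
by exists (\sum_(i < n) T (u i) (v i)) => //; exists n, v, u.
Qed.

Section TensorAlgebra.
Context (R : realType) (H1 H2 K : hilbert R) (T : H1 -> H2 -> K).
Hypothesis hT : is_hilbert_tensor T.

Definition tensor_gen (M1 : set (H1 -> H1)) (M2 : set (H2 -> H2)) : set (K -> K) :=
  [set X | bounded_op X /\ exists A B,
    [/\ M1 A, M2 B & forall x y, X (T x y) = T (A x) (B y)]].

Lemma tensor_gen_bounded (M1 : set (H1 -> H1)) (M2 : set (H2 -> H2)) : tensor_gen M1 M2 `<=` @bounded_op R K.
Proof. by move=> X []. Qed.

Lemma tensor_gen_star (M1 : set (H1 -> H1)) (M2 : set (H2 -> H2)) : von_neumann M1 -> von_neumann M2 ->
  star_closed (tensor_gen M1 M2).
Proof.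
move=> v1 v2 X [bX [A [B [MA MB hX]]]].
have [A' MA' AA'] := vN_star v1 MA; have [B' MB' BB'] := vN_star v2 MB.
have [Y bY XY] := bounded_adjoint bX.
exists Y => //; split=> //; exists A', B'; split=> // x y.
by apply: (ten_ext hT) => x' y'; rewrite -XY hX !(ten_hip hT) AA' BB'.
Qed.

Lemma vN_tensorE (M1 : set (H1 -> H1)) (M2 : set (H2 -> H2)) : vN_tensor T M1 M2 =
  [set X | forall N, von_neumann N /\ tensor_gen M1 M2 `<=` N -> N X].
Proof. by apply/seteqP; split=> X h N; [case; exact: h | move=> vN sN; exact: h]. Qed.

Lemma vN_vN_tensor (M1 : set (H1 -> H1)) (M2 : set (H2 -> H2)) : von_neumann M1 -> von_neumann M2 ->
  von_neumann (vN_tensor T M1 M2).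
Proof.
move=> v1 v2; rewrite vN_tensorE; apply: vN_inter => [N []//|].
exists (commutant (commutant (tensor_gen M1 M2))); split.
  apply/vN_commutant_vN/vN_commutant; first exact: tensor_gen_bounded.
  exact: tensor_gen_star.
exact/commutant_bi/tensor_gen_bounded.
Qed.

Lemma tensor_gen_sub (M1 : set (H1 -> H1)) (M2 : set (H2 -> H2)) : tensor_gen M1 M2 `<=` vN_tensor T M1 M2.
Proof. by move=> X gX N _; exact. Qed.

(** By [vN_unitaries] it suffices to test unitaries [v] of [M1]. For these v (x) 1 exists as an
    element of the tensor product algebra and can be moved from one side of the matrix element
    defining the slice to the other. *)
Lemma commute_unitary_slice (M1 : set (H1 -> H1)) (M2 : set (H2 -> H2)) C y y' s : von_neumann M1 -> von_neumann M2 ->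
  commutant (vN_tensor T M1 M2) C -> is_slice T C y y' s -> commutant M1 s.
Proof.
move=> v1 v2 [bC hC] [bs hs]; apply: vN_unitaries => // v Mv uv x.
have [X bX hX] := tensor_unitary hT uv.
have /hC/(congr1 (@^~ (T x y))) /= : vN_tensor T M1 M2 X.
  by apply: tensor_gen_sub; split=> //; exists v, id; split=> //; exact: vN_id.
have [v' [bv' vv' vK v'K]] := unitary_adjoint uv.
have [X' bX' XX'] := bounded_adjoint bX.
rewrite hX => e; apply: hip_ext => x'.
rewrite hs e -(adjoint_sym XX').
have -> : X' (T x' y') = T (v' x') y'.
  by apply: (ten_ext hT) => a b; rewrite -XX' hX !(ten_hip hT) vv'.
by rewrite -hs (adjoint_sym vv').
Qed.

End TensorAlgebra.

Section TensorSub.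
Context (R : realType) (H1 H2 K : hilbert R) (T : H1 -> H2 -> K).
Hypothesis hT : is_hilbert_tensor T.

(** The slices of operators commuting with [N] form a star-closed family preserving all graphs of
    [F], so these graphs are affiliated with its commutant; minimality of [Wstar F] concludes. *)
Lemma slices_commute (F : set (set (H1 * H1)%type)) N :
  (forall G, F G -> closed_subspace G) -> @von_neumann R K N ->
  (forall G, F G -> forall C y y' s, commutant N C -> is_slice T C y y' s ->
     forall x, G x -> G (map2 s x)) ->
  forall A C y y' s, Wstar F A -> commutant N C -> is_slice T C y y' s ->
    forall x, s (A x) = A (s x).
Proof.
move=> cF vN hF A C y y' s FA NC Cs x.
pose S := [set s | exists C y y', commutant N C /\ is_slice T C y y' s].
suff : commutant S A.
  by move=> [_ hA]; have /hA/(congr1 (@^~ x)) : S s by exists C, y, y'.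
have bS : S `<=` @bounded_op R H1 by move=> ? [? [? [? [_ []]]]].
have sS : star_closed S.
  move=> s1 [C1 [y1 [y2 [NC1 C1s]]]].
  have [C1' NC1' CC] := vN_star (vN_commutant_vN vN) NC1.
  have [s1' bs hs] := slice_exists hT y2 y1 (commutant_bounded NC1').
  have s1'P : is_slice T C1' y2 y1 s1' by [].
  exists s1'; first by exists C1', y2, y1.
  exact: slice_adjoint CC C1s s1'P.
apply: FA; first exact: vN_commutant.
move=> G FG; apply: aff_of_invariant => //; first exact: cF.
by move=> ? [C1 [y1 [y2 [NC1 C1s]]]]; exact: (hF _ FG) C1s.
Qed.
End TensorSub.

Lemma vN_tensor_sub (R : realType) (H1 H2 K : hilbert R) (T : H1 -> H2 -> K)
    (F1 : set (set (H1 * H1)%type)) (F2 : set (set (H2 * H2)%type)) N :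
  is_hilbert_tensor T -> @von_neumann R K N ->
  (forall G, F1 G -> closed_subspace G) -> (forall G, F2 G -> closed_subspace G) ->
  (forall G, F1 G -> forall C y y' s, commutant N C -> is_slice T C y y' s ->
     forall x, G x -> G (map2 s x)) ->
  (forall G, F2 G -> forall C y y' s, commutant N C ->
     is_slice (fun y x => T x y) C y y' s -> forall x, G x -> G (map2 s x)) ->
  vN_tensor T (Wstar F1) (Wstar F2) `<=` N.
Proof.
move=> hT vN cF1 cF2 hF1 hF2 X hX; apply: hX => // {}X [bX [A [B [FA FB hX]]]].
apply: vN_mem => // C NC; have bC := commutant_bounded NC; apply/esym.
apply: (ten_ext_op hT); [exact: bounded_comp..|] => x y /=.
apply: (ten_ext hT) => x' y'.
have hT' := tensor_swap hT.
have bA := vN_bounded (vN_Wstar cF1) FA; have bB := vN_bounded (vN_Wstar cF2) FB.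
have [A' bA' AA'] := bounded_adjoint bA; have [B' bB' BB'] := bounded_adjoint bB.
have [X' bX' XX'] := bounded_adjoint bX.
have X'E : X' (T x' y') = T (A' x') (B' y').
  by apply: (ten_ext hT) => a b; rewrite -XX' hX !(ten_hip hT) AA' BB'.
(* [A] is moved across [C] by the slice taken at [B y] and [y'], then [B] by the slice of the other
   leg taken at [x] and the already moved [A' x']. *)
have [s bs hs] := slice_exists hT (B y) y' bC.
have [r br hr] := slice_exists hT' x (A' x') bC.
have sA := slices_commute hT cF1 vN hF1 FA NC (conj bs hs).
have rB := slices_commute hT' cF2 vN hF2 FB NC (conj br hr).
rewrite hX -(adjoint_sym XX') X'E -hs sA -(adjoint_sym AA') hs.
by rewrite -(hr _ (B' y')) -(hr (B y)) rB (adjoint_sym BB').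
Qed.

(** * Coefficient calculus of formal distributions *)

Section Shifts.
Context (R : realType) (V : lmodType R[i]).
Implicit Types (F G : int -> int -> V).

(** Multiplication by z - w, read on coefficients of z^(-m-1) w^(-k-1). Its iterates express
    locality without binomial sums. *)
Definition zw F : int -> int -> V := fun m k => F (m + 1) k - F m (k + 1).

Lemma iter_zw_ext N F G : (forall m k, F m k = G m k) ->
  forall m k, iter N zw F m k = iter N zw G m k.
Proof.
move=> h; have -> : F = G by apply/funext => m; apply/funext => k.
by [].
Qed.

Lemma iter_zwD N F G m k :
  iter N zw (fun m k => F m k + G m k) m k = iter N zw F m k + iter N zw G m k.
Proof. by elim: N m k => [//|N ih] m k; rewrite !iterS /zw !ih opprD addrACA. Qed.

Lemma iter_zwL N F (L : V -> V) m k : linear L ->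
  iter N zw (fun m k => L (F m k)) m k = L (iter N zw F m k).
Proof. by move=> lL; elim: N m k => [//|N ih] m k; rewrite !iterS /zw !ih (linB lL). Qed.

Lemma iter_zw0 N M F : (forall m k, iter N zw F m k = 0) -> (N <= M)%N ->
  forall m k, iter M zw F m k = 0.
Proof.
move=> h /subnK <-; elim: (M - N)%N => [//|n ih] m k.
by rewrite addSn iterS /zw !ih subrr.
Qed.

Lemma iter_zw_shift N F m k :
  iter N zw (fun m k => F (m + 1) k) m k = iter N zw F (m + 1) k.
Proof. by elim: N m k => [//|N ih] m k; rewrite !iterS /zw !ih. Qed.

Lemma iter_zw_sum N F m k : iter N zw F m k =
  \sum_(j < N.+1) ((-1) ^+ j * 'C(N, j)%:R) *: F (m + N%:Z - j%:Z) (k + j%:Z).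
Proof.
elim: N m k => [|N ih] m k.
  by rewrite big_ord1 /= expr0 bin0 mul1r scale1r !addr0.
rewrite iterS /zw !ih.
rewrite [in RHS]big_ord_recl [in RHS]big_ord_recr /=.
rewrite [X in X - _ = _]big_ord_recl [X in _ - X = _]big_ord_recr /=.
rewrite opprD addrA [RHS]addrA; congr (_ + _); last first.
  by rewrite -scaleNr -mulNr /bump /= add1n exprS mulN1r !binn; congr (_ *: F _ _); lia.
rewrite -addrA; congr (_ + _).
  by rewrite !bin0 expr0; congr (_ *: F _ _); lia.
rewrite -sumrB; apply: eq_bigr => j _.
rewrite /bump /= !add1n.
have -> : F (m + 1 + N%:Z - (j.+1)%:Z) (k + (j.+1)%:Z) = F (m + N%:Z - j%:Z) (k + 1 + j%:Z).
  by congr F; lia.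
have -> : F (m + (N.+1)%:Z - (j.+1)%:Z) (k + (j.+1)%:Z) = F (m + N%:Z - j%:Z) (k + 1 + j%:Z).
  by congr F; lia.
rewrite -scalerBl binS natrD mulrDr; congr (_ *: _); congr (_ + _).
by rewrite exprS mulN1r mulNr.
Qed.

(** In the expansion of the N-th power of z - w every term except the pure power of z moves [k] from
    -1 to a nonnegative index. *)
Lemma iter_zw_creation N F m : (forall m k, 0 <= k -> F m k = 0) ->
  iter N zw F m (-1) = F (m + N%:Z) (-1).
Proof.
elim: N F m => [|N ih] F m hF; first by rewrite addr0.
rewrite iterSr ih /zw => [|m' k k0].
  by rewrite (hF _ (-1 + 1)) // subr0; congr F; lia.
by rewrite !hF ?subrr// ler_wpDr.
Qed.

(** * Unitary vertex operator algebras *)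

(* X x z w stands for the coefficients of a formal distribution in three
   variables; if (x - z)^N X = 0 and (x - w)^M (z - w)^P X = 0 then
   (z - w)^(M + N + P) X = 0, as z - w = (x - w) - (x - z). *)
Definition op3 : Type := int -> int -> int -> V.
Definition d_xz (X : op3) : op3 := fun x z w => X (x + 1) z w - X x (z + 1) w.
Definition d_xw (X : op3) : op3 := fun x z w => X (x + 1) z w - X x z (w + 1).
Definition d_zw (X : op3) : op3 := fun x z w => X x (z + 1) w - X x z (w + 1).

Lemma iter_xz N X x z w : iter N d_xz X x z w = iter N zw (fun x z => X x z w) x z.
Proof. by elim: N x z w => [//|N ih] x z w; rewrite !iterS /d_xz /zw !ih. Qed.
Lemma iter_xw N X x z w : iter N d_xw X x z w = iter N zw (fun x w => X x z w) x w.
Proof. by elim: N x z w => [//|N ih] x z w; rewrite !iterS /d_xw /zw !ih. Qed.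
Lemma iter_dzw N X x z w : iter N d_zw X x z w = iter N zw (X x) z w.
Proof. by elim: N x z w => [//|N ih] x z w; rewrite !iterS /d_zw /zw !ih. Qed.

Lemma d_xz_xw X : d_xz (d_xw X) = d_xw (d_xz X).
Proof.
apply/funext => x; apply/funext => z; apply/funext => w; rewrite /d_xz /d_xw.
by rewrite !opprB addrACA [RHS]addrACA; congr (_ + _); rewrite addrC.
Qed.
Lemma d_xz_zw X : d_xz (d_zw X) = d_zw (d_xz X).
Proof.
apply/funext => x; apply/funext => z; apply/funext => w; rewrite /d_xz /d_zw.
by rewrite !opprB addrACA [RHS]addrACA; congr (_ + _); rewrite addrC.
Qed.

Lemma d_xw_zw X : d_xw (d_zw X) = d_zw (d_xw X).
Proof.
apply/funext => x; apply/funext => z; apply/funext => w; rewrite /d_xw /d_zw.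
by rewrite !opprB addrACA [RHS]addrACA; congr (_ + _); rewrite addrC.
Qed.

Lemma iter_commute (E : Type) (f g : E -> E) : (forall X, f (g X) = g (f X)) ->
  forall n m X, iter n f (iter m g X) = iter m g (iter n f X).
Proof.
move=> fg n m X; elim: n => [//|n ih]; rewrite iterS ih.
elim: m {ih} => [//|m ih]; by rewrite iterS fg ih.
Qed.

Definition zero3 : op3 := fun _ _ _ => 0.
Lemma iter_op3_0 (d : op3 -> op3) n : d zero3 = zero3 -> iter n d zero3 = zero3.
Proof. by move=> h; elim: n => [//|n ih]; rewrite iterS ih. Qed.
Lemma d_xz0 : d_xz zero3 = zero3.
Proof. by do 3!apply/funext => ?; rewrite /d_xz subrr. Qed.
Lemma d_zw0 : d_zw zero3 = zero3.
Proof. by do 3!apply/funext => ?; rewrite /d_zw subrr. Qed.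
Lemma d_xw0 : d_xw zero3 = zero3.
Proof. by do 3!apply/funext => ?; rewrite /d_xw subrr. Qed.

Lemma kill_zw N M X : iter N d_xz X = zero3 -> iter M d_xw X = zero3 ->
  iter (M + N) d_zw X = zero3.
Proof.
move=> hN hM.
(* Replacing a factor z - w by (x - w) - (x - z) raises one of the exponents [i], [j]; when no
   factor is left, [i] has reached [M] or [j] has reached [N]. *)
have key n i j : (M + N <= n + i + j)%N ->
    iter n d_zw (iter i d_xw (iter j d_xz X)) = zero3.
  elim: n i j => [|n ih] i j hij.
    rewrite /=; have [Mi|iM] := leqP M i.
      rewrite -(subnK Mi) iterD -(iter_commute d_xz_xw) hM.
      by rewrite !iter_op3_0 ?d_xz0 ?d_xw0.
    have Nj : (N <= j)%N by lia.
    by rewrite -(subnK Nj) iterD hN !iter_op3_0 ?d_xz0 ?d_xw0.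
  rewrite iterSr.
  set Y := iter i d_xw _.
  have -> : d_zw Y = (fun x z w => d_xw Y x z w - d_xz Y x z w).
    do 3!apply/funext => ?; rewrite /d_zw /d_xw /d_xz.
    by rewrite opprB [RHS]addrC addrA subrK.
  apply/funext => x; apply/funext => z; apply/funext => w.
  rewrite iter_dzw.
  rewrite (iter_zwD n (fun z w => d_xw Y x z w) (fun z w => - d_xz Y x z w)).
  rewrite (iter_zwL n _ (L := -%R)); last by move=> k a b; rewrite opprD scalerN.
  have h1 : iter n d_zw (d_xw Y) = zero3 by rewrite /Y -iterS; apply: ih; lia.
  have h2 : iter n d_zw (d_xz Y) = zero3.
    rewrite /Y -[d_xz _]/(iter 1 d_xz _) (iter_commute d_xz_xw) -iterD.
    by apply: ih; lia.
  have := iter_dzw n (d_xw Y) x z w; rewrite h1 => <-.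
  by have := iter_dzw n (d_xz Y) x z w; rewrite h2 => <-; rewrite oppr0 addr0.
by have := key (M + N)%N 0%N 0%N; rewrite !addn0; exact.
Qed.

Lemma kill_zw3 N M P X : iter N d_xz X = zero3 ->
  iter M d_xw (iter P d_zw X) = zero3 -> iter (M + N + P) d_zw X = zero3.
Proof.
move=> hN hM; rewrite iterD; apply: kill_zw => //.
by rewrite (iter_commute d_xz_zw) hN iter_op3_0 ?d_zw0.
Qed.

End Shifts.

Lemma fsumZ (V : nmodType) (I : choiceType) (s : seq I) (F : I -> V) : uniq s ->
  (forall n, n \notin s -> F n = 0) -> \sum_(n \in [set: I]) F n = \sum_(n <- s) F n.
Proof.
move=> us hF; rewrite (fsbigE s)//=; last by move=> n _; exact: hF.
by apply: eq_bigl => i; rewrite in_setT.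
Qed.

(** * Weights, modes and adjoints *)

Section Grading.
Context (R : realType) (V : unitary_voa R).
Local Notation Y := (vop V).
Local Notation Om := (vac V).
Local Notation nu := (conf V).
Local Notation L0 := (Y nu 1).
Local Notation weight := (has_weight (vop V) (conf V)).
Implicit Types (a b c v : V) (n m k d e : int).

Lemma ipDr a b c : ip a (b + c) = ip a b + ip a c. Proof. exact: braketDr. Qed.
Lemma ipNr a b : ip a (- b) = - ip a b. Proof. exact: braketNr. Qed.
Lemma ipZr a z b : ip a (z *: b) = z * ip a b. Proof. exact: braketZr. Qed.
Lemma ip0r a : ip a 0 = 0. Proof. exact: braket0r. Qed.
Lemma ipC a b : ip a b = (ip b a)^*. Proof. exact: braketC. Qed.

Lemma ip_ext a b : (forall c, ip c a = ip c b) -> a = b.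
Proof.
move=> h; apply/eqP; rewrite -subr_eq0 -(braket_eq0 (uv_dot V)); apply/eqP.
by rewrite -/(ip _ _) ipDr ipNr h subrr.
Qed.

(* reduces an identity between linear combinations to one between scalars *)
Ltac module_ring := apply: ip_ext => ?; rewrite ?(ipDr, ipNr, ipZr, ip0r); ring.

Lemma vop_va : is_vertex_algebra Om (L Y nu (-1)) Y.
Proof. exact: voa_va (uv_is_voa V). Qed.

Lemma vop_linr a n : linear (Y a n).
Proof. by have [_ h] := va_bilinear vop_va n; exact: h. Qed.
Lemma vop_linl n b : linear (fun a => Y a n b).
Proof. by have [h _] := va_bilinear vop_va n; exact: h. Qed.

Lemma LE n b : L Y nu n b = Y nu (n + 1) b. Proof. by []. Qed.

Lemma vop_translation a n b : Y nu 0 (Y a n b) - Y a n (Y nu 0 b) = (- n)%:~R *: Y a (n - 1) b.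
Proof. exact: (va_translation vop_va). Qed.

(** Since T kills the vacuum, translation covariance at index m + 1 expresses a multiple of a_(m)
    vac, with nonzero factor for m >= 0, through a_(m+1) vac; the field property starts the
    descending induction. *)
Lemma vop_vac_ge0 a n : 0 <= n -> Y a n Om = 0.
Proof.
have [N hN] := va_field vop_va a Om.
suff h (k : nat) m : 0 <= m -> N <= m + k%:Z -> Y a m Om = 0.
  by move=> n0; apply: (h `|N|%N) => //; lia.
elim: k m => [|k ih] m m0 hm; first by apply: hN; lia.
have e : Y a (m + 1) Om = 0 by apply: ih; lia.
have T0 : Y nu 0 Om = 0 by exact: (va_T_vacuum vop_va).
have := vop_translation a (m + 1) Om; rewrite e T0 !(lin0 (vop_linr _ _)) subrr.
rewrite addrK => /esym/eqP; rewrite scaler_eq0 intr_eq0 => /orP[|/eqP//].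
by move=> /eqP; lia.
Qed.

Lemma vop_locality a b : exists N, forall c m k,
  iter N (@zw R V) (fun m k => Y a m (Y b k c) - Y b k (Y a m c)) m k = 0.
Proof.
have [N hN] := va_locality vop_va a b; exists N => c m k.
by rewrite iter_zw_sum; exact: hN.
Qed.

Lemma virasoro n m b : n + m != 0 ->
  L Y nu n (L Y nu m b) - L Y nu m (L Y nu n b) = (n - m)%:~R *: L Y nu (n + m) b.
Proof.
have [c hc] := voa_virasoro (uv_is_voa V) => h; rewrite hc (negbTE h).
by rewrite scale0r addr0.
Qed.

Lemma L0_vac : L0 Om = 0. Proof. by rewrite vop_vac_ge0. Qed.

Lemma L0_T b : L0 (Y nu 0 b) = Y nu 0 (L0 b) + Y nu 0 b.
Proof.
have /eqP := @virasoro 0 (-1) b isT; rewrite !LE subr_eq => /eqP.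
by rewrite add0r /= => ->; rewrite scale1r addrC.
Qed.

Lemma weightE n v : weight n v <-> L0 v = n%:~R *: v.
Proof. by []. Qed.

(** Up to a factor, a_(-k-1) vac is L_(-1) applied k times to a, and each application raises the
    eigenvalue of L_0 by one. *)
Lemma L0_vop_vac d a n : weight d a -> L0 (Y a n Om) = (d - n - 1)%:~R *: Y a n Om.
Proof.
move=> /weightE wa; have [n0|n0] := leP 0 n.
  by rewrite vop_vac_ge0// (lin0 (vop_linr _ _)) scaler0.
suff h (k : nat) : L0 (Y a (- k%:Z - 1) Om) =
    (d + k%:Z)%:~R *: Y a (- k%:Z - 1) Om.
  have := h (absz (n + 1)); have -> : - (absz (n + 1))%:Z - 1 = n by lia.
  by have -> : d + (absz (n + 1))%:Z = d - n - 1 by lia.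
elim: k => [|k ih].
  by rewrite oppr0 sub0r addr0 (va_creation vop_va).
have T0 : Y nu 0 Om = 0 by exact: (va_T_vacuum vop_va).
have := vop_translation a (- k%:Z - 1) Om.
rewrite T0 (lin0 (vop_linr _ _)) subr0.
have -> : - (- k%:Z - 1) = k.+1%:Z by lia.
have -> : - k%:Z - 1 - 1 = - k.+1%:Z - 1 by lia.
move=> e.
have k0 : (k.+1%:Z)%:~R != 0 :> R[i] by rewrite intr_eq0.
have e' : Y a (- k.+1%:Z - 1) Om = ((k.+1%:Z)%:~R)^-1 *: Y nu 0 (Y a (- k%:Z - 1) Om).
  by rewrite e scalerA mulVf// scale1r.
rewrite e' (linZ (vop_linr _ _)) L0_T ih (linZ (vop_linr _ _)).
have -> : (d + k.+1%:Z)%:~R = (d + k%:Z)%:~R + 1 :> R[i].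
  by rewrite -[1]/(1%:~R) -intrD; congr (_%:~R); lia.
by module_ring.
Qed.

(* Locality with respect to [Y(b, w)] of the field
   [L_0, Y(a, z)] - d Y(a, z) - [L_{-1}, Y(a, z)] z, an instance of Dong's lemma *)
Definition deviation d a n b : V := (L0 (Y a n b) - Y a n (L0 b)) - d%:~R *: Y a n b
  - (Y nu 0 (Y a (n + 1) b) - Y a (n + 1) (Y nu 0 b)).

Lemma deviation_lin d a n : linear (deviation d a n).
Proof.
by move=> k x y; rewrite /deviation !(vop_linr _ _); module_ring.
Qed.

(** The double commutator of nu, a and b is killed by a power of x - z and, once a power of z - w
    has removed the commutator of a and b, by a power of x - w; [kill_zw3] combines the three
    powers. *)
Lemma vop_dong a b : exists Q, forall c x m k,
  iter Q (@zw R V) (fun m k =>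
    (Y nu x (Y a m (Y b k c)) - Y a m (Y nu x (Y b k c)))
    - (Y b k (Y nu x (Y a m c)) - Y b k (Y a m (Y nu x c)))) m k = 0.
Proof.
have [N hN] := vop_locality nu a; have [M hM] := vop_locality nu b.
have [P hP] := vop_locality a b.
exists (M + N + P)%N => c x m k.
pose X : op3 V := fun x m k =>
    (Y nu x (Y a m (Y b k c)) - Y a m (Y nu x (Y b k c)))
    - (Y b k (Y nu x (Y a m c)) - Y b k (Y a m (Y nu x c))).
have hN3 : iter N (@d_xz R V) X = @zero3 R V.
  apply/funext => x'; apply/funext => z; apply/funext => w; rewrite iter_xz.
  rewrite (iter_zwD N (fun x z => Y nu x (Y a z (Y b w c)) - Y a z (Y nu x (Y b w c)))
    (fun x z => - (Y b w (Y nu x (Y a z c)) - Y b w (Y a z (Y nu x c))))) hN add0r.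
  rewrite (iter_zw_ext N (G := fun x z => - Y b w (Y nu x (Y a z c) - Y a z (Y nu x c)))).
    rewrite (iter_zwL N _ (L := fun v => - Y b w v)) ?hN ?(lin0 (vop_linr _ _)) ?oppr0//.
    by move=> l u v; rewrite (vop_linr _ _) opprD scalerN.
  by move=> *; rewrite (linB (vop_linr _ _)).
have hM3 : iter M (@d_xw R V) (iter P (@d_zw R V) X) = @zero3 R V.
  (* Jacobi identity: [A] is the commutator of nu with [a, b], and [B] the commutator of [nu, b]
     with a. *)
  pose A : op3 V := fun x z w =>
      Y nu x (Y a z (Y b w c) - Y b w (Y a z c)) +
       - (Y a z (Y b w (Y nu x c)) - Y b w (Y a z (Y nu x c))).
  pose B : op3 V := fun x z w =>
      (Y nu x (Y b w (Y a z c)) - Y b w (Y nu x (Y a z c))) +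
       (- Y a z (Y nu x (Y b w c) - Y b w (Y nu x c))).
  have -> : X = fun x z w => A x z w + B x z w.
    do 3!apply/funext => ?; rewrite /X /A /B !(linB (vop_linr _ _)).
    by module_ring.
  have A0 : iter P (@d_zw R V) A = @zero3 R V.
    apply/funext => x'; apply/funext => z; apply/funext => w; rewrite iter_dzw /A.
    rewrite (iter_zwD P (fun z w => Y nu x' (Y a z (Y b w c) - Y b w (Y a z c)))).
    rewrite (iter_zwL P _ _ _ (vop_linr _ _)) hP (lin0 (vop_linr _ _)) add0r.
    rewrite (iter_zwL P _ (L := -%R)) ?hP ?oppr0//.
    by move=> l u v; rewrite opprD scalerN.
  have B0 : iter M (@d_xw R V) B = @zero3 R V.
    apply/funext => x'; apply/funext => z; apply/funext => w; rewrite iter_xw /B.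
    rewrite (iter_zwD M (fun x w => Y nu x (Y b w (Y a z c)) - Y b w (Y nu x (Y a z c)))).
    rewrite hM add0r (iter_zwL M _ (L := fun v => - Y a z v)) ?hM.
      by rewrite (lin0 (vop_linr _ _)) oppr0.
    by move=> l u v; rewrite (vop_linr _ _) opprD scalerN.
  have -> : iter P (@d_zw R V) (fun x z w => A x z w + B x z w) = iter P (@d_zw R V) B.
    apply/funext => x'; apply/funext => z; apply/funext => w; rewrite !iter_dzw.
    by rewrite iter_zwD -(iter_dzw P A) A0 add0r.
  by rewrite (iter_commute (@d_xw_zw _ V)) B0 iter_op3_0// d_zw0.
have := congr1 (fun F => F x m k) (kill_zw3 hN3 hM3).
by rewrite iter_dzw.
Qed.

(** On the vacuum the formula is already known. The deviation from it is local with respect to every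
    Y(b, w) and kills the vacuum, hence vanishes, as in Goddard's uniqueness theorem. *)
Lemma L0_commutator d a n b : weight d a ->
  L0 (Y a n b) - Y a n (L0 b) = (d - n - 1)%:~R *: Y a n b.
Proof.
move=> wa.
have dE m c : deviation d a m c =
    L0 (Y a m c) - Y a m (L0 c) - (d - m - 1)%:~R *: Y a m c.
  rewrite /deviation vop_translation; have -> : m + 1 - 1 = m by lia.
  have -> : (d - m - 1)%:~R = d%:~R + (- (m + 1))%:~R :> R[i].
    by rewrite -intrD; congr (_%:~R); lia.
  by module_ring.
suff d0 : deviation d a n b = 0.
  by apply/eqP; rewrite -subr_eq0 -dE d0.
have dv m : deviation d a m Om = 0.
  by rewrite dE (L0_vop_vac _ wa) L0_vac (lin0 (vop_linr _ _)) subr0 subrr.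
have [Q hQ] := vop_dong a b; have [P hP] := vop_locality a b.
pose S := (Q + P)%N.
have hS m : iter S (@zw R V) (fun m k => deviation d a m (Y b k Om)
    - Y b k (deviation d a m Om)) m (-1) = 0.
  pose F1 x m k := (Y nu x (Y a m (Y b k Om)) - Y a m (Y nu x (Y b k Om)))
    - (Y b k (Y nu x (Y a m Om)) - Y b k (Y a m (Y nu x Om))).
  pose F2 m k := Y a m (Y b k Om) - Y b k (Y a m Om).
  rewrite (iter_zw_ext S (G := fun m k =>
   (F1 1 m k + - d%:~R *: F2 m k) + - F1 0 (m + 1) k)); last first.
    move=> m' k'; rewrite /deviation /F1 /F2 !(linB (vop_linr _ _)) (linZ (vop_linr _ _)).
    by module_ring.
  rewrite (iter_zwD S (fun m k => F1 1 m k + - d%:~R *: F2 m k)).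
  rewrite (iter_zwD S (F1 1)) (iter_zwL S _ (L := -%R)); last first.
    by move=> l u v; rewrite opprD scalerN.
  rewrite (iter_zwL S _ (L := fun v => - d%:~R *: v)); last first.
    by move=> l u v; module_ring.
  rewrite (iter_zw_shift S (F1 0)).
  rewrite (iter_zw0 (hQ Om 1)) ?leq_addr// (iter_zw0 (hQ Om 0)) ?leq_addr//.
  rewrite (iter_zw0 (hP Om)) ?leq_addl//.
  by rewrite scaler0 oppr0 !addr0.
(* The coefficient of w^0 keeps only b_(-1) vac = b; starting at [n - S] compensates the shift by
   [S] of the first index. *)
have := hS (n - S%:Z); rewrite iter_zw_creation => [|m k k0].
  rewrite dv (lin0 (vop_linr _ _)) subr0 (va_creation vop_va).
  by have -> : n - S%:Z + S%:Z = n by lia.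
rewrite dv vop_vac_ge0// !(lin0 (vop_linr _ _)) subr0.
exact: (lin0 (deviation_lin _ _ _)).
Qed.

Lemma vop_weight d e a b n : weight d a -> weight e b -> weight (d + e - n - 1) (Y a n b).
Proof.
move=> wa /weightE wb; apply/weightE.
have /eqP := L0_commutator n b wa; rewrite subr_eq => /eqP ->.
rewrite wb (linZ (vop_linr _ _)) -scalerDl; congr (_ *: _).
by rewrite -intrD; congr (_%:~R); lia.
Qed.

Lemma weight0 n : weight n (0 : V).
Proof. by apply/weightE; rewrite (lin0 (vop_linr _ _)) scaler0. Qed.

Lemma weightD n z v w : weight n v -> weight n w -> weight n (z *: v + w).
Proof.
move=> /weightE hv /weightE hw; apply/weightE.
by rewrite (vop_linr _ _) hv hw scalerDr !scalerA mulrC.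
Qed.

Lemma weightZ n z v : weight n v -> weight n (z *: v).
Proof. by move=> h; rewrite -[_ *: _]addr0; apply: weightD => //; exact: weight0. Qed.

Lemma weight_independent (s : seq int) (p : int -> V) : uniq s ->
  (forall n, n \in s -> weight n (p n)) -> \sum_(n <- s) p n = 0 ->
  forall n, n \in s -> p n = 0.
Proof.
elim: s p => [//|k s ih] p /= /andP[ks us] wp; rewrite big_cons => hs.
have ps n : n \in s -> p n = 0.
  move=> ns; have nk : n != k by apply: contra ks => /eqP <-.
  have : (n - k)%:~R *: p n = 0.
    apply: (ih (fun n => (n - k)%:~R *: p n)) => // [m ms|].
      by apply: weightZ; apply: wp; rewrite inE ms orbT.
    have : L0 (p k + \sum_(j <- s) p j) = k%:~R *: (p k + \sum_(j <- s) p j).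
      by rewrite hs (lin0 (vop_linr _ _)) scaler0.
    rewrite (linD (vop_linr _ _)) (weightE k _).1; last by apply: wp; rewrite inE eqxx.
    rewrite scalerDr => /addrI; rewrite (lin_sum (vop_linr _ _)) scaler_sumr => e.
    rewrite -[RHS](subrr (\sum_(i <- s) k%:~R *: p i)) -{1}e -sumrB.
    rewrite big_seq [RHS]big_seq; apply: eq_bigr => j js.
    rewrite (weightE j _).1; last by apply: wp; rewrite inE js orbT.
    by rewrite -scalerBl intrD mulrNz.
  by move=> /eqP; rewrite scaler_eq0 intr_eq0 subr_eq0 (negbTE nk) => /eqP.
move=> n; rewrite inE => /orP[/eqP ->|]; last exact: ps.
by move: hs; rewrite big_seq big1 ?addr0.
Qed.

Lemma hcomp_weight a n : weight n (hcomp a n).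
Proof. by rewrite /hcomp; case: cid => p [/= h _ _]. Qed.

Lemma hcomp_support a : exists2 s : seq int, uniq s &
  (forall n, n \notin s -> hcomp a n = 0) /\ a = \sum_(n <- s) hcomp a n.
Proof.
rewrite /hcomp; case: cid => p [/= _ fp e].
exists (finmap.enum_fset (fset_set [set n | p n != 0])); first exact: finmap.fset_uniq.
have out n : n \notin finmap.enum_fset (fset_set [set n | p n != 0]) -> p n = 0.
  rewrite in_fset_set// => /negP; rewrite inE /= => /negP; rewrite negbK => /eqP //.
split=> //; rewrite {1}e; apply: fsumZ => //; exact: finmap.fset_uniq.
Qed.

(** [hcomp] comes from a choice; independence of the eigenspaces makes it computable from any
    decomposition. *)
Lemma hcomp_uniq a (s : seq int) (p : int -> V) : uniq s ->
  (forall n, n \in s -> weight n (p n)) -> a = \sum_(n <- s) p n ->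
  forall n, hcomp a n = if n \in s then p n else 0.
Proof.
move=> us wp ap n; have [r ur [hr ar]] := hcomp_support a.
pose q m := hcomp a m - (if m \in s then p m else 0).
pose t := undup (r ++ s).
have wq m : weight m (q m).
  rewrite /q; case: ifPn => ms; rewrite ?subr0; last exact: hcomp_weight.
  by rewrite addrC -scaleN1r; apply: weightD; [exact: wp | exact: hcomp_weight].
have sum (u : seq int) (F : int -> V) : uniq u -> (forall m, m \notin u -> F m = 0) ->
    {subset u <= t} -> \sum_(m <- t) F m = \sum_(m <- u) F m.
  move=> uu hF ut; rewrite -(fsumZ uu hF) -(fsumZ (undup_uniq _))// => m mt.
  by apply: hF; apply: contra mt => /ut.
have q0 : \sum_(m <- t) q m = 0.
  rewrite sumrB (sum r)// => [|m]; last by rewrite mem_undup mem_cat => ->.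
  rewrite (sum s)// => [|m /negbTE -> //|m]; last by rewrite mem_undup mem_cat orbC => ->.
  have -> : \sum_(m <- s) (if m \in s then p m else 0) = \sum_(m <- s) p m.
    by apply: eq_big_seq => m ->.
  by rewrite -ar -ap subrr.
have [nt|nt] := boolP (n \in t).
  have := weight_independent (undup_uniq _) (fun m _ => wq m) q0 nt.
  by rewrite /q => /eqP; rewrite subr_eq0 => /eqP.
move: nt; rewrite mem_undup mem_cat negb_or => /andP[/hr -> /negbTE -> //].
Qed.

Lemma modeE a (s : seq int) (p : int -> V) n b : uniq s ->
  (forall d, d \in s -> weight d (p d)) -> a = \sum_(d <- s) p d ->
  mode a n b = \sum_(d <- s) Y (p d) (n + d - 1) b.
Proof.
move=> us wp ap; rewrite /mode (fsumZ us).
  by apply: eq_big_seq => d ds; rewrite (hcomp_uniq us wp ap) ds.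
by move=> d /negbTE ds; rewrite (hcomp_uniq us wp ap) ds (lin0 (vop_linl _ _)).
Qed.

Lemma mode_weight_vop d a n b : weight d a -> mode a n b = Y a (n + d - 1) b.
Proof.
move=> wa; rewrite (@modeE a [:: d] (fun=> a)) ?big_seq1//.
by move=> e; rewrite inE => /eqP ->.
Qed.

Lemma mode_linr a n : linear (mode a n).
Proof.
move=> k x y; have [s us [_ e]] := hcomp_support a.
have wp d : d \in s -> weight d (hcomp a d) by move=> _; exact: hcomp_weight.
rewrite !(modeE _ _ us wp e) scaler_sumr -big_split; apply: eq_bigr => d _ /=.
by rewrite (vop_linr _ _).
Qed.

Lemma hcomp_common (x y : V) : exists2 t : seq int, uniq t &
  x = \sum_(m <- t) hcomp x m /\ y = \sum_(m <- t) hcomp y m /\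
  (forall m, m \notin t -> hcomp x m = 0 /\ hcomp y m = 0).
Proof.
have [s us [hs es]] := hcomp_support x; have [r ur [hr er]] := hcomp_support y.
have ut := undup_uniq (s ++ r).
have widen (z : V) (u : seq int) : uniq u -> (forall m, m \notin u -> hcomp z m = 0) ->
    {subset u <= undup (s ++ r)} -> z = \sum_(m <- u) hcomp z m ->
    z = \sum_(m <- undup (s ++ r)) hcomp z m.
  move=> uu hu sub e; rewrite {1}e -(fsumZ uu hu) (fsumZ ut)// => m mt.
  by apply: hu; apply: contra mt; exact: sub.
exists (undup (s ++ r)) => //; split; last split.
- by apply: widen es => // m; rewrite mem_undup mem_cat => ->.
- by apply: widen er => // m; rewrite mem_undup mem_cat orbC => ->.
- by move=> m; rewrite mem_undup mem_cat negb_or => /andP[/hs ? /hr ?].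
Qed.

Lemma hcomp_lin n : linear (fun x : V => hcomp x n).
Proof.
move=> k x y; have [t ut [xE [yE h0]]] := hcomp_common x y.
rewrite (@hcomp_uniq (k *: x + y) t (fun m => k *: hcomp x m + hcomp y m))//.
- by case: ifPn => // /h0[-> ->]; rewrite scaler0 addr0.
- by move=> m _; apply: weightD; exact: hcomp_weight.
- by rewrite big_split -scaler_sumr /= -xE -yE.
Qed.

Lemma mode_linl n b : linear (fun a => mode a n b).
Proof.
move=> k x y; have [t ut [xE [yE _]]] := hcomp_common x y.
have wx (z : V) d : d \in t -> weight d (hcomp z d) by move=> _; exact: hcomp_weight.
rewrite (modeE _ _ ut (wx x) xE) (modeE _ _ ut (wx y) yE).
rewrite (@modeE _ t (fun d => k *: hcomp x d + hcomp y d))//.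
- by rewrite scaler_sumr -big_split; apply: eq_bigr => d _ /=; rewrite (vop_linl _ _).
- by move=> d _; apply: weightD; exact: hcomp_weight.
- by rewrite big_split -scaler_sumr /= -xE -yE.
Qed.

Lemma weight_ind (P : V -> Prop) : P 0 -> (forall a b, P a -> P b -> P (a + b)) ->
  (forall d a, weight d a -> P a) -> forall a, P a.
Proof.
move=> P0 PD Pw a; have [s us [_ ->]] := hcomp_support a.
by elim/big_ind: _ => // d _; apply: Pw; exact: hcomp_weight.
Qed.

Lemma mode_weight a n e b : weight e b -> weight (e - n) (mode a n b).
Proof.
move=> wb; elim/weight_ind: a => [|x y hx hy|d a wa].
- by rewrite (lin0 (mode_linl _ _)); exact: weight0.
- rewrite (linD (mode_linl _ _)) -[mode x n b]scale1r; exact: weightD.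
- rewrite (mode_weight_vop _ _ wa).
  by have := vop_weight (n + d - 1) wa wb; congr weight; lia.
Qed.

Lemma mode_field a b : exists N : int, forall n, N <= n -> mode a n b = 0.
Proof.
elim/weight_ind: a => [|x y [N hN] [M hM]|d a wa].
- by exists 0 => n _; rewrite (lin0 (mode_linl _ _)).
- exists (Num.max N M) => n; rewrite ge_max => /andP[/hN h1 /hM h2].
  by rewrite (linD (mode_linl _ _)) h1 h2 addr0.
- have [N hN] := va_field vop_va a b; exists (N - d + 1) => n Nn.
  by rewrite (mode_weight_vop _ _ wa) hN//; lia.
Qed.

(** nu is L_(-2) vac, so this is [L_0, L_(-2)] = 2 L_(-2). In the same way [L1_conf] is L_1 nu = 3
    L_(-1) vac = 0. *)
Lemma conf_weight : weight 2 nu.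
Proof.
apply/weightE; have := @virasoro 0 (-2) Om isT.
rewrite -[L Y nu (-2) Om]/(Y nu (-1) Om).
rewrite ?(va_creation vop_va) -[L Y nu 0 Om]/(L0 Om) L0_vac -[L Y nu 0 nu]/(L0 nu).
by rewrite [L _ _ _ 0](lin0 (vop_linr _ _)) subr0.
Qed.

Lemma L1_conf : Y nu 2 nu = 0.
Proof.
have := @virasoro 1 (-2) Om isT.
rewrite -[L Y nu (-2) Om]/(Y nu (-1) Om) -[L Y nu (1 - 2) Om]/(Y nu 0 Om).
rewrite (va_creation vop_va) -[L Y nu 1 Om]/(Y nu 2 Om) vop_vac_ge0//.
rewrite [L _ _ _ 0](lin0 (vop_linr _ _)) subr0.
by rewrite (va_T_vacuum vop_va : Y nu 0 Om = 0) scaler0.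
Qed.

Lemma weight_bounded : exists N : int, forall n, n < N -> forall v, weight n v -> v = 0.
Proof. exact: (voa_bounded_below (uv_is_voa V)). Qed.

Lemma L_weight e n b : weight e b -> weight (e - n) (L Y nu n b).
Proof.
move=> wb; rewrite LE; have := vop_weight (n + 1) conf_weight wb.
by congr weight; lia.
Qed.

Lemma iter_L1_weight e l b : weight e b -> weight (e - l%:Z) (iter l (L Y nu 1) b).
Proof.
move=> wb; elim: l => [|l ih]; first by rewrite subr0.
by rewrite iterS; have := L_weight 1 ih; congr weight; lia.
Qed.

(** For homogeneous a = theta a0, invariance moves Y(a, z) to the other side as a sum over l of
    modes of L_1^l a0. The weights d - l of these vectors differ, but in the energy indexing every
    summand has index -n, so one vector independent of n collects them. *)
Lemma mode_adjoint a : exists a', forall n b c, ip (mode a n b) c = ip b (mode a' (- n) c).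
Proof.
elim/weight_ind: a => [|x y [x' hx] [y' hy]|d a wa].
- by exists 0 => n b c; rewrite !(lin0 (mode_linl _ _)) ip0r ipC ip0r conjC0.
- exists (x' + y') => n b c; rewrite !(linD (mode_linl _ _)) ipDr.
  by rewrite ipC ipDr rmorphD /= -!ipC hx hy.
have [th [[thl [th' thK thK'] thm] thnu inv]] := uv_invariant V.
have [_ _ hinv] := inv.
pose a0 := th' a.
have wa0 : weight d a0.
  apply/weightE; apply: (can_inj thK); rewrite thm thnu thK'.
  have -> : th (d%:~R *: a0) = d%:~R *: a.
    have t0 : th 0 = 0.
      by apply: (addrI (th 0)); rewrite addr0; have := thl 1 0 0; rewrite scaler0 addr0 conjC1 scale1r.
    by rewrite -[_ *: a0]addr0 thl t0 addr0 thK' rmorph_int.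
  exact: wa.
have [N hN] := weight_bounded.
pose M := absz (d - N + 1).
have L10 l : (M <= l)%N -> iter l (L Y nu 1) a0 = 0.
  by move=> Ml; apply: (hN (d - l%:Z)); [lia | exact: iter_L1_weight].
exists (\sum_(l < M) ((-1) ^ d / (l`!%:R)) *: iter l (L Y nu 1) a0) => n b c.
rewrite (mode_weight_vop _ _ wa) -{1}(thK' a) -/a0 -(thK' b) -thm.
rewrite /ip (hinv d a0 wa0).
rewrite (@fsumZ _ _ (index_iota 0 M)) ?iota_uniq//; last first.
  move=> l; rewrite mem_index_iota /= -leqNgt => /L10 ->.
  by rewrite (lin0 (vop_linl _ _)) [braket _ _ _]ip0r mulr0.
rewrite thK' (lin_sum (mode_linl _ _)) braket_sumr mulr_sumr.
rewrite big_mkord; apply: eq_bigr => l _.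
rewrite (linZ (mode_linl _ _)) braketZr mulrA; congr (_ * _).
by rewrite (mode_weight_vop _ _ (iter_L1_weight _ wa0)); congr (braket _ _ (Y _ _ _)); lia.
Qed.

(** theta fixes nu and L_1 nu = 0, so only the term l = 0 of the invariance formula remains; its
    sign is +1 because nu has even weight. *)
Lemma L_adjoint n b c : ip (L Y nu n b) c = ip b (L Y nu (- n) c).
Proof.
have [th [[thl [th' thK thK'] thm] thnu inv]] := uv_invariant V.
have [_ _ hinv] := inv.
rewrite LE -{1}thnu -(thK' b) -thm /ip (hinv _ _ conf_weight).
rewrite (@fsumZ _ _ [:: 0%N])//.
  rewrite big_seq1 /= fact0 invr1 mul1r -exprnP expr2 mulrNN mulr1 mul1r thK'.
  by congr (braket _ _ (Y _ _ _)); lia.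
move=> l; rewrite inE => l0; rewrite -(prednK (n := l)) ?lt0n// iterSr.
rewrite [L _ _ _ _]L1_conf.
have -> : iter l.-1 (L Y nu 1) 0 = 0.
  by elim: l.-1 => [//|k ih]; rewrite iterS ih; exact: (lin0 (vop_linr _ _)).
by rewrite (lin0 (vop_linl _ _)) [braket _ _ _]ip0r mulr0.
Qed.

Lemma ipZl z a b : ip (z *: a) b = z^* * ip a b. Proof. exact: braketZl. Qed.

Lemma weight_orth d e a b : weight d a -> weight e b -> d != e -> ip a b = 0.
Proof.
move=> /weightE wa /weightE wb de.
have := L_adjoint 0 a b; rewrite oppr0 !LE add0r wa wb ipZl ipZr rmorph_int => /eqP.
rewrite -subr_eq0 -mulrBl -intrB mulf_eq0 intr_eq0 subr_eq0 (negbTE de) /= => /eqP //.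
Qed.

Lemma ip_ge0 a : 0 <= ip a a. Proof. exact: braket_ge0. Qed.
Lemma ip_eq0 a : ip a a = 0 -> a = 0.
Proof. by move=> h; apply/eqP; rewrite -(braket_eq0 (uv_dot V)); apply/eqP. Qed.

(* the norm of L_{-1} v is 2n times that of v when L_1 v = 0 *)
Lemma weight_ge0 n v : n < 0 -> weight n v -> v = 0.
Proof.
have [N hN] := weight_bounded.
(* Induction on the height [k] above the lower bound [N] of the weights: L_1 w has weight m - 1 and
   vanishes by induction. *)
suff h (k : nat) m w : m < 0 -> m < N + k%:Z -> weight m w -> w = 0.
  by move=> n0; apply: (h (absz (n - N + 1))) => //; lia.
elim: k m w => [|k ih] m w m0 hm wm; first by apply: hN wm; lia.
have L1w : L Y nu 1 w = 0.
  by apply: ih (L_weight 1 wm); lia.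
apply: ip_eq0; apply/eqP; rewrite eq_le ip_ge0 andbT.
have := ip_ge0 (L Y nu (-1) w); rewrite L_adjoint opprK.
have [c hc] := voa_virasoro (uv_is_voa V).
have /eqP := hc 1 (-1) w; rewrite L1w [L Y nu (-1) 0](lin0 (vop_linr _ _)) subr0 subrr.
rewrite eqxx mul0r mul0r scale0r addr0 (wm : L Y nu 0 w = _) => /eqP ->.
rewrite scalerA -intrM ipZr => h; have : 0 <= - (2 * m)%:~R * - ip w w.
  by rewrite mulrNN; apply: le_trans h _; rewrite le_eqVlt; apply/orP; left; apply/eqP; congr (_%:~R * _); lia.
have m2 : 0 < - (2 * m)%:~R :> R[i] by rewrite oppr_gt0 ltrz0; lia.
by rewrite pmulr_rge0// oppr_ge0.
Qed.

End Grading.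

(** * Finite-dimensional projection and orthogonalization of tensors *)

Section FiniteProjection.
Context (R : realType) (V : lmodType R[i]) (f : {dot V for @Num.conj R[i]}).
Local Notation "'<< x , y >>" := (braket f x y) (at level 8, x at level 99).

(** The intersection of all subspaces containing [s]: membership is used by instantiating [P], for
    instance with an annihilator or a weight space. *)
Definition in_span (s : seq V) (v : V) := forall P : set V, subspace_set P ->
  (forall x, x \in s -> P x) -> P v.

Lemma in_span_subspace s : subspace_set (in_span s).
Proof.
split=> [P [P0 _] //|k a b ha hb P sP hP].
by case: (sP) => _ PD; apply: (PD); [exact: ha | exact: hb].
Qed.

Lemma subspaceZ (P : set V) k a : subspace_set P -> P a -> P (k *: a).
Proof. by move=> [P0 PD] Pa; rewrite -[_ *: _]addr0; apply: (PD). Qed.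
Lemma subspace_add (P : set V) a b : subspace_set P -> P a -> P b -> P (a + b).
Proof. by move=> [P0 PD] Pa Pb; rewrite -[a]scale1r; apply: (PD). Qed.
Lemma subspace_sub (P : set V) a b : subspace_set P -> P a -> P b -> P (a - b).
Proof. by move=> sP Pa Pb; apply: subspace_add => //; rewrite -scaleN1r; exact: subspaceZ. Qed.
Lemma subspace_sum (P : set V) (I : Type) (r : seq I) (Q : pred I) (F : I -> V) :
  subspace_set P -> (forall i, Q i -> P (F i)) -> P (\sum_(i <- r | Q i) F i).
Proof.
move=> sP h; elim/big_ind: _ => //; first by case: sP.
by move=> x y; exact: subspace_add.
Qed.

Lemma braket_annihilator x : subspace_set [set s | '<< s, x >> = 0].
Proof.
split; first exact: braket0l.
by move=> k a b /= ha hb; rewrite braketDl braketZl ha hb mulr0 addr0.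
Qed.

(** Gram-Schmidt: the component [q] of the new vector orthogonal to the old span contributes one
    more term, or none when [q = 0]. *)
Lemma finite_projection (s : seq V) x :
  exists2 v, in_span s v & forall y, y \in s -> '<< y, x - v >> = 0.
Proof.
elim: s x => [|s0 s ih] x; first by exists 0 => // P [].
have spanS v : in_span s v -> in_span (s0 :: s) v.
  by move=> h P sP hP; apply: h => // y ys; apply: hP; rewrite inE ys orbT.
have s0S : in_span (s0 :: s) s0 by move=> P sP; apply; rewrite mem_head.
have sS := in_span_subspace (s0 :: s).
have [v0 hv0 ov0] := ih x; have [p0 hp0 op0] := ih s0.
have annih y z : (forall u, u \in s -> '<< u, y >> = 0) -> in_span s z -> '<< z, y >> = 0.
  by move=> h hz; exact: (hz _ (braket_annihilator y) h).
set q := s0 - p0 in op0; have qE : s0 = p0 + q by rewrite /q addrC subrK.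
have [q0|q0] := eqVneq q 0.
  exists v0 => [|y]; first exact: spanS.
  rewrite inE => /orP[/eqP ->|]; last exact: ov0.
  by rewrite qE q0 addr0 (annih _ _ ov0).
have hq : in_span (s0 :: s) q := subspace_sub sS s0S (spanS _ hp0).
pose k := '<< q, x >> / '<< q, q >>.
have hs y : in_span s y -> '<< y, x - (v0 + k *: q) >> = 0.
  move=> ys; rewrite opprD addrA braketBr braketZr (annih _ _ ov0)//.
  by rewrite (annih _ _ op0)// mulr0 subr0.
have hqq : '<< q, x - (v0 + k *: q) >> = 0.
  rewrite opprD addrA braketBr braketZr braketBr /k divfK ?braket_eq0//.
  by rewrite (braketC f q v0) (annih _ _ op0)// rmorph0 subr0 subrr.
exists (v0 + k *: q).
  exact: (subspace_add sS (spanS _ hv0) (subspaceZ k sS hq)).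
move=> y; rewrite inE => /orP[/eqP ->|ys]; last by apply: hs => P _; exact.
by rewrite qE braketDl hs// hqq addr0.
Qed.

End FiniteProjection.

Section Legs.
Context (R : realType) (U1 U2 W : lmodType R[i]) (f1 : {dot U1 for @Num.conj R[i]})
  (f2 : {dot U2 for @Num.conj R[i]}) (f : {dot W for @Num.conj R[i]}).

(** Gram-Schmidt on the second leg, with the coefficients moved to the first leg by bilinearity. The
    rewriting is asserted for all bilinear maps at once, because it is applied both to [t] and to
    [t] precomposed with an operator on the first leg. *)
Lemma orthogonalize (c : nat -> U1) (d : nat -> U2) n (P : set U1) :
  subspace_set P -> (forall i, P (c i)) ->
  exists m (c' : nat -> U1) (d' : nat -> U2), [/\ forall i, P (c' i),
    forall i j, (i < m)%N -> (j < m)%N -> i != j -> braket f2 (d' i) (d' j) = 0 &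
    forall g : U1 -> U2 -> W, is_bilinear g ->
      \sum_(i < n) g (c i) (d i) = \sum_(i < m) g (c' i) (d' i)].
Proof.
move=> sP; elim: n c d => [|n ih] c d Pc.
  by exists 0%N, c, d; split=> // g _; rewrite !big_ord0.
have [m [c1 [d1 [Pc1 o1 e1]]]] := ih (c \o S) (d \o S) (fun i => Pc i.+1).
pose l j := braket f2 (d1 j) (d 0) / braket f2 (d1 j) (d1 j).
pose d0 := d 0%N - \sum_(j < m) l j *: d1 j.
have od0 j : (j < m)%N -> braket f2 (d1 j) d0 = 0.
  move=> jm; rewrite /d0 braketBr braket_sumr (bigD1 (Ordinal jm))//= big1.
    rewrite addr0 braketZr /l; have [->|dj] := eqVneq (d1 j) 0.
      by rewrite !braket0l mul0r mul0r subrr.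
    by rewrite divfK ?braket_eq0// subrr.
  by move=> i ij; rewrite braketZr o1 ?mulr0//; apply: contra ij => /eqP h; apply/eqP/val_inj.
exists m.+1, (fun i => if i is j.+1 then c1 j + l j *: c 0%N else c 0%N),
  (fun i => if i is j.+1 then d1 j else d0); split.
- by case=> [|i] //; apply: subspace_add => //; exact: subspaceZ.
- move=> [|i] [|j]//= im jm ij; last exact: o1.
    by rewrite braketC od0// rmorph0.
  exact: od0.
- move=> g bg; have [gl gr] := bg.
  rewrite !big_ord_recl /= (e1 g bg) /d0 (linB (gr _)) (lin_sum (gr _)) -addrA; congr (_ + _).
  rewrite addrC -sumrB; apply: eq_bigr => j _.
  rewrite (linD (gl _)) (linZ (gl _)) (linZ (gr _)).
  by rewrite addrK.
Qed.

Hypothesis (t : U1 -> U2 -> W) (bt : is_bilinear t).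
Hypothesis ht : forall a b c d,
  braket f (t a b) (t c d) = braket f1 a c * braket f2 b d.

(** Once the second leg is orthogonal, both sides are sums of products of squared norms of the legs,
    so a bound for [A] on the first leg passes to A (x) 1 with the same constant, whatever the
    number of terms. *)
Lemma leg_bound (A : U1 -> U1) (C : R) (P : set U1) : linear A -> subspace_set P ->
  (forall c, P c -> sqn f1 (A c) <= C * sqn f1 c) ->
  forall n (c : nat -> U1) (d : nat -> U2), (forall i, P (c i)) ->
  sqn f (\sum_(i < n) t (A (c i)) (d i)) <= C * sqn f (\sum_(i < n) t (c i) (d i)).
Proof.
move=> lA sP hA n c d Pc.
have [m [c' [d' [Pc' o e]]]] := orthogonalize d n sP Pc.
have bA : is_bilinear (fun a b => t (A a) b).
  by have [tl tr] := bt; split=> [v k a b|u]; [rewrite lA tl | exact: tr].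
rewrite (e t bt) (e _ bA).
have S (g : U1 -> U1) : sqn f (\sum_(i < m) t (g (c' i)) (d' i)) =
    \sum_(i < m) sqn f1 (g (c' i)) * sqn f2 (d' i).
  apply: (@complexI R); rewrite -sqnE braket_suml rmorph_sum; apply: eq_bigr => i _.
  rewrite braket_sumr (bigD1 i)//= big1 ?addr0 => [|j ji].
    by rewrite ht rmorphM /= -!sqnE.
  by rewrite ht o ?mulr0// eq_sym.
rewrite (S A) (S id) mulr_sumr; apply: ler_sum => i _.
by rewrite mulrA ler_wpM2r ?sqn_ge0// hA.
Qed.

End Legs.

(** * Energy bounds and the grading *)

Section EnergyNorm.
Context (R : realType) (V : unitary_voa R) (H : completion V).
Local Notation weight := (has_weight (vop V) (conf V)).
Implicit Types (a b : V) (n m : int).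

Definition vn a : R := rn (emb H a).

Lemma vn_sqn a : sqn (uv_dot V) a = vn a ^+ 2.
Proof.
apply: (@complexI R); rewrite -sqnE rmorphXn /= -/(ip a a) -(emb_isometry H).
by rewrite hip_rn rmorphXn.
Qed.
Lemma vnormE a : vnorm a = (vn a)%:C.
Proof.
rewrite /vnorm -(emb_isometry H) hip_rn rmorphXn /= sqrCK//.
by rewrite -[0]/(0%:C) lecR rn_ge0.
Qed.
Lemma vn_ge0 a : 0 <= vn a. Proof. exact: rn_ge0. Qed.
Lemma vn0 : vn 0 = 0. Proof. by rewrite /vn (lin0 (emb_linear H)) rn0. Qed.
Lemma vnD a b : vn (a + b) <= vn a + vn b.
Proof. by rewrite /vn (linD (emb_linear H)) rnD. Qed.
Lemma vnZ k a : vn (k *: a) = rn k * vn a.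
Proof. by rewrite /vn (linZ (emb_linear H)) rnZ. Qed.
Lemma vn_sum (I : Type) (r : seq I) (P : pred I) (F : I -> V) :
  vn (\sum_(i <- r | P i) F i) <= \sum_(i <- r | P i) vn (F i).
Proof. by rewrite /vn (lin_sum (emb_linear H)) rn_sum. Qed.

Definition L0p1 : V -> V := fun v => L (vop V) (conf V) 0 v + v.

Lemma L0p1_lin : linear L0p1.
Proof. by move=> k a b; rewrite /L0p1 /L (vop_linr _ _) scalerDr addrACA. Qed.

Lemma iter_lin (f : V -> V) k : linear f -> linear (iter k f).
Proof. by move=> lf; elim: k => [//|k ih] z a b; rewrite !iterS ih lf. Qed.

Lemma L0p1_weight k n a : weight n a -> iter k L0p1 a = (n + 1)%:~R ^+ k *: a.
Proof.
move=> wa; elim: k => [|k ih]; first by rewrite scale1r.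
rewrite iterS ih (linZ L0p1_lin) /L0p1 (wa : L _ _ 0 a = _).
by rewrite -{2}[a]scale1r -scalerDl scalerA exprSr intrD.
Qed.

Lemma energy_boundsP a : energy_bounds a <-> exists (s k : nat) (M : R),
  [/\ (0 < s)%N, (0 < k)%N, 0 < M & forall n b,
    vn (mode a n b) <= M * (absz n).+1%:R ^+ s * vn (iter k L0p1 b)].
Proof.
split=> [[s [k [M [s0 k0 M0 h]]]]|[s [k [M [s0 k0 M0 h]]]]].
  exists s, k, (complex.Re M); split=> //.
    by move: M0; rewrite ltcE => /andP[].
  move=> n b; have := h n b; rewrite !vnormE.
  have -> : M = (complex.Re M)%:C.
    by move: M0; rewrite ltcE; case: (M) => x y /= /andP[/eqP -> _].
  by rewrite -(rmorph_nat (real_complex R)) -rmorphXn -!rmorphM /= lecR.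
exists s, k, M%:C; split=> //; first by rewrite ltcR.
move=> n b; rewrite !vnormE -(rmorph_nat (real_complex R)) -rmorphXn -!rmorphM /= lecR.
exact: h.
Qed.

Lemma vn2_sum (s : seq int) (p : int -> V) : uniq s ->
  (forall m, m \in s -> weight m (p m)) ->
  vn (\sum_(m <- s) p m) ^+ 2 = \sum_(m <- s) vn (p m) ^+ 2.
Proof.
move=> us wp; apply: (@complexI R).
rewrite -vn_sqn -sqnE braket_suml rmorph_sum /= big_seq [RHS]big_seq.
apply: eq_bigr => i si; rewrite braket_sumr (bigD1_seq i)//= big_seq_cond big1 ?addr0.
  by rewrite -vn_sqn -sqnE.
by move=> j /andP[js ji]; apply: (weight_orth (wp _ si) (wp _ js)); rewrite eq_sym.
Qed.

Lemma iter_L0p1_sum k (s : seq int) (p : int -> V) :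
  (forall m, m \in s -> weight m (p m)) ->
  iter k L0p1 (\sum_(m <- s) p m) = \sum_(m <- s) (m + 1)%:~R ^+ k *: p m.
Proof.
move=> wp; rewrite (lin_sum (iter_lin k L0p1_lin)); apply: eq_big_seq => m ms.
exact/L0p1_weight/wp.
Qed.

Lemma rn_int n : rn (n%:~R : R[i]) = `|n%:~R|.
Proof. by rewrite -(rmorph_int (real_complex R)) rn_real. Qed.

Lemma nneg_decomp a : exists (s : seq int) (p : int -> V), [/\ uniq s,
  forall m, m \in s -> weight m (p m), forall m, m \in s -> 0 <= m &
  a = \sum_(m <- s) p m].
Proof.
have [s us [_ e]] := hcomp_support a.
exists [seq m <- s | 0 <= m], (hcomp a); split=> [||m|].
- exact: filter_uniq.
- by move=> m _; exact: hcomp_weight.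
- by rewrite mem_filter => /andP[].
- rewrite {1}e big_filter [RHS]big_mkcond; apply: eq_bigr => m _.
  by case: leP => // m0; apply: weight_ge0 m0 (hcomp_weight _ _).
Qed.

Lemma ler_sqr2 (x y : R) : 0 <= y -> x ^+ 2 <= y ^+ 2 -> x <= y.
Proof.
move=> y0 h; have [x0|x0] := ltP 0 x; last exact: le_trans x0 y0.
by rewrite -(ler_pXn2r (n:=2))// nnegrE ltW.
Qed.

(** Weights are nonnegative, so L_0 + 1 acts by scalars at least 1 on the orthogonal weight spaces;
    this allows exponents to be raised when energy bounds are combined. *)
Lemma L0p1_mono k l b : (k <= l)%N -> vn (iter k L0p1 b) <= vn (iter l L0p1 b).
Proof.
move=> kl; have [s [p [us wp s0 ->]]] := nneg_decomp b.
apply: ler_sqr2; rewrite ?vn_ge0// !iter_L0p1_sum// !vn2_sum//;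
  try by move=> m ms; apply: weightZ; exact: wp.
rewrite big_seq [leRHS]big_seq; apply: ler_sum => m ms.
rewrite !vnZ !rnX !rn_int ler_pXn2r ?nnegrE ?mulr_ge0 ?exprn_ge0 ?vn_ge0//.
rewrite ler_wpM2r ?vn_ge0// ler_weXn2l//.
by rewrite ger0_norm ?ler1z ?ler0z; have := s0 _ ms; lia.
Qed.

Lemma L0p1_bound k (N : int) (s : seq int) (p : int -> V) : uniq s ->
  (forall m, m \in s -> weight m (p m)) -> (forall m, m \in s -> 0 <= m <= N) ->
  vn (iter k L0p1 (\sum_(m <- s) p m)) <= (N + 1)%:~R ^+ k * vn (\sum_(m <- s) p m).
Proof.
move=> us wp sN; have [s0|[m0 ms0]] : s = [::] \/ exists m, m \in s.
    by case: (s) => [|x r]; [left | right; exists x; rewrite mem_head].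
  by rewrite s0 !big_nil (lin0 (iter_lin k L0p1_lin)) vn0 mulr0.
have N0 : 0 <= N by have := sN _ ms0; lia.
have c0 : 0 <= (N + 1)%:~R ^+ k :> R by rewrite exprn_ge0// ler0z; lia.
apply: ler_sqr2; first by rewrite mulr_ge0 ?vn_ge0.
rewrite exprMn iter_L0p1_sum// !vn2_sum// => [|m ms]; last by apply: weightZ; exact: wp.
rewrite mulr_sumr big_seq [leRHS]big_seq; apply: ler_sum => m ms.
rewrite vnZ rnX rn_int exprMn ler_wpM2r ?sqr_ge0// ler_pXn2r ?nnegrE ?exprn_ge0//.
  have /andP[m0' mN] := sN _ ms.
  rewrite ger0_norm ?ler0z; last by lia.
  by rewrite lerXn2r ?nnegrE ?ler0z ?ler_int; lia.
by rewrite ler0z; lia.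
Qed.

Lemma energy_boundsD a b : energy_bounds a -> energy_bounds b -> energy_bounds (a + b).
Proof.
move=> /energy_boundsP[s [k [M [s0 k0 M0 h]]]] /energy_boundsP[r [l [N [r0 l0 N0 h']]]].
apply/energy_boundsP; exists (s + r)%N, (k + l)%N, (M + N).
split=> [|||n c]; rewrite ?addn_gt0 ?s0 ?k0 ?addr_gt0//.
rewrite (linD (mode_linl _ _)); apply: le_trans (vnD _ _) _.
have n1 : 1 <= (absz n).+1%:R :> R by rewrite ler1n.
rewrite !mulrDl lerD//.
  apply: le_trans (h n c) _.
  rewrite ler_pM ?vn_ge0 ?mulr_ge0 ?exprn_ge0 ?(ltW M0)//; last by apply: L0p1_mono; exact: leq_addr.
  by rewrite ler_wpM2l ?(ltW M0)// ler_weXn2l// leq_addr.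
apply: le_trans (h' n c) _.
rewrite ler_pM ?vn_ge0 ?mulr_ge0 ?exprn_ge0 ?(ltW N0)//; last by apply: L0p1_mono; exact: leq_addl.
by rewrite ler_wpM2l ?(ltW N0)// ler_weXn2l// leq_addl.
Qed.

Lemma energy_boundsZ z a : energy_bounds a -> energy_bounds (z *: a).
Proof.
move=> /energy_boundsP[s [k [M [s0 k0 M0 h]]]].
have z1 : 0 < rn z + 1 by rewrite ltr_wpDl ?rn_ge0.
apply/energy_boundsP; exists s, k, ((rn z + 1) * M); split=> // [|n b].
  exact: mulr_gt0.
rewrite (linZ (mode_linl _ _)) vnZ -!mulrA ler_pM ?rn_ge0 ?vn_ge0//.
  by rewrite lerDl.
by rewrite mulrA; exact: h.
Qed.

Lemma energy_bounds0 : energy_bounds (0 : V).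
Proof.
apply/energy_boundsP; exists 1%N, 1%N, 1; split=> // n b.
by rewrite (lin0 (mode_linl _ _)) vn0 !mulr_ge0 ?vn_ge0.
Qed.

(* modes of [a] map distinct weight spaces to orthogonal ones *)
Lemma energy_bounds_weight a (s k : nat) (M : R) : (0 < s)%N -> (0 < k)%N -> 0 < M ->
  (forall (n m : int) b, 0 <= m -> weight m b ->
     vn (mode a n b) <= M * (absz n).+1%:R ^+ s * (m + 1)%:~R ^+ k * vn b) ->
  energy_bounds a.
Proof.
move=> s0 k0 M0 h; apply/energy_boundsP; exists s, k, M; split=> // n b.
have [r [p [us wp r0 ->]]] := nneg_decomp b.
set c := M * _; have c0 : 0 <= c by rewrite mulr_ge0 ?exprn_ge0// ltW.
apply: ler_sqr2; first by rewrite mulr_ge0 ?vn_ge0.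
rewrite exprMn iter_L0p1_sum// (lin_sum (mode_linr _ _)).
rewrite [X in _ * X](vn2_sum us) => [|m ms]; last by apply: weightZ; exact: wp.
(* Reindexed by the weight m - n of the image, the form in which orthogonality of weight spaces
   applies. *)
have -> : \sum_(m <- r) mode a n (p m) = \sum_(m <- [seq m - n | m <- r]) mode a n (p (m + n)).
  by rewrite big_map; apply: eq_bigr => m _; rewrite subrK.
rewrite vn2_sum; last first.
- by move=> _ /mapP[m ms ->]; rewrite subrK; apply: mode_weight; exact: wp.
- by rewrite map_inj_uniq// => x y /addIr.
rewrite big_map mulr_sumr big_seq [leRHS]big_seq; apply: ler_sum => m ms.
rewrite subrK vnZ rnX rn_int -exprMn.
rewrite ler_pXn2r ?nnegrE ?mulr_ge0 ?exprn_ge0 ?vn_ge0 ?(ltW M0)//.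
rewrite ger0_norm ?ler0z; last by have := r0 _ ms; lia.
by rewrite mulrA; apply: h; [exact: r0 | exact: wp].
Qed.

End EnergyNorm.

(** * Modes and weights in the tensor product *)

Section VOATensor.
Context (R : realType) (Va Vb W : unitary_voa R) (t : Va -> Vb -> W).
Hypothesis ht : is_voa_tensor t.
Local Notation wa := (has_weight (vop Va) (conf Va)).
Local Notation wb := (has_weight (vop Vb) (conf Vb)).
Local Notation ww := (has_weight (vop W) (conf W)).

Lemma vt_bilinear : is_bilinear t. Proof. by have [] := vt_tensor ht. Qed.
Lemma vtl b : linear (fun a => t a b). Proof. by have [h _] := vt_bilinear; exact: h. Qed.
Lemma vtr a : linear (t a). Proof. by have [_ h] := vt_bilinear; exact: h. Qed.

(** Vacuum modes are nonzero only at index -1, which selects k = 1 for nu (x) vac and k = -1 for vac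
    (x) nu. *)
Lemma L0_tensor a b :
  vop W (conf W) 1 (t a b) = t (vop Va (conf Va) 1 a) b + t a (vop Vb (conf Vb) 1 b).
Proof.
rewrite (vt_conf ht) (linD (vop_linl _ _)) !(vt_vop ht).
rewrite (@fsumZ _ _ [:: (1 : int)])//; last first.
  move=> k; rewrite inE => k1; rewrite (va_vacuum (vop_va Vb)) ifF ?(lin0 (vtr _))//.
  by apply: contraNF k1 => /eqP h; apply/eqP; lia.
rewrite (@fsumZ _ _ [:: (-1 : int)])//; last first.
  move=> k; rewrite inE => k1; rewrite (va_vacuum (vop_va Va)) ifF ?(lin0 (vtl _))//.
  exact/negbTE.
by rewrite !big_seq1 (va_vacuum (vop_va Vb)) (va_vacuum (vop_va Va)) !eqxx.
Qed.

Lemma weight_tensor d e a b : wa d a -> wb e b -> ww (d + e) (t a b).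
Proof.
move=> /weightE ha /weightE hb; apply/weightE; rewrite L0_tensor ha hb.
by rewrite (linZ (vtl _)) (linZ (vtr _)) -scalerDl intrD.
Qed.

(** In the energy indexing the convolution of n-th products becomes a_k (x) b_(n-k), because the
    weight shifts of the two factors add up to that of the tensor. *)
Lemma mode_tensor da db a b c d n (s : seq int) : wa da a -> wb db b -> uniq s ->
  (forall k, k \notin s -> t (mode a k c) (mode b (n - k) d) = 0) ->
  mode (t a b) n (t c d) = \sum_(k <- s) t (mode a k c) (mode b (n - k) d).
Proof.
move=> ha hb us hs; rewrite (mode_weight_vop _ _ (weight_tensor ha hb)) (vt_vop ht).
have e k : t (vop Va a (k + da - 1) c)
    (vop Vb b (n + (da + db) - 1 - 1 - (k + da - 1)) d) = t (mode a k c) (mode b (n - k) d).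
  rewrite (mode_weight_vop _ _ ha) (mode_weight_vop _ _ hb); congr (t _ (vop Vb _ _ _)); lia.
rewrite (@fsumZ _ _ [seq k + da - 1 | k <- s]).
- by rewrite big_map; apply: eq_bigr => k _; rewrite e.
- by rewrite map_inj_uniq// => x y; lia.
- move=> k ks; have -> : k = (k - da + 1) + da - 1 by lia.
  rewrite e; apply: hs; apply: contra ks => ks; apply/mapP; exists (k - da + 1) => //; lia.
Qed.

(** The uniqueness half of the universal property, applied to the zero bilinear map. *)
Lemma tensor_functional0 (phi : W -> R[i]) : scalar phi ->
  (forall a b, phi (t a b) = 0) -> forall w, phi w = 0.
Proof.
move=> lp h w; have [_ univ] := vt_tensor ht.
have b0 : is_bilinear (fun (_ : Va) (_ : Vb) => 0 : R[i]^o).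
  by split=> [v k x y|v k x y]; rewrite scaler0 addr0.
have [g [_ _ gu]] := univ _ _ b0.
have e1 := gu (phi : W -> R[i]^o) lp h.
have e2 := gu (fun _ : W => 0 : R[i]^o).
have e3 : (fun _ : W => 0 : R[i]^o) = g by apply: e2 => [k x y|//]; rewrite scaler0 addr0.
by rewrite -[phi w]/((phi : W -> R[i]^o) w) e1 -e3.
Qed.

(** The given finite family need not lie in the weight space; its components of weight [n] do, and
    they still span because taking components is linear. *)
Lemma weight_basis (V : unitary_voa R) (n : int) : exists s : seq V,
  (forall x, x \in s -> has_weight (vop V) (conf V) n x) /\
  (forall (P : set V), subspace_set P -> (forall x, x \in s -> P x) ->
    forall v, has_weight (vop V) (conf V) n v -> P v).
Proof.
have [s hs] := voa_finite_dim (uv_is_voa V) n.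
exists [seq hcomp x n | x <- s]; split=> [_ /mapP[x _ ->]|P sP Ps v wv].
  exact: hcomp_weight.
have [c vE] := hs v wv.
have hv : hcomp v n = v.
  rewrite (@hcomp_uniq _ _ v [:: n] (fun=> v)) ?mem_head ?big_seq1//.
  by move=> m; rewrite inE => /eqP ->.
have lh := @hcomp_lin _ V n.
rewrite -hv vE (lin_sum lh); apply: subspace_sum => // i _.
by rewrite (linZ lh); apply: subspaceZ => //; apply: Ps; apply: map_f; exact: mem_nth.
Qed.

(** Let [v] be the orthogonal projection of [w] onto the span of products of spanning families of
    the weight spaces of the factors. Then [w - v] is orthogonal to all elementary tensors, those of
    other weights being orthogonal anyway, and it vanishes by [tensor_functional0]. *)
Lemma tensor_span n w : ww n w -> forall P : set W, subspace_set P ->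
  (forall k c d, 0 <= k <= n -> wa k c -> wb (n - k) d -> P (t c d)) -> P w.
Proof.
move=> wn P sP hP; have /choice[A hA] := fun k => weight_basis Va k.
have /choice[B hB] := fun k => weight_basis Vb k.
pose ks := [seq j%:Z | j <- iota 0 (absz n).+1].
pose s := [seq t p.1 p.2 | p <- flatten [seq [seq (x, y) | x <- A k, y <- B (n - k)] | k <- ks]].
have [n0|n0] := ltP n 0.
  by rewrite (weight_ge0 n0 wn); case: sP.
have memE y : y \in s -> exists k c d, [/\ 0 <= k <= n, c \in A k, d \in B (n - k) & y = t c d].
  move=> /mapP[[c d] /flattenP[_ /mapP[k kk ->] /allpairsP[[c' d'] /= [cA dB [-> ->]]]] ->].
  exists k, c', d'; split=> //; move: kk => /mapP[j]; rewrite mem_iota => jn ->; lia.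
have [v hv ov] := finite_projection (uv_dot W) s w.
have sw y : y \in s -> ww n y.
  move=> /memE[k [c [d [_ cA dB ->]]]].
  have := weight_tensor ((hA k).1 _ cA) ((hB (n - k)).1 _ dB).
  by have -> : k + (n - k) = n by lia.
have vn : ww n v.
  apply: hv => //; split; first exact: weight0.
  by move=> k a b; exact: weightD.
have wvn : ww n (w - v).
  by rewrite addrC -scaleN1r; exact: weightD.
have phi0 a b : ip (w - v) (t a b) = 0.
  have lip z : linear (fun x => ip z x : R[i]^o) by move=> l x y; rewrite ipDr ipZr.
  elim/weight_ind: a => [|x y hx hy|k a wka]; first by rewrite (lin0 (vtl _)) ip0r.
    by rewrite (linD (vtl _)) ipDr hx hy addr0.
  elim/weight_ind: b => [|x y hx hy|l b wlb]; first by rewrite (lin0 (vtr _)) ip0r.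
    by rewrite (linD (vtr _)) ipDr hx hy addr0.
  have [kl|kl] := eqVneq n (k + l); last exact: weight_orth wvn (weight_tensor wka wlb) kl.
  have [k0|k0] := ltP k 0; first by rewrite (weight_ge0 k0 wka) (lin0 (vtl _)) ip0r.
  have [l0|l0] := ltP l 0; first by rewrite (weight_ge0 l0 wlb) (lin0 (vtr _)) ip0r.
  have lE : l = n - k by lia.
  have sub1 (z : Vb) : subspace_set [set x : Va | ip (w - v) (t x z) = 0].
    split=> [|r x y /= hx hy] /=; first by rewrite (lin0 (vtl _)) ip0r.
    by rewrite (vtl z) ipDr ipZr hx hy mulr0 addr0.
  have sub2 (z : Va) : subspace_set [set x : Vb | ip (w - v) (t z x) = 0].
    split=> [|r x y /= hx hy] /=; first by rewrite (lin0 (vtr _)) ip0r.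
    by rewrite (vtr z) ipDr ipZr hx hy mulr0 addr0.
  apply: ((hA k).2 _ (sub1 b)) wka => x xA /=.
  rewrite lE in wlb; apply: ((hB (n - k)).2 _ (sub2 x)) wlb => y yB /=.
  rewrite ipC; have -> : ip (t x y) (w - v) = 0; last by rewrite conjC0.
  apply: ov; apply/mapP; exists (x, y) => //; apply/flattenP.
  exists [seq (x, y) | x <- A k, y <- B (n - k)]; last by apply/allpairsP; exists (x, y).
  apply/mapP; exists k => //; apply/mapP; exists (absz k); rewrite ?mem_iota; lia.
suff -> : w = v.
  apply: hv => // y /memE[k [c [d [k0 cA dB ->]]]].
  by apply: (hP k) => //; [exact: (hA k).1 | exact: (hB (n - k)).1].
apply/eqP; rewrite -subr_eq0; apply/eqP/ip_eq0.
apply: (@tensor_functional0 (fun x => ip (w - v) x)) => //.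
by move=> k x y; rewrite ipDr ipZr.
Qed.

Lemma tensor_ind (P : set W) : subspace_set P ->
  (forall k l c d, wa k c -> wb l d -> P (t c d)) -> forall w, P w.
Proof.
move=> sP hP; apply: weight_ind; first by case: sP.
  by move=> a b; exact: subspace_add.
move=> d a wd; apply: (tensor_span wd) => // k c e _ wc we; exact: hP wc we.
Qed.

End VOATensor.

(** * Energy bounds for the tensor product *)

Section LowWeights.
Context (R : realType) (V : unitary_voa R) (H : completion V).
Local Notation weight := (has_weight (vop V) (conf V)).

Definition upto (N : nat) : seq int := [seq j%:Z | j <- iota 0 N.+1].
Lemma upto_uniq N : uniq (upto N).
Proof. by rewrite map_inj_uniq ?iota_uniq// => x y []. Qed.
Lemma mem_upto N (m : int) : (m \in upto N) = (0 <= m <= N%:Z).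
Proof.
apply/mapP/idP => [[j]|]; first by rewrite mem_iota => jN ->; lia.
by move=> mN; exists (absz m); rewrite ?mem_iota; lia.
Qed.

Definition low (N : nat) : set V := [set c | exists2 p : int -> V,
  (forall m, weight m (p m)) & c = \sum_(m <- upto N) p m].

Lemma low_subspace N : subspace_set (low N).
Proof.
split; first by exists (fun=> 0) => [m|]; [exact: weight0 | rewrite big1].
move=> k _ _ [p wp ->] [q wq ->]; exists (fun m => k *: p m + q m) => [m|].
  exact: weightD.
by rewrite big_split scaler_sumr.
Qed.

Lemma low_weight (N : nat) k c : 0 <= k <= N%:Z -> weight k c -> low N c.
Proof.
move=> kN wc; exists (fun m => if m == k then c else 0) => [m|].
  by case: eqP => [->|_] //; exact: weight0.
rewrite (bigD1_seq k) ?upto_uniq ?mem_upto//= eqxx big1 ?addr0// => m /negbTE -> //.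
Qed.

(** On weights at most N the power of L_0 + 1 is a constant, so the energy bound becomes a plain
    operator bound, the only kind that [leg_bound] can transport. *)
Lemma mode_low a (s k : nat) (M : R) N n c : 0 < M ->
  (forall n b, vn H (mode a n b) <= M * (absz n).+1%:R ^+ s * vn H (iter k (@L0p1 R V) b)) ->
  low N c -> vn H (mode a n c) <= M * (absz n).+1%:R ^+ s * N.+1%:R ^+ k * vn H c.
Proof.
move=> M0 h [p wp ->]; apply: le_trans (h _ _) _.
rewrite -[leRHS]mulrA ler_wpM2l ?mulr_ge0 ?exprn_ge0 ?(ltW M0)//.
have := @L0p1_bound _ _ H k N%:Z (upto N) p (upto_uniq N) (fun m _ => wp m).
rewrite intrD -natr1; apply => m; by rewrite mem_upto.
Qed.

End LowWeights.

Section TensorEnergy.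
Context (R : realType) (Va Vb W : unitary_voa R) (t : Va -> Vb -> W).
Context (Ha : completion Va) (Hb : completion Vb) (K : completion W).
Hypothesis ht : is_voa_tensor t.
Local Notation wa := (has_weight (vop Va) (conf Va)).
Local Notation wb := (has_weight (vop Vb) (conf Vb)).
Local Notation ww := (has_weight (vop W) (conf W)).

Definition zbox (B : nat) : seq int := [seq j%:Z - B%:Z | j <- iota 0 (B + B).+1].
Lemma zbox_uniq B : uniq (zbox B).
Proof. by rewrite map_inj_uniq ?iota_uniq// => x y; lia. Qed.
Lemma mem_zbox B (m : int) : (m \in zbox B) = (absz m <= B)%N.
Proof.
apply/mapP/idP => [[j]|]; first by rewrite mem_iota => jN ->; lia.
by move=> mN; exists (absz (m + B%:Z)); rewrite ?mem_iota; lia.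
Qed.

(** Outside |k| <= N + |n| one of the two legs is sent to negative weight and vanishes. A single
    list represents x and all the summands, as needed to compare their norms. *)
Lemma mode_tensor_low da db a b (N : nat) n x : wa da a -> wb db b -> ww N%:Z x ->
  exists l : seq (Va * Vb), [/\ forall p, p \in l -> low N p.1 /\ low N p.2,
    x = \sum_(p <- l) t p.1 p.2 &
    mode (t a b) n x = \sum_(k <- zbox (N + absz n))
      \sum_(p <- l) t (mode a k p.1) (mode b (n - k) p.2)].
Proof.
move=> ha hb wx.
pose P : set W := [set x | exists l : seq (Va * Vb),
    [/\ forall p, p \in l -> low N p.1 /\ low N p.2,
    x = \sum_(p <- l) t p.1 p.2 &
    mode (t a b) n x = \sum_(k <- zbox (N + absz n))
      \sum_(p <- l) t (mode a k p.1) (mode b (n - k) p.2)]].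
apply: (tensor_span ht wx (P := P)).
  split.
    exists [::]; rewrite big_nil (lin0 (mode_linr _ _)); split=> //.
    by rewrite big1// => k _; rewrite big_nil.
  move=> z _ _ [l [hl -> el]] [l' [hl' -> el']].
  exists ([seq (z *: p.1, p.2) | p <- l] ++ l'); split.
  - move=> p; rewrite mem_cat => /orP[/mapP[q /hl[q1 q2] ->]|/hl' //]; split=> //.
    by apply: subspaceZ => //; exact: low_subspace.
  - rewrite big_cat big_map /= scaler_sumr; congr (_ + _); apply: eq_bigr => p _.
    by rewrite (linZ (vtl ht _)).
  - rewrite (mode_linr _ _) el el' scaler_sumr -big_split; apply: eq_bigr => k _ /=.
    rewrite big_cat big_map /= scaler_sumr; congr (_ + _); apply: eq_bigr => p _.
    by rewrite (linZ (mode_linr _ _)) (linZ (vtl ht _)).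
move=> k c d k0 hc hd; exists [:: (c, d)]; split.
- move=> p; rewrite inE => /eqP ->; split; first exact: low_weight hc.
  by apply: low_weight hd; lia.
- by rewrite big_seq1.
- rewrite (mode_tensor ht ha hb (zbox_uniq (N + absz n))).
    by apply: eq_bigr => j _; rewrite big_seq1.
  move=> j; rewrite mem_zbox -ltnNge => jB.
  have [j0|j0] := ltP j 0.
    have -> : mode b (n - j) d = 0; last by rewrite (lin0 (vtr ht _)).
    by apply: weight_ge0 (mode_weight _ _ hd); lia.
  have -> : mode a j c = 0; last by rewrite (lin0 (vtl ht _)).
  by apply: weight_ge0 (mode_weight _ _ hc); lia.
Qed.

Lemma vt_braket a b c d : braket (uv_dot W) (t a b) (t c d) =
  braket (uv_dot Va) a c * braket (uv_dot Vb) b d.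
Proof. exact: vt_ip. Qed.
Lemma vt_braket_swap b a d c : braket (uv_dot W) (t a b) (t c d) =
  braket (uv_dot Vb) b d * braket (uv_dot Va) a c.
Proof. by rewrite vt_braket mulrC. Qed.

(** [leg_bound] is used twice: for [B] on the second leg, with the first leg already acted on by
    [A], then for [A]. The constants enter squared because [leg_bound] speaks of squared norms. *)
Lemma legs_bound (A : Va -> Va) (B : Vb -> Vb) (C D : R) N (l : seq (Va * Vb)) :
  linear A -> linear B -> 0 <= C -> 0 <= D ->
  (forall p, p \in l -> low N p.1 /\ low N p.2) ->
  (forall c, low N c -> vn Ha (A c) <= C * vn Ha c) ->
  (forall c, low N c -> vn Hb (B c) <= D * vn Hb c) ->
  vn K (\sum_(p <- l) t (A p.1) (B p.2)) <= C * D * vn K (\sum_(p <- l) t p.1 p.2).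
Proof.
move=> lA lB C0 D0 hl hA hB.
pose c i := (nth (0, 0) l i).1; pose d i := (nth (0, 0) l i).2.
have lc i : low N (c i).
  rewrite /c; have [il|il] := ltnP i (size l); last by rewrite nth_default//; case: (low_subspace Va N).
  exact: (hl _ (mem_nth (0, 0) il)).1.
have ld i : low N (d i).
  rewrite /d; have [il|il] := ltnP i (size l); last by rewrite nth_default//; case: (low_subspace Vb N).
  exact: (hl _ (mem_nth (0, 0) il)).2.
rewrite (big_nth (0, 0)) big_mkord [X in _ <= _ * vn K X](big_nth (0, 0)) big_mkord.
rewrite -/(\sum_(i < size l) t (A (c i)) (B (d i))).
have bt : is_bilinear (fun b a => t a b) by split; [exact: vtr | exact: vtl].
apply: ler_sqr2; first by rewrite !mulr_ge0 ?vn_ge0.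
have h1 := leg_bound (vt_bilinear ht) vt_braket lA (low_subspace Va N)
  (C := C ^+ 2) _ (size l) d lc.
have h2 := leg_bound bt vt_braket_swap lB (low_subspace Vb N)
  (C := D ^+ 2) _ (size l) (A \o c) ld.
rewrite !exprMn -!vn_sqn; apply: le_trans (h2 _) _.
  move=> e he; rewrite !(vn_sqn Hb) -exprMn ler_pXn2r ?nnegrE ?mulr_ge0 ?vn_ge0//.
  exact: hB.
rewrite [C ^+ 2 * D ^+ 2]mulrC -[leRHS]mulrA ler_wpM2l ?sqr_ge0//; apply: h1.
move=> e he; rewrite !(vn_sqn Ha) -exprMn ler_pXn2r ?nnegrE ?mulr_ge0 ?vn_ge0//.
exact: hA.
Qed.

Lemma tensor_energy_bounded : energy_bounded Va -> energy_bounded Vb -> energy_bounded W.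
Proof.
move=> ea eb; apply: (weight_ind (V := W)).
- exact: (energy_bounds0 K).
- by move=> x y; exact: (energy_boundsD K).
move=> e w we; apply: (tensor_span ht we (P := [set w | energy_bounds w])).
  split; first exact: (energy_bounds0 K).
  move=> k x y hx hy; apply: (energy_boundsD K) hy; exact: (energy_boundsZ K).
move=> da a b _ ha hb.
have /(energy_boundsP Ha)[sa [ka [Ma [_ _ Ma0 hMa]]]] := ea a.
have /(energy_boundsP Hb)[sb [kb [Mb [_ _ Mb0 hMb]]]] := eb b.
(* One power for the number of summands, [sa] and [sb] for the growth in the mode index of the two
   factors. *)
pose S := (1 + sa + sb)%N.
apply: (energy_bounds_weight (H := K) (s := S) (k := (S + ka + kb)%N)
  (M := Ma * Mb * 2 ^+ S)) => //.
  by rewrite !mulr_gt0 ?exprn_gt0.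
move=> n m x m0 wx; have mE : m = (absz m)%:Z by lia.
move: wx; rewrite mE; move: (absz m) => N {mE m0 m} wx.
have [l [hl xE ->]] := mode_tensor_low n ha hb wx.
(* A common bound for the number of summands and for |k| + 1 and |n - k| + 1. *)
pose Q : R := 2 * N.+1%:R * (absz n).+1%:R.
have term k : k \in zbox (N + absz n) ->
    vn K (\sum_(p <- l) t (mode a k p.1) (mode b (n - k) p.2)) <=
    (Ma * Q ^+ sa * N.+1%:R ^+ ka) * (Mb * Q ^+ sb * N.+1%:R ^+ kb) * vn K x.
  rewrite mem_zbox => kB; rewrite xE.
  apply: (legs_bound (N := N)) => //; try exact: mode_linr.
  - by rewrite !mulr_ge0 ?exprn_ge0 ?mulr_ge0 ?(ltW Ma0).
  - by rewrite !mulr_ge0 ?exprn_ge0 ?mulr_ge0 ?(ltW Mb0).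
  - move=> c lc; apply: le_trans (mode_low k Ma0 hMa lc) _.
    rewrite ler_wpM2r ?vn_ge0// ler_wpM2r ?exprn_ge0// ler_wpM2l ?(ltW Ma0)//.
    rewrite lerXn2r ?nnegrE /Q ?mulr_ge0// -!natrM ler_nat; nia.
  - move=> c lc; apply: le_trans (mode_low (n - k) Mb0 hMb lc) _.
    rewrite ler_wpM2r ?vn_ge0// ler_wpM2r ?exprn_ge0// ler_wpM2l ?(ltW Mb0)//.
    rewrite lerXn2r ?nnegrE /Q ?mulr_ge0// -!natrM ler_nat; nia.
apply: le_trans (vn_sum _ _ _ _) _.
apply: (@le_trans _ _ (Q * ((Ma * Q ^+ sa * N.+1%:R ^+ ka) * (Mb * Q ^+ sb * N.+1%:R ^+ kb) * vn K x))).
  rewrite big_seq; apply: le_trans (ler_sum _ term) _.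
  rewrite -big_seq big_const_seq count_predT size_map size_iota iter_addr_0 -[leLHS]mulr_natl.
  rewrite ler_wpM2r ?vn_ge0//; last by rewrite /Q -!natrM ler_nat; nia.
  by rewrite !mulr_ge0 ?vn_ge0 ?exprn_ge0 ?mulr_ge0 ?(ltW Ma0) ?(ltW Mb0).
rewrite le_eqVlt; apply/orP; left; apply/eqP.
have -> : (N%:Z + 1)%:~R = N.+1%:R :> R by rewrite intrD -natr1.
rewrite /Q /S; move: (N.+1%:R) ((absz n).+1%:R) => u v.
by rewrite !exprD !exprMn !expr1; ring.
Qed.

End TensorEnergy.

(** * Smooth functions on the line *)

Section Smooth.
Context (R : realType).
Implicit Types (f g : R -> R) (t x : R).

Definition deriv f f' := forall t, is_derive t (1 : R) f (f' t).

Lemma isd_eq f g x (df dg : R) : is_derive x (1 : R) f df -> (forall y, f y = g y) ->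
  df = dg -> is_derive x (1 : R) g dg.
Proof. by move=> h /funext <- <-. Qed.

Lemma deriv_ext f g f' g' : (forall t, f t = g t) -> (forall t, f' t = g' t) ->
  deriv f f' -> deriv g g'.
Proof. by move=> /funext <- /funext <-. Qed.

Lemma deriv_cst (c : R) : deriv (fun=> c) (fun=> 0).
Proof. by move=> t; exact: is_derive_cst. Qed.
Lemma derivD f g f' g' : deriv f f' -> deriv g g' ->
  deriv (fun t => f t + g t) (fun t => f' t + g' t).
Proof. by move=> df dg t; apply: is_deriveD. Qed.
Lemma derivN f f' : deriv f f' -> deriv (fun t => - f t) (fun t => - f' t).
Proof. by move=> df t; apply: is_deriveN. Qed.
Lemma derivM f g f' g' : deriv f f' -> deriv g g' ->
  deriv (fun t => f t * g t) (fun t => f' t * g t + f t * g' t).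
Proof.
move=> df dg t; apply: isd_eq (is_deriveM (df t) (dg t)) _ _ => //.
by rewrite addrC [g t *: _]mulrC.
Qed.
Lemma deriv_comp f g f' g' : deriv f f' -> deriv g g' ->
  deriv (fun t => f (g t)) (fun t => f' (g t) * g' t).
Proof. by move=> df dg t; exact: is_derive1_comp. Qed.
Lemma derivV f f' : (forall t, f t != 0) -> deriv f f' ->
  deriv (fun t => (f t)^-1) (fun t => - (f' t * ((f t)^-1 * (f t)^-1))).
Proof.
move=> f0 df t; apply: isd_eq (is_deriveV (f0 t) (df t)) _ _ => //.
by rewrite -[_ *: _]/(_ * _) expr2 invfM; ring.
Qed.
Lemma deriv_id : deriv id (fun=> 1).
Proof. by move=> t; exact: is_derive_id. Qed.

Lemma deriv_continuous f f' : deriv f f' -> continuous f.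
Proof.
move=> df t; have [d _] := df t.
by apply: differentiable_continuous; apply/derivable1_diffP.
Qed.

(** Recursion on the derivative itself, so that closure under products, composition and inverses is
    a plain induction. *)
Fixpoint Sm n f : Prop :=
  if n is n.+1 then exists2 f', deriv f f' & Sm n f' else True.

Definition smooth f := forall n, Sm n f.

Lemma Sm_pred n f : Sm n.+1 f -> Sm n f.
Proof. by elim: n f => [//|n ih] f [f' df h]; exists f' => //; exact: ih. Qed.
Lemma Sm_cst n (c : R) : Sm n (fun=> c).
Proof. by elim: n c => [//|n ih] c; exists (fun=> 0) => //; exact: deriv_cst. Qed.
Lemma SmD n f g : Sm n f -> Sm n g -> Sm n (fun t => f t + g t).
Proof.
elim: n f g => [//|n ih] f g [f' df hf] [g' dg hg]; exists (fun t => f' t + g' t).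
  exact: derivD.
exact: ih.
Qed.
Lemma SmN n f : Sm n f -> Sm n (fun t => - f t).
Proof.
elim: n f => [//|n ih] f [f' df hf]; exists (fun t => - f' t); [exact: derivN | exact: ih].
Qed.
Lemma SmM n f g : Sm n f -> Sm n g -> Sm n (fun t => f t * g t).
Proof.
elim: n f g => [//|n ih] f g hf hg.
have hf1 := Sm_pred hf; have hg1 := Sm_pred hg.
case: hf => f' df hf; case: hg => g' dg hg.
exists (fun t => f' t * g t + f t * g' t); first exact: derivM.
by apply: SmD; exact: ih.
Qed.
Lemma Sm_comp n f g : Sm n f -> Sm n g -> Sm n (fun t => f (g t)).
Proof.
elim: n f g => [//|n ih] f g [f' df hf] hg; have hg1 := Sm_pred hg.
case: hg => g' dg hg.
exists (fun t => f' (g t) * g' t); first exact: deriv_comp.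
by apply: SmM => //; exact: ih.
Qed.
Lemma SmV n f : (forall t, f t != 0) -> Sm n f -> Sm n (fun t => (f t)^-1).
Proof.
move=> f0; elim: n => [//|n ih] hf; have hf1 := ih (Sm_pred hf).
case: hf => f' df hf; exists (fun t => - (f' t * ((f t)^-1 * (f t)^-1))).
  exact: derivV.
by apply: SmN; apply: SmM => //; exact: SmM.
Qed.
Lemma Sm_id n : Sm n id.
Proof. by case: n => [//|n]; exists (fun=> 1); [exact: deriv_id | exact: Sm_cst]. Qed.
Lemma Sm_cos_sin n : Sm n (@cos R) /\ Sm n (@sin R).
Proof.
elim: n => [//|n [hc hs]]; split.
  exists (fun t => - sin t); last exact: SmN.
  by move=> t; exact: is_derive_cos.
by exists (@cos R) => // t; exact: is_derive_sin.
Qed.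

Lemma smooth_realP f : smooth_real f <-> smooth f.
Proof.
split=> [h n|h n t].
  elim: n f h => [//|n ih] f h; exists (derive1 f).
    move=> t; rewrite derive1E; exact: derivableP (h 0%N t).
  by apply: ih => m t; have := h m.+1 t; rewrite /derive1n iterSr.
elim: n f h => [|n ih] f h.
  by have [f' df _] := h 1%N; have [] := df t.
rewrite /derive1n iterSr; apply: ih => m.
have [f' df hf'] := h m.+1; suff -> : derive1 f = f' by [].
by apply/funext => s; rewrite derive1E; have [_ ->] := df s.
Qed.

(** With the powers of x included, the family is closed under differentiation up to linear
    combinations, so smoothness of all its members is a single induction. *)
Definition flat (k : nat) (x : R) : R := if 0 < x then x ^- k * expR (- x^-1) else 0.

Lemma flat_ge0 k x : 0 <= flat k x.
Proof. by rewrite /flat; case: ifP => // x0; rewrite mulr_ge0 ?expR_ge0// invr_ge0 exprn_ge0// ltW. Qed.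
Lemma flat_gt0 k x : 0 < x -> 0 < flat k x.
Proof. by move=> x0; rewrite /flat x0 mulr_gt0 ?expR_gt0// invr_gt0 exprn_gt0. Qed.
Lemma flat_le0 k x : x <= 0 -> flat k x = 0.
Proof. by rewrite /flat leNgt => /negbTE ->. Qed.

Lemma flat_small k x : flat k x <= (k.+2%:R) ^+ k.+2 * x ^+ 2.
Proof.
have [x0|x0] := ltP 0 x; last first.
  by rewrite (flat_le0 _ x0) mulr_ge0 ?sqr_ge0 ?exprn_ge0.
rewrite /flat x0.
(* The exponential dominates a power of order k + 2, two more than x^-k cancels, which leaves x^2
   and hence derivative 0 at the origin. *)
have e : expR x^-1 >= (x^-1 / k.+2%:R) ^+ k.+2.
  rewrite -[x^-1 in leRHS](divfK (_ : k.+2%:R != 0 :> R))// expRM_natr.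
  rewrite lerXn2r ?nnegrE ?expR_ge0 ?divr_ge0 ?invr_ge0 ?(ltW x0)//.
  by apply: le_trans (expR_ge1Dx _); rewrite lerDr.
have p0 : 0 < (x^-1 / k.+2%:R) ^+ k.+2 by rewrite exprn_gt0// divr_gt0 ?invr_gt0.
rewrite expRN.
apply: (@le_trans _ _ (x ^- k * ((x^-1 / k.+2%:R) ^+ k.+2)^-1)).
  by rewrite ler_wpM2l ?invr_ge0 ?exprn_ge0 ?(ltW x0)// lef_pV2 ?posrE ?expR_gt0.
rewrite le_eqVlt; apply/orP; left; apply/eqP.
have c0 : k.+2%:R != 0 :> R by rewrite pnatr_eq0.
move: (k.+2%:R) c0 => c c0; rewrite expr_div_n -[x ^- k]exprVn.
have -> : x ^+ 2 = (x^-1 ^+ 2)^-1 by rewrite exprVn invrK.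
have : x^-1 != 0 by rewrite invr_neq0// gt_eqF.
move: (x^-1) => y y0; rewrite [y ^+ k.+2]exprS [y ^+ k.+1]exprS.
by field; rewrite !expf_neq0 ?y0.
Qed.

Lemma is_derive_quad f x (C : R) :
  (forall h, `|f (h + x) - f x| <= C * h ^+ 2) -> is_derive x (1 : R) f 0.
Proof.
move=> hC.
have C1 : 0 < `|C| + 1 by rewrite ltr_wpDl.
suff h : (fun h => h^-1 *: ((f \o shift x) (h *: (1 : R)) - f x)) @ 0^' --> (0 : R).
  by apply: DeriveDef; [apply/cvg_ex; exists 0 | exact: cvg_lim].
apply/cvgrPdist_le => e e0.
near=> h.
have h0 : h != 0 by near: h; exact: nbhs_dnbhs_neq.
rewrite sub0r normrN normrZ /shift /= -[_ *: 1]/(_ * 1) mulr1.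
rewrite normfV ler_pdivrMl ?normr_gt0//; apply: le_trans (hC h) _.
rewrite -[h ^+ 2]real_normK ?num_real// expr2 mulrA mulrC ler_wpM2l//.
have : `|h| <= e / (`|C| + 1).
  near: h; apply: dnbhs0_le; rewrite divr_gt0//.
rewrite ler_pdivlMr// => he; apply: le_trans he.
by rewrite mulrC ler_wpM2l// (le_trans (ler_norm C))// lerDl.
Unshelve. all: by end_near. Qed.

Lemma deriv_flat k : deriv (flat k) (fun x => flat k.+2 x - k%:R * flat k.+1 x).
Proof.
move=> x; have [x0|x0] := ltP 0 x.
- have e : \forall y \near x, flat k y = (y^-1) ^+ k * expR (- y^-1).
    by near=> y; rewrite /flat ifT ?exprVn//; near: y; exact: lt_nbhsr.
  have dV : is_derive x (1:R) (fun y : R => y^-1) (- x ^- 2).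
    apply: isd_eq (is_deriveV (f := id) (lt0r_neq0 x0) (is_derive_id x 1)) _ _ => //.
    by rewrite -[_ *: _]/(_ * _) mulr1.
  have dE : is_derive x (1:R) (fun y : R => expR (- y^-1)) (expR (- x^-1) * (x ^- 2)).
    apply: isd_eq (is_derive1_comp (is_derive_expR _) (is_deriveN dV)) _ _ => //.
    by rewrite opprK.
  have d : is_derive x (1:R) (fun y : R => (y^-1) ^+ k * expR (- y^-1))
      (flat k.+2 x - k%:R * flat k.+1 x).
    apply: isd_eq (is_deriveM (is_deriveX k dV) dE) _ _ => //.
      by move=> y; rewrite [in LHS]exprfctE.
    rewrite /flat x0 -![_ *: _]/(_ * _) /= exprfctE -!exprVn.
    case: k {e} => [|k]; first by rewrite !mul0r; ring.
    by rewrite /= !exprS; ring.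
  apply: near_eq_is_derive d => //; near=> y; symmetry; near: y; exact: e.
- apply: isd_eq (@is_derive_quad (flat k) x (k.+2%:R ^+ k.+2) _) _ _ => //; last first.
    by rewrite !flat_le0// mulr0 subr0.
  move=> h; rewrite (flat_le0 k x0) subr0 ger0_norm ?flat_ge0//.
  have [hx|hx] := leP (h + x) 0; first by rewrite flat_le0// mulr_ge0 ?sqr_ge0 ?exprn_ge0.
  apply: le_trans (flat_small _ _) _; rewrite ler_wpM2l ?exprn_ge0//.
  rewrite lerXn2r ?nnegrE ?(ltW hx)//; lra.
Unshelve. all: by end_near. Qed.

Lemma smooth_flat k : smooth (flat k).
Proof.
move=> n; elim: n k => [//|n ih] k; exists (fun x => flat k.+2 x - k%:R * flat k.+1 x).
  exact: deriv_flat.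
by apply: SmD => //; apply: SmN; apply: SmM => //; exact: Sm_cst.
Qed.

(** The standard smooth transition from 0 (up to [a]) to 1 (from [b] on). *)
Definition step (a b x : R) := flat 0 (x - a) / (flat 0 (x - a) + flat 0 (b - x)).

Lemma step_den (a b x : R) : a < b -> 0 < flat 0 (x - a) + flat 0 (b - x).
Proof.
move=> ab; have [xa|xa] := ltP a x.
  by rewrite ltr_pwDl ?flat_ge0// flat_gt0// subr_gt0.
by rewrite ltr_wpDl ?flat_ge0// flat_gt0// subr_gt0 (le_lt_trans xa).
Qed.

Lemma smooth_step (a b : R) : a < b -> smooth (step a b).
Proof.
move=> ab n.
have s1 : Sm n (fun x => flat 0 (x - a)).
  by apply: (Sm_comp (smooth_flat 0 n)); apply: SmD; [exact: Sm_id | exact: Sm_cst].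
have s2 : Sm n (fun x => flat 0 (b - x)).
  by apply: (Sm_comp (smooth_flat 0 n)); apply: SmD; [exact: Sm_cst | apply: SmN; exact: Sm_id].
apply: SmM => //; apply: SmV; last exact: SmD.
by move=> x; rewrite gt_eqF// step_den.
Qed.

Lemma step0 (a b x : R) : x <= a -> step a b x = 0.
Proof. by move=> xa; rewrite /step flat_le0 ?mul0r// subr_le0. Qed.
Lemma step1 (a b x : R) : a < b -> b <= x -> step a b x = 1.
Proof.
move=> ab bx; rewrite /step (flat_le0 0 (x := b - x)) ?subr_le0// addr0 divff//.
by rewrite gt_eqF// flat_gt0// subr_gt0 (lt_le_trans ab).
Qed.

End Smooth.

(** * Fourier series *)

Section RealIntegral.
Context (R : realType).
Implicit Types (f g : R -> R).
Local Notation I := (`[- pi, pi]%classic : set R).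

Definition RI f : R := Rintegral (@lebesgue_measure R) I f.
(** Continuity relative to [-pi, pi] only, because the quotients of [per_quotient] are controlled on
    that interval and not beyond. *)
Definition ri f : Prop := {within I, continuous f}.

Lemma ri_continuous f : continuous f -> ri f.
Proof. exact: continuous_subspaceT. Qed.

Lemma riD f g : ri f -> ri g -> ri (fun t => f t + g t).
Proof. by move=> cf cg t; apply: continuousD; [exact: cf | exact: cg]. Qed.
Lemma riN f : ri f -> ri (fun t => - f t).
Proof. by move=> cf t; apply: continuousN; exact: cf. Qed.
Lemma riM f g : ri f -> ri g -> ri (fun t => f t * g t).
Proof. by move=> cf cg t; apply: continuousM; [exact: cf | exact: cg]. Qed.
Lemma ri_cst (c : R) : ri (fun=> c).
Proof. by apply: ri_continuous => t; exact: cst_continuous. Qed.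

Lemma ri_integrable f : ri f -> (@lebesgue_measure R).-integrable I (EFin \o f).
Proof. move=> cf; apply: continuous_compact_integrable => //; exact: segment_compact. Qed.

Lemma pi_lt : - pi < pi :> R.
Proof. by rewrite gtrN ?pi_gt0. Qed.

Lemma RID f g : ri f -> ri g -> RI (fun t => f t + g t) = RI f + RI g.
Proof. by move=> cf cg; rewrite /RI RintegralD//; exact: ri_integrable. Qed.
Lemma RIZ (c : R) f : ri f -> RI (fun t => c * f t) = c * RI f.
Proof. by move=> cf; rewrite /RI RintegralZl//; exact: ri_integrable. Qed.
Lemma RI_ext f g : (forall t, - pi <= t <= pi -> f t = g t) -> RI f = RI g.
Proof. by move=> fg; apply: eq_Rintegral => t; rewrite inE /= in_itv /= => /fg. Qed.
Lemma RI_le f g : ri f -> ri g -> (forall t, - pi <= t <= pi -> f t <= g t) ->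
  RI f <= RI g.
Proof.
move=> cf cg fg; apply: le_Rintegral; [by []|exact: ri_integrable|exact: ri_integrable|].
by move=> t; rewrite /= in_itv /= => /fg.
Qed.
Lemma RI_FTC f f' : deriv f f' -> continuous f' -> RI f' = f pi - f (- pi).
Proof.
move=> df cf'; have cf := deriv_continuous df.
rewrite /RI /Rintegral (@continuous_FTC2 _ f' f (- pi) pi pi_lt)//.
- exact: continuous_subspaceT.
- split=> [t _||]; first by have [] := df t.
    by apply: cvg_at_right_filter; exact: cf.
  by apply: cvg_at_left_filter; exact: cf.
- by move=> t _; rewrite derive1E; have [_ ->] := df t.
Qed.
Lemma RI_cst (c : R) : RI (fun=> c) = 2 * pi * c.
Proof.
rewrite (@RI_FTC (fun t => c * t) (fun=> c)); first by ring.
- by apply: deriv_ext (derivM (deriv_cst c) (@deriv_id R)) => t; rewrite ?mul0r ?add0r ?mulr1.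
- by move=> t; exact: cst_continuous.
Qed.
Lemma RI_gt0 f : ri f -> (forall t, 0 <= f t) -> forall d e : R, 0 < d -> 0 < e -> e <= pi ->
  (forall t, - e <= t <= e -> d <= f t) -> 0 < RI f.
Proof.
move=> cf f0 d e d0 e0 epi h.
have /integrableP[mI _] := ri_integrable cf.
have fin : (\int[@lebesgue_measure R]_(t in I) (f t)%:E)%E \is a fin_num.
  by apply: integrable_fin_num => //; exact: ri_integrable.
pose J : set R := `[- e, e]%classic.
have sJ : J `<=` I by apply: subset_itv; rewrite bnd_simp//; lra.
have k1 : (\int[@lebesgue_measure R]_(t in J) (cst d%:E t) <= \int[@lebesgue_measure R]_(t in J) (f t)%:E)%E.
  apply: ge0_le_integral => //=; [exact: measurable_itv|by move=> t _; rewrite lee_fin ltW|].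
  exact: measurable_funS mI.
have k2 : (\int[@lebesgue_measure R]_(t in J) (f t)%:E <= \int[@lebesgue_measure R]_(t in I) (f t)%:E)%E.
  by apply: ge0_subset_integral => //; [exact: measurable_itv|move=> t _; rewrite lee_fin].
have k3 : (\int[@lebesgue_measure R]_(t in J) (cst d%:E t) = (d * (2 * e))%:E)%E.
  rewrite integral_cst//=; last exact: measurable_itv.
  rewrite /J lebesgue_measure_itv /= lte_fin ifT; last by lra.
  by rewrite -EFinD -EFinM opprK; congr (_ * _)%:E; ring.
rewrite -lte_fin /RI /Rintegral fineK//; apply: lt_le_trans k2; apply: lt_le_trans k1.
by rewrite k3 lte_fin !mulr_gt0.
Qed.

Lemma ri_bounded f : ri f -> exists B, forall t, - pi <= t <= pi -> `|f t| <= B.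
Proof.
move=> cf.
have [c _ hc] := EVT_max (ltW pi_lt) cf; have [d _ hd] := EVT_min (ltW pi_lt) cf.
exists (`|f c| + `|f d|) => t ht; have tI : t \in `[- pi, pi] by rewrite in_itv.
have := hc t tI; have := hd t tI; have := ler_norm (f c); have := ler_norm (- f d).
rewrite normrN ler_norml => *; apply/andP; have := normr_ge0 (f c); have := normr_ge0 (f d).
by split; lra.
Qed.

End RealIntegral.

Section ComplexMean.
Context (R : realType).
Implicit Types (F G : R -> R[i]) (a b z : R[i]).
Local Notation Re := (@complex.Re R).
Local Notation Im := (@complex.Im R).

Lemma complex_ext a b : Re a = Re b -> Im a = Im b -> a = b.
Proof. by case: a => ? ?; case: b => ? ? /= -> ->. Qed.
Lemma ReD a b : Re (a + b) = Re a + Re b. Proof. by case: a; case: b. Qed.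
Lemma ImD a b : Im (a + b) = Im a + Im b. Proof. by case: a; case: b. Qed.
Lemma ReM a b : Re (a * b) = Re a * Re b - Im a * Im b. Proof. by case: a; case: b. Qed.
Lemma ImM a b : Im (a * b) = Re a * Im b + Im a * Re b.
Proof. by case: a => ? ?; case: b => ? ?. Qed.

Definition ci F := ri (fun t => Re (F t)) /\ ri (fun t => Im (F t)).
Definition mean F : R[i] :=
  ((2 * pi)^-1 * RI (fun t => Re (F t))) +i* ((2 * pi)^-1 * RI (fun t => Im (F t))).

Lemma ri_eq (f g : R -> R) : (forall t, f t = g t) -> ri f -> ri g.
Proof. by move=> /funext ->. Qed.

Lemma ciD F G : ci F -> ci G -> ci (fun t => F t + G t).
Proof.
move=> [f1 f2] [g1 g2]; split.
  by apply: ri_eq (riD f1 g1) => t; rewrite ReD.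
by apply: ri_eq (riD f2 g2) => t; rewrite ImD.
Qed.
Lemma ciM F G : ci F -> ci G -> ci (fun t => F t * G t).
Proof.
move=> [f1 f2] [g1 g2]; split.
  by apply: ri_eq (riD (riM f1 g1) (riN (riM f2 g2))) => t; rewrite ReM.
by apply: ri_eq (riD (riM f1 g2) (riM f2 g1)) => t; rewrite ImM.
Qed.
Lemma ci_cst a : ci (fun=> a).
Proof. by split; exact: ri_cst. Qed.
Lemma ci_conj F : ci F -> ci (fun t => (F t)^*).
Proof.
move=> [f1 f2]; split; first by apply: ri_eq f1 => t; case: (F t).
by apply: ri_eq (riN f2) => t; case: (F t).
Qed.
Lemma ci_real (f : R -> R) : ri f -> ci (fun t => (f t)%:C).
Proof. by move=> cf; split => //; exact: ri_cst. Qed.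
Lemma ci_sum (I : Type) (r : seq I) (F : I -> R -> R[i]) :
  (forall i, ci (F i)) -> ci (fun t => \sum_(i <- r) F i t).
Proof.
move=> h; elim: r => [|i r ih].
  by have := ci_cst 0; congr ci; apply/funext => t; rewrite big_nil.
by have := ciD (h i) ih; congr ci; apply/funext => t; rewrite big_cons.
Qed.

Lemma mean_ext F G : (forall t, - pi <= t <= pi -> F t = G t) -> mean F = mean G.
Proof. by move=> h; rewrite /mean; congr (_ * _ +i* (_ * _)); apply: RI_ext => t /h ->. Qed.

Lemma meanD F G : ci F -> ci G -> mean (fun t => F t + G t) = mean F + mean G.
Proof.
move=> [f1 f2] [g1 g2]; apply: complex_ext; rewrite ?ReD ?ImD /= -mulrDr; congr (_ * _).
  by rewrite -RID//; apply: RI_ext => t _; rewrite ReD.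
by rewrite -RID//; apply: RI_ext => t _; rewrite ImD.
Qed.
Lemma meanZ a F : ci F -> mean (fun t => a * F t) = a * mean F.
Proof.
move=> [f1 f2]; apply: complex_ext; rewrite ?ReM ?ImM /=.
  have e : RI (fun t => Re (a * F t)) = Re a * RI (fun t => Re (F t)) + - Im a * RI (fun t => Im (F t)).
    rewrite -!RIZ// -RID; [|by apply: riM => //; exact: ri_cst..].
    by apply: RI_ext => t _; rewrite ReM mulNr.
  by rewrite e; ring.
have e : RI (fun t => Im (a * F t)) = Re a * RI (fun t => Im (F t)) + Im a * RI (fun t => Re (F t)).
  rewrite -!RIZ// -RID; [|by apply: riM => //; exact: ri_cst..].
  by apply: RI_ext => t _; rewrite ImM.
by rewrite e; ring.
Qed.
Lemma mean0 : mean (fun=> 0) = 0.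
Proof. by rewrite -[RHS](mul0r (mean (fun=> 0))) -(meanZ 0 (ci_cst 0)); apply: mean_ext => t _; rewrite mul0r. Qed.
Lemma mean_cst a : mean (fun=> a) = a.
Proof.
have pi0 : (2 * pi)^-1 * (2 * pi) = 1 :> R by rewrite mulVf// mulf_neq0// gt_eqF ?pi_gt0.
by apply: complex_ext; rewrite /= RI_cst mulrA pi0 mul1r.
Qed.
Lemma mean_sum (I : Type) (r : seq I) (F : I -> R -> R[i]) : (forall i, ci (F i)) ->
  mean (fun t => \sum_(i <- r) F i t) = \sum_(i <- r) mean (F i).
Proof.
move=> h; elim: r => [|i r ih].
  by rewrite [RHS]big_nil -[RHS]mean0; apply: mean_ext => t _; rewrite big_nil.
rewrite [RHS]big_cons -ih -meanD//; first by apply: mean_ext => t _; rewrite big_cons.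
exact: ci_sum.
Qed.
Lemma mean_conj F : ci F -> mean (fun t => (F t)^*) = (mean F)^*.
Proof.
move=> [f1 f2]; apply: complex_ext => /=.
  by congr (_ * _); apply: RI_ext => t _; case: (F t).
have -> : RI (fun t => Im ((F t)^*)) = - RI (fun t => Im (F t)).
  by rewrite -mulN1r -RIZ//; apply: RI_ext => t _; rewrite mulN1r; case: (F t).
by rewrite mulrN.
Qed.

(* the factor 2 comes from bounding the real and imaginary parts separately *)
Lemma mean_bound (w : R -> R) F (B : R) : ri w -> (forall t, 0 <= w t) -> ci F -> 0 <= B ->
  (forall t, - pi <= t <= pi -> w t = 0 \/ rn (F t) <= B) ->
  rn (mean (fun t => (w t)%:C * F t)) <= 2 * B * ((2 * pi)^-1 * RI w).
Proof.
move=> cw w0 [f1 f2] B0 h.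
have p0 : 0 <= (2 * pi)^-1 :> R by rewrite invr_ge0 mulr_ge0// pi_ge0.
have key (p : R[i] -> R) : ri (fun t => p (F t)) -> (forall t, p ((w t)%:C * F t) = w t * p (F t)) ->
    (forall z, `|p z| <= rn z) -> `|RI (fun t => p ((w t)%:C * F t))| <= B * RI w.
  move=> cp pE pn.
  have -> : RI (fun t => p ((w t)%:C * F t)) = RI (fun t => w t * p (F t)).
    by apply: RI_ext => t _; rewrite pE.
  have cwp := riM cw cp.
  have bnd t : - pi <= t <= pi -> `|w t * p (F t)| <= B * w t.
    move=> ht; rewrite normrM (ger0_norm (w0 t)) mulrC.
    case: (h t ht) => [->|hB]; first by rewrite !mulr0.
    by rewrite ler_wpM2r// (le_trans (pn _)).
  rewrite -RIZ// ler_norml -mulN1r -RIZ; last by apply: riM => //; exact: ri_cst.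
  apply/andP; split; apply: RI_le => //; try by apply: riM; [exact: ri_cst | ].
    by apply: riM; [exact: ri_cst | apply: riM => //; exact: ri_cst].
  - by move=> t /bnd; rewrite ler_norml mulN1r => /andP[].
  - by move=> t /bnd; rewrite ler_norml => /andP[].
apply: le_trans (rn_le _) _; rewrite /= !normrM !(ger0_norm p0).
have := key Re f1 _ (@rn_Re R); have := key Im f2 _ (@rn_Im R).
move=> k2 k1; have -> : 2 * B * ((2 * pi)^-1 * RI w) = (2 * pi)^-1 * (B * RI w + B * RI w) by ring.
rewrite -mulrDr ler_wpM2l//.
by rewrite lerD ?k1 ?k2// => t; rewrite ?ReM ?ImM /= mul0r ?subr0 ?addr0.
Qed.

Lemma mean_le F (B : R) : ci F -> 0 <= B -> (forall t, - pi <= t <= pi -> rn (F t) <= B) ->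
  rn (mean F) <= 2 * B.
Proof.
move=> cF B0 h; have := mean_bound (@ri_cst R 1) (fun=> ler01) cF B0 (fun t ht => or_intror (h t ht)).
have pi0 : (2 * pi)^-1 * (2 * pi) = 1 :> R by rewrite mulVf// mulf_neq0// gt_eqF ?pi_gt0.
rewrite RI_cst !mulr1 pi0 mulr1; congr (rn _ <= _).
by apply: mean_ext => t _; rewrite mul1r.
Qed.

Lemma ci_bounded F : ci F -> exists2 B, 0 <= B & forall t, - pi <= t <= pi -> rn (F t) <= B.
Proof.
move=> [/ri_bounded[B1 h1] /ri_bounded[B2 h2]]; exists (`|B1| + `|B2|).
  by rewrite addr_ge0.
move=> t ht; apply: le_trans (rn_le _) _; rewrite lerD//.
  exact: le_trans (h1 t ht) (ler_norm _).
exact: le_trans (h2 t ht) (ler_norm _).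
Qed.

Definition cderiv F F' := deriv (fun t => Re (F t)) (fun t => Re (F' t)) /\
  deriv (fun t => Im (F t)) (fun t => Im (F' t)).
Definition csmooth F := smooth (fun t => Re (F t)) /\ smooth (fun t => Im (F t)).

Lemma csmooth_ci F : csmooth F -> ci F.
Proof.
move=> [h1 h2]; have [f1 d1 _] := h1 1%N; have [f2 d2 _] := h2 1%N.
by split; apply: ri_continuous; [exact: deriv_continuous d1 | exact: deriv_continuous d2].
Qed.

Lemma cderivM F G F' G' : cderiv F F' -> cderiv G G' ->
  cderiv (fun t => F t * G t) (fun t => F' t * G t + F t * G' t).
Proof.
move=> [f1 f2] [g1 g2]; split.
  apply: deriv_ext (derivD (derivM f1 g1) (derivN (derivM f2 g2))) => t.
    by rewrite ReM.
  by rewrite ReD !ReM; ring.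
apply: deriv_ext (derivD (derivM f1 g2) (derivM f2 g1)) => t.
  by rewrite ImM.
by rewrite ImD !ImM; ring.
Qed.

Lemma mean_deriv F F' : cderiv F F' -> continuous (fun t => Re (F' t)) ->
  continuous (fun t => Im (F' t)) -> F pi = F (- pi) -> mean F' = 0.
Proof.
move=> [d1 d2] c1 c2 p; rewrite /mean (RI_FTC d1 c1) (RI_FTC d2 c2) p !subrr !mulr0.
by [].
Qed.

Definition ex (x : R) : R[i] := cos x +i* sin x.

Lemma exD x y : ex (x + y) = ex x * ex y.
Proof. by rewrite /ex cosD sinD; apply: complex_ext; rewrite ?ReM ?ImM /=; ring. Qed.
Lemma ex0 : ex 0 = 1. Proof. by rewrite /ex cos0 sin0. Qed.
Lemma rn_ex x : rn (ex x) = 1.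
Proof. by rewrite rn_sqrt /= cos2Dsin2 sqrtr1. Qed.
Lemma exN x : ex (- x) = (ex x)^*.
Proof. by rewrite /ex cosN sinN; apply: complex_ext. Qed.
Lemma exNM x : ex (- x) * ex x = 1.
Proof. by rewrite -exD addNr ex0. Qed.

Lemma deriv_cos_mul (n : R) : deriv (fun t => cos (n * t)) (fun t => - (n * sin (n * t))).
Proof.
have d := derivM (deriv_cst n) (@deriv_id R).
apply: deriv_ext (deriv_comp (fun t => is_derive_cos t) d) => t //=.
by rewrite mul0r add0r mulr1 mulNr mulrC.
Qed.
Lemma deriv_sin_mul (n : R) : deriv (fun t => sin (n * t)) (fun t => n * cos (n * t)).
Proof.
have d := derivM (deriv_cst n) (@deriv_id R).
apply: deriv_ext (deriv_comp (fun t => is_derive_sin t) d) => t //=.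
by rewrite mul0r add0r mulr1 mulrC.
Qed.
Lemma csmooth_ex (n : R) : csmooth (fun t => ex (n * t)).
Proof.
split=> m /=.
  by apply: (Sm_comp (Sm_cos_sin R m).1); apply: SmM; [exact: Sm_cst | exact: Sm_id].
by apply: (Sm_comp (Sm_cos_sin R m).2); apply: SmM; [exact: Sm_cst | exact: Sm_id].
Qed.
Lemma cderiv_ex (n : R) : cderiv (fun t => ex (n * t)) (fun t => (0 +i* n) * ex (n * t)).
Proof.
split.
  by apply: deriv_ext (deriv_cos_mul n) => t //; rewrite ReM /= mul0r sub0r.
by apply: deriv_ext (deriv_sin_mul n) => t //; rewrite ImM /= mul0r add0r.
Qed.

End ComplexMean.

(** * Unconditional and absolute summation *)

Section HasSum.
Context (R : realType).

Lemma big_subset_split (V : zmodType) (I : eqType) (x : I -> V) (S0 S : seq I) :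
  uniq S0 -> uniq S -> {subset S0 <= S} ->
  \sum_(i <- S) x i = \sum_(i <- S0) x i + \sum_(i <- [seq i <- S | i \notin S0]) x i.
Proof.
move=> u0 u h; rewrite -big_cat; apply: perm_big; apply: uniq_perm => //.
  rewrite cat_uniq u0 filter_uniq// andbT /=; apply/hasPn => i.
  by rewrite mem_filter => /andP[].
move=> i; rewrite mem_cat mem_filter; case: (boolP (i \in S0)) => [/h ->|] //.
Qed.

(* unconditional convergence, i.e. along the net of finite subsets of I *)
Definition hsum (V : normedModType R[i]) (I : eqType) (x : I -> V) (s : V) :=
  forall e : R, 0 < e -> exists S0 : seq I, forall S, uniq S -> {subset S0 <= S} ->
    rn (\sum_(i <- S) x i - s) < e.

(** Meant for nonnegative families, where boundedness of the finite sums amounts to summability. *)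
Definition asum (I : eqType) (x : I -> R) :=
  exists B, forall S, uniq S -> \sum_(i <- S) x i <= B.

Lemma asum_le (I : eqType) (x y : I -> R) (C : R) : 0 <= C -> (forall i, x i <= C * y i) ->
  asum y -> asum x.
Proof.
move=> C0 xy [B hB]; exists (C * B) => S uS.
apply: le_trans (_ : \sum_(i <- S) C * y i <= _); first by apply: ler_sum => i _; exact: xy.
by rewrite -mulr_sumr ler_wpM2l// hB.
Qed.

Lemma asum_tail (I : eqType) (x : I -> R) : asum x -> forall e, 0 < e ->
  exists2 S0 : seq I, uniq S0 & forall S, uniq S -> (forall i, i \in S -> i \notin S0) ->
    \sum_(i <- S) x i < e.
Proof.
move=> [B hB] e e0; pose A := [set r | exists2 S, uniq S & r = \sum_(i <- S) x i].
have sA : has_sup A.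
  split; first by exists 0, [::]; rewrite ?big_nil.
  by exists B => _ [S uS ->]; exact: hB.
have [_ [S0 u0 ->] h] := sup_adherent e0 sA.
exists S0 => // S uS dS; rewrite ltNge; apply/negP => le.
have : \sum_(i <- S0 ++ S) x i <= sup A.
  apply: sup_upper_bound => //; exists (S0 ++ S) => //.
  by rewrite cat_uniq u0 uS andbT /=; apply/hasPn => i /dS.
by rewrite big_cat /=; lra.
Qed.

Lemma asum_prod (I J : eqType) (x : I -> R) (y : J -> R) : (forall i, 0 <= x i) ->
  (forall j, 0 <= y j) -> asum x -> asum y -> asum (fun p : I * J => x p.1 * y p.2).
Proof.
move=> x0 y0 [B hB] [C hC]; exists (B * C) => S uS.
pose S1 := undup [seq p.1 | p <- S]; pose S2 := undup [seq p.2 | p <- S].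
pose P := [seq (i, j) | i <- S1, j <- S2].
have uP : uniq P by apply: allpairs_uniq; rewrite ?undup_uniq// => -[? ?] [? ?] _ _ [-> ->].
have sP : {subset S <= P}.
  by move=> [i j] h; apply/allpairsP; exists (i, j); rewrite !mem_undup /=; split => //;
     [exact: (map_f fst h)|exact: (map_f snd h)].
rewrite (le_trans (y := \sum_(p <- P) x p.1 * y p.2))//.
  rewrite (big_subset_split (fun p : I * J => x p.1 * y p.2) uS uP sP) lerDl.
  by apply: sumr_ge0 => p _; rewrite mulr_ge0.
rewrite big_allpairs_dep /=.
apply: le_trans (_ : \sum_(i <- S1) x i * C <= _).
  by apply: ler_sum => i _; rewrite -mulr_sumr ler_wpM2l// hC// undup_uniq.
rewrite -mulr_suml ler_wpM2r ?hB ?undup_uniq//.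
by apply: le_trans (hC [::] _); rewrite ?big_nil.
Qed.

Section One.
Context (V : normedModType R[i]) (I : eqType).
Implicit Types (x y : I -> V) (s : V).

Lemma hsum_uniq x s s' : hsum x s -> hsum x s' -> s = s'.
Proof.
move=> h h'; apply/eqP; rewrite -subr_eq0 -rn_eq0; apply/eqP.
apply: (@eq0_eps _ _ 2) => [|e e0]; first exact: rn_ge0.
have [S0 h0] := h e e0; have [S1 h1] := h' e e0.
have uS : uniq (undup (S0 ++ S1)) by exact: undup_uniq.
have l0 := h0 _ uS; have l1 := h1 _ uS.
apply: le_trans (rn_tri _ (\sum_(i <- undup (S0 ++ S1)) x i) _) _.
rewrite (rn_distC s) mulr2n mulrDl mul1r lerD// ltW//; [apply: l0|apply: l1] => i h2; by rewrite mem_undup mem_cat h2 ?orbT.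
Qed.

Lemma hsum_ext x y s : (forall i, x i = y i) -> hsum x s -> hsum y s.
Proof. by move=> /funext ->. Qed.

Lemma hsum_fin x (S0 : seq I) : uniq S0 -> (forall i, i \notin S0 -> x i = 0) ->
  hsum x (\sum_(i <- S0) x i).
Proof.
move=> u0 h e e0; exists S0 => S uS sS.
rewrite (big_subset_split _ u0 uS sS) addrAC subrr add0r big_filter.
by rewrite big1 ?rn0// => i; exact: h.
Qed.

Lemma hsumD x y s s' : hsum x s -> hsum y s' -> hsum (fun i => x i + y i) (s + s').
Proof.
move=> h h' e e0; have e2 : 0 < e / 2 by rewrite divr_gt0.
have [S0 h0] := h _ e2; have [S1 h1] := h' _ e2; exists (S0 ++ S1) => S uS sS.
rewrite big_split opprD addrACA (splitr e); apply: le_lt_trans (rnD _ _) _; rewrite ltrD//.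
  by apply: h0 => // i hi; apply: sS; rewrite mem_cat hi.
by apply: h1 => // i hi; apply: sS; rewrite mem_cat hi orbT.
Qed.

Lemma hsum_reindex (J : eqType) (f : J -> I) (g : I -> J) x s : cancel f g -> cancel g f ->
  hsum x s -> hsum (fun j => x (f j)) s.
Proof.
move=> fg gf h e e0; have [S0 h0] := h e e0; exists (map g S0) => S uS sS.
have := h0 (map f S); rewrite big_map; apply; first by rewrite map_inj_uniq//; exact: can_inj fg.
by move=> i hi; rewrite -(gf i) map_f// sS// map_f.
Qed.

Lemma hsum_bound x s B : hsum x s -> (forall S, uniq S -> \sum_(i <- S) rn (x i) <= B) ->
  rn s <= B.
Proof.
move=> h hB; apply/ler_addgt0Pr => e e0; have [S0 h0] := h e e0.
have := h0 (undup S0) (undup_uniq _) _.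
have -> : rn s = rn (\sum_(i <- undup S0) x i - (\sum_(i <- undup S0) x i - s)) by rewrite subKr.
move=> /(_ _)/ltW l; apply: le_trans (rnB _ _) _; rewrite lerD//.
  by apply: le_trans (rn_sum _ _ _) _; rewrite hB ?undup_uniq.
by apply: l => i; rewrite mem_undup.
Qed.

End One.

Lemma hsum_map (V W : normedModType R[i]) (I : eqType) (A : V -> W) (C : R) (x : I -> V) s :
  linear A -> 0 <= C -> (forall v, rn (A v) <= C * rn v) -> hsum x s ->
  hsum (fun i => A (x i)) (A s).
Proof.
move=> lA C0 hA h e e0; have C1 : 0 < C + 1 by rewrite ltr_wpDl.
have [S0 h0] := h (e / (C + 1)) (divr_gt0 e0 C1); exists S0 => S uS sS.
have sE : \sum_(i <- S) A (x i) = A (\sum_(i <- S) x i) by rewrite (lin_sum lA).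
rewrite sE -(linB lA); apply: le_lt_trans (hA _) _.
have := h0 S uS sS; rewrite ltr_pdivlMr// mulrC; apply: le_lt_trans.
by rewrite ler_wpM2r ?rn_ge0// lerDl.
Qed.

(** A property of the norm, so that one existence theorem covers the Hilbert spaces as well as the
    scalars [R[i]^o]. *)
Definition cauchy_complete (V : normedModType R[i]) := forall u : nat -> V,
  (forall e : R, 0 < e -> exists N, forall m n, (N <= m)%N -> (N <= n)%N ->
     rn (u m - u n) < e) ->
  exists l, forall e : R, 0 < e -> exists N, forall n, (N <= n)%N -> rn (u n - l) < e.

Lemma complex_complete : cauchy_complete R[i]^o.
Proof.
move=> u h.
have key (p : R[i] -> R) : (forall a b, p (a - b) = p a - p b) -> (forall a, `|p a| <= rn a) ->
    exists l, forall e : R, 0 < e -> exists N, forall n, (N <= n)%N -> `|p (u n) - l| < e.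
  move=> pB pn; suff /cvg_ex[l /cvgrPdist_lt hl] : cvgn (fun n => p (u n)).
    exists l => e e0; have [N _ hN] := hl e e0; exists N => n Nn.
    by rewrite distrC; exact: hN.
  apply/cauchy_cvgP/cauchy_ballP => e e0; have [N hN] := h _ e0.
  exists ((fun n => p (u n)) @` [set n | (N <= n)%N], (fun n => p (u n)) @` [set n | (N <= n)%N]) => /=.
    by split; exists N => // n Nn; exists n.
  move=> [_ _] /= [[m Nm <-] [n Nn <-]].
  by rewrite /ball /= -pB; apply: le_lt_trans (pn _) _; exact: hN.
have [|a ha] := key (@complex.Re R) _ (@rn_Re R); first by move=> [? ?] [? ?].
have [|b hb] := key (@complex.Im R) _ (@rn_Im R); first by move=> [? ?] [? ?].
exists (a +i* b) => e e0; have e2 : 0 < e / 2 by rewrite divr_gt0.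
have [N1 h1] := ha _ e2; have [N2 h2] := hb _ e2; exists (maxn N1 N2) => n.
rewrite geq_max => /andP[n1 n2]; apply: le_lt_trans (rn_le _) _.
rewrite (splitr e) ltrD//; first by move: (h1 n n1); case: (u n).
by move: (h2 n n2); case: (u n).
Qed.

Lemma hsum_exists_complete (V : normedModType R[i]) (I : eqType) (x : I -> V) :
  cauchy_complete V -> asum (fun i => rn (x i)) -> exists s, hsum x s.
Proof.
move=> cV ax.
have /choice[S hS] : forall n : nat, exists S0 : seq I, uniq S0 /\
    forall S, uniq S -> (forall i, i \in S -> i \notin S0) -> \sum_(i <- S) rn (x i) < n.+1%:R^-1.
  by move=> n; have [|S0 u0 h] := asum_tail ax (e := n.+1%:R^-1); [rewrite invr_gt0|exists S0].
pose u n := \sum_(i <- S n) x i.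
have near n T : uniq T -> {subset S n <= T} -> rn (\sum_(i <- T) x i - u n) < n.+1%:R^-1.
  move=> uT sT; have [un hn] := hS n.
  rewrite (big_subset_split x un uT sT) addrAC subrr add0r.
  apply: le_lt_trans (rn_sum _ _ _) _; apply: hn; first exact: filter_uniq.
  by move=> i; rewrite mem_filter => /andP[].
have [e e0|l hl] := cV u.
  have e2 : 0 < e / 2 by rewrite divr_gt0.
  have [N hN] := invS_small e2; exists N => m n lm ln.
  pose T := undup (S m ++ S n).
  have sm : {subset S m <= T} by move=> i hi; rewrite mem_undup mem_cat hi.
  have sn : {subset S n <= T} by move=> i hi; rewrite mem_undup mem_cat hi orbT.
  apply: le_lt_trans (rn_tri _ (\sum_(i <- T) x i) _) _; rewrite (splitr e) ltrD//.
    by rewrite rn_distC; apply: lt_trans (near _ _ (undup_uniq _) sm) (hN _ lm).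
  by apply: lt_trans (near _ _ (undup_uniq _) sn) (hN _ ln).
exists l => e e0; have e2 : 0 < e / 2 by rewrite divr_gt0.
have [N1 h1] := invS_small e2; have [N2 h2] := hl _ e2.
exists (S (maxn N1 N2)) => T uT sT.
apply: le_lt_trans (rn_tri _ (u (maxn N1 N2)) _) _; rewrite (splitr e) ltrD//.
  by apply: lt_trans (near _ _ uT sT) _; rewrite h1 ?leq_maxl.
by rewrite h2 ?leq_maxr.
Qed.

Lemma hsum_exists (V : completeNormedModType R[i]) (I : eqType) (x : I -> V) :
  asum (fun i => rn (x i)) -> exists s, hsum x s.
Proof. by move=> ax; apply: hsum_exists_complete ax => u; exact: complete_rn. Qed.

(* Fubini for unconditional sums needs no absolute convergence. *)
Lemma hsum_fubini (V : normedModType R[i]) (I J : eqType) (x : I * J -> V) y s : hsum x s ->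
  (forall i, hsum (fun j => x (i, j)) (y i)) -> hsum y s.
Proof.
move=> h hy e e0; have e2 : 0 < e / 2 by rewrite divr_gt0.
have [S0 h0] := h _ e2; exists [seq p.1 | p <- S0] => S uS sS.
(* Tolerance for each inner sum, so that the errors over [S] add up to less than e / 2. *)
pose d := e / 2 / (size S).+1%:R.
have d0 : 0 < d by rewrite divr_gt0.
have /choice[Q hQ] : forall i, exists T : seq J, uniq T /\
    {subset [seq p.2 | p <- S0] <= T} /\ rn (\sum_(j <- T) x (i, j) - y i) < d.
  move=> i; have [T0 hT] := hy i _ d0; exists (undup (T0 ++ [seq p.2 | p <- S0])).
  split; first exact: undup_uniq.
  split; first by move=> j hj; rewrite mem_undup mem_cat hj orbT.
  by apply: hT; [exact: undup_uniq | move=> j hj; rewrite mem_undup mem_cat hj].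
pose P := [seq (i, j) | i <- S, j <- Q i].
have uP : uniq P.
  apply: allpairs_uniq_dep => //; first by move=> i _; have [] := hQ i.
  by move=> [? ?] [? ?] _ _ /= [-> ->].
have sP : {subset S0 <= P}.
  move=> [i j] hp; apply/allpairsPdep; exists i, j; split => //.
    by apply: sS; exact: (map_f fst hp).
  by have [_ [hh _]] := hQ i; apply: hh; exact: (map_f snd hp).
have hP := h0 P uP sP.
have EP : \sum_(p <- P) x p = \sum_(i <- S) \sum_(j <- Q i) x (i, j).
  by rewrite big_allpairs_dep.
apply: le_lt_trans (rn_tri _ (\sum_(p <- P) x p) _) _; rewrite (splitr e) ltr_leD//; last exact: ltW.
rewrite EP -sumrB; apply: le_lt_trans (rn_sum _ _ _) _.
apply: le_lt_trans (_ : \sum_(i <- S) d < _).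
  by apply: ler_sum => i _; rewrite rn_distC ltW//; have [_ []] := hQ i.
rewrite big_const_seq count_predT iter_addr_0 /d -[_ *+ _]mulr_natr -mulrA gtr_pMr//.
by rewrite mulrC ltr_pdivrMr// mul1r ltr_nat.
Qed.

Lemma asum_sub (I J : eqType) (f : J -> I) (x : I -> R) : injective f -> asum x ->
  asum (fun j => x (f j)).
Proof.
by move=> fi [B hB]; exists B => S uS; have := hB (map f S); rewrite big_map map_inj_uniq//; apply.
Qed.

(** The summable majorant on the integers to which the absolute convergence of rapidly decreasing
    series is reduced. *)
Definition wgt (n : int) : R := (absz n).+1%:R ^- 2.

Lemma wgt_ge0 n : 0 <= wgt n.
Proof. by rewrite /wgt invr_ge0 exprn_ge0. Qed.

Lemma sum_zbox (V : zmodType) N (x : int -> V) :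
  \sum_(k < (N + N).+1) x (k%:Z - N%:Z) = \sum_(n <- zbox N) x n.
Proof.
by rewrite big_map -(big_mkord xpredT (fun k => x (k%:Z - N%:Z))) /index_iota subn0.
Qed.

Lemma sum_zboxS (V : zmodType) N (x : int -> V) :
  \sum_(n <- zbox N.+1) x n = \sum_(n <- zbox N) x n + x N.+1 + x (- N.+1%:Z).
Proof.
rewrite [LHS](perm_big (zbox N ++ [:: N.+1%:Z; - N.+1%:Z])).
  by rewrite big_cat /= big_cons big_seq1 addrA.
apply: uniq_perm; first exact: zbox_uniq.
  rewrite cat_uniq zbox_uniq andTb /has !mem_zbox orbF cons_uniq !inE /=.
  by rewrite ltnn.
move=> n; rewrite mem_cat !mem_zbox !inE.
apply/idP/idP => [h|].
  have [//|h1] := leqP; have [->|->] : n = N.+1%:Z \/ n = - N.+1%:Z by lia.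
    by rewrite eqxx.
  by rewrite eqxx orbT.
by move=> /or3P[|/eqP ->|/eqP ->] //; lia.
Qed.

Lemma zbox_sup (S : seq int) : exists N, {subset S <= zbox N}.
Proof.
exists (\sum_(n <- S) absz n)%N => n nS; rewrite mem_zbox.
by rewrite (big_rem n)//= leq_addr.
Qed.

Lemma asum_wgt : asum wgt.
Proof.
exists 3 => S uS; have [N sN] := zbox_sup S.
apply: le_trans (_ : \sum_(n <- zbox N) wgt n <= _).
  rewrite (big_subset_split wgt uS (zbox_uniq N) sN) lerDl.
  by apply: sumr_ge0 => *; exact: wgt_ge0.
(* Telescoping majorant: it equals 1 at N = 0, and the two new terms 2 / (N+2)^2 are at most 2 /
   (N+1) - 2 / (N+2). *)
suff : \sum_(n <- zbox N) wgt n <= 3 - 2 / N.+1%:R.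
  by move=> /le_trans; apply; rewrite gerBl divr_ge0.
elim: N {sN} => [|N ih].
  by rewrite /zbox /= big_cons big_nil /wgt /= expr1n invr1 mulr1; lra.
rewrite sum_zboxS; have -> : wgt N.+1 = N.+2%:R ^- 2 by [].
have -> : wgt (- N.+1%:Z) = N.+2%:R ^- 2 by rewrite /wgt abszN.
have h : N.+2%:R ^- 2 <= N.+1%:R^-1 - N.+2%:R^-1 :> R.
  have p1 : 0 < N.+1%:R :> R by []. have -> : N.+2%:R = N.+1%:R + 1 :> R by rewrite natr1.
  move: (N.+1%:R : R) p1 => p p0.
  have -> : p^-1 - (p + 1)^-1 = (p * (p + 1))^-1 by field; rewrite !gt_eqF//; lra.
  rewrite lef_pV2 ?posrE; nra.
move: (\sum_(n <- _) _) (N.+2%:R ^- 2) (N.+2%:R^-1) (N.+1%:R^-1) ih h => a b c d; lra.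
Qed.

Lemma hsum_cvg (V : normedModType R[i]) (x : int -> V) s : hsum x s ->
  (fun N : nat => \sum_(k < (N + N).+1) x (k%:Z - N%:Z)) @ \oo --> s.
Proof.
move=> h; apply/cvg_rn => e e0; have [S0 h0] := h e e0; have [N sN] := zbox_sup S0.
exists N => n Nn; rewrite sum_zbox; apply: h0; first exact: zbox_uniq.
by move=> i /sN; rewrite !mem_zbox => /leq_trans; apply.
Qed.

(** Connects the symmetric partial sums of [smeared0] with unconditional sums: once an unconditional
    sum exists, the two limits agree. *)
Lemma hsum_limit (V : normedModType R[i]) (x : int -> V) s : (exists s', hsum x s') ->
  (fun N : nat => \sum_(k < (N + N).+1) x (k%:Z - N%:Z)) @ \oo --> s -> hsum x s.
Proof.
move=> [s' hs'] /cvg_rn h.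
suff -> : s = s' by [].
have /cvg_rn h' := hsum_cvg hs'.
apply/eqP; rewrite -subr_eq0 -rn_eq0; apply/eqP.
apply: (@eq0_eps _ _ 2) => [|e e0]; first exact: rn_ge0.
have [N hN] := h e e0; have [N' hN'] := h' e e0.
apply: le_trans (rn_tri _ _ _) _; rewrite mulr2n mulrDl mul1r rn_distC; apply: lerD.
  by apply/ltW/(hN (maxn N N')); rewrite leq_maxl.
by apply/ltW/hN'; rewrite leq_maxr.
Qed.

End HasSum.

(** * Fourier coefficients of smooth periodic functions *)

Section Fourier.
Context (R : realType).
Implicit Types (f g : R -> R) (F G : R -> R[i]).
Local Notation Re := (@complex.Re R).
Local Notation Im := (@complex.Im R).

Lemma deriv_uniq f f1 f2 : deriv f f1 -> deriv f f2 -> f1 = f2.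
Proof. by move=> d1 d2; apply/funext => t; have [_ <-] := d1 t; have [_ <-] := d2 t. Qed.

Lemma smooth_deriv f : smooth f -> exists2 f', deriv f f' & smooth f'.
Proof.
move=> h; have [f' d _] := h 1%N; exists f' => // n.
by have [f2 d2] := h n.+1; rewrite (deriv_uniq d2 d).
Qed.

Lemma deriv_shift f f' s : deriv f f' -> deriv (fun t => f (t + s)) (fun t => f' (t + s)).
Proof.
move=> d; apply: deriv_ext (deriv_comp d (derivD (@deriv_id R) (deriv_cst s))) => t //.
by rewrite addr0 mulr1.
Qed.

Lemma mvt f f' x y : deriv f f' -> exists2 c, `|c - x| <= `|y - x| & f y - f x = f' c * (y - x).
Proof.
move=> d; have cf := deriv_continuous d.
have key a b : a <= b -> exists2 c, a <= c <= b & f b - f a = f' c * (b - a).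
  move=> ab; have [|c hc e] := @MVT_segment _ f f' a b ab (fun x _ => d x).
    exact: continuous_subspaceT.
  by exists c => //; move: hc; rewrite in_itv.
have [xy|yx] := lerP x y.
  have [c /andP[c1 c2] e] := key x y xy; exists c => //.
  by rewrite !ger0_norm ?subr_ge0//; lra.
have [c /andP[c1 c2] e] := key y x (ltW yx); exists c; last by lra.
by rewrite !ler0_norm ?subr_le0 ?(ltW yx)//; lra.
Qed.

Lemma smooth_shift f s : smooth f -> smooth (fun t => f (t + s)).
Proof.
by move=> h n; apply: (Sm_comp (h n)); apply: SmD; [exact: Sm_id | exact: Sm_cst].
Qed.

(** Periodicity is stated as dependence on [ex t] alone, the form in which functions on the circle
    provide it. *)
Definition per F := csmooth F /\ forall s t, ex s = ex t -> F s = F t.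

Lemma csmoothM F G : csmooth F -> csmooth G -> csmooth (fun t => F t * G t).
Proof.
move=> [f1 f2] [g1 g2]; split=> n.
  suff -> : (fun t => Re (F t * G t)) = (fun t => Re (F t) * Re (G t) + - (Im (F t) * Im (G t))).
    by apply: SmD; [|apply: SmN]; apply: SmM.
  by apply/funext => t; rewrite ReM.
suff -> : (fun t => Im (F t * G t)) = (fun t => Re (F t) * Im (G t) + Im (F t) * Re (G t)).
  by apply: SmD; apply: SmM.
by apply/funext => t; rewrite ImM.
Qed.

Lemma ex_shift s t u : ex s = ex t -> ex (s + u) = ex (t + u) :> R[i].
Proof. by rewrite !exD => ->. Qed.

Lemma perM F G : per F -> per G -> per (fun t => F t * G t).
Proof. by move=> [f1 f2] [g1 g2]; split=> [|s t h]; [exact: csmoothM | rewrite (f2 _ _ h) (g2 _ _ h)]. Qed.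
Lemma per_shift F s : per F -> per (fun t => F (t + s)).
Proof.
move=> [[f1 f2] h]; split=> [|u v e]; [split | apply: h; exact: ex_shift].
  exact: (smooth_shift (f := fun t => Re (F t))).
exact: (smooth_shift (f := fun t => Im (F t))).
Qed.

Lemma ex_int (n : int) s t : ex s = ex t -> ex (n%:~R * s) = ex (n%:~R * t) :> R[i].
Proof.
move=> e; have key (m : nat) : ex (m%:R * s) = ex (m%:R * t) :> R[i].
  by elim: m => [|m ih]; rewrite ?mul0r// -natr1 !mulrDl !mul1r !exD ih e.
by case: n => m; rewrite ?NegzE ?rmorphN /= -?pmulrn ?mulNr ?exN key.
Qed.

Lemma per_ex (n : int) : per (fun t => ex (n%:~R * t)).
Proof. by split=> [|s t h]; [exact: csmooth_ex | exact: ex_int]. Qed.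

Lemma ex_pi : ex (- pi) = ex pi :> R[i].
Proof. by rewrite /ex cosN sinN sinpi oppr0. Qed.

Lemma ex_onto (z : R[i]) : `|z| = 1 -> exists2 t, - pi <= t <= pi & ex t = z.
Proof.
case: z => a b; rewrite normc_def /= => /complexI h.
have h1 : a ^+ 2 + b ^+ 2 = 1.
  by rewrite -[LHS]sqr_sqrtr ?h ?expr1n// addr_ge0 ?sqr_ge0.
have ha : -1 <= a <= 1.
  by have b0 := sqr_ge0 b; apply/andP; split; nra.
have hs : sin (acos a) = `|b|.
  by rewrite sin_acos// (_ : 1 - a ^+ 2 = b ^+ 2) ?sqrtr_sqr//; lra.
have p0 := acos_ge0 ha; have p1 := acos_lepi ha.
have [b0|b0] := lerP 0 b.
  exists (acos a); first by apply/andP; split=> //; have := pi_gt0 R; lra.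
  by rewrite /ex acosK// hs ger0_norm.
exists (- acos a); first by apply/andP; split=> //; have := pi_gt0 R; lra.
by rewrite /ex cosN sinN acosK// hs ltr0_norm// opprK.
Qed.

Lemma per_deriv F : per F -> exists2 F', cderiv F F' & per F'.
Proof.
move=> [[/smooth_deriv[f1 d1 s1] /smooth_deriv[f2 d2 s2]] h].
exists (fun t => f1 t +i* f2 t); first by split.
split; first by split.
move=> s t e; have sh u : F (u + (s - t)) = F u.
  by apply: h; rewrite !exD e [ex t * _]mulrC exNM mulr1.
have e1 : (fun u => f1 (u + (s - t))) = f1.
  apply: (deriv_uniq (f := fun u => Re (F u)) _ d1).
  by apply: deriv_ext (deriv_shift (s - t) d1) => // u; rewrite sh.
have e2 : (fun u => f2 (u + (s - t))) = f2.
  apply: (deriv_uniq (f := fun u => Im (F u)) _ d2).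
  by apply: deriv_ext (deriv_shift (s - t) d2) => // u; rewrite sh.
have := congr1 (@^~ t) e1; have := congr1 (@^~ t) e2; rewrite /= [t + _]addrC subrK.
by move=> -> ->.
Qed.

Lemma per_ci F : per F -> ci F.
Proof. by move=> [/csmooth_ci]. Qed.

Lemma csmooth_continuous F : csmooth F ->
  continuous (fun t => Re (F t)) /\ continuous (fun t => Im (F t)).
Proof.
move=> [h1 h2]; have [f1 d1 _] := h1 1%N; have [f2 d2 _] := h2 1%N.
by split; apply: deriv_continuous; [exact: d1 | exact: d2].
Qed.

Lemma cderiv_uniq F F1 F2 : cderiv F F1 -> cderiv F F2 -> F1 = F2.
Proof.
move=> [a1 b1] [a2 b2]; apply/funext => t; apply: complex_ext.
  by have /(congr1 (@^~ t)) := deriv_uniq a1 a2.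
by have /(congr1 (@^~ t)) := deriv_uniq b1 b2.
Qed.

Lemma per_mean_deriv F F' : per F -> cderiv F F' -> mean F' = 0.
Proof.
move=> pF d; have [F2 d2 [/csmooth_continuous[c1 c2] _]] := per_deriv pF.
rewrite (cderiv_uniq d d2); apply: (mean_deriv d2) => //.
by have [_ h] := pF; apply: h; rewrite ex_pi.
Qed.

Lemma per_bounded F : per F -> exists2 B, 0 <= B & forall t, rn (F t) <= B.
Proof.
move=> pF; have [B B0 hB] := ci_bounded (per_ci pF); exists B => // t.
have [|t' ht e] := @ex_onto (ex t); first by rewrite rnE rn_ex.
by have [_ h] := pF; rewrite -(h _ _ e); exact: hB.
Qed.

Lemma per_real (f : R -> R) : smooth f -> (forall s t, ex s = ex t :> R[i] -> f s = f t) ->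
  per (fun t => (f t)%:C).
Proof.
move=> sf h; split; last by move=> s t /h ->.
by split=> //= n; exact: Sm_cst.
Qed.

(** As a function of the shift, the integral over a period has derivative 0: its increment is the
    integral of a second-order Taylor remainder, since the first-order term integrates to 0 over the
    period. *)
Lemma RI_shift f s : per (fun t => (f t)%:C) -> RI (fun t => f (t + s)) = RI f.
Proof.
move=> pf; have [F' [d1 _] pF'] := per_deriv pf; have [F2 [d2 _] pF2] := per_deriv pF'.
move: d1 d2 => /= d1 d2.
pose g u := RI (fun t => f (t + u)).
have cs u : ri (fun t => f (t + u)) by have [] := per_ci (per_shift u pf).
have cs' u : ri (fun t => Re (F' (t + u))) by have [] := per_ci (per_shift u pF').
have [B B0 hB] := per_bounded pF2.
have z u : RI (fun t => Re (F' (t + u))) = 0.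
  rewrite (RI_FTC (deriv_shift u d1)).
    have [_ h] := per_shift u pf; have := h _ _ ex_pi => /complexI ->.
    by rewrite subrr.
  have [[_ _] _] := per_shift u pF'.
  by have [] := csmooth_continuous (per_shift u pF').1.
have p0 : 0 <= 2 * pi :> R by rewrite mulr_ge0 ?pi_ge0.
have dg u : is_derive u (1 : R) g 0.
  apply: (@is_derive_quad _ _ _ (2 * pi * B)) => h.
  have -> : g (h + u) - g u = RI (fun t => f (t + (h + u)) + (- 1 * f (t + u) + - h * Re (F' (t + u)))).
    have c1 : ri (fun t => - 1 * f (t + u)) by apply: riM => //; exact: ri_cst.
    have c2 : ri (fun t => - h * Re (F' (t + u))) by apply: riM => //; exact: ri_cst.
    by rewrite !RID ?RIZ ?z ?mulr0 ?addr0 ?mulN1r//; exact: riD.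
  set k := fun t => _.
  have ck : ri k.
    apply: riD => //; apply: riD; apply: riM => //; exact: ri_cst.
  have bk t : `|k t| <= B * h ^+ 2.
    have [c hc e1] := mvt (t + u) (t + (h + u)) d1.
    have [c' _ e2] := mvt (t + u) c d2.
    have -> : k t = Re (F2 c') * (c - (t + u)) * h.
      have -> : k t = (f (t + (h + u)) - f (t + u)) - h * Re (F' (t + u)) by rewrite /k; ring.
      by rewrite e1 -e2; ring.
    rewrite !normrM -mulrA; apply: ler_pM => //.
      exact: le_trans (rn_Re _) (hB _).
    have -> : h ^+ 2 = `|h| * `|h| by rewrite -normrM -expr2 ger0_norm ?sqr_ge0.
    rewrite ler_wpM2r//; apply: le_trans hc _; rewrite le_eqVlt; apply/orP; left.
    by apply/eqP; congr `|_|; ring.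
  rewrite -mulrA -RI_cst ler_norml; apply/andP; split.
    rewrite -mulN1r -RIZ; last exact: ri_cst.
    apply: RI_le => //; first by apply: riM; exact: ri_cst.
    by move=> t _; have := bk t; rewrite mulN1r ler_norml => /andP[].
  apply: RI_le => //; first exact: ri_cst.
  by move=> t _; have := bk t; rewrite ler_norml => /andP[].
have := is_derive_0_is_cst s 0 dg; rewrite /g => ->.
by apply: RI_ext => t _; rewrite addr0.
Qed.

Lemma mean_shift F s : per F -> mean (fun t => F (t + s)) = mean F.
Proof.
move=> [[s1 s2] h]; rewrite /mean.
rewrite (RI_shift (f := fun t => Re (F t))); last by apply: per_real => // u v /h ->.
by rewrite (RI_shift (f := fun t => Im (F t)))//; apply: per_real => // u v /h ->.
Qed.

Definition fc F (n : int) : R[i] := mean (fun t => F t * ex (- (n%:~R * t))).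

Lemma per_exN (n : int) : per (fun t => ex (- (n%:~R * t))).
Proof.
have := per_ex (- n); congr per; apply/funext => t.
by rewrite rmorphN /= mulNr.
Qed.

Lemma mean_ex (n : int) : mean (fun t => ex (n%:~R * t)) = (n == 0)%:R :> R[i].
Proof.
have [->|n0] := eqVneq n 0.
  by rewrite -[RHS](mean_cst 1); apply: mean_ext => t _; rewrite mul0r ex0.
have := per_mean_deriv (per_ex n) (cderiv_ex (n%:~R : R)).
rewrite meanZ; last exact: per_ci (per_ex n).
move/eqP; rewrite mulf_eq0 => /orP[|/eqP //].
by rewrite eq_complex /= eqxx intr_eq0 (negbTE n0).
Qed.

Lemma fc_deriv F F' n : per F -> per F' -> cderiv F F' ->
  fc F' n = (0 +i* n%:~R) * fc F n.
Proof.
move=> pF pF' d; have pe := per_exN n.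
have de : cderiv (fun t => ex (- (n%:~R * t))) (fun t => - (0 +i* n%:~R) * ex (- (n%:~R * t)) : R[i]).
  have := cderiv_ex (- n%:~R : R); congr cderiv; apply/funext => t; rewrite mulNr//.
  by congr (_ * _); apply: complex_ext; rewrite /= ?oppr0.
have cF := per_ci (perM pF pe); have cF' := per_ci (perM pF' pe).
have := per_mean_deriv (perM pF pe) (cderivM d de).
have -> : (fun t => F' t * ex (- (n%:~R * t)) + F t * (- (0 +i* n%:~R) * ex (- (n%:~R * t))))
  = (fun t => F' t * ex (- (n%:~R * t)) + - (0 +i* n%:~R) * (F t * ex (- (n%:~R * t)))).
  by apply/funext => t; ring.
rewrite meanD// ?meanZ//; last by apply: ciM => //; exact: ci_cst.
by rewrite mulNr => /eqP; rewrite subr_eq0 => /eqP.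
Qed.

(** Induction on [k]: the extra factor |n| + 1 is shared between F and its derivative, whose n-th
    coefficient is the n-th coefficient of F multiplied by i n. *)
Lemma fc_decay F (k : nat) : per F ->
  exists2 C, 0 <= C & forall n, rn (fc F n) <= C * (absz n).+1%:R ^- k.
Proof.
suff h : per F -> exists2 C, 0 <= C & forall n, rn (fc F n) * (absz n).+1%:R ^+ k <= C.
  by move=> /h[C C0 hC]; exists C => // n; rewrite ler_pdivlMr ?exprn_gt0.
elim: k F => [|k ih] F pF.
  have [B B0 hB] := per_bounded pF; exists (2 * B); first by rewrite mulr_ge0.
  move=> n; rewrite expr0 mulr1; apply: mean_le => //.
    exact: per_ci (perM pF (per_exN n)).
  by move=> t _; rewrite rnM rn_ex mulr1.
have [F' d pF'] := per_deriv pF.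
have [C1 C10 h1] := ih _ pF; have [C2 C20 h2] := ih _ pF'.
exists (C1 + C2); first by rewrite addr_ge0.
move=> n; have := lerD (h1 n) (h2 n); apply: le_trans.
rewrite (fc_deriv n pF pF' d) rnM -mulrDl exprS mulrA ler_wpM2r ?exprn_ge0//.
rewrite -[X in X + _]mul1r -mulrDl mulrC ler_wpM2r ?rn_ge0//.
rewrite -natr1 [_ + 1]addrC lerD2l rn_sqrt /= expr0n add0r sqrtr_sqr.
by rewrite -intr_norm -abszE.
Qed.

End Fourier.

(** * Fourier inversion and convolution *)

Section Inversion.
Context (R : realType).
Implicit Types (f g : R -> R) (F G : R -> R[i]).
Local Notation Re := (@complex.Re R).
Local Notation Im := (@complex.Im R).

Local Notation chsum := (@hsum R (R[i]^o : normedModType R[i]) _).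

Lemma chsumZ (I : eqType) (c : R[i]) (x : I -> R[i]) s : @hsum R R[i]^o I x s ->
  @hsum R R[i]^o I (fun i => c * x i) (c * s).
Proof.
apply: (hsum_map (V := R[i]^o) (W := R[i]^o) (C := rn c) (A := fun z => c * z)).
- by move=> k a b; rewrite /GRing.scale /=; ring.
- exact: rn_ge0.
- by move=> v; rewrite rnM.
Qed.

Lemma asum_fc F : per F -> asum (fun n => rn (fc F n) : R).
Proof. by move=> /(fc_decay 2)[C C0 h]; exact: (asum_le C0 h (asum_wgt R)). Qed.

Lemma exN_conj (n : int) t : ex (- (n%:~R * t)) = (ex (n%:~R * t))^* :> R[i].
Proof. exact: exN. Qed.

(** Stated for functions merely continuous on the interval, since it is applied to the quotient of
    [per_quotient], whose coefficients must be shown to tend to 0. *)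
Lemma bessel q : ci q -> asum (fun n => rn (fc q n) ^+ 2 : R).
Proof.
move=> cq; pose e n t : R[i] := ex (n%:~R * t).
have ce n : ci (e n) by exact: per_ci (per_ex R n).
have fcE n : fc q n = mean (fun t => q t * (e n t)^*).
  by apply: mean_ext => t _; rewrite exN_conj.
have orth m n : mean (fun t => e m t * (e n t)^*) = (m == n)%:R.
  rewrite -subr_eq0 -(mean_ex R (m - n)); apply: mean_ext => t _.
  by rewrite /e -exN -exD rmorphB /= mulrBl.
exists (Re (mean (fun t => q t * (q t)^*))) => S uS.
pose P t := \sum_(n <- S) fc q n * e n t.
have cP : ci P by apply: ci_sum => n; apply: ciM => //; exact: ci_cst.
pose D t := q t + -1 * P t.
have cD : ci D by apply: ciD => //; apply: ciM => //; exact: ci_cst.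
have cc F : ci F -> ci (fun t => (F t)^*) by exact: ci_conj.
have mP G : ci G -> mean (fun t => P t * G t) = \sum_(n <- S) fc q n * mean (fun t => e n t * G t).
  move=> cG; have h n : ci (fun t => fc q n * e n t * G t).
    by apply: ciM => //; apply: ciM => //; exact: ci_cst.
  transitivity (mean (fun t => \sum_(n <- S) fc q n * e n t * G t)).
    by apply: mean_ext => t _; rewrite mulr_suml.
  rewrite (mean_sum _ h).
  by apply: eq_bigr => n _; rewrite -meanZ; [apply: mean_ext => t _; rewrite mulrA | exact: ciM].
have mD G : ci G -> mean (fun t => D t * G t) =
    mean (fun t => q t * G t) - \sum_(n <- S) fc q n * mean (fun t => e n t * G t).
  move=> cG; rewrite -mP// -mulN1r -meanZ; last exact: ciM.
  rewrite -meanD; [by apply: mean_ext => t _; rewrite /D; ring | exact: ciM |].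
  by apply: ciM; [exact: ci_cst | exact: ciM].
(* The remainder [D] is orthogonal to the chosen exponentials, so its squared norm is that of [q]
   minus the finite sum. *)
have z n : n \in S -> mean (fun t => D t * (e n t)^*) = 0.
  move=> nS; rewrite mD; last exact: cc.
  rewrite (bigD1_seq n)//= orth eqxx mulr1 big1 => [|m mn]; last by rewrite orth (negbTE mn) mulr0.
  by rewrite addr0 -fcE subrr.
have E : mean (fun t => D t * (D t)^*) = mean (fun t => q t * (q t)^*) - (\sum_(n <- S) rn (fc q n) ^+ 2)%:C.
  have -> : mean (fun t => D t * (D t)^*) = mean (fun t => D t * (q t)^*).
    have mC G : ci G -> mean (fun t => D t * (G t)^*) = (mean (fun t => G t * (D t)^*))^*.
      by move=> cG; rewrite -mean_conj; [apply: mean_ext => t _; rewrite rmorphM /= conjCK mulrC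
        | apply: ciM => //; exact: cc].
    have PD : mean (fun t => P t * (D t)^*) = 0.
      rewrite mP; last exact: cc.
      apply: big1_seq => n /= nS; have := mC _ (ce n); rewrite z// => /(congr1 Num.conj).
      by rewrite conjCK rmorph0 => <-; rewrite mulr0.
    rewrite (mC _ cD) (mC _ cq); congr Num.conj.
    have -> : mean (fun t => q t * (D t)^*) = mean (fun t => D t * (D t)^*) + mean (fun t => P t * (D t)^*).
      by rewrite -meanD; [apply: mean_ext => t _; rewrite /D; ring | apply: ciM => //; exact: cc..].
    by rewrite PD addr0.
  rewrite mD; last exact: cc.
  congr (_ - _); rewrite rmorph_sum /=; apply: eq_bigr => n _.
  have -> : mean (fun t => e n t * (q t)^*) = (fc q n)^*.
    rewrite fcE -mean_conj; last by apply: ciM => //; exact: cc.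
    by apply: mean_ext => t _; rewrite rmorphM /= conjCK mulrC.
  by rewrite -normCK rnE rmorphXn.
have : 0 <= Re (mean (fun t => D t * (D t)^*)).
  have p0 : 0 <= (2 * pi)^-1 :> R by rewrite invr_ge0 mulr_ge0// pi_ge0.
  rewrite /= mulr_ge0//; have {1}-> : 0 = RI (fun=> 0) :> R by rewrite RI_cst mulr0.
  apply: RI_le; [exact: ri_cst | by have [] := ciM cD (cc _ cD) |].
  by move=> t _; rewrite -normCK rnE -rmorphXn /= sqr_ge0.
by rewrite E ReD /= subr_ge0.
Qed.

Lemma diffquot_continuous f f' : deriv f f' -> continuous f' ->
  continuous (fun t => if t == 0 then f' 0 else (f t - f 0) / t).
Proof.
move=> d cf' t; have cf := deriv_continuous d; have [->|t0] := eqVneq t 0.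
  apply/cvgrPdist_lt => e e0; have /cvgrPdist_lt/(_ _ e0) := cf' 0.
  move=> /nbhs_ballP[r r0 h]; apply/nbhs_ballP; exists r => // u.
  rewrite /ball /= !sub0r !normrN eqxx => hu.
  have [_|u0] := eqVneq u 0; first by rewrite subrr normr0.
  have [c hc e1] := mvt 0 u d; rewrite !subr0 in hc e1.
  have -> : (f u - f 0) / u = f' c by rewrite e1 mulfK.
  by apply: h; rewrite /ball /= sub0r normrN; apply: le_lt_trans hc _.
rewrite /continuous_at (negbTE t0).
have c : (fun u => (f u - f 0) / u) @ t --> (f t - f 0) / t.
  apply: cvgM; last exact: cvgV.
  by apply: cvgB; [exact: cf | exact: cvg_cst].
apply: cvg_trans c; apply: near_eq_cvg.
exists `|t|; first by rewrite /= normr_gt0.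
move=> u /= tu; suff /negbTE -> : u != 0 by [].
by apply: contraTneq tu => ->; rewrite subr0 ltxx.
Qed.

Lemma riV f : continuous f -> (forall t, - pi <= t <= pi -> f t != 0) -> ri (fun t => (f t)^-1).
Proof.
move=> cf f0; apply: continuous_in_subspaceT => t; rewrite inE /= in_itv /= => /f0 h.
by apply: cvgV => //; exact: cf.
Qed.

(** Isolates the zero of e^(it) - 1 at t = 0, its only one in [-pi, pi], so that [per_quotient] can
    divide by the remaining factor. *)
Lemma sin_half_quot : exists2 h : R -> R, continuous h &
  (forall t, sin (2^-1 * t) = t * h t) /\ forall t, - pi <= t <= pi -> h t != 0.
Proof.
have d := deriv_sin_mul (2^-1 : R).
have cf' : continuous (fun t : R => 2^-1 * cos (2^-1 * t)).
  have [c _] := csmooth_continuous (csmooth_ex (2^-1 : R)).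
  by move=> t; apply: cvgM; [exact: cvg_cst | exact: c].
have c := diffquot_continuous d cf'; move: c => /=; set h := (X in continuous X) => ch.
exists h => //; split=> [t|t ht]; rewrite /h.
  have [->|t0] := eqVneq t 0; first by rewrite mulr0 sin0 mul0r.
  by rewrite mulr0 sin0 subr0 [RHS]mulrC divfK.
have [_|t0] := eqVneq t 0; first by rewrite mulr0 cos0 mulr1 invr_eq0.
rewrite mulr0 sin0 subr0 mulf_eq0 invr_eq0 (negbTE t0) orbF.
have pp := pi_gt0 R; have /andP[t1 t2] := ht.
have [tp|tn] := ltP 0 t; first by rewrite gt_eqF// sin_gt0_pi//; apply/andP; split; lra.
have tn' : t < 0 by rewrite lt_neqAle t0.
rewrite -oppr_eq0 -sinN gt_eqF// sin_gt0_pi//; apply/andP; split; lra.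
Qed.

Lemma ex_sub1 t : ex t - 1 = (0 +i* (2 * sin (2^-1 * t))) * ex (2^-1 * t) :> R[i].
Proof.
have -> : ex t = ex (2^-1 * t) * ex (2^-1 * t) :> R[i].
  by rewrite -exD; congr ex; lra.
have h : cos (2^-1 * t) ^+ 2 = 1 - sin (2^-1 * t) ^+ 2 by have := cos2Dsin2 (2^-1 * t); lra.
rewrite /ex; move: (cos _) (sin _) h => c s h.
have h1 := h; rewrite expr2 in h1.
by apply: complex_ext; rewrite ?ReD ?ImD ?ReM ?ImM /= ?h1; ring.
Qed.

Lemma per_quotient F : per F -> exists2 q, ci q &
  forall t, - pi <= t <= pi -> F t - F 0 = (ex t - 1) * q t.
Proof.
move=> pF; have [F' [d1 d2] [/csmooth_continuous[c1 c2] _]] := per_deriv pF.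
have [h ch [hE h0]] := sin_half_quot.
pose dq (f f' : R -> R) t := if t == 0 then f' 0 else (f t - f 0) / t.
have dqE f f' t : f t - f 0 = t * dq f f' t.
  rewrite /dq; have [->|t0] := eqVneq t 0; first by rewrite subrr mul0r.
  by rewrite [RHS]mulrC divfK.
pose Q t := dq (fun t => Re (F t)) (fun t => Re (F' t)) t +i* dq (fun t => Im (F t)) (fun t => Im (F' t)) t.
have cQ : ci Q by split; apply: ri_continuous; exact: diffquot_continuous.
have rh := riV ch h0.
exists (fun t => (0 +i* (- 2^-1)) * (Q t * ((h t)^-1)%:C) * ex (- 2^-1 * t)).
  apply: ciM; last exact: csmooth_ci (csmooth_ex _).
  apply: ciM; first exact: ci_cst.
  by apply: ciM => //; exact: ci_real.
move=> t ht; rewrite ex_sub1 hE.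
have -> : F t - F 0 = t%:C * Q t.
  apply: complex_ext; rewrite ?ReM ?ImM /= ?mul0r ?subr0 ?addr0 -dqE.
    by case: (F t); case: (F 0).
  by case: (F t); case: (F 0).
have -> : 0 +i* (2 * (t * h t)) = (0 +i* 2) * t%:C * (h t)%:C :> R[i].
  by apply: complex_ext; rewrite !(ReM, ImM) /=; ring.
have e1 : ex (2^-1 * t) * ex (- 2^-1 * t) = 1 :> R[i] by rewrite mulNr mulrC exNM.
have e2 : (h t)%:C * ((h t)^-1)%:C = 1 :> R[i] by rewrite -rmorphM /= mulfV ?h0.
have e3 : (0 +i* 2) * (0 +i* (- 2^-1)) = 1 :> R[i].
  by apply: complex_ext; rewrite !(ReM, ImM) /=; lra.
transitivity (t%:C * Q t * ((0 +i* 2) * (0 +i* (- 2^-1))) * ((h t)%:C * ((h t)^-1)%:C)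
   * (ex (2^-1 * t) * ex (- 2^-1 * t))).
  by rewrite e1 e2 e3 !mulr1.
by ring.
Qed.

(** Writing F(t) - F(0) = (e^(it) - 1) q(t), the coefficients of F, diminished by F(0) at n = 0,
    telescope into differences of coefficients of q, which tend to 0 by Bessel's inequality. *)
Lemma fc_inversion0 F : per F -> chsum (fun n => fc F n) (F 0).
Proof.
move=> pF; have [q cq qE] := per_quotient pF.
have step n : fc F n - F 0 * (n == 0)%:R = fc q (n - 1) - fc q n.
  have ce (m : int) : ci (fun t : R => ex (- (m%:~R * t))) by exact: per_ci (per_exN R m).
  have -> : F 0 * (n == 0)%:R = mean (fun t => F 0 * ex (- (n%:~R * t))).
    rewrite meanZ//; congr (_ * _); rewrite -oppr_eq0 -(mean_ex R).
    by apply: mean_ext => t _; rewrite rmorphN /= mulNr.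
  have mN G : ci G -> - mean G = mean (fun t => -1 * G t) by move=> cG; rewrite meanZ// mulN1r.
  have cN G : ci G -> ci (fun t => -1 * G t) by move=> cG; apply: ciM => //; exact: ci_cst.
  have cA : ci (fun t => F t * ex (- (n%:~R * t))) by apply: ciM => //; exact: per_ci.
  have cB : ci (fun t => F 0 * ex (- (n%:~R * t))) by apply: ciM => //; exact: ci_cst.
  have cC m : ci (fun t => q t * ex (- (m%:~R * t))) by exact: ciM.
  rewrite /fc (mN _ cB) (mN _ (cC n)) -(meanD cA (cN _ cB)) -(meanD (cC _) (cN _ (cC _))).
  apply: mean_ext => t /qE h.
  have -> : F t * ex (- (n%:~R * t)) + -1 * (F 0 * ex (- (n%:~R * t)))
     = (F t - F 0) * ex (- (n%:~R * t)) by ring.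
  have -> : ex (- ((n - 1)%:~R * t)) = ex t * ex (- (n%:~R * t)) :> R[i].
    by rewrite -exD rmorphB /=; congr ex; ring.
  by rewrite h; ring.
apply: hsum_limit.
  by apply: hsum_exists_complete; [exact: complex_complete | exact: asum_fc].
have E N : \sum_(n <- zbox N) fc F n = F 0 + (fc q (- N.+1%:Z) - fc q N).
  elim: N => [|N ih].
    rewrite /zbox /= big_cons big_nil addr0.
    by have := step 0; rewrite eqxx mulr1 => /(congr1 (fun z => F 0 + z)); rewrite addrC subrK.
  rewrite sum_zboxS ih.
  have := step N.+1; have := step (- N.+1%:Z); rewrite /= !mulr0 !subr0 => -> ->.
  have -> : N.+1%:Z - 1 = N by lia.
  have -> : - N.+1%:Z - 1 = - N.+2%:Z by lia.
  by ring.
apply/cvg_rn => e e0; have e2 : 0 < e / 2 by rewrite divr_gt0.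
have [S0 u0 hS] := asum_tail (bessel cq) (exprn_gt0 2 e2).
have [N0 sN] := zbox_sup S0.
have small n : n \notin zbox N0 -> rn (fc q n) < e / 2.
  move=> nN; rewrite -(ltr_pXn2r (n:=2))// ?nnegrE ?rn_ge0// ?ltW//.
  have := hS [:: n] isT; rewrite big_seq1; apply=> i; rewrite inE => /eqP ->.
  by apply: contra nN; exact: sN.
exists N0.+1 => N lN; rewrite sum_zbox E addrAC subrr add0r (splitr e).
apply: le_lt_trans (rnB _ _) _; rewrite ltrD// small// mem_zbox; lia.
Qed.

Lemma fc_shift F s n : per F -> fc (fun t => F (t + s)) n = ex (n%:~R * s) * fc F n.
Proof.
move=> pF; have pe := perM pF (per_exN R n); rewrite /fc.
have <- := mean_shift s pe; rewrite -meanZ; last exact: per_ci (per_shift s pe).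
apply: mean_ext => t _; rewrite mulrCA -exD; congr (_ * ex _); ring.
Qed.

Lemma fc_inversion F t : per F -> chsum (fun n => ex (n%:~R * t) * fc F n) (F t).
Proof.
move=> pF; have := fc_inversion0 (per_shift t pF); rewrite add0r; apply: hsum_ext => n.
exact: fc_shift.
Qed.

(** The Weierstrass test along finite subsets: the tail of [a] gives one estimate valid for all
    parameters in [D]. *)
Lemma hsum_unif (I : eqType) (V : normedModType R[i]) (X : Type) (D : set X) (x : X -> I -> V) s
    (a : I -> R) : asum a -> (forall t i, D t -> rn (x t i) <= a i) ->
  (forall t, D t -> hsum (x t) (s t)) ->
  forall e, 0 < e -> exists S0 : seq I, forall S, uniq S -> {subset S0 <= S} ->
    forall t, D t -> rn (\sum_(i <- S) x t i - s t) <= e.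
Proof.
move=> aa xa h e e0; have e2 : 0 < e / 2 by rewrite divr_gt0.
have [S0 u0 h0] := asum_tail aa e2; exists S0 => S uS sS t Dt.
have [S1 h1] := h t Dt _ e2; pose T := undup (S ++ S1).
have sT : {subset S <= T} by move=> i hi; rewrite mem_undup mem_cat hi.
have uT : uniq T by exact: undup_uniq.
apply: le_trans (rn_tri _ (\sum_(i <- T) x t i) _) _; rewrite (splitr e) lerD//.
  rewrite rn_distC (big_subset_split (x t) uS uT sT) addrAC subrr add0r.
  apply: le_trans (rn_sum _ _ _) _.
  apply: le_trans (_ : \sum_(i <- [seq i <- T | i \notin S]) a i <= _).
    by apply: ler_sum => i _; exact: xa.
  apply/ltW/h0; first exact: filter_uniq.
  by move=> i; rewrite mem_filter => /andP[+ _]; apply: contra; exact: sS.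
by apply/ltW/h1 => // i hi; rewrite mem_undup mem_cat hi orbT.
Qed.

Lemma mean_hsum (a : int -> R[i]) G H : asum (fun n => rn (a n) : R) -> ci G -> ci H ->
  (forall t, - pi <= t <= pi -> chsum (fun n => a n * ex (n%:~R * t) * G t) (H t)) ->
  chsum (fun n => a n * mean (fun t => ex (n%:~R * t) * G t)) (mean H).
Proof.
move=> aa cG cH h e e0; have [B B0 hB] := ci_bounded cG.
have aB : asum (fun n => B * rn (a n) : R) by apply: (asum_le B0 _ aa).
have e4 : 0 < e / 4 by rewrite divr_gt0.
have [|S0 hS] := hsum_unif (D := [set t | - pi <= t <= pi]) aB _ h e4.
  by move=> t n /hB ht; rewrite !rnM rn_ex mulr1 mulrC ler_wpM2r ?rn_ge0.
exists S0 => S uS sS.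
have cx n : ci (fun t => ex (n%:~R * t) * G t) by apply: ciM => //; exact: per_ci (per_ex R n).
have cs n : ci (fun t => a n * (ex (n%:~R * t) * G t)) by apply: ciM => //; exact: ci_cst.
have cS := ci_sum S cs.
have cN : ci (fun t => -1 * H t) by apply: ciM => //; exact: ci_cst.
have -> : \sum_(n <- S) a n * mean (fun t => ex (n%:~R * t) * G t) - mean H
   = mean (fun t => \sum_(n <- S) a n * (ex (n%:~R * t) * G t) + -1 * H t).
  rewrite meanD// (mean_sum S cs) meanZ// mulN1r; congr (_ - _).
  by apply: eq_bigr => n _; rewrite meanZ.
apply: le_lt_trans (mean_le (B := e / 4) _ _ _) _.
- exact: ciD.
- exact: ltW.
- move=> t ht; have := hS S uS sS t ht; rewrite mulN1r.
  by under eq_bigr do rewrite -mulrA.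
- by lra.
Qed.

(** The inversion formula for F is inserted into the n-th coefficient of F G and integrated term by
    term. *)
Lemma fc_conv F G n : per F -> per G ->
  chsum (fun j => fc F j * fc G (n - j)) (fc (fun t => F t * G t) n).
Proof.
move=> pF pG; have cG := per_ci (perM pG (per_exN R n)).
have cH := per_ci (perM (perM pF pG) (per_exN R n)).
have h t : - pi <= t <= pi -> chsum (fun j => fc F j * ex (j%:~R * t) * (G t * ex (- (n%:~R * t))))
    (F t * G t * ex (- (n%:~R * t))).
  move=> _; have -> : F t * G t * ex (- (n%:~R * t)) = G t * ex (- (n%:~R * t)) * F t by ring.
  by apply: hsum_ext (chsumZ _ (fc_inversion t pF)) => j; ring.
have := mean_hsum (asum_fc pF) cG cH h; apply: hsum_ext => j; congr (_ * _).
apply: mean_ext => t _; rewrite mulrCA -exD; congr (_ * ex _).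
by rewrite rmorphB /=; ring.
Qed.

End Inversion.

(** * Functions on the circle, cut-offs and mollifiers *)

Section Circle.
Context (R : realType).
Local Notation circle := (set_type (S1 R)).
Implicit Types (z w : circle) (f g : circle -> R[i]) (I : set circle) (s t : R).
Local Notation Re := (@complex.Re R).
Local Notation Im := (@complex.Im R).
Local Notation support := (@Defs.support R).

Lemma val_expi t : set_val (expi t) = ex t.
Proof. by []. Qed.

Lemma circle_inj z w : set_val z = set_val w -> z = w.
Proof. exact: val_inj. Qed.

Lemma expi_onto z : exists2 t, - pi <= t <= pi & expi t = z.
Proof.
have [t ht e] := @ex_onto R (set_val z) (set_mem (valP z)).
by exists t => //; apply: circle_inj.
Qed.

Lemma expi_eq s t : ex s = ex t :> R[i] -> expi s = expi t.
Proof. by move=> h; exact: circle_inj. Qed.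

Lemma nbhs_circle z (e : R) : 0 < e -> nbhs z [set w | rn (set_val z - set_val w : R[i]) < e].
Proof.
move=> e0; have c := @initial_continuous circle R[i]^o set_val z.
apply: (c [set w : R[i]^o | rn (set_val z - w : R[i]) < e]).
apply/nbhs_ballP; exists e%:C; first by rewrite /= ltcR.
by move=> w; rewrite -ball_normE /= rnE ltcR.
Qed.

Lemma open_circle I z : open I -> I z ->
  exists2 e : R, 0 < e & forall w, rn (set_val z - set_val w : R[i]) < e -> I w.
Proof.
move=> [U oU <-] Uz; have /nbhs_ballP[e] := open_nbhs_nbhs (conj oU Uz).
rewrite /= ltcE => /andP[/eqP e1 e0] h; exists (Re e) => //= w hw.
by apply: h; rewrite -ball_normE /= rnE ltcE /= e1 eqxx.
Qed.

Lemma closure_circle (A : set circle) z (e : R) : closure A z -> 0 < e ->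
  exists2 w, A w & rn (set_val z - set_val w : R[i]) < e.
Proof. by move=> cA e0; have [w [Aw hw]] := cA _ (nbhs_circle z e0); exists w. Qed.

Lemma ex_lipschitz s t : rn (ex s - ex t : R[i]) <= 2 * `|s - t|.
Proof.
have key (h h' : R -> R) : deriv h h' -> (forall x : R, `|h' x| <= 1) -> `|h s - h t| <= `|s - t|.
  move=> d hb; have [c _ ->] := mvt t s d.
  by rewrite normrM ler_piMl.
have hc := key _ _ (fun t => is_derive_cos t).
have hs := key _ _ (fun t => is_derive_sin t) (@cos_max R).
apply: le_trans (rn_le _) _; rewrite mulr2n mulrDl mul1r /ex /= lerD//.
by apply: hc => x; rewrite normrN sin_max.
Qed.

(* a Lebesgue number for a compact subset of an open set *)
Lemma closed_thickening (K I : set circle) : closed K -> open I -> K `<=` I ->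
  exists2 d : R, 0 < d & forall z w, K z -> rn (set_val z - set_val w : R[i]) < d -> I w.
Proof.
move=> cK oI KI.
pose P (d : R) (t : R) := forall w, K (expi t) -> rn (ex t - set_val w : R[i]) < d -> I w.
have cpt := @segment_compact R (- pi) pi.
have ct x : closure [set` `[(- pi : R), pi]] x -> True by [].
have near : \forall d \near (0 : R)^'+, [set` `[(- pi : R), pi]] `<=` P d.
  apply: ((compact_near_coveringP _).1 cpt R _ P) => t _.
  have [Kt|Kt] := pselect (K (expi t)).
    have [r r0 hr] := open_circle oI (KI _ Kt).
    have r4 : 0 < r / 4 by rewrite divr_gt0.
    exists ([set u | `|t - u| < r / 4], [set d | 0 < d < r / 4]) => /=.
      split; first by apply/nbhs_ballP; exists (r / 4).
      by exists (r / 4) => //= d; rewrite /ball /= sub0r normrN => h d0;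
        rewrite d0 /= (le_lt_trans _ h) ?ler_norm.
    move=> [u d] /= [hu /andP[d0 hd]] w _ hw; apply: hr; rewrite val_expi.
    apply: le_lt_trans (rn_tri _ (ex u) _) _.
    have := ex_lipschitz t u; lra.
  have [r r0 hr] := open_circle (closed_openC cK) Kt.
  have r2 : 0 < r / 2 by rewrite divr_gt0.
  exists ([set u | `|t - u| < r / 2], setT) => /=.
    by split; [apply/nbhs_ballP; exists (r / 2) | exact: filterT].
  move=> [u d] /= [hu _] w Ku _; exfalso; apply: (hr (expi u)) => //; rewrite !val_expi.
  by apply: le_lt_trans (ex_lipschitz _ _) _; lra.
have [d [d0 hd]] : exists d, 0 < d /\ [set` `[(- pi : R), pi]] `<=` P d.
  have h : \forall d \near (0 : R)^'+, 0 < d /\ [set` `[(- pi : R), pi]] `<=` P d.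
    by near=> d; split; near: d; [exact: nbhs_right_gt | exact: near].
  by have [d] := filter_ex h; exists d.
exists d => // z w Kz hw; have [t ht e] := expi_onto z.
by apply: (hd t); rewrite -?val_expi ?e// /= in_itv.
Unshelve. all: by end_near. Qed.

Lemma rot_S1 s z : (set_val z * ex s : R[i]^o) \in S1 R.
Proof.
apply/mem_set; rewrite /S1 /= normrM (set_mem (valP z)) mul1r.
exact: (set_mem (expi_S1 s)).
Qed.

Lemma rn_circle z : rn (set_val z : R[i]) = 1.
Proof. by rewrite /rn (set_mem (valP z)). Qed.

Definition rot s z : circle := @exist _ (fun c => c \in S1 R) _ (rot_S1 s z).

Lemma rot_expi s t : rot s (expi t) = expi (t + s).
Proof. by apply: circle_inj; rewrite /= val_expi exD. Qed.

Lemma smooth_circleP f : smooth_circle f <-> csmooth (fun t => f (expi t)).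
Proof. by split=> -[/smooth_realP h1 /smooth_realP h2]; split. Qed.

Lemma smooth_per f : smooth_circle f -> per (fun t => f (expi t)).
Proof. by move=> /smooth_circleP h; split=> // s t /expi_eq ->. Qed.

Lemma fourierE f n : fourier f n = fc (fun t => f (expi t)) n.
Proof. by []. Qed.

Lemma support_open (I : set circle) f d : 0 < d ->
  (forall z w, f z != 0 -> rn (set_val z - set_val w : R[i]) < d -> I w) -> support f `<=` I.
Proof.
move=> d0 h z /closure_circle/(_ d0)[w fw hw]; apply: (h w) => //.
by rewrite rn_distC.
Qed.

Lemma support_sub (I : set circle) f g : (forall z, f z != 0 -> g z != 0) ->
  support g `<=` I -> support f `<=` I.
Proof. by move=> h; apply: subset_trans; exact: closureS. Qed.

(** The support is compact in the open set I, so a whole neighbourhood of fixed width lies in I;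
    rotations by smaller angles stay inside it. *)
Lemma support_rot (I : set circle) f : open I -> support f `<=` I ->
  exists2 e : R, 0 < e & forall s, `|s| < e -> support (fun z => f (rot s z)) `<=` I.
Proof.
move=> oI fI; have [d d0 hd] := closed_thickening (@closed_closure _ _) oI fI.
have d4 : 0 < d / 4 by rewrite divr_gt0.
exists (d / 4) => // s hs; apply: (support_open d4) => z w fz hw.
apply: (hd (rot s z)); first exact: subset_closure.
apply: le_lt_trans (rn_tri _ (set_val z) _) _.
have -> : rn (set_val (rot s z) - set_val z : R[i]) = rn (ex s - ex 0 : R[i]).
  have -> : set_val (rot s z) - set_val z = set_val z * (ex s - ex 0) :> R[i].
    by rewrite ex0 mulrBr mulr1.
  by rewrite rnM rn_circle mul1r.
by have := ex_lipschitz s 0; rewrite subr0; lra.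
Qed.

Lemma grid (e : R) : 0 < e -> exists S : seq R, forall t, - pi <= t <= pi ->
  exists2 s, s \in S & `|t - s| <= e.
Proof.
move=> e0; exists [seq - pi + j%:R * e | j <- iota 0 (Num.truncn (2 * pi / e)).+1] => t /andP[t1 t2].
pose j := Num.truncn ((t + pi) / e).
have x0 : 0 <= (t + pi) / e by rewrite divr_ge0 ?(ltW e0)//; lra.
have /andP[j1 j2] := truncn_itv x0; rewrite -/j in j1 j2.
exists (- pi + j%:R * e).
  apply: (map_f (fun j : nat => - pi + j%:R * e)); rewrite mem_iota add0n ltnS /=.
  by apply: le_truncn; rewrite ler_pM2r ?invr_gt0//; lra.
rewrite ler_pdivlMr// in j1; rewrite ltr_pdivrMr// -natr1 mulrDl mul1r in j2.
by rewrite ger0_norm; lra.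
Qed.

(** The squared chordal distance to e^(is) is an affine function of the cosine of the angle, so
    transition functions of the real part are smooth cut-offs around e^(is). *)
Lemma Re_rn z s : Re (set_val z * (ex s)^*) = 1 - rn (set_val z - ex s : R[i]) ^+ 2 / 2.
Proof.
have [t _ <-] := expi_onto z; rewrite val_expi rn_sqrt sqr_sqrtr ?addr_ge0 ?sqr_ge0//.
rewrite ReM /ex /=; have := cos2Dsin2 t; have := cos2Dsin2 s; rewrite !expr2 => *; lra.
Qed.

(** The cut-off is 1 minus the product of 1 - [step] over the points of a fine grid near the
    support. On the support some factor vanishes; away from it all factors are 1. *)
Lemma bump (I : set circle) f : open I -> smooth_circle f -> support f `<=` I -> exists chi,
  [/\ smooth_circle chi, support chi `<=` I & forall z, f z * chi z = f z].
Proof.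
move=> oI sf fI; have [d d0 hd] := closed_thickening (@closed_closure _ _) oI fI.
have d16 : 0 < d / 16 by rewrite divr_gt0.
have [S hS] := grid d16.
(* Thresholds for the chordal distances d/4, from which on the step is 0, and d/8, up to which it is
   1. The mesh d/16 is doubled by the Lipschitz constant of [ex]; the margins d/8 + d/4 + d/4 stay
   below d. *)
pose a := 1 - (d / 4) ^+ 2 / 2; pose b := 1 - (d / 8) ^+ 2 / 2.
have ab : a < b by rewrite /a /b; nra.
pose J := [seq s <- S | asbool (exists2 z, support f z & rn (set_val z - ex s : R[i]) <= d / 8)].
pose p (r : seq R) z := \prod_(s <- r) (1 - step a b (Re (set_val z * (ex s)^*))).
have smp r : smooth (fun t => p r (expi t)).
  move=> n; elim: r => [|s r ih].
    by rewrite (_ : (fun t => _) = fun=> 1); [exact: Sm_cst | apply/funext => t; rewrite /p big_nil].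
  rewrite (_ : (fun t => _) = fun t => (1 + - step a b (cos (t - s))) * p r (expi t)).
    apply: SmM ih; apply: SmD; first exact: Sm_cst.
    apply: SmN; apply: (Sm_comp (smooth_step ab n)); apply: (Sm_comp (Sm_cos_sin R n).1).
    by apply: SmD; [exact: Sm_id | exact: Sm_cst].
  apply/funext => t; rewrite /p big_cons val_expi; congr ((1 - step _ _ _) * _).
  by rewrite ReM /ex /= cosB; ring.
exists (fun z => (1 - p J z)%:C); split.
- apply/smooth_circleP; split=> n /=; last exact: Sm_cst.
  by apply: SmD; [exact: Sm_cst | apply: SmN; exact: smp].
- have d4 : 0 < d / 4 by rewrite divr_gt0.
  apply: (support_open d4) => z w pz hw.
  have [s sJ hs] : exists2 s, s \in J & rn (set_val z - ex s : R[i]) < d / 4.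
    apply: contrapT => hn; move/negP: pz; apply; apply/eqP.
    have -> : p J z = 1; last by rewrite subrr.
    rewrite /p big1_seq// => s /= sJ; rewrite step0 ?subr0// Re_rn /a.
    have : d / 4 <= rn (set_val z - ex s : R[i]).
      by rewrite leNgt; apply/negP => hs; apply: hn; exists s.
    move=> hx; rewrite lerD2l lerN2 ler_pM2r ?invr_gt0//.
    by apply: lerXn2r hx; rewrite ?nnegrE ?rn_ge0 ?(ltW d4).
  move: sJ; rewrite mem_filter => /andP[/asboolP[k fk hk] _].
  apply: (hd k) => //; apply: le_lt_trans (rn_tri _ (ex s) _) _.
  have := rn_tri (ex s) (set_val z) (set_val w : R[i]).
  by rewrite [rn (ex s - set_val z)]rn_distC; lra.
- move=> z; have [->|fz] := eqVneq (f z) 0; first by rewrite mul0r.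
  suff -> : p J z = 0 by rewrite subr0 mulr1.
  have [t ht e] := expi_onto z; have [s sS ts] := hS t ht.
  have zs : rn (set_val z - ex s : R[i]) <= d / 8.
    by rewrite -e val_expi; apply: le_trans (ex_lipschitz _ _) _; lra.
  have sJ : s \in J.
    rewrite mem_filter sS andbT; apply/asboolP; exists z => //; exact: subset_closure.
  rewrite /p (big_rem s)//= step1 ?subrr ?mul0r// Re_rn /b.
  rewrite lerD2l lerN2 ler_pM2r ?invr_gt0//.
  by apply: lerXn2r zs; rewrite ?nnegrE ?rn_ge0// divr_ge0 ?(ltW d0).
Qed.

(** [c] consists of the Fourier integrals of a nonnegative smooth weight of mean 1 concentrated on
    angles below e. Integrating a Fourier series against the weight multiplies its coefficients by
    [c], so vanishing near angle 0 gives the third property. The constants 2 and 4 contain the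
    factor 2 of [mean_bound]. *)
Lemma mollifier (e : R) : 0 < e -> exists c : int -> R[i],
  [/\ forall k, rn (c k) <= 2,
      forall p, exists2 C, 0 <= C & forall k, rn (c k) <= C * (absz k).+1%:R ^- p,
      forall a : int -> R[i], asum (fun n => rn (a n) : R) ->
        (forall s, `|s| < e -> @hsum R R[i]^o int (fun n => a n * ex (n%:~R * s)) 0) ->
        @hsum R R[i]^o int (fun n => a n * c n) 0 &
      forall k, rn (c k - 1) <= 4 * `|k%:~R| * e].
Proof.
move=> e0; pose d := Num.min e pi.
have pp := pi_gt0 R.
have d0 : 0 < d by rewrite lt_min e0.
have de : d <= e by rewrite ge_min lexx.
have dpi : d <= pi by rewrite ge_min lexx orbT.
have cos_d t : 0 <= t <= pi -> (cos d < cos t) = (t < d).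
  by move=> /andP[t0 t1]; apply: ltr_cos; rewrite in_itv /= ?t0 ?t1 ?(ltW d0) ?dpi.
(* A function of cos t, hence periodic; on [-pi, pi] it is positive exactly for angles below [d]. *)
pose f (t : R) := flat 0 (cos t - cos d).
have sf : smooth f.
  move=> n; apply: (Sm_comp (@smooth_flat R 0 n)).
  by apply: SmD; [exact: (Sm_cos_sin R n).1 | exact: Sm_cst].
have f0 t : 0 <= f t by exact: flat_ge0.
have fd t : - pi <= t <= pi -> f t != 0 -> `|t| < d.
  move=> /andP[t1 t2] ft; rewrite -cos_d; last by rewrite normr_ge0 ler_norml t1 t2.
  rewrite ltNge; apply: contra ft => h; rewrite /f flat_le0// subr_le0.
  by have [t0|t0] := lerP 0 t; move: h; [rewrite ger0_norm | rewrite ltr0_norm// cosN].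
have cf : continuous f by have [f' d' _] := sf 1%N; exact: deriv_continuous d'.
have f00 : 0 < f 0.
  by apply: flat_gt0; rewrite subr_gt0 cos_d// lexx ltW.
have Ipos : 0 < RI f.
  have f2 : 0 < f 0 / 2 by rewrite divr_gt0.
  have /cvgrPdist_lt/(_ _ f2)/nbhs_ballP[r /= r0 hr] := cf 0.
  pose r' := Num.min (r / 2) pi.
  have r'0 : 0 < r' by rewrite lt_min pp andbT divr_gt0.
  apply: (RI_gt0 (ri_continuous cf) f0 f2 r'0); first by rewrite ge_min lexx orbT.
  move=> t ht; have /hr : ball (0 : R) r t.
    rewrite /ball /= sub0r normrN; apply: (@le_lt_trans _ _ r').
      by rewrite ler_norml.
    by apply: (@le_lt_trans _ _ (r / 2)); [rewrite ge_min lexx | lra].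
  by move=> /= /ltr_distlDr; lra.
pose m := (2 * pi)^-1 * RI f.
have m0 : 0 < m by rewrite mulr_gt0// invr_gt0 mulr_gt0.
pose w t := m^-1 * f t.
have w0 t : 0 <= w t by rewrite mulr_ge0// invr_ge0 ltW.
have sw : smooth w by move=> n; apply: SmM => //; exact: Sm_cst.
have cw : continuous w by have [f' d' _] := sw 1%N; exact: deriv_continuous d'.
have rw := ri_continuous cw.
have Iw : (2 * pi)^-1 * RI w = 1.
  transitivity (m^-1 * m); last by rewrite mulVf// gt_eqF.
  by rewrite [RI w](RIZ m^-1 (ri_continuous cf)) mulrCA.
have pw : per (fun t => (w t)%:C).
  by apply: per_real => // s t [h _]; rewrite /w /f h.
have mw F B : ci F -> 0 <= B -> (forall t, - pi <= t <= pi -> w t = 0 \/ rn (F t) <= B) ->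
    rn (mean (fun t => (w t)%:C * F t)) <= 2 * B.
  by move=> cF B0 h; have := mean_bound rw w0 cF B0 h; rewrite Iw mulr1.
exists (fun k => mean (fun t => (w t)%:C * ex (k%:~R * t))); split.
- move=> k; rewrite -[leRHS]mulr1; apply: mw => //; first exact: per_ci (per_ex R k).
  by move=> t _; right; rewrite rn_ex.
- move=> p; have [C C0 hC] := fc_decay p pw; exists C => // k.
  have := hC (- k); rewrite abszN; apply: le_trans; rewrite le_eqVlt; apply/orP; left; apply/eqP.
  by congr rn; apply: mean_ext => t _; rewrite rmorphN /= mulNr opprK.
- move=> a aa ha; have := mean_hsum (G := fun t => (w t)%:C) (H := fun=> 0) aa (per_ci pw) (ci_cst 0).
  rewrite mean0 => H; apply: hsum_ext (H _) => [n|t ht].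
    by congr (_ * _); apply: mean_ext => t _; rewrite mulrC.
  have [wt|wt] := eqVneq (w t) 0.
    have h0 := @hsum_fin R R[i]^o int (fun=> 0) [::] isT (fun _ _ => erefl).
    rewrite big_nil in h0; apply: hsum_ext h0 => n.
    by rewrite wt mulr0.
  rewrite -(mulr0 (w t)%:C); apply: hsum_ext (chsumZ (w t)%:C (ha t _)) => [n|].
    by rewrite mulrC.
  apply: lt_le_trans de; apply: fd => //.
  by apply: contra wt => /eqP ft; rewrite /w ft mulr0.
- move=> k; have cwC : ci (fun t => (w t)%:C) by exact: per_ci pw.
  have E1 : mean (fun t => (w t)%:C) = 1.
    apply: complex_ext => //=.
    by rewrite (_ : RI _ = 0) ?mulr0//; rewrite RI_cst mulr0.
  have ce : ci (fun t => ex (k%:~R * t) : R[i]) by exact: per_ci (per_ex R k).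
  have -> : mean (fun t => (w t)%:C * ex (k%:~R * t)) - 1 =
      mean (fun t => (w t)%:C * (ex (k%:~R * t) + - 1)).
    rewrite -{1}E1 -mulN1r -meanZ// -meanD; [|exact: ciM|by apply: ciM => //; exact: ci_cst].
    by apply: mean_ext => t _; rewrite mulrDr mulrN1 mulN1r.
  have -> : 4 * `|k%:~R| * e = 2 * (2 * `|k%:~R| * e) :> R by ring.
  apply: mw; first by apply: ciD => //; exact: ci_cst.
    by rewrite !mulr_ge0// ltW.
  move=> t ht; have [->|wt] := eqVneq (w t) 0; [by left | right].
  rewrite -(ex0 R); apply: le_trans (ex_lipschitz _ _) _; rewrite subr0 normrM.
  rewrite mulrA ler_wpM2l ?mulr_ge0//; apply/ltW; apply: lt_le_trans de; apply: fd => //.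
  by apply: contra wt => /eqP ft; rewrite /w ft mulr0.
Qed.

End Circle.

(** * Smeared vertex operators *)

Section RapidDecay.
Context (R : realType).

Definition rapid (s : int -> R[i]) := forall p : nat, exists2 C : R, 0 <= C &
  forall n, rn (s n) <= C * (absz n).+1%:R ^- p.
Definition poly_bounded (x : int -> R) := exists (C : R) (p : nat), 0 <= C /\
  forall n, x n <= C * (absz n).+1%:R ^+ p.

Lemma rapid_mul_bound (s : int -> R[i]) (x : int -> R) : rapid s -> poly_bounded x -> (forall n, 0 <= x n) ->
  exists2 C : R, 0 <= C & forall n, rn (s n) * x n <= C * wgt R n.
Proof.
move=> rs [D [p [D0 hD]]] x0; have [C C0 hC] := rs (p + 2)%N; exists (C * D); first exact: mulr_ge0.
move=> n; apply: le_trans (ler_pM (rn_ge0 _) (x0 n) (hC n) (hD n)) _.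
have q0 : (absz n).+1%:R ^+ p != 0 :> R by rewrite expf_neq0 ?pnatr_eq0.
rewrite /wgt exprD invfM le_eqVlt; apply/orP; left; apply/eqP.
by move: q0; move: (_ ^+ p) (_ ^- 2) => u v u0; field.
Qed.

Lemma asum_rapid (s : int -> R[i]) (x : int -> R) : rapid s -> poly_bounded x -> (forall n, 0 <= x n) ->
  asum (fun n => rn (s n) * x n).
Proof.
by move=> rs px x0; have [C C0 h] := rapid_mul_bound rs px x0; exact: asum_le C0 h (asum_wgt R).
Qed.

Lemma rapid_fc F : per F -> rapid (@fc R F).
Proof. by move=> pF p; exact: fc_decay. Qed.

Lemma rapid_conj s : rapid s -> rapid (fun n => (s n)^*).
Proof. by move=> h p; have [C C0 hC] := h p; exists C => // n; rewrite rn_conj. Qed.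

Lemma poly_neg x : poly_bounded x -> poly_bounded (fun n => x (- n)).
Proof. by move=> [C [p [C0 h]]]; exists C, p; split=> // n; rewrite -(abszN n); exact: h. Qed.

End RapidDecay.

Section Smeared.
Context (R : realType) (V : unitary_voa R) (H : completion V).
Local Notation circle := (set_type (S1 R)).
Implicit Types (a b c : V) (n : int) (f : circle -> R[i]) (s : int -> R[i]).

Lemma mode_poly a b : energy_bounds a -> poly_bounded (fun n => vn H (mode a n b)).
Proof.
move=> /(energy_boundsP H)[p [k [M [_ _ M0 h]]]].
exists (M * vn H (iter k (@L0p1 R V) b)), p; split; first by rewrite mulr_ge0 ?vn_ge0// ltW.
by move=> n; rewrite mulrAC.
Qed.

(** The unconditional form of the smeared action, which can be reindexed and rearranged; [smeared0]
    records symmetric partial sums only. *)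
Definition smears a s b (y : H) := hsum (fun n => s n *: emb H (mode a n b)) y.

Lemma smears_asum a s b : energy_bounds a -> rapid s ->
  asum (fun n => rn (s n *: emb H (mode a n b))).
Proof.
move=> ea rs; have h := asum_rapid rs (mode_poly b ea) (fun n => vn_ge0 _ _).
by apply: (asum_le ler01 _ h) => n; rewrite mul1r rnZ.
Qed.

Lemma smears_exists a s b : energy_bounds a -> rapid s -> exists y, smears a s b y.
Proof. by move=> ea rs; apply: hsum_exists; exact: smears_asum. Qed.

Lemma rapid_fourier f : smooth_circle f -> rapid (fourier f).
Proof. by move=> sf; apply: rapid_fc; exact: smooth_per. Qed.

Lemma smears_smeared0 a f b y : smears a (fourier f) b y -> smeared0 a f (emb H b, y).
Proof. by move=> h; exists b => //; exact: hsum_cvg h. Qed.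

Lemma smeared0_smears a f (p : (H * H)%type) : energy_bounds a -> smooth_circle f -> smeared0 a f p ->
  exists2 b, p.1 = emb H b & smears a (fourier f) b p.2.
Proof.
move=> ea sf [b e h]; exists b => //; apply: hsum_limit h.
by apply: smears_exists => //; exact: rapid_fourier.
Qed.

Lemma smears_smeared a f b y : smears a (fourier f) b y -> smeared a f (emb H b, y).
Proof. by move=> /smears_smeared0; exact: subset_closure. Qed.

Lemma smeared_ind a f (G : set (H * H)%type) : energy_bounds a -> smooth_circle f ->
  closure G `<=` G -> (forall b y, smears a (fourier f) b y -> G (emb H b, y)) ->
  smeared a f `<=` G.
Proof.
move=> ea sf cG h; apply: subset_trans cG; apply: closureS => -[x y].
by move=> /(smeared0_smears ea sf)[b /= -> ]; exact: h.
Qed.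

Lemma closure_subspace (G : set (H * H)%type) : subspace_set G -> subspace_set (closure G).
Proof.
move=> [G0 GD]; split; first exact: subset_closure.
move=> k x y /closure2_rn hx /closure2_rn hy; apply/closure2_rn => e e0.
have k1 : 0 < rn k + 1 by rewrite ltr_wpDl ?rn_ge0.
have e2 : 0 < e / 2 by rewrite divr_gt0.
have [x' Gx' [x1 x2]] := hx _ (divr_gt0 e2 k1); have [y' Gy' [y1 y2]] := hy _ e2.
exists (k *: x' + y'); first exact: GD.
have key (u v u' v' : H) : rn (u - u') < e / 2 / (rn k + 1) -> rn (v - v') < e / 2 ->
    rn (k *: u + v - (k *: u' + v')) < e.
  move=> h1 h2; rewrite opprD addrACA -scalerBr; apply: le_lt_trans (rnD _ _) _.
  rewrite (splitr e) rnZ ltrD// mulrC.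
  have := h1; rewrite ltr_pdivlMr//; apply: le_lt_trans.
  by rewrite ler_wpM2l ?rn_ge0// lerDl.
by split; apply: key.
Qed.

Lemma smeared_closed a f : closed_subspace (@smeared R V H a f).
Proof.
split; last by rewrite /smeared -(closure_id _).1//; exact: closed_closure.
apply: closure_subspace; split.
  exists 0; first by rewrite (lin0 (emb_linear H)).
  apply/cvg_rn => e e0; exists 0%N => N _.
  by rewrite big1 ?subrr ?rn0// => n _; rewrite (lin0 (mode_linr _ _)) (lin0 (emb_linear H)) scaler0.
move=> k p q [b1 e1 /cvg_rn h1] [b2 e2 /cvg_rn h2]; exists (k *: b1 + b2).
  by rewrite /= e1 e2 (emb_linear H).
apply/cvg_rn => e e0.
have k1 : 0 < rn k + 1 by rewrite ltr_wpDl ?rn_ge0.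
have e2' : 0 < e / 2 by rewrite divr_gt0.
have [N1 {}h1] := h1 _ (divr_gt0 e2' k1); have [N2 {}h2] := h2 _ e2'.
exists (maxn N1 N2) => N; rewrite geq_max => /andP[/h1 l1 /h2 l2].
rewrite (_ : \sum_(_ < _) _ = k *: (\sum_(i < (N + N).+1) fourier f (i%:Z - N%:Z) *: emb H (mode a (i%:Z - N%:Z) b1))
   + \sum_(i < (N + N).+1) fourier f (i%:Z - N%:Z) *: emb H (mode a (i%:Z - N%:Z) b2)); last first.
  rewrite scaler_sumr -big_split; apply: eq_bigr => i _ /=.
  by rewrite mode_linr (emb_linear H) scalerDr !scalerA mulrC.
rewrite opprD addrACA -scalerBr; apply: le_lt_trans (rnD _ _) _.
rewrite (splitr e) rnZ ltrD// mulrC.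
have := l1; rewrite ltr_pdivlMr//; apply: le_lt_trans.
by rewrite ler_wpM2l ?rn_ge0// lerDl.
Qed.

Definition adjoint_vec a a' := forall n b c, ip (mode a n b) c = ip b (mode a' (- n) c).

Lemma hip_bounded (v : H) : linear (hip v : H -> R[i]^o).
Proof. by move=> k x y; rewrite hipDr hipZr. Qed.

Lemma hsum_hip (I : eqType) (v : H) (x : I -> H) y : hsum x y ->
  @hsum R R[i]^o I (fun i => hip v (x i)) (hip v y).
Proof.
by apply: (hsum_map (hip_bounded v) (rn_ge0 v)) => u; exact: hip_CS.
Qed.

Lemma chsum_conj (I : eqType) (x : I -> R[i]) y : @hsum R R[i]^o I x y ->
  @hsum R R[i]^o I (fun i => (x i)^*) (y^*).
Proof.
move=> h e e0; have [S0 hS] := h e e0; exists S0 => S uS sS.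
by have := hS S uS sS; rewrite -[in X in _ -> X]rmorph_sum -rmorphB rn_conj.
Qed.

Lemma smears_adjoint a a' s b c y y' : adjoint_vec a a' -> smears a s b y ->
  hsum (fun n => (s n)^* *: emb H (mode a' (- n) c)) y' -> hip (emb H c) y = hip y' (emb H b).
Proof.
move=> aa /(hsum_hip (emb H c)) h /(hsum_hip (emb H b))/chsum_conj h'.
rewrite [RHS]hipC; apply: (hsum_uniq h); apply: hsum_ext h' => n.
rewrite !hipZr rmorphM /= conjCK -hipC !emb_isometry; congr (_ * _).
by rewrite ipC -aa -ipC.
Qed.

Lemma gperp_closure (G : set (H * H)%type) h : (forall g, G g -> hip g.1 h.1 + hip g.2 h.2 = 0) ->
  gperp (closure G) h.
Proof.
move=> hG g /closure2_rn cg; apply/eqP; rewrite -rn_eq0; apply/eqP.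
apply: (@eq0_eps _ _ (rn h.1 + rn h.2)) => [|e e0]; first exact: rn_ge0.
have [x Gx [x1 x2]] := cg e e0; rewrite -[_ + _]subr0 -(hG x Gx).
rewrite opprD addrACA -!hipBl; apply: le_trans (rnD _ _) _.
rewrite mulrDl; apply: lerD; apply: le_trans (hip_CS _ _) _;
  by rewrite mulrC ler_wpM2l ?rn_ge0// ltW.
Qed.

(** [(- y', emb H c)] in the complement of the graph means that c lies in the domain of the adjoint
    operator, with value y'. *)
Lemma smears_gperp a a' f c y' : energy_bounds a -> smooth_circle f -> adjoint_vec a a' ->
  hsum (fun n => (fourier f n)^* *: emb H (mode a' (- n) c)) y' ->
  gperp (smeared a f) (- y', emb H c).
Proof.
move=> ea sf aa h'; apply: gperp_closure => -[x y] /(smeared0_smears ea sf)[b /= -> h].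
by rewrite hipNr addrC; apply/eqP; rewrite subr_eq0 hipC (smears_adjoint aa h h') -hipC.
Qed.

(** Pairing the transported graph vector with [(- y', emb H c)], which is orthogonal to the graph,
    gives weak commutation. *)
Lemma smears_weak a a' f (A : H -> H) b c y y' : energy_bounds a -> smooth_circle f ->
  adjoint_vec a a' -> (forall x, smeared a f x -> smeared a f (map2 A x)) ->
  smears a (fourier f) b y ->
  hsum (fun n => (fourier f n)^* *: emb H (mode a' (- n) c)) y' ->
  hip (emb H c) (A y) = hip y' (A (emb H b)).
Proof.
move=> ea sf aa hA h h'; have := smears_gperp ea sf aa h' (hA _ (smears_smeared h)).
rewrite /= hipNr addrC => /eqP; rewrite subr_eq0 => /eqP e.
by rewrite hipC e -hipC.
Qed.

End Smeared.

(** * Restriction of a two-variable distribution to the diagonal *)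

Section DiagonalSum.
Context (R : realType).
Local Notation chsum := (@hsum R R[i]^o _).

Lemma diagonal_asum (f g : int -> R[i]) (X : int -> int -> R[i]) (C : R) (p K0 : nat) :
  rapid f -> rapid g -> 0 <= C ->
  (forall k l, rn (X k l) <= C * (absz k).+1%:R ^+ p * (absz l).+1%:R ^+ p) ->
  (forall m j i, X (j + m) (i - m) != 0 -> (absz m <= absz j + absz i + K0)%N) ->
  asum (fun q : int * (int * int) =>
    rn (f q.2.1 * g q.2.2 * X (q.2.1 + q.1) (q.2.2 - q.1)) : R).
Proof.
(* 2p powers pay for the growth of [X] in both indices, two more for the summable weight in m. *)
move=> rf rg C0 hX sX; pose q := (p + p + 2)%N.
have pq : poly_bounded (fun n : int => (absz n).+1%:R ^+ q : R).
  by exists 1, q; split=> // n; rewrite mul1r.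
have [Cf Cf0 hf] := rapid_mul_bound rf pq (fun n => exprn_ge0 _ (ler0n _ _)).
have [Cg Cg0 hg] := rapid_mul_bound rg pq (fun n => exprn_ge0 _ (ler0n _ _)).
pose kp : R := K0.+3%:R.
have kp0 : 0 <= kp by [].
have w0 := @wgt_ge0 R.
have aw := asum_prod w0 (fun q => mulr_ge0 (w0 q.1) (w0 q.2)) (asum_wgt R)
  (asum_prod w0 w0 (asum_wgt R) (asum_wgt R)).
apply: (asum_le (C := C * kp ^+ q * (Cf * Cg)) _ _ aw); first by rewrite !mulr_ge0// exprn_ge0.
move=> [m [j i]] /=; have [->|X0] := eqVneq (X (j + m) (i - m)) 0.
  by rewrite mulr0 rn0 !mulr_ge0// exprn_ge0.
have hm := sX _ _ _ X0.
pose J : R := (absz j).+1%:R; pose I : R := (absz i).+1%:R.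
(* Bounds |j + m| + 1, |i - m| + 1 and |m| + 1 simultaneously, once the support condition has
   confined m in terms of i and j. *)
pose P := kp * J * I.
have bnd (r : nat) : (r <= 2 * absz j + 2 * absz i + K0 + 1)%N -> r%:R <= P.
  move=> hr; rewrite /P /kp /J /I -!natrM ler_nat; apply: leq_trans hr _; nia.
have hP1 : (absz (j + m)).+1%:R <= P by apply: bnd; lia.
have hP2 : (absz (i - m)).+1%:R <= P by apply: bnd; lia.
have hP3 : (absz m).+1%:R <= P by apply: bnd; lia.
have P0 : 0 <= P by rewrite !mulr_ge0.
have hw : 1 <= P ^+ 2 * wgt R m.
  by rewrite /wgt -ler_pdivrMr ?invr_gt0 ?exprn_gt0// invrK mul1r lerXn2r// nnegrE.
have hX' : rn (X (j + m) (i - m)) <= C * kp ^+ q * (J ^+ q * I ^+ q) * wgt R m.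
  apply: le_trans (hX _ _) _; apply: (@le_trans _ _ (C * P ^+ p * P ^+ p)).
    by apply: ler_pM; rewrite ?mulr_ge0 ?exprn_ge0//; [rewrite ler_wpM2l// | ]; rewrite lerXn2r// nnegrE.
  have -> : C * kp ^+ q * (J ^+ q * I ^+ q) * wgt R m = C * P ^+ p * P ^+ p * (P ^+ 2 * wgt R m).
    by rewrite /P /q !exprMn !exprD; ring.
  by rewrite ler_peMr// !mulr_ge0// exprn_ge0.
rewrite !rnM; apply: le_trans (ler_wpM2l _ hX') _; first by rewrite mulr_ge0 ?rn_ge0.
have -> : rn (f j) * rn (g i) * (C * kp ^+ q * (J ^+ q * I ^+ q) * wgt R m) =
  C * kp ^+ q * wgt R m * ((rn (f j) * J ^+ q) * (rn (g i) * I ^+ q)) by ring.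
have -> : C * kp ^+ q * (Cf * Cg) * (wgt R m * (wgt R j * wgt R i)) =
  C * kp ^+ q * wgt R m * ((Cf * wgt R j) * (Cg * wgt R i)) by ring.
rewrite ler_wpM2l ?mulr_ge0 ?exprn_ge0//; apply: ler_pM; rewrite ?mulr_ge0 ?rn_ge0 ?exprn_ge0//.
Qed.

(* Pairing the distribution with coefficients X with F(z) G(w) delta(z/w), where
   delta(z/w) = sum_m z^m w^-m; the one-sided support of X makes the sum over m
   absolutely convergent, and F G = F leaves the diagonal restriction tested on F. *)
Lemma diagonal_sum (F G : R -> R[i]) (X : int -> int -> R[i]) (C : R) (p K0 : nat) :
  per F -> per G -> (forall t, F t * G t = F t) -> 0 <= C ->
  (forall k l, rn (X k l) <= C * (absz k).+1%:R ^+ p * (absz l).+1%:R ^+ p) ->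
  (forall m j i, X (j + m) (i - m) != 0 -> (absz m <= absz j + absz i + K0)%N) ->
  exists s, chsum (fun q : int * (int * int) =>
      fc F q.2.1 * fc G q.2.2 * X (q.2.1 + q.1) (q.2.2 - q.1)) s /\
    chsum (fun q : int * int => fc F q.1 * X q.2 (q.1 - q.2)) s.
Proof.
move=> pF pG FG C0 hX sX.
have ax := diagonal_asum (rapid_fc pF) (rapid_fc pG) C0 hX sX.
have [s hs] := hsum_exists_complete (@complex_complete R) ax.
exists s; split=> //.
(* Change of variables n = j + i, k = j + m: for fixed n and k the sum over j is the convolution
   giving the n-th coefficient of F G = F. *)
pose f3 (q : (int * int) * int) : int * (int * int) := (q.1.2 - q.2, (q.2, q.1.1 - q.2)).
pose g3 (q : int * (int * int)) : (int * int) * int := ((q.2.1 + q.2.2, q.2.1 + q.1), q.2.1).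
have fg : cancel f3 g3 by move=> [[n k] j]; rewrite /f3 /g3 /=; congr ((_, _), _); lia.
have gf : cancel g3 f3 by move=> [m [j i]]; rewrite /f3 /g3 /=; congr (_, (_, _)); lia.
apply: hsum_fubini (hsum_reindex fg gf hs) _ => -[n k] /=.
have := fc_conv n pF pG.
have -> : (fun t => F t * G t) = F by apply/funext.
rewrite mulrC => /(chsumZ (X k (n - k))); apply: hsum_ext => j.
have -> : j + (k - j) = k by lia.
have -> : n - j - (k - j) = n - k by lia.
by rewrite mulrC.
Qed.

End DiagonalSum.

Section PairSum.
Context (R : realType) (H1 H2 : hilbert R).

(** Existence comes from the product of two absolutely summable families; the value is identified by
    summing one variable at a time. *)
Lemma bilin_hsum (B : H1 -> H2 -> R[i]) (C : R) (x : int -> H1) (z : int -> H2) y w :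
  (forall z, linear (fun x => B x z : R[i]^o)) -> (forall x, linear (B x : H2 -> R[i]^o)) ->
  0 <= C -> (forall x z, rn (B x z) <= C * rn x * rn z) ->
  asum (fun k => rn (x k)) -> asum (fun k => rn (z k)) -> hsum x y -> hsum z w ->
  @hsum R R[i]^o _ (fun q : int * int => B (x q.1) (z q.2)) (B y w).
Proof.
move=> lx lz C0 hB ax az hx hz.
have ap := asum_prod (fun k => rn_ge0 (x k)) (fun k => rn_ge0 (z k)) ax az.
have [|v hv] := @hsum_exists_complete R R[i]^o _ (fun q : int * int => B (x q.1) (z q.2)) (@complex_complete R).
  by apply: asum_le C0 _ ap => q; rewrite mulrA.
suff <- : v = B y w by [].
have h k : @hsum R R[i]^o _ (fun l => B (x k) (z l)) (B (x k) w).
  apply: (hsum_map (lz (x k)) (C := C * rn (x k))) => //; first by rewrite mulr_ge0 ?rn_ge0.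
have h2 := hsum_fubini hv h.
apply: (hsum_uniq h2).
apply: (hsum_map (lx w) (C := C * rn w)) => //; first by rewrite mulr_ge0 ?rn_ge0.
by move=> a; rewrite mulrAC.
Qed.

End PairSum.

Section Modulation.
Context (R : realType).
Local Notation circle := (set_type (S1 R)).
Local Notation support := (@Defs.support R).

Lemma expi_exprz (m : int) (t : R) : (set_val (expi t) : R[i]) ^ m = ex (m%:~R * t).
Proof.
rewrite val_expi; have key (k : nat) : ex t ^+ k = ex (k%:R * t) :> R[i].
  by elim: k => [|k ih]; rewrite ?mul0r ?ex0// exprSr ih -exD -natr1 mulrDl mul1r.
case: m => k; first by rewrite -exprnP key pmulrn.
rewrite NegzE -exprnN key rmorphN /= mulNr -pmulrn.
apply: (mulIf (_ : ex (k.+1%:R * t) != 0)); last by rewrite exNM mulVf// -rn_eq0 rn_ex oner_eq0.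
by rewrite -rn_eq0 rn_ex oner_eq0.
Qed.

(** Multiplication by z^m shifts the Fourier coefficients by m without enlarging the support; the
    sum over m will play the role of a delta distribution. *)
Definition modulate (f : circle -> R[i]) (m : int) z := f z * (set_val z : R[i]) ^ m.

Lemma modulate_smooth f m : smooth_circle f -> smooth_circle (modulate f m).
Proof.
move=> /smooth_per pf; apply/smooth_circleP; have [h _] := perM pf (per_ex R m).
by move: h; congr csmooth; apply/funext => t; rewrite /modulate expi_exprz.
Qed.

Lemma modulate_support (I : set circle) f m : support f `<=` I -> support (modulate f m) `<=` I.
Proof. by apply: support_sub => z; apply: contraNneq => h; rewrite /modulate h mul0r. Qed.

Lemma modulate_fourier f m n : fourier (modulate f m) n = fourier f (n - m).
Proof.
rewrite !fourierE; apply: mean_ext => t _; rewrite /modulate expi_exprz -mulrA -exD.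
by congr (_ * ex _); rewrite rmorphB /=; ring.
Qed.

End Modulation.

Lemma emb_ext (R : realType) (V : unitary_voa R) (H : completion V) (x y : H) :
  (forall b, hip x (emb H b) = hip y (emb H b)) -> x = y.
Proof.
move=> h; apply/eqP; rewrite -subr_eq0; apply/eqP.
apply: (@hip_dense0 R H (range (emb H)) (x - y) (@emb_dense R V H)) => _ [b _ <-].
by rewrite hipC hipBl h subrr rmorph0.
Qed.

(** * Weak commutation with smeared operators of the tensor product *)

Section TensorWeak.
Context (R : realType) (Va Vb W : unitary_voa R) (t : Va -> Vb -> W).
Hypothesis ht : is_voa_tensor t.
Context (Ha : completion Va) (Hb : completion Vb) (K : completion W) (T : Ha -> Hb -> K).
Hypothesis hT : is_hilbert_tensor T.
Hypothesis T_emb : forall a b, T (emb Ha a) (emb Hb b) = emb K (t a b).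
Local Notation circle := (set_type (S1 R)).
Local Notation support := (@Defs.support R).
Local Notation chsum := (@hsum R R[i]^o _).
Local Notation wa := (has_weight (vop Va) (conf Va)).
Local Notation wb := (has_weight (vop Vb) (conf Vb)).

Lemma poly_bound2 (X : int -> int -> R[i]) (D : R) (x y : int -> R) : 0 <= D ->
  (forall k l, rn (X k l) <= D * x k * y l) -> (forall k, 0 <= x k) -> (forall k, 0 <= y k) ->
  poly_bounded x -> poly_bounded y -> exists C p, 0 <= C /\
  forall k l, rn (X k l) <= C * (absz k).+1%:R ^+ p * (absz l).+1%:R ^+ p.
Proof.
move=> D0 hX x0 y0 [C1 [p1 [C10 h1]]] [C2 [p2 [C20 h2]]].
exists (D * C1 * C2), (p1 + p2)%N; split=> [|k l]; first by rewrite !mulr_ge0.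
have up (r q : nat) (n : int) : (r <= q)%N -> (absz n).+1%:R ^+ r <= (absz n).+1%:R ^+ q :> R.
  by move=> rq; apply: ler_weXn2l => //; rewrite ler1n.
apply: le_trans (hX k l) _; rewrite -!mulrA ler_wpM2l//.
have -> : C1 * (C2 * ((absz k).+1%:R ^+ (p1 + p2) * (absz l).+1%:R ^+ (p1 + p2))) =
  (C1 * (absz k).+1%:R ^+ (p1 + p2)) * (C2 * (absz l).+1%:R ^+ (p1 + p2)) by ring.
apply: ler_pM => //.
  by apply: le_trans (h1 k) _; rewrite ler_wpM2l// up// leq_addr.
by apply: le_trans (h2 l) _; rewrite ler_wpM2l// up// leq_addl.
Qed.

Lemma adj_asum (V : unitary_voa R) (H : completion V) (a : V) c s : energy_bounds a -> rapid s ->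
  asum (fun n => rn ((s n)^* *: emb H (mode a (- n) c))).
Proof.
move=> ea rs; have h := asum_rapid (rapid_conj rs) (poly_neg (mode_poly H c ea)) (fun n => vn_ge0 _ _).
by apply: (asum_le ler01 _ h) => n; rewrite mul1r rnZ.
Qed.

(** The vectors on the other leg are arbitrary, not only of finite energy: in [pair_weak] that leg
    holds the limit of a smeared sum. *)
Definition leg_weak (V : unitary_voa R) (H : completion V) (Z : hilbert R) (S : H -> Z -> K)
    (u : K -> K) (a a' : V) (h : circle -> R[i]) :=
  forall c c' y y', smears a (fourier h) c y ->
    hsum (fun n => (fourier h n)^* *: emb H (mode a' (- n) c')) y' ->
    forall z z', hip (S (emb H c') z) (u (S y z')) = hip (S y' z) (u (S (emb H c) z')).

Variables (I : set circle) (u : K -> K) (a a' : Va) (b b' : Vb) (da db : int).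
Hypotheses (bu : bounded_op u) (oI : open I).
Hypotheses (ea : energy_bounds a) (ea' : energy_bounds a').
Hypotheses (eb : energy_bounds b) (eb' : energy_bounds b').
Hypotheses (aa : adjoint_vec a a') (bb : adjoint_vec b b').
Hypotheses (hda : wa da a) (hdb : wb db b).
Hypothesis lega : forall h, smooth_circle h -> support h `<=` I -> leg_weak T u a a' h.
Hypothesis legb : forall h, smooth_circle h -> support h `<=` I ->
  leg_weak (fun y x => T x y) u b b' h.

Let ul : linear u. Proof. by case: bu. Qed.
Let Tl z : linear (fun x => T x z). Proof. exact: (tenl hT). Qed.
Let Tr x : linear (T x). Proof. exact: (tenr hT). Qed.

(** Matrix elements with the modes acting before [u]; in [X'] the adjoint modes act on the left
    vector instead. *)
Let X c d c' d' (k l : int) : R[i] :=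
  hip (T (emb Ha c') (emb Hb d')) (u (T (emb Ha (mode a k c)) (emb Hb (mode b l d)))).
Let X' c d c' d' (k l : int) : R[i] :=
  hip (T (emb Ha (mode a' (- k) c')) (emb Hb (mode b' (- l) d'))) (u (T (emb Ha c) (emb Hb d))).

(** The common value is obtained by moving first the smeared a, then the smeared b, across [u]. *)
Lemma pair_weak c d c' d' h g : smooth_circle h -> smooth_circle g -> support h `<=` I ->
  support g `<=` I -> exists v,
  chsum (fun q : int * int => fourier h q.1 * fourier g q.2 * X c d c' d' q.1 q.2) v /\
  chsum (fun q : int * int => fourier h q.1 * fourier g q.2 * X' c d c' d' q.1 q.2) v.
Proof.
move=> sh sg hI gI; have rh := rapid_fourier sh; have rg := rapid_fourier sg.
have [ya hya] := smears_exists Ha c ea rh; have [yb hyb] := smears_exists Hb d eb rg.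
have [ya' hya'] := hsum_exists (adj_asum Ha c' ea' rh).
have [yb' hyb'] := hsum_exists (adj_asum Hb d' eb' rg).
have /bounded_opP[_ [Cu Cu0 hu]] := bu.
exists (hip (T (emb Ha c') (emb Hb d')) (u (T ya yb))); split.
  have := bilin_hsum (B := fun x z => hip (T (emb Ha c') (emb Hb d')) (u (T x z)))
    (C := rn (T (emb Ha c') (emb Hb d')) * Cu) _ _ _ _ (smears_asum Ha c ea rh) (smears_asum Hb d eb rg) hya hyb.
  move=> H; apply: hsum_ext (H _ _ _ _) => [[k l]|z k x y|x k y z||x z] /=.
  - by rewrite (linZ (Tl _)) (linZ (Tr _)) !(linZ ul) !hipZr mulrA.
  - by rewrite (Tl z) ul hipDr hipZr.
  - by rewrite (Tr x) ul hipDr hipZr.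
  - by rewrite mulr_ge0 ?rn_ge0.
  - apply: le_trans (hip_CS _ _) _; rewrite -!mulrA ler_wpM2l ?rn_ge0//.
    by apply: le_trans (hu _) _; rewrite (ten_rn hT).
rewrite (lega sh hI hya hya') (legb sg gI hyb hyb') hipC.
have := bilin_hsum (B := fun x z => hip (u (T (emb Ha c) (emb Hb d))) (T x z))
    (C := rn (u (T (emb Ha c) (emb Hb d)))) _ _ _ _ (adj_asum Ha c' ea' rh) (adj_asum Hb d' eb' rg) hya' hyb'.
move=> H; have := chsum_conj (H _ _ _ _).
move=> {}H; apply: hsum_ext (H _ _ _ _) => [[k l]|z k x y|x k y z||x z] /=.
- by rewrite (linZ (Tl _)) (linZ (Tr _)) !hipZr !rmorphM /= !conjCK -hipC mulrA.
- by rewrite (Tl z) hipDr hipZr.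
- by rewrite (Tr x) hipDr hipZr.
- by rewrite rn_ge0.
- by apply: le_trans (hip_CS _ _) _; rewrite (ten_rn hT) mulrA.
Qed.

Lemma X_bound c d c' d' : exists C p, 0 <= C /\
  forall k l, rn (X c d c' d' k l) <= C * (absz k).+1%:R ^+ p * (absz l).+1%:R ^+ p.
Proof.
have /bounded_opP[_ [Cu Cu0 hu]] := bu.
apply: (poly_bound2 (D := rn (T (emb Ha c') (emb Hb d')) * Cu)
  _ _ _ _ (mode_poly Ha c ea) (mode_poly Hb d eb)) => [|k l|k|k]; try exact: rn_ge0.
  by rewrite mulr_ge0 ?rn_ge0.
apply: le_trans (hip_CS _ _) _; rewrite -!mulrA ler_wpM2l ?rn_ge0//.
by apply: le_trans (hu _) _; rewrite (ten_rn hT).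
Qed.

Lemma X'_bound c d c' d' : exists C p, 0 <= C /\
  forall k l, rn (X' c d c' d' k l) <= C * (absz k).+1%:R ^+ p * (absz l).+1%:R ^+ p.
Proof.
apply: (poly_bound2 (D := rn (u (T (emb Ha c) (emb Hb d))))
  _ _ _ _ (poly_neg (mode_poly Ha c' ea')) (poly_neg (mode_poly Hb d' eb'))) => [|k l|k|k]; try exact: rn_ge0.
by apply: le_trans (hip_CS _ _) _; rewrite (ten_rn hT) mulrC mulrA.
Qed.

(** Both indices are bounded on the same side; along (j + m, i - m) this confines m to a range
    depending on j and i, which is the support condition of [diagonal_sum]. *)
Lemma X_zero c d c' d' : exists N : nat, forall k l,
  X c d c' d' k l != 0 -> k < N%:Z /\ l < N%:Z.
Proof.
have [Na hNa] := mode_field a c; have [Nb hNb] := mode_field b d.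
exists (absz Na + absz Nb)%N => k l; apply: contraNP => h; apply/eqP.
have [k1|k1] := lerP Na k.
  by rewrite /X (hNa _ k1) (lin0 (emb_linear Ha)) (lin0 (Tl _)) (lin0 ul) hip0r.
have [l1|l1] := lerP Nb l; last by exfalso; apply: h; split; lia.
by rewrite /X (hNb _ l1) (lin0 (emb_linear Hb)) (lin0 (Tr _)) (lin0 ul) hip0r.
Qed.

Lemma X'_zero c d c' d' : exists N : nat, forall k l,
  X' c d c' d' k l != 0 -> - k < N%:Z /\ - l < N%:Z.
Proof.
have [Na hNa] := mode_field a' c'; have [Nb hNb] := mode_field b' d'.
exists (absz Na + absz Nb)%N => k l; apply: contraNP => h; apply/eqP.
have [k1|k1] := lerP Na (- k).
  by rewrite /X' (hNa _ k1) (lin0 (emb_linear Ha)) (lin0 (Tl _)) hip0l.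
have [l1|l1] := lerP Nb (- l); last by exfalso; apply: h; split; lia.
by rewrite /X' (hNb _ l1) (lin0 (emb_linear Hb)) (lin0 (Tr _)) hip0l.
Qed.

Lemma diagonal_weak f c d c' d' : smooth_circle f -> support f `<=` I -> exists s,
  chsum (fun q : int * int => fourier f q.1 * X c d c' d' q.2 (q.1 - q.2)) s /\
  chsum (fun q : int * int => fourier f q.1 * X' c d c' d' q.2 (q.1 - q.2)) s.
Proof.
move=> sf fI; have [chi [sc cI fc_]] := bump oI sf fI.
have pf := smooth_per sf; have pc := smooth_per sc.
have fcE x : f (expi x) * chi (expi x) = f (expi x) by exact: fc_.
have [C [p [C0 hC]]] := X_bound c d c' d'; have [C' [p' [C0' hC']]] := X'_bound c d c' d'.
have [N hN] := X_zero c d c' d'; have [N' hN'] := X'_zero c d c' d'.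
have [m j i /hN|s [hs1 hs2]] := diagonal_sum (K0 := (N + N)%N) pf pc fcE C0 hC; first lia.
have [m j i /hN'|s' [hs1' hs2']] := diagonal_sum (K0 := (N' + N')%N) pf pc fcE C0' hC'; first lia.
suff e : s = s' by exists s; split=> //; rewrite e.
(* One relation for each m, from z^m f and z^-m chi; Fubini adds them up to the triple sums of
   [diagonal_sum], where chi has disappeared because f chi = f. *)
have /choice[y hy] m := pair_weak c d c' d' (modulate_smooth m sf) (modulate_smooth (- m) sc)
  (modulate_support (m := m) fI) (modulate_support (m := - m) cI).
have key (Z : int -> int -> R[i]) m v :
    chsum (fun q : int * int => fourier (modulate f m) q.1 * fourier (modulate chi (- m)) q.2 * Z q.1 q.2) v ->
    chsum (fun q : int * int => fourier f q.1 * fourier chi q.2 * Z (q.1 + m) (q.2 - m)) v.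
  pose f2 (q : int * int) := (q.1 + m, q.2 - m); pose g2 (q : int * int) := (q.1 - m, q.2 + m).
  have fg : cancel f2 g2 by move=> [j i]; rewrite /f2 /g2 /=; congr (_, _); lia.
  have gf : cancel g2 f2 by move=> [j i]; rewrite /f2 /g2 /=; congr (_, _); lia.
  move=> /(hsum_reindex fg gf); apply: hsum_ext => -[j i] /=.
  by rewrite !modulate_fourier addrK opprK subrK.
have h1 := hsum_fubini hs1 (fun m => key _ _ _ (hy m).1).
have h2 := hsum_fubini hs1' (fun m => key _ _ _ (hy m).2).
exact: hsum_uniq h1 h2.
Qed.

(** [psi n] is given by its inner products only: the adjoint vector of [t a b] is not presented as a
    tensor of adjoint vectors, so [psi n] is expanded by testing it on elementary tensors. *)
Lemma tensor_weak f c d c' d' (psi : int -> K) : smooth_circle f -> support f `<=` I ->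
  (forall n x, hip (psi n) (emb K x) = hip (emb K (t c' d')) (emb K (mode (t a b) n x))) ->
  exists s,
  chsum (fun n => fourier f n * hip (emb K (t c' d')) (u (emb K (mode (t a b) n (t c d))))) s /\
  chsum (fun n => fourier f n * hip (psi n) (u (emb K (t c d)))) s.
Proof.
move=> sf fI hpsi; have [s [h1 h2]] := diagonal_weak c d c' d' sf fI; exists s.
have fin1 n c0 d0 : exists2 S : seq int, uniq S & forall k, k \notin S ->
    mode a k c0 = 0 \/ mode b (n - k) d0 = 0.
  have [Na hNa] := mode_field a c0; have [Nb hNb] := mode_field b d0.
  exists (zbox (absz Na + absz Nb + absz n)%N) => [|k]; first exact: zbox_uniq.
  rewrite mem_zbox -ltnNge => hk; have [k1|k1] := lerP Na k; first by left; exact: hNa.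
  by right; apply: hNb; lia.
have fin2 n : exists2 S : seq int, uniq S & forall k, k \notin S ->
    mode a' (- k) c' = 0 \/ mode b' (- (n - k)) d' = 0.
  have [Na hNa] := mode_field a' c'; have [Nb hNb] := mode_field b' d'.
  exists (zbox (absz Na + absz Nb + absz n)%N) => [|k]; first exact: zbox_uniq.
  rewrite mem_zbox -ltnNge => hk; have [k1|k1] := lerP Na (- k); first by left; exact: hNa.
  by right; apply: hNb; lia.
have modeT n c0 d0 S : uniq S -> (forall k, k \notin S -> mode a k c0 = 0 \/ mode b (n - k) d0 = 0) ->
    mode (t a b) n (t c0 d0) = \sum_(k <- S) t (mode a k c0) (mode b (n - k) d0).
  move=> uS hS; apply: (mode_tensor ht hda hdb uS) => k /hS[->|->].
    by rewrite (lin0 (vtl ht _)).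
  by rewrite (lin0 (vtr ht _)).
split.
  apply: hsum_fubini h1 _ => n /=; have [S uS hS] := fin1 n c d.
  rewrite (modeT n c d S uS hS) (lin_sum (emb_linear K)) (lin_sum ul) hip_sumr mulr_sumr.
  have := @hsum_fin R R[i]^o int (fun k => fourier f n * X c d c' d' k (n - k)) S uS.
  have -> : \sum_(k <- S) (fourier f n * X c d c' d' k (n - k) : R[i]^o) = \sum_(i <- S) fourier f n *
     hip (emb K (t c' d')) (u (emb K (t (mode a i c) (mode b (n - i) d)))).
    by apply: eq_bigr => k _; rewrite /X !T_emb.
  apply=> k /hS[] e; rewrite /X e.
    by rewrite (lin0 (emb_linear Ha)) (lin0 (Tl _)) (lin0 ul) hip0r mulr0.
  by rewrite (lin0 (emb_linear Hb)) (lin0 (Tr _)) (lin0 ul) hip0r mulr0.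
apply: hsum_fubini h2 _ => n /=; have [S uS hS] := fin2 n.
have psiE : psi n = \sum_(k <- S) T (emb Ha (mode a' (- k) c')) (emb Hb (mode b' (- (n - k)) d')).
  apply: emb_ext => x.
  move: x; apply: (tensor_ind ht (P := fun x => hip (psi n) (emb K x) = _)).
    split; first by rewrite (lin0 (emb_linear K)) !hip0r.
    by move=> k x y hx hy; rewrite (emb_linear K) !hipDr !hipZr hx hy.
  move=> _ _ c0 d0 _ _; rewrite hpsi hip_suml; have [S1 uS1 hS1] := fin1 n c0 d0.
  rewrite (modeT n c0 d0 S1 uS1 hS1) (lin_sum (emb_linear K)) hip_sumr.
  pose g k := ip c' (mode a k c0) * ip d' (mode b (n - k) d0).
  have ipN (V : unitary_voa R) (H : completion V) (e e' : V) k x y : adjoint_vec e e' ->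
      hip (emb H (mode e' (- k) x)) (emb H y) = ip x (mode e k y).
    by move=> he; rewrite emb_isometry ipC -he -ipC.
  have E1 : \sum_(k <- S1) hip (emb K (t c' d')) (emb K (t (mode a k c0) (mode b (n - k) d0))) =
      \sum_(k <- S1) g k.
    by apply: eq_bigr => k _; rewrite emb_isometry (vt_ip ht).
  have E2 : \sum_(k <- S) hip (T (emb Ha (mode a' (- k) c')) (emb Hb (mode b' (- (n - k)) d')))
      (emb K (t c0 d0)) = \sum_(k <- S) g k.
    by apply: eq_bigr => k _; rewrite -T_emb (ten_hip hT) (ipN _ Ha _ _ _ _ _ aa) (ipN _ Hb _ _ _ _ _ bb).
  rewrite E1 E2; apply: (@hsum_uniq R R[i]^o int g); apply: hsum_fin => // k.
    by move=> /hS1[] e; rewrite /g e ip0r ?mulr0 ?mul0r.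
  move=> /hS[] e; rewrite /g.
    by rewrite -(ipN _ Ha _ _ _ _ _ aa) e (lin0 (emb_linear Ha)) hip0l mul0r.
  by rewrite -(ipN _ Hb _ _ _ _ _ bb) e (lin0 (emb_linear Hb)) hip0l mulr0.
rewrite psiE hip_suml mulr_sumr.
have := @hsum_fin R R[i]^o int (fun k => fourier f n * X' c d c' d' k (n - k)) S uS.
have -> : \sum_(k <- S) (fourier f n * X' c d c' d' k (n - k) : R[i]^o) = \sum_(i <- S) fourier f n *
   hip (T (emb Ha (mode a' (- i) c')) (emb Hb (mode b' (- (n - i)) d'))) (u (emb K (t c d))).
  by apply: eq_bigr => k _; rewrite /X' -T_emb.
apply=> k /hS[] e; rewrite /X' e.
  by rewrite (lin0 (emb_linear Ha)) (lin0 (Tl _)) hip0l mulr0.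
by rewrite (lin0 (emb_linear Hb)) (lin0 (Tr _)) hip0l mulr0.
Qed.

End TensorWeak.

(** * Functions of L_0 as bounded operators *)

Section Multiplier.
Context (R : realType) (V : unitary_voa R) (H : completion V).
Local Notation weight := (has_weight (vop V) (conf V)).
Implicit Types (g : int -> R[i]) (v : V).

(** The operator g(L_0) on finite-energy vectors. *)
Definition diagop g v : V := \sum_(d \in [set: int]) g d *: hcomp v d.

Lemma diagopE g v (s : seq int) : uniq s -> (forall d, d \notin s -> hcomp v d = 0) ->
  diagop g v = \sum_(d <- s) g d *: hcomp v d.
Proof. by move=> us h; apply: fsumZ => // d /h ->; rewrite scaler0. Qed.

Lemma diagop_lin g : linear (diagop g).
Proof.
move=> k x y; have [s us [_ [_ h0]]] := hcomp_common x y.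
rewrite !(@diagopE g _ s) => // [|d /h0[]|d /h0[]|d /h0[h1 h2]] //; last first.
  by rewrite hcomp_lin h1 h2 scaler0 addr0.
rewrite scaler_sumr -big_split; apply: eq_bigr => d _ /=.
by rewrite hcomp_lin scalerDr !scalerA mulrC.
Qed.

Lemma diagop_bound g (C : R) v : 0 <= C -> (forall d, rn (g d) <= C) ->
  vn H (diagop g v) <= C * vn H v.
Proof.
move=> C0 hg; have [s us [h0 e]] := hcomp_support v.
apply: ler_sqr2; first by rewrite mulr_ge0 ?vn_ge0.
have wp d : d \in s -> weight d (hcomp v d) by move=> _; exact: hcomp_weight.
rewrite (diagopE g us h0) exprMn {2}e !vn2_sum//; last first.
  by move=> d /wp h; exact: weightZ.
rewrite mulr_sumr; apply: ler_sum => d _; rewrite vnZ exprMn ler_wpM2r ?sqr_ge0//.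
by rewrite lerXn2r// nnegrE ?rn_ge0.
Qed.

Lemma iter_diagop g k v : iter k (@L0p1 R V) (diagop g v) =
  diagop (fun d => (d + 1)%:~R ^+ k * g d) v.
Proof.
have [s us [h0 e]] := hcomp_support v.
rewrite (diagopE g us h0) (diagopE _ us h0) iter_L0p1_sum.
  by apply: eq_bigr => d _; rewrite scalerA.
by move=> d _; apply: weightZ; exact: hcomp_weight.
Qed.

(** The closure of the graph over V is single-valued by the bound and total by completeness. *)
Lemma dense_extension (A : V -> H) (C : R) : linear A -> 0 <= C ->
  (forall v, rn (A v) <= C * vn H v) -> exists B : H -> H,
  [/\ linear B, forall x, rn (B x) <= C * rn x & forall v, B (emb H v) = A v].
Proof.
move=> lA C0 hA; pose G0 : set (H * H)%type := [set p | exists v, p = (emb H v, A v)].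
have sG : subspace_set (closure G0).
  apply: closure_subspace; split.
    by exists 0; rewrite (lin0 (emb_linear H)) (lin0 lA).
  move=> k _ _ [v ->] [w ->]; exists (k *: v + w).
  by rewrite (emb_linear H) lA.
have bG p : closure G0 p -> rn p.2 <= C * rn p.1.
  move=> /closure2_rn cp; apply/ler_addgt0Pr => e e0.
  have C1 : 0 < C + 1 by rewrite ltr_wpDl.
  have [_ [v ->] /= [h1 h2]] := cp _ (divr_gt0 e0 C1).
  have -> : rn p.2 = rn (A v + (p.2 - A v)) by rewrite addrC subrK.
  apply: le_trans (rnD _ _) _; have := hA v.
  have := rn_tri (emb H v) p.1 0; rewrite !subr0 (rn_distC (emb H v)) -/(vn H v) => h3 h4.
  have h5 : C * vn H v <= C * (rn p.1 + e / (C + 1)).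
    by rewrite ler_wpM2l//; lra.
  have h6 : C * (e / (C + 1)) + e / (C + 1) = e.
    by field; rewrite gt_eqF.
  by rewrite mulrDr in h5; lra.
have dom x : exists y, closure G0 (x, y).
  have /dense_rn dE := @emb_dense R V H.
  have /choice[v hv] (n : nat) : exists v, rn (x - emb H v) < n.+1%:R^-1.
    by have [|_ [v _ <-] h] := dE x n.+1%:R^-1; [rewrite invr_gt0 | exists v].
  have [e e0|l hl] := @complete_rn R H (fun n => A (v n)).
    have C1 : 0 < C + 1 by rewrite ltr_wpDl.
    have e2 : 0 < e / (C + 1) / 2 by rewrite !divr_gt0.
    have [N hN] := invS_small e2; exists N => m n /hN hm /hN hn.
    rewrite -(linB lA); apply: le_lt_trans (hA _) _.
    have : vn H (v m - v n) < e / (C + 1).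
      rewrite /vn (linB (emb_linear H)); apply: le_lt_trans (rn_tri _ x _) _.
      by rewrite rn_distC (splitr (e / _)) ltrD// (lt_trans (hv _)).
    move=> h; apply: (@le_lt_trans _ _ ((C + 1) * vn H (v m - v n))).
      by rewrite ler_wpM2r ?vn_ge0// lerDl.
    by rewrite mulrC -ltr_pdivlMr.
  exists l; apply/closure2_rn => e e0; have [N1 h1] := invS_small e0; have [N2 h2] := hl e e0.
  exists (emb H (v (maxn N1 N2)), A (v (maxn N1 N2))); first by exists (v (maxn N1 N2)).
  split => /=; first by apply: lt_trans (hv _) _; rewrite h1 ?leq_maxl.
  by rewrite rn_distC h2 ?leq_maxr.
have /choice[B hB] := dom.
have Buniq x y : closure G0 (x, y) -> B x = y.
  move=> h; have := sG.2 (- 1) _ _ h (hB x); move/bG => /=.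
  rewrite !scaleN1r !addNr rn0 mulr0 addrC => h1.
  by apply/eqP; rewrite -subr_eq0 -rn_eq0 eq_le h1 rn_ge0.
exists B; split=> [k x y|x|v].
- by apply: Buniq; exact: (sG.2 k _ _ (hB x) (hB y)).
- exact: bG (hB x).
- by apply: Buniq; apply: subset_closure; exists v.
Qed.

Lemma multiplier g (C : R) : 0 <= C -> (forall d, rn (g d) <= C) -> exists M : H -> H,
  [/\ linear M, forall x, rn (M x) <= C * rn x & forall v, M (emb H v) = emb H (diagop g v)].
Proof.
move=> C0 hg; apply: (dense_extension (A := fun v => emb H (diagop g v)) _ C0).
  by move=> k x y; rewrite (diagop_lin g) (emb_linear H).
by move=> v; exact: diagop_bound.
Qed.

(** The adjoint of g(L_0) acts on a weight vector by a scalar; this evaluates the multiplier at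
    vectors of H outside V. *)
Lemma hip_multiplier g M d (b : V) x : linear M -> (exists C, forall x, rn (M x) <= C * rn x) ->
  (forall v, M (emb H v) = emb H (diagop g v)) -> weight d b ->
  hip (emb H b) (M x) = g d * hip (emb H b) x.
Proof.
move=> lM [C hC] hM wb; have bM : bounded_op M.
  apply/bounded_opP; split=> //; exists `|C| => // y; apply: le_trans (hC y) _.
  by rewrite ler_wpM2r ?rn_ge0// ler_norm.
have [M' bM' MM'] := bounded_adjoint bM.
have -> : hip (emb H b) (M x) = hip (M' (emb H b)) x by rewrite hipC MM' -hipC.
suff -> : M' (emb H b) = (g d)^* *: emb H b by rewrite hipZl conjCK.
apply: emb_ext => v; rewrite hipC -MM' -hipC hM hipZl conjCK !emb_isometry.
have [s us [h0 e]] := hcomp_support v.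
rewrite (diagopE g us h0) {2}e /ip !braket_sumr mulr_sumr; apply: eq_bigr => m _.
rewrite braketZr; have [->//|md] := eqVneq m d.
by rewrite [braket _ _ _](weight_orth wb (hcomp_weight v m)) ?mulr0// eq_sym.
Qed.

End Multiplier.

(** * From weak commutation to invariance of the closed graph *)

Section Smoothing.
Context (R : realType) (V : unitary_voa R) (H : completion V).
Local Notation circle := (set_type (S1 R)).
Local Notation weight := (has_weight (vop V) (conf V)).
Local Notation chsum := (@hsum R R[i]^o _).

(** |n| + 1 is at most (|n + l| + 1)(|l| + 1). *)
Lemma rapid_shift (c : int -> R[i]) (l : int) : rapid c -> rapid (fun n => c (n + l)).
Proof.
move=> hc p; have [C C0 h] := hc p; exists (C * (absz l).+1%:R ^+ p).
  by rewrite mulr_ge0 ?exprn_ge0.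
move=> n; apply: le_trans (h _) _; rewrite -mulrA ler_wpM2l//.
rewrite ler_pdivlMr ?exprn_gt0// mulrC ler_pdivrMr ?exprn_gt0// -exprMn.
rewrite lerXn2r ?nnegrE ?mulr_ge0// -natrM ler_nat; nia.
Qed.

Lemma asum_shift (a : int -> R) (l : int) : asum a -> asum (fun n => a (n + l)).
Proof. by apply: (asum_sub (f := fun n => n + l)) => n m /addIr. Qed.

(** Translating the index multiplies the rotated series by a phase, so it still vanishes for small
    angles. *)
Lemma mollifier_shift (c : int -> R[i]) (a : int -> R[i]) (e : R) (r : int) :
  (forall a : int -> R[i], asum (fun n => rn (a n) : R) ->
     (forall s, `|s| < e -> chsum (fun n => a n * ex (n%:~R * s)) 0) ->
     chsum (fun n => a n * c n) 0) ->
  asum (fun n => rn (a n) : R) ->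
  (forall s, `|s| < e -> chsum (fun n => a n * ex (n%:~R * s)) 0) ->
  chsum (fun n => a n * c (n + r)) 0.
Proof.
move=> hc aa ha.
have fg : cancel (fun n : int => n + r) (fun n => n - r) by move=> n; rewrite addrK.
have gf : cancel (fun n : int => n - r) (fun n => n + r) by move=> n; rewrite subrK.
have h := hc (fun n => a (n - r)) (asum_shift (- r) aa) _.
have {}h := hsum_reindex fg gf (h _).
apply: hsum_ext (h _) => [n|s hs]; first by rewrite /= addrK.
have h2 := chsumZ (ex (r%:~R * s)) (ha s hs); rewrite mulr0 in h2.
apply: hsum_ext (hsum_reindex gf fg h2) => n.
by rewrite mulrCA -exD -mulrDl -intrD (_ : r + (n - r) = n)//; lia.
Qed.

Variables (w : V) (f : circle -> R[i]).
Hypotheses (ew : energy_bounds w) (sf : smooth_circle f).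

(** The energy bound costs a power of L_0 + 1, which the rapid decay of [g] absorbs, so Y(w, f)
    g(L_0) is bounded. *)
Lemma regular_operator (g : int -> R[i]) : rapid g -> exists B : H -> H,
  [/\ linear B, exists2 C, 0 <= C & forall x, rn (B x) <= C * rn x &
    forall v, smears w (fourier f) (diagop g v) (B (emb H v))].
Proof.
move=> rg; have rf := rapid_fourier sf.
have /choice[A hA] v := smears_exists H (diagop g v) ew rf.
have lA : linear A.
  move=> k x y; apply: (hsum_uniq (hA _)).
  have lk : linear (fun z : H => k *: z) by move=> z p q; rewrite scalerDr !scalerA mulrC.
  have h1 := hsum_map lk (rn_ge0 k) (fun z => _) (hA x).
  have h2 := hsumD (h1 _) (hA y); apply: hsum_ext (h2 _) => [n|z].
    by rewrite diagop_lin mode_linr (emb_linear H) scalerDr !scalerA mulrC.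
  by rewrite rnZ.
have /(energy_boundsP H)[p [k [M [_ _ M0 h]]]] := ew.
have [C C0 hC] := rg k.
have iterb v : vn H (iter k (@L0p1 R V) (diagop g v)) <= C * vn H v.
  rewrite iter_diagop; apply: diagop_bound => // d; rewrite rnM rnX rn_int.
  apply: le_trans (ler_wpM2l _ (hC d)) _; first by rewrite exprn_ge0.
  rewrite mulrCA ler_piMr// ler_pdivrMr ?exprn_gt0// mul1r lerXn2r ?nnegrE//.
  by rewrite -intr_norm -abszE ler_nat; lia.
have pq : poly_bounded (fun n : int => (absz n).+1%:R ^+ p : R).
  by exists 1, p; split=> // n; rewrite mul1r.
have [B1 hB1] := asum_rapid rf pq (fun n => exprn_ge0 _ (ler0n _ _)).
have B10 : 0 <= B1 by have := hB1 [::] isT; rewrite big_nil.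
have bA v : rn (A v) <= B1 * (M * C) * vn H v.
  apply: hsum_bound (hA v) _ => S uS.
  apply: (@le_trans _ _ (\sum_(n <- S) rn (fourier f n) * (absz n).+1%:R ^+ p * (M * (C * vn H v)))).
    apply: ler_sum => n _; rewrite rnZ -mulrA ler_wpM2l ?rn_ge0//.
    apply: le_trans (h n _) _; rewrite mulrCA mulrA ler_wpM2l//.
    by rewrite mulr_ge0 ?exprn_ge0 ?ltW.
  rewrite -mulr_suml -[leRHS]mulrA -[M * C * _]mulrA ler_wpM2r ?hB1//.
  by rewrite !mulr_ge0 ?vn_ge0// ltW.
have BMC0 : 0 <= B1 * (M * C) by rewrite !mulr_ge0// ltW.
have [B [lB bB BE]] := dense_extension lA BMC0 bA.
exists B; split=> // [|v]; first by exists (B1 * (M * C)).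
by rewrite BE.
Qed.

(** g(L_0) maps all of H into the domain of the closed operator, by approximation from V. *)
Lemma regular_smeared (g : int -> R[i]) M B (C D : R) : linear M -> linear B ->
  (forall x, rn (M x) <= C * rn x) -> (forall x, rn (B x) <= D * rn x) ->
  (forall v, M (emb H v) = emb H (diagop g v)) ->
  (forall v, smears w (fourier f) (diagop g v) (B (emb H v))) ->
  forall x, smeared w f (M x, B x).
Proof.
move=> lM lB hM hB ME BE x; apply: (smeared_closed H w f).2.
apply/closure2_rn => e e0; have C1 : 0 < `|C| + `|D| + 1 by rewrite ltr_wpDl ?addr_ge0.
have /dense_rn dE := @emb_dense R V H.
have [_ [v _ <-] hv] := dE x _ (divr_gt0 e0 C1).
exists (M (emb H v), B (emb H v)); first by rewrite ME; exact: smears_smeared.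
rewrite ltr_pdivlMr// in hv.
split; rewrite /= -?(linB lM) -?(linB lB); [apply: le_lt_trans (hM _) _|apply: le_lt_trans (hB _) _];
  apply: le_lt_trans hv; rewrite mulrC ler_wpM2l ?rn_ge0//.
  by have := ler_norm C; have := normr_ge0 D; lra.
by have := ler_norm D; have := normr_ge0 C; lra.
Qed.

(** c(L_0 + r) tends strongly to the identity as the mollifier narrows: explicitly on a
    finite-energy approximation of [x], while the uniform norm bound 2 handles the rest. The
    threshold does not depend on [c] or [M], since one mollifier has to serve several vectors. *)
Lemma multiplier_approx (x : H) (r : int) (dl : R) : 0 < dl -> exists2 e1, 0 < e1 &
  forall e c M, 0 < e -> e <= e1 -> (forall k, rn (c k - 1) <= 4 * `|k%:~R| * e) ->
    linear M -> (forall y : H, rn (M y) <= 2 * rn y) ->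
    (forall v, M (emb H v) = emb H (diagop (fun d => c (d + r)) v)) -> rn (M x - x) < dl.
Proof.
move=> dl0; have d8 : 0 < dl / 8 by rewrite divr_gt0.
have /dense_rn dE := @emb_dense R V H; have [_ [v _ <-] hv] := dE x _ d8.
have [s us [h0 ev]] := hcomp_support v.
pose N := \sum_(d <- s) 4 * `|(d + r)%:~R| * vn H (hcomp v d).
have N0 : 0 <= N by apply: sumr_ge0 => d _; rewrite !mulr_ge0 ?vn_ge0.
have N1 : 0 < N + 1 by rewrite ltr_wpDl.
exists (dl / 2 / (N + 1)); first by rewrite !divr_gt0.
move=> e c M e0 ee hc lM hM ME.
have h1 : rn (M (emb H v) - emb H v) <= N * e.
  rewrite ME (diagopE _ us h0) {2}ev -(linB (emb_linear H)) -sumrB.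
  apply: le_trans (vn_sum H _ _ _) _; rewrite mulr_suml; apply: ler_sum => d _.
  by rewrite -{2}[hcomp v d]scale1r -scalerBl vnZ mulrAC ler_wpM2r ?vn_ge0// hc.
have h2 : N * e < dl / 2.
  apply: (@lt_le_trans _ _ ((N + 1) * e)); first by rewrite ltr_pM2r// ltrDl.
  by rewrite mulrC -ler_pdivlMr.
have h3 := hM (x - emb H v); rewrite (linB lM) in h3.
have h4 := rn_tri (M x) (M (emb H v)) x; have h5 := rn_tri (M (emb H v)) (emb H v) x.
by rewrite (rn_distC (emb H v) x) in h5; lra.
Qed.

Variables (w' : V) (ew' : energy_bounds w') (ww' : adjoint_vec w w').
Variables (u : H -> H) (bu : bounded_op u) (e : R) (e0 : 0 < e).

(** Weak commutation with the smeared operator of f rotated by s, in terms of Fourier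
    coefficients. *)
Definition weak_at (s : R) := forall b b', exists r,
  chsum (fun n => ex (n%:~R * s) * fourier f n * hip (emb H b') (u (emb H (mode w n b)))) r /\
  chsum (fun n => ex (n%:~R * s) * fourier f n * hip (emb H (mode w' (- n) b')) (u (emb H b))) r.
Hypothesis weak : forall s, `|s| < e -> weak_at s.

(* With c the Fourier coefficients of an approximate identity, c(L_0 - l) u b is
   in the domain of the closed operator Y(w, f), and by the weak commutation with
   the rotations of f its image is sum_n f^_n c(L_0 + n - l) u w_n b, which tends
   to u y. *)
Lemma smoothing_weight l b y : weight l b -> smears w (fourier f) b y ->
  smeared w f (u (emb H b), u y).
Proof.
move=> wb hy; apply: (smeared_closed H w f).2; apply/closure2_rn => dl dl0 /=.
have rf := rapid_fourier sf.
have /bounded_opP[ul [Cu Cu0 hu]] := bu.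
pose v n := u (emb H (mode w n b)).
(* The factor 3 bounds the norm of c(L_0 + n - l) - 1: 2 for the multiplier and 1 for the
   identity. *)
have av : asum (fun n => 3 * (rn (fourier f n) * rn (v n))).
  have h := asum_rapid rf (mode_poly H b ew) (fun n => vn_ge0 _ _).
  apply: (asum_le (C := 3 * Cu) _ _ h) => [|n]; first by rewrite mulr_ge0.
  rewrite -[leRHS]mulrA ler_wpM2l// mulrCA ler_wpM2l ?rn_ge0//; exact: hu.
have hv : hsum (fun n => fourier f n *: v n) (u y).
  by apply: hsum_ext (hsum_map ul Cu0 hu hy) => n; rewrite (linZ ul).
have d2 : 0 < dl / 2 by rewrite divr_gt0.
have [S0 uS0 hS0] := asum_tail av d2.
pose F := \sum_(n <- S0) rn (fourier f n).
have F0 : 0 <= F by apply: sumr_ge0 => *; exact: rn_ge0.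
have F1 : 0 < F + 1 by rewrite ltr_wpDl.
have d3 : 0 < dl / 2 / (F + 1) by rewrite divr_gt0.
(* One width makes the multipliers close to the identity on the finitely many vectors [v n] with n
   in [S0]; the tail outside [S0] is controlled by [av]. *)
have [e1 e10 he1] : exists2 e1, 0 < e1 & forall ee c, 0 < ee -> ee <= e1 ->
    (forall k, rn (c k - 1) <= 4 * `|k%:~R| * ee) -> forall n, n \in S0 -> forall M,
    linear M -> (forall y : H, rn (M y) <= 2 * rn y) ->
    (forall x, M (emb H x) = emb H (diagop (fun d => c (d + (n - l))) x)) ->
    rn (M (v n) - v n) < dl / 2 / (F + 1).
  elim: S0 {uS0 hS0 F F0 F1} (dl / 2 / (F + 1)) d3 => [|n S ih] q q0; first by exists 1.
  have [e1 e10 h1] := ih q q0; have [e2 e20 h2] := multiplier_approx (v n) (n - l) q0.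
  exists (Num.min e1 e2); first by rewrite lt_min e10.
  move=> ee c ee0; rewrite le_min => /andP[l1 l2] hc m; rewrite inE => /orP[/eqP ->|mS] M lM hM ME.
    exact: (h2 ee c M).
  exact: (h1 ee c _ _ _ m).
have [e2 e20 he2] := multiplier_approx (u (emb H b)) (- l) dl0.
pose ee := Num.min e (Num.min e1 e2).
have ee0 : 0 < ee by rewrite !lt_min e0 e10.
have lee : ee <= e by rewrite ge_min lexx.
have le1 : ee <= e1 by rewrite !ge_min lexx orbT.
have le2 : ee <= e2 by rewrite !ge_min lexx !orbT.
have [c [c2 cr c0 c1]] := mollifier ee0.
have /choice[M hM] r := multiplier H (g := fun d => c (d + r)) (ler0n R 2) (fun d => c2 _).
have lM r : linear (M r) by have [] := hM r.
have bM r x : rn (M r x) <= 2 * rn x by have [_ h _] := hM r.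
have ME r x : M r (emb H x) = emb H (diagop (fun d => c (d + r)) x) by have [_ _ h] := hM r.
have [B [lB [D D0 bB] BE]] := regular_operator (rapid_shift (- l) cr).
have bB' : bounded_op B by apply/bounded_opP; split=> //; exists D.
exists (M (- l) (u (emb H b)), B (u (emb H b))).
  exact: (regular_smeared (lM _) lB (bM _) bB (ME _) BE).
split=> /=.
  by rewrite rn_distC; exact: (he2 ee c _ ee0 le2 c1 (lM _) (bM _) (ME _)).
have [Z hZ] : exists Z, hsum (fun n => fourier f n *: M (n - l) (v n)) Z.
  apply: hsum_exists; apply: (asum_le ler01 _ av) => n.
  rewrite mul1r rnZ mulrCA ler_wpM2l ?rn_ge0//; apply: le_trans (bM _ _) _.
  by rewrite ler_wpM2r ?rn_ge0// ler_nat.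
suff ZE : B (u (emb H b)) = Z.
  rewrite ZE rn_distC.
  have hd : hsum (fun n => fourier f n *: (M (n - l) (v n) - v n)) (Z - u y).
    have lN : linear (fun z : H => - z) by move=> k p q; rewrite opprD scalerN.
    have h1 := hsum_map lN ler01 (fun z => _) hv.
    by apply: hsum_ext (hsumD hZ (h1 _)) => [n|z]; rewrite ?scalerBr// rnN mul1r.
  apply: (@le_lt_trans _ _ (F * (dl / 2 / (F + 1)) + dl / 2)); last first.
    have : F * (dl / 2 / (F + 1)) < dl / 2.
      by rewrite mulrCA -[ltRHS]mulr1 ltr_pM2l// ltr_pdivrMr// mul1r ltrDl.
    by lra.
  apply: hsum_bound hd _ => S uS; rewrite (bigID (mem S0)) /= lerD//.
    rewrite -big_filter; pose S1 := [seq n <- S0 | n \in S].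
    rewrite (perm_big S1); last first.
      apply: uniq_perm; rewrite ?filter_uniq// => n.
      by rewrite !mem_filter andbC.
    apply: (@le_trans _ _ (\sum_(n <- S1) rn (fourier f n) * (dl / 2 / (F + 1)))).
      rewrite big_seq [leRHS]big_seq; apply: ler_sum => n; rewrite mem_filter => /andP[_ nS].
      rewrite rnZ ler_wpM2l ?rn_ge0// ltW//.
      exact: (he1 ee c ee0 le1 c1 n nS _ (lM _) (bM _) (ME _)).
    rewrite -mulr_suml ler_wpM2r ?(ltW d3)// /S1 big_filter /F (bigID (mem S) xpredT)/= lerDl.
    by apply: sumr_ge0 => *; exact: rn_ge0.
  rewrite -big_filter.
  apply: (@le_trans _ _ (\sum_(n <- [seq n <- S | n \notin S0]) 3 * (rn (fourier f n) * rn (v n)))).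
    apply: ler_sum => n _; rewrite rnZ mulrCA ler_wpM2l ?rn_ge0//.
    by apply: le_trans (rnB _ _) _; have := bM (n - l) (v n); lra.
  apply/ltW/hS0; first exact: filter_uniq.
  by move=> n; rewrite mem_filter => /andP[].
(* Matrix elements with a weight vector on the left are compared, where the multipliers on both
   sides become the same scalar c(n + d - l). *)
suff hh d b' : weight d b' -> hip (emb H b') (B (u (emb H b))) = hip (emb H b') Z.
  apply: emb_ext => b'; apply: (can_inj (@conjCK _)); rewrite -!hipC.
  elim/weight_ind: b' => [|p q hp hq|d b' wb']; last exact: hh wb'.
    by rewrite (lin0 (emb_linear H)) !hip0l.
  by rewrite (linD (emb_linear H)) !hipDl hp hq.
move=> wb'.
pose psi n := emb H (mode w' (- n) b').
have psiE n x : hip (psi n) (emb H x) = hip (emb H b') (emb H (mode w n x)).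
  by rewrite /psi !emb_isometry ipC -ww' -ipC.
have apsi : asum (fun n => rn (fourier f n) * rn (psi n)).
  exact: (asum_rapid rf (poly_neg (mode_poly H b' ew')) (fun n => vn_ge0 _ _)).
have hcZ := hsum_hip (emb H b') hZ.
have [zeta hzeta] : exists z, hsum (fun n => (fourier f n * c (n + (d - l)))^* *: psi n) z.
  apply: hsum_exists; apply: (asum_le (ler0n R 2) _ apsi) => n.
  rewrite rnZ rn_conj rnM [rn (fourier f n) * _]mulrC -mulrA ler_wpM2r ?mulr_ge0 ?rn_ge0//.
have [B' bB'' BB'] := bounded_adjoint bB'.
have -> : hip (emb H b') (B (u (emb H b))) = hip zeta (u (emb H b)).
  suff <- : B' (emb H b') = zeta by rewrite hipC BB' -hipC.
  apply: emb_ext => x; rewrite hipC -BB' -hipC [RHS]hipC.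
  apply: (hsum_uniq (hsum_hip (emb H b') (BE x))).
  apply: hsum_ext (chsum_conj (hsum_hip (emb H x) hzeta)) => n.
  rewrite !hipZr rmorphM /= conjCK -hipC psiE -!mulrA; congr (_ * _).
  rewrite -!psiE /psi -ME.
  have wpsi : weight (d + n) (mode w' (- n) b') by have := mode_weight w' (- n) wb'; rewrite opprK.
  rewrite (hip_multiplier _ (lM (- l)) (ex_intro _ _ (bM (- l))) (ME (- l)) wpsi).
  by rewrite [n + (d - l)]addrCA addrA.
have h1 := chsum_conj (hsum_hip (u (emb H b)) hzeta); rewrite -hipC in h1.
apply/eqP; rewrite -subr_eq0; apply/eqP.
have hN := chsumZ (-1) hcZ.
have := hsumD h1 hN; rewrite mulN1r => hdiff; apply: (hsum_uniq hdiff).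
(* The defect of weak commutation, mode by mode. By hypothesis its Fourier series vanishes at all
   small angles, and the mollifier turns this into a relation weighted by [c]. *)
pose a n := fourier f n * (hip (psi n) (u (emb H b)) - hip (emb H b') (v n)).
have aa : asum (fun n => rn (a n) : R).
  have a1 := asum_rapid rf (mode_poly H b ew) (fun n => vn_ge0 _ _).
  have [B1 hB1] := apsi; have [B2 hB2] := a1.
  exists (B1 * rn (u (emb H b)) + rn (emb H b') * Cu * B2) => S uS.
  apply: (@le_trans _ _ (\sum_(n <- S) (rn (fourier f n) * rn (psi n) * rn (u (emb H b)) +
     rn (emb H b') * Cu * (rn (fourier f n) * vn H (mode w n b))))).
    apply: ler_sum => n _; rewrite /a rnM.
    have -> : rn (fourier f n) * rn (psi n) * rn (u (emb H b)) + rn (emb H b') * Cu *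
        (rn (fourier f n) * vn H (mode w n b)) = rn (fourier f n) *
        (rn (psi n) * rn (u (emb H b)) + rn (emb H b') * (Cu * vn H (mode w n b))) by ring.
    rewrite ler_wpM2l ?rn_ge0//; apply: le_trans (rnB _ _) _; apply: lerD; first exact: hip_CS.
    by apply: le_trans (hip_CS _ _) _; rewrite ler_wpM2l ?rn_ge0//; exact: hu.
  rewrite big_split -mulr_suml -mulr_sumr /=; apply: lerD.
    by rewrite ler_wpM2r ?rn_ge0// hB1.
  by rewrite ler_wpM2l ?mulr_ge0 ?rn_ge0// hB2.
have az s : `|s| < ee -> chsum (fun n => a n * ex (n%:~R * s)) 0.
  move=> hs; have [r [k1 k2]] := weak (lt_le_trans hs lee) b b'.
  have := hsumD k2 (chsumZ (-1) k1); rewrite mulN1r subrr; apply: hsum_ext => n.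
  by rewrite /a /psi /v; ring.
apply: hsum_ext (mollifier_shift (d - l) c0 aa az) => n.
rewrite !hipZr rmorphM /= conjCK -hipC.
rewrite (hip_multiplier _ (lM _) (ex_intro _ _ (bM _)) (ME _) wb').
rewrite [d + (n - l)]addrCA.
by rewrite /a; ring.
Qed.

Lemma smoothing x : smeared w f x -> smeared w f (map2 u x).
Proof.
have /bounded_opP[ul [Cu Cu0 hu]] := bu.
have cu : closure [set x | smeared w f (map2 u x)] `<=` [set x | smeared w f (map2 u x)].
  move=> p /closure2_rn cp; apply: (smeared_closed H w f).2; apply/closure2_rn => q q0.
  have C1 : 0 < Cu + 1 by rewrite ltr_wpDl.
  have [p' hp' [h1 h2]] := cp _ (divr_gt0 q0 C1); exists (map2 u p') => //.
  have key (x1 x2 : H) : rn (x1 - x2) < q / (Cu + 1) -> rn (u x1 - u x2) < q.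
    rewrite ltr_pdivlMr// -(linB ul) => h; apply: le_lt_trans (hu _) _.
    by apply: le_lt_trans h; rewrite mulrC ler_wpM2l ?rn_ge0// lerDl.
  by split; exact: key.
apply: (smeared_ind ew sf cu) => b.
have [[g0 gD] _] := smeared_closed H w f.
elim/weight_ind: b => [|b1 b2 h1 h2|l b wb] y hy; last exact: smoothing_weight wb hy.
  suff -> : y = 0 by rewrite /map2 /= (lin0 (emb_linear H)) (lin0 ul).
  apply: (hsum_uniq hy); have h0 := @hsum_fin R H int (fun=> 0) [::] isT (fun _ _ => erefl).
  rewrite big_nil in h0; apply: hsum_ext h0 => n.
  by rewrite (lin0 (mode_linr _ _)) (lin0 (emb_linear H)) scaler0.
have rf := rapid_fourier sf.
have [y1 hy1] := smears_exists H b1 ew rf; have [y2 hy2] := smears_exists H b2 ew rf.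
have -> : y = y1 + y2.
  apply: (hsum_uniq hy); apply: hsum_ext (hsumD hy1 hy2) => n.
  by rewrite (linD (mode_linr _ _)) (linD (emb_linear H)) scalerDr.
have := gD 1 _ _ (h1 _ hy1) (h2 _ hy2).
by rewrite /map2 /= !scale1r (linD (emb_linear H)) !(linD ul).
Qed.

End Smoothing.

(** * Local algebras and the legs of the tensor product *)

Section LocalAlgebra.
Context (R : realType) (V : unitary_voa R) (H : completion V).
Local Notation circle := (set_type (S1 R)).
Local Notation support := (@Defs.support R).
Implicit Types (I : set circle).

Definition local_graphs I : set (set (H * H)%type) := [set G | exists a f,
  [/\ smooth_circle f, support f `<=` I & G = smeared a f]].

Lemma local_graphs_closed I G : local_graphs I G -> closed_subspace G.
Proof. by move=> [a [f [_ _ ->]]]; exact: smeared_closed. Qed.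

Lemma vN_local I : von_neumann (local_algebra H I).
Proof. by apply: vN_Wstar; exact: local_graphs_closed. Qed.

Lemma local_invariant I (s : H -> H) a f : commutant (local_algebra H I) s ->
  smooth_circle f -> support f `<=` I -> forall x, smeared a f x -> smeared a f (map2 s x).
Proof.
move=> hs sf fI; apply: (invariant_of_aff (vN_local I) (smeared_closed H a f) _ hs).
by apply: affiliated_Wstar; [exists a, f | exact: smeared_closed].
Qed.

Lemma mode_vac n (b : V) : mode (vac V) n b = if n == 0 then b else 0.
Proof.
have w0 : has_weight (vop V) (conf V) 0 (vac V).
  by rewrite /has_weight /L (vop_vac_ge0 _ _) ?scale0r.
rewrite (mode_weight_vop _ _ w0) (va_vacuum (vop_va V)) addr0.
by congr (if _ then _ else _); apply/eqP/eqP; lia.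
Qed.

End LocalAlgebra.

Lemma vN_tensor_swap (R : realType) (H1 H2 K : hilbert R) (T : H1 -> H2 -> K) M1 M2 :
  vN_tensor (fun y x => T x y) M2 M1 = vN_tensor T M1 M2.
Proof.
rewrite /vN_tensor; congr vN_generated; apply/seteqP.
by split=> X [bX [A [B [MA MB hX]]]]; split=> //; exists B, A.
Qed.

(* Instantiated with tau = t, w = a (x) 1 and with the flip of t, w = 1 (x) b. *)
Section Leg.
Context (R : realType) (V Z W : unitary_voa R) (tau : V -> Z -> W).
Context (H : completion V) (HZ : completion Z) (K : completion W) (S : H -> HZ -> K).
Hypothesis hS : is_hilbert_tensor S.
Hypothesis S_emb : forall c d, S (emb H c) (emb HZ d) = emb K (tau c d).
Hypothesis tau_ind : forall P : set W, subspace_set P -> (forall c d, P (tau c d)) -> forall w, P w.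
Variables (a : V) (w : W) (f : set_type (S1 R) -> R[i]).
Hypothesis (wE : forall n c d, mode w n (tau c d) = tau (mode a n c) d).
Hypotheses (ea : energy_bounds a) (ew : energy_bounds w) (sf : smooth_circle f).

Lemma leg_smears c d y : smears a (fourier f) c y ->
  smears w (fourier f) (tau c d) (S y (emb HZ d)).
Proof.
move=> hy; have l := tenl hS (emb HZ d).
apply: hsum_ext (hsum_map l (rn_ge0 (emb HZ d)) (fun x => _) hy) => [n|x].
  by rewrite (linZ l) S_emb wE.
by rewrite (ten_rn hS) mulrC.
Qed.

(** Two approximations: of a graph element by smeared sums, and of [z] by finite-energy vectors. *)
Lemma leg_smeared g z : smeared a f g -> smeared w f (S g.1 z, S g.2 z).
Proof.
have [sG cG] := smeared_closed K w f.
have approx (p q : HZ -> K) : (exists2 C, 0 <= C & forall x y, rn (p x - p y) <= C * rn (x - y)) ->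
    (exists2 C, 0 <= C & forall x y, rn (q x - q y) <= C * rn (x - y)) ->
    (forall d, smeared w f (p (emb HZ d), q (emb HZ d))) -> forall z, smeared w f (p z, q z).
  move=> [C C0 hp] [D D0 hq] h x; apply: cG; apply/closure2_rn => e e0.
  have C1 : 0 < C + D + 1 by rewrite ltr_wpDl// addr_ge0.
  have /dense_rn dE := @emb_dense R Z HZ; have [_ [d _ <-]] := dE x _ (divr_gt0 e0 C1).
  rewrite ltr_pdivlMr// => hd; exists (p (emb HZ d), q (emb HZ d)) => //=.
  by split; [apply: le_lt_trans (hp _ _) _ | apply: le_lt_trans (hq _ _) _];
    apply: le_lt_trans hd; rewrite mulrC ler_wpM2l ?rn_ge0//; lra.
have lip x : exists2 C, 0 <= C & forall z y, rn (S x z - S x y) <= C * rn (z - y).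
  by exists (rn x); [exact: rn_ge0 | move=> y v; rewrite -(linB (tenr hS x)) (ten_rn hS)].
have cl : closure [set g | smeared w f (S g.1 z, S g.2 z)] `<=` [set g | smeared w f (S g.1 z, S g.2 z)].
  move=> x /closure2_rn cx; apply: cG; apply/closure2_rn => e e0.
  have C1 : 0 < rn z + 1 by rewrite ltr_wpDl ?rn_ge0.
  have [x' hx' [h1 h2]] := cx _ (divr_gt0 e0 C1); exists (S x'.1 z, S x'.2 z) => //=.
  have key (u v : H) : rn (u - v) < e / (rn z + 1) -> rn (S u z - S v z) < e.
    rewrite ltr_pdivlMr// -(linB (tenl hS z)) (ten_rn hS); apply: le_lt_trans.
    by rewrite ler_wpM2l ?rn_ge0// lerDl.
  by split; exact: key.
apply: (smeared_ind ea sf cl) => c y hy; apply: approx => // d.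
by rewrite /= S_emb; apply: smears_smeared; exact: leg_smears.
Qed.

(** With [leg_smeared] this says that tensoring with [z] respects both a graph and its complement,
    which is all that [leg_slice] uses about the closed operator of the leg. *)
Lemma leg_gperp h z : gperp (smeared a f) h -> gperp (smeared w f) (S h.1 z, S h.2 z).
Proof.
move=> hh; apply: gperp_closure => -[x y] /(smeared0_smears ew sf)[v /= -> hv].
have rf := rapid_fourier sf; move: v y hv {x}.
apply: (tau_ind (P := fun v => forall y, smears w (fourier f) v y ->
  hip (emb K v) (S h.1 z) + hip y (S h.2 z) = 0)).
  split=> [y hy|k v1 v2 h1 h2 y hy].
    suff -> : y = 0 by rewrite (lin0 (emb_linear K)) !hip0l addr0.
    apply: (hsum_uniq hy); have h0 := @hsum_fin R K int (fun=> 0) [::] isT (fun _ _ => erefl).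
    rewrite big_nil in h0; apply: hsum_ext h0 => n.
    by rewrite (lin0 (mode_linr _ _)) (lin0 (emb_linear K)) scaler0.
  have [y1 hy1] := smears_exists K v1 ew rf; have [y2 hy2] := smears_exists K v2 ew rf.
  have -> : y = k *: y1 + y2.
    have lk : linear (fun z : K => k *: z) by move=> q p r; rewrite scalerDr !scalerA mulrC.
    have h3 := hsum_map lk (rn_ge0 k) (fun z => _) hy1.
    apply: (hsum_uniq hy); apply: hsum_ext (hsumD (h3 _) hy2) => [n|q].
      by rewrite mode_linr (emb_linear K) scalerDr !scalerA mulrC.
    by rewrite rnZ.
  have e1 := h1 _ hy1; have e2 := h2 _ hy2.
  rewrite (emb_linear K) !hipDl !hipZl addrACA -mulrDr e1 e2.
  by rewrite mulr0 addr0.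
move=> c d y hy; have [ya hya] := smears_exists H c ea rf.
have -> : y = S ya (emb HZ d) by apply: (hsum_uniq hy); exact: leg_smears.
rewrite -S_emb !(ten_hip hS) -mulrDl.
by rewrite (hh (emb H c, ya) (smears_smeared hya)) mul0r.
Qed.

(** By [gperp_perp] it suffices to pair with h in the complement of the graph. That pairing is one
    of h (x) z' with C applied to x (x) z, a vector of the graph over W, and it vanishes. *)
Lemma leg_slice C z z' s : (forall x, smeared w f x -> smeared w f (map2 C x)) ->
  is_slice S C z z' s -> forall x, smeared a f x -> smeared a f (map2 s x).
Proof.
move=> hC [_ hs] x hx; apply: (gperp_perp (smeared_closed H a f)) => h hh.
have := @leg_gperp _ z' hh _ (hC _ (@leg_smeared _ z hx)); rewrite /= => e.
rewrite !hs; have /(congr1 Num.conj) := e.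
by rewrite rmorphD /= -!hipC rmorph0.
Qed.

End Leg.

(** * The local algebras of the tensor product *)

Section Main.
Context (R : realType) (Va Vb W : unitary_voa R) (t : Va -> Vb -> W).
Hypothesis ht : is_voa_tensor t.
Context (Ha : completion Va) (Hb : completion Vb) (K : completion W) (T : Ha -> Hb -> K).
Hypothesis hT : is_hilbert_tensor T.
Hypothesis T_emb : forall a b, T (emb Ha a) (emb Hb b) = emb K (t a b).
Hypotheses (eA : energy_bounded Va) (eB : energy_bounded Vb).
Local Notation circle := (set_type (S1 R)).
Local Notation support := (@Defs.support R).
Local Notation chsum := (@hsum R R[i]^o _).
Implicit Types (I : set circle).

Let eW : energy_bounded W. Proof. exact: (tensor_energy_bounded Ha Hb K ht eA eB). Qed.

Lemma weak_tensor_commutant I u a b da db f c d c' d' (psi : int -> K) : open I ->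
  commutant (vN_tensor T (local_algebra Ha I) (local_algebra Hb I)) u ->
  has_weight (vop Va) (conf Va) da a -> has_weight (vop Vb) (conf Vb) db b ->
  smooth_circle f -> support f `<=` I ->
  (forall n x, hip (psi n) (emb K x) = hip (emb K (t c' d')) (emb K (mode (t a b) n x))) ->
  exists s,
  chsum (fun n => fourier f n * hip (emb K (t c' d')) (u (emb K (mode (t a b) n (t c d))))) s /\
  chsum (fun n => fourier f n * hip (psi n) (u (emb K (t c d)))) s.
Proof.
move=> oI cu wa wb sf fI hpsi; have bu := commutant_bounded cu.
have [a' aa] := mode_adjoint a; have [b' bb] := mode_adjoint b.
apply: (tensor_weak ht hT T_emb bu oI (eA a) (eA a') (eB b) (eB b') aa bb wa wb _ _ c d sf fI hpsi).
  move=> h sh hI p p' y y' hy hy' z z'.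
  have [s bs hs] := slice_exists hT z' z bu.
  have cs := commute_unitary_slice hT (vN_local Ha I) (vN_local Hb I) cu (conj bs hs).
  have := smears_weak (eA a) sh aa (local_invariant (a := a) cs sh hI) hy hy'.
  by rewrite !hs.
move=> h sh hI p p' y y' hy hy' z z'.
have [s bs hs] := slice_exists (tensor_swap hT) z' z bu.
rewrite -vN_tensor_swap in cu.
have cs := commute_unitary_slice (tensor_swap hT) (vN_local Hb I) (vN_local Ha I) cu (conj bs hs).
have := smears_weak (eB b) sh bb (local_invariant (a := b) cs sh hI) hy hy'.
by rewrite !hs.
Qed.

Definition weak_pair (u : K -> K) (f : circle -> R[i]) (w w' b b' : W) := exists s,
  chsum (fun n => fourier f n * hip (emb K b') (u (emb K (mode w n b)))) s /\
  chsum (fun n => fourier f n * hip (emb K (mode w' (- n) b')) (u (emb K b))) s.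

(** The relation is linear or antilinear in each of w, b and b', which reduces it to elementary
    tensors. The adjoint vector of w enters through its pairings alone. *)
Lemma weak_commutant I u w w' f b b' : open I ->
  commutant (vN_tensor T (local_algebra Ha I) (local_algebra Hb I)) u ->
  smooth_circle f -> support f `<=` I -> adjoint_vec w w' -> weak_pair u f w w' b b'.
Proof.
move=> oI cu sf fI; have [ul _] := commutant_bounded cu.
have c0 : @hsum R R[i]^o int (fun=> 0) 0.
  by have h := @hsum_fin R R[i]^o int (fun=> 0) [::] isT (fun _ _ => erefl); rewrite big_nil in h.
move: w w' b b'.
apply: (tensor_ind ht (P := fun w => forall w' b b', adjoint_vec w w' -> weak_pair u f w w' b b')).
  split=> [w' b b' ww'|k w1 w2 h1 h2 w' b b' ww'].
    exists 0; split; apply: hsum_ext c0 => n.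
      by rewrite (lin0 (mode_linl _ _)) (lin0 (emb_linear K)) (lin0 ul) hip0r mulr0.
    suff -> : mode w' (- n) b' = 0 by rewrite (lin0 (emb_linear K)) hip0l mulr0.
    by apply: ip_ext => x; rewrite -ww' (lin0 (mode_linl _ _)) ip0r ipC ip0r rmorph0.
  have [w1' ww1] := mode_adjoint w1; have [w2' ww2] := mode_adjoint w2.
  have [s1 [p1 q1]] := h1 w1' b b' ww1; have [s2 [p2 q2]] := h2 w2' b b' ww2.
  exists (k * s1 + s2); split.
    apply: hsum_ext (hsumD (chsumZ k p1) p2) => n.
    by rewrite mode_linl (emb_linear K) ul hipDr hipZr; ring.
  apply: hsum_ext (hsumD (chsumZ k q1) q2) => n.
  have -> : mode w' (- n) b' = k^* *: mode w1' (- n) b' + mode w2' (- n) b'.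
    apply: ip_ext => x; rewrite ipDr ipZr -ww' mode_linl -ww1 -ww2.
    by rewrite ipC ipDr ipZr rmorphD rmorphM /= -!ipC.
  by rewrite (emb_linear K) hipDl hipZl conjCK; ring.
move=> da db a b0 wa wb w' b b' ww'; move: b.
apply: (tensor_ind ht (P := fun b => weak_pair u f (t a b0) w' b b')).
  split=> [|k b1 b2 [s1 [p1 q1]] [s2 [p2 q2]]].
    exists 0; split; apply: hsum_ext c0 => n.
      by rewrite (lin0 (mode_linr _ _)) (lin0 (emb_linear K)) (lin0 ul) hip0r mulr0.
    by rewrite (lin0 (emb_linear K)) (lin0 ul) hip0r mulr0.
  exists (k * s1 + s2); split.
    apply: hsum_ext (hsumD (chsumZ k p1) p2) => n.
    by rewrite mode_linr (emb_linear K) ul hipDr hipZr; ring.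
  apply: hsum_ext (hsumD (chsumZ k q1) q2) => n.
  by rewrite (emb_linear K) ul hipDr hipZr; ring.
move=> _ _ c d _ _; move: b'.
apply: (tensor_ind ht (P := fun b' => weak_pair u f (t a b0) w' (t c d) b')).
  split=> [|k b1 b2 [s1 [p1 q1]] [s2 [p2 q2]]].
    exists 0; split; apply: hsum_ext c0 => n.
      by rewrite (lin0 (emb_linear K)) hip0l mulr0.
    by rewrite (lin0 (mode_linr _ _)) (lin0 (emb_linear K)) hip0l mulr0.
  exists (k^* * s1 + s2); split.
    apply: hsum_ext (hsumD (chsumZ k^* p1) p2) => n.
    by rewrite (emb_linear K) hipDl hipZl; ring.
  apply: hsum_ext (hsumD (chsumZ k^* q1) q2) => n.
  by rewrite mode_linr (emb_linear K) hipDl hipZl; ring.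
move=> _ _ c' d' _ _; apply: (weak_tensor_commutant c d oI cu wa wb sf fI) => n x.
by rewrite !emb_isometry ipC -ww' -ipC.
Qed.

(** Rotating f by s multiplies its n-th coefficient by e^(ins) and, I being open, keeps the support
    in I for small s; this supplies the weak relations that [smoothing] asks for. *)
Lemma tensor_commutant_invariant I u w f : open I ->
  commutant (vN_tensor T (local_algebra Ha I) (local_algebra Hb I)) u ->
  smooth_circle f -> support f `<=` I ->
  forall x, smeared w f x -> smeared w f (map2 u x).
Proof.
move=> oI cu sf fI; have [w' ww'] := mode_adjoint w.
have [e e0 he] := support_rot oI fI.
apply: (smoothing (eW w) sf (eW w') ww' (commutant_bounded cu) e0) => s hs b b'.
have ff : (fun t => (f \o rot s) (expi t)) = fun t => f (expi (t + s)).
  by apply/funext => x /=; rewrite rot_expi.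
have srot : smooth_circle (f \o rot s).
  by apply/smooth_circleP; rewrite ff; have [] := per_shift s (smooth_per sf).
have fr n : fourier (f \o rot s) n = ex (n%:~R * s) * fourier f n.
  by rewrite !fourierE ff (fc_shift s n (smooth_per sf)).
have [r [h1 h2]] := weak_commutant b b' oI cu srot (he s hs) ww'.
by exists r; split; [apply: hsum_ext h1 | apply: hsum_ext h2] => n; rewrite fr.
Qed.

Lemma local_tensor_sub I : open I ->
  local_algebra K I `<=` vN_tensor T (local_algebra Ha I) (local_algebra Hb I).
Proof.
move=> oI X hX; have vN := vN_vN_tensor hT (vN_local Ha I) (vN_local Hb I).
apply: hX => // _ [w [f [sf fI ->]]] u cu uu x y.
split=> h; first exact: (tensor_commutant_invariant oI cu sf fI h).
(* The converse implication is the same invariance for the inverse of [u], which also lies in the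
   commutant. *)
have [v [bv uv vK Kv]] := unitary_adjoint uu.
have cv := vN_adjoint (vN_commutant_vN vN) cu bv uv.
have := tensor_commutant_invariant oI cv sf fI h.
by rewrite /map2 /= !vK.
Qed.

Lemma mode_leg_l a n c d : mode (t a (vac Vb)) n (t c d) = t (mode a n c) d.
Proof.
elim/weight_ind: a => [|x y hx hy|e a wa].
- by rewrite (lin0 (vtl ht _)) !(lin0 (mode_linl _ _)) (lin0 (vtl ht _)).
- by rewrite (linD (vtl ht _)) !(linD (mode_linl _ _)) hx hy (linD (vtl ht _)).
have w0 : has_weight (vop Vb) (conf Vb) 0 (vac Vb).
  by rewrite /has_weight /L (vop_vac_ge0 _ _) ?scale0r.
rewrite (mode_tensor ht (s := [:: n]) wa w0)// ?big_seq1 ?mode_vac ?subrr//.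
move=> k; rewrite inE => kn; rewrite mode_vac ifF ?(lin0 (vtr ht _))//.
by rewrite subr_eq0 eq_sym; exact: negbTE.
Qed.

Lemma mode_leg_r b n d c : mode (t (vac Va) b) n (t c d) = t c (mode b n d).
Proof.
elim/weight_ind: b => [|x y hx hy|e b wb].
- by rewrite (lin0 (vtr ht _)) !(lin0 (mode_linl _ _)) (lin0 (vtr ht _)).
- by rewrite (linD (vtr ht _)) !(linD (mode_linl _ _)) hx hy (linD (vtr ht _)).
have w0 : has_weight (vop Va) (conf Va) 0 (vac Va).
  by rewrite /has_weight /L (vop_vac_ge0 _ _) ?scale0r.
rewrite (mode_tensor ht (s := [:: 0]) w0 wb)// ?big_seq1 ?mode_vac ?subr0//.
by move=> k; rewrite inE => /negbTE k0; rewrite mode_vac k0 (lin0 (vtl ht _)).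
Qed.

Lemma tensor_local_sub I :
  vN_tensor T (local_algebra Ha I) (local_algebra Hb I) `<=` local_algebra K I.
Proof.
apply: (vN_tensor_sub hT (vN_local K I)); try exact: local_graphs_closed.
  move=> _ [a [f [sf fI ->]]] C y y' s cC hs.
  apply: (leg_slice hT T_emb _ (mode_leg_l a) (eA a) (eW _) sf _ hs).
    by move=> P sP hP; apply: (tensor_ind ht sP).
  exact: local_invariant cC sf fI.
move=> _ [b [f [sf fI ->]]] C y y' s cC hs.
apply: (leg_slice (tensor_swap hT) (fun d c => T_emb c d) _ (mode_leg_r b) (eB b) (eW _) sf _ hs).
  by move=> P sP hP; apply: (tensor_ind ht sP).
exact: local_invariant cC sf fI.
Qed.

Lemma local_tensor I : open I ->
  local_algebra K I = vN_tensor T (local_algebra Ha I) (local_algebra Hb I).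
Proof.
by move=> oI; apply/seteqP; split; [exact: local_tensor_sub | exact: tensor_local_sub].
Qed.

(** Once both algebras are tensor products, only generators are compared: A (x) B and A' (x) B'
    commute leg by leg, and passing to commutants twice extends this to the generated algebras. *)
Lemma tensor_local I : interval1 I ->
  local_algebra Ha I `<=` commutant (local_algebra Ha (icompl I)) ->
  local_algebra Hb I `<=` commutant (local_algebra Hb (icompl I)) ->
  local_algebra K I `<=` commutant (local_algebra K (icompl I)).
Proof.
move=> [oI _ _ _] lA lB; have oI' : open (icompl I) by exact: open_interior.
rewrite (local_tensor oI) (local_tensor oI').
have vA := vN_local Ha I; have vB := vN_local Hb I.
pose S := tensor_gen T (local_algebra Ha I) (local_algebra Hb I).
pose N' := vN_tensor T (local_algebra Ha (icompl I)) (local_algebra Hb (icompl I)).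
have bS : S `<=` @bounded_op R K by exact: tensor_gen_bounded.
have vS : von_neumann (commutant S) by apply: vN_commutant => //; exact: tensor_gen_star.
have sub : N' `<=` commutant S.
  move=> Y; apply=> // {}Y [bY [A' [B' [hA' hB' hY]]]]; split=> // X [bX [A [B [hA hB hX]]]].
  apply: (ten_ext_op hT); [exact: bounded_comp..|] => x y /=.
  have [_ cA] := lA _ hA; have [_ cB] := lB _ hB.
  have eA' := congr1 (@^~ x) (cA _ hA'); have eB' := congr1 (@^~ y) (cB _ hB').
  by rewrite hX !hY hX; move: eA' eB' => /= -> ->.
have vN' : von_neumann N' by apply: (vN_vN_tensor hT); exact: vN_local.
move=> X; apply; first exact: vN_commutant_vN.
by apply: subset_trans (commutant_bi bS) _; exact: commutant_anti.
Qed.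

End Main.

Theorem corollary8p2 (R : realType) (Va Vb : unitary_voa R)
    (Ha : completion Va) (Hb : completion Vb)
    (simple_a : simple_voa Va) (simple_b : simple_voa Vb)
    (sl_a : strongly_local Ha) (sl_b : strongly_local Hb)
    (W : unitary_voa R) (t : Va -> Vb -> W) (t_tensor : is_voa_tensor t)
    (K : completion W) (T : Ha -> Hb -> K) (T_tensor : is_hilbert_tensor T)
    (T_emb : forall a b, T (emb Ha a) (emb Hb b) = emb K (t a b)) :
  strongly_local K /\ voa_net K = net_tensor T (voa_net Ha) (voa_net Hb).
Proof.
have [eA lA] := sl_a; have [eB lB] := sl_b; split; first split.
- exact: (tensor_energy_bounded Ha Hb K t_tensor eA eB).
- move=> I hI; exact: (tensor_local t_tensor T_tensor T_emb eA eB hI (lA I hI) (lB I hI)).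
rewrite /voa_net /net_tensor /= (vt_vac t_tensor) T_emb; congr (Net _ _).
apply/funext => -[I [oI c n d]] /=.
exact: (local_tensor t_tensor T_tensor T_emb eA eB).
Qed.
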